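(* Let $F_0\in C^1([0,\infty);[0,\infty))$ satisfy (i) $4\pi\sqrt{2}\int_0^\infty \sqrt{r}\,F_0(r)\,dr = 1$; (ii) there is a constant $C>0$ such that $|F_0(r)|+|F_0'(r)|\le \frac{C}{1+r^3}$ for all $r\ge 0$; (iii) $F_0'(r)<0$ for all $r\ge 0$. Let $f_0(v)=F_0(\tfrac12|v|^2)$ for $v\in\mathbb{R}^3$, and let $\mu$ be a signed Borel measure on $\mathbb{R}^3$ with finite total variation, $\int_{\mathbb{R}^3}|\mu|(dx)<\infty$. Then there exists a solution $(f,Q)$ of the stationary Vlasov-Poisson problem with data $(f_0,\mu)$ (in the sense defined in the context), with $$f\in W^{1,1}_{\mathrm{loc}}(\mathbb{R}^3\times\mathbb{R}^3)\cap L^1_{\mathrm{loc}}(\mathbb{R}^3;L^1(\mathbb{R}^3)),\qquad Q\in W^{1,1}(\mathbb{R}^3)\cap L^2(\mathbb{R}^3).$$ Moreover, if the total charge $\theta=\int_{\mathbb{R}^3}\mu(dx)$ is negative, then there exist infinitely many different solutions of this problem (in the same sense and the same function classes).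
   Context: For $f=f(x,v)$ on $\mathbb{R}^3\times\mathbb{R}^3$, the spatial density is $\rho[f](x)=\int_{\mathbb{R}^3} f(x,v)\,dv$. The space $L^1_{\mathrm{loc}}(\mathbb{R}^3;L^1(\mathbb{R}^3))$ consists of functions $f(x,v)$ that are locally integrable in $x$ with values in $L^1$ in the variable $v$. The stationary Vlasov-Poisson problem with data $(f_0,\mu)$ is $$v\cdot\nabla_x f-\nabla_x Q\cdot\nabla_v f=0,\qquad -\Delta Q=\rho[f]-1+\mu,\qquad \lim_{|x|\to\infty}f(x,v)=f_0(v).$$ A pair $(f,Q)$ in the stated function classes is a solution if: the first equation holds almost everywhere on $\mathbb{R}^3\times\mathbb{R}^3$ (with weak derivatives); the second equation holds in the weak (distributional) sense on $\mathbb{R}^3$; and the boundary condition holds in the sense that $\|f(\cdot,v)-f_0(v)\|_{L^2(\mathbb{R}^3)}<\infty$ for almost every $v\in\mathbb{R}^3$. At $r=0$ the derivative $F_0'$ is one-sided. *)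

(* Defs.v *)
From HB Require Import structures.
From mathcomp Require Import all_boot all_order all_algebra.
From mathcomp Require Import all_classical all_reals all_analysis.

Set Implicit Arguments.
Unset Strict Implicit.
Unset Printing Implicit Defensive.

Import Order.TTheory GRing.Theory Num.Theory.
Import numFieldNormedType.Exports.

Local Open Scope classical_set_scope.
Local Open Scope ring_scope.

Section ProductMeasure.
Local Open Scope ereal_scope.
Context d1 d2 (T1 : measurableType d1) (T2 : measurableType d2) (R : realType).
Variable m1 : {sigma_finite_measure set T1 -> \bar R}.
Variable m2 : {sigma_finite_measure set T2 -> \bar R}.

(* The library proves that m1 \x m2 is sigma-finite, but the instance is not
   found by inference; this alias restores it so that products can be nested. *)
Definition prod_measure : set (T1 * T2) -> \bar R := m1 \x m2.

HB.instance Definition _ := Measure.on prod_measure.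

Lemma prod_measure_sigma_finite : sigma_finite setT prod_measure.
Proof.
have /sigma_finiteP[F [TF ndF Foo]] := sigma_finiteT m1.
have /sigma_finiteP[G [TG ndG Goo]] := sigma_finiteT m2.
exists (fun n => F n `*` G n).
  rewrite -setXTT TF TG predeqE => -[x y]; split.
    move=> [/= [n _ Fnx] [k _ Gky]]; exists (maxn n k) => //; split.
    - by move: x Fnx; exact/subsetPset/ndF/leq_maxl.
    - by move: y Gky; exact/subsetPset/ndG/leq_maxr.
  by move=> [n _ []/= ? ?]; split; exists n.
move=> k; have [? ?] := Foo k; have [? ?] := Goo k.
split; first exact: measurableX.
by rewrite /prod_measure product_measure1E// lte_mul_pinfty// ge0_fin_numE.
Qed.

HB.instance Definition _ :=
  Measure_isSigmaFinite.Build _ _ _ prod_measure prod_measure_sigma_finite.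

End ProductMeasure.

(* R^3 is the iterated product R * R * R, which carries both the normed-module
   structure used for derivatives and, through measurableTypeR, the Borel
   sigma-algebra (as a product sigma-algebra).  The two spellings R3 and mR3
   are convertible. *)
Notation R3 R := (R * R * R)%type.
Notation mR3 R :=
  (measurableTypeR R * measurableTypeR R * measurableTypeR R)%type.

Section Euclidean.
Context {R : realType}.

Definition coord3 (i : 'I_3) (x : R3 R) : R := [:: x.1.1; x.1.2; x.2]`_i.

Definition basis3 (i : 'I_3) : R3 R :=
  ((i == 0%N :> nat)%:R, (i == 1%N :> nat)%:R, (i == 2%N :> nat)%:R).

(* The norm `|x| of the product type is the max norm, hence this definition. *)
Definition sqnorm (x : R3 R) : R := \sum_(i < 3) coord3 i x ^+ 2.

Definition leb3 : {sigma_finite_measure set (mR3 R) -> \bar R} :=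
  prod_measure (prod_measure lebesgue_measure lebesgue_measure)
    lebesgue_measure.

Definition leb6 : {sigma_finite_measure set (mR3 R * mR3 R)%type -> \bar R} :=
  prod_measure leb3 leb3.

End Euclidean.

Section TestFunctions.
Context {R : realType} {E : normedModType R}.

Fixpoint Ck (k : nat) (phi : E -> R) : Prop :=
  continuous phi /\
  match k with
  | 0 => True
  | k'.+1 => forall e : E, (forall x, derivable phi x e) /\ Ck k' ('D_e phi)
  end.

Definition test_function (phi : E -> R) : Prop :=
  (forall k, Ck k phi) /\ compact (closure [set x | phi x != 0]).

End TestFunctions.

Section SobolevSpaces.
Context {R : realType}.

Definition L1loc3 (g : R3 R -> R) : Prop :=
  measurable_fun [set: mR3 R] g /\
  forall K : set (R3 R), compact K ->
    (\int[leb3]_(x in K) `|g x|%:E < +oo)%E.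

Definition L1loc6 (g : R3 R * R3 R -> R) : Prop :=
  measurable_fun [set: mR3 R * mR3 R] g /\
  forall K : set (R3 R * R3 R), compact K ->
    (\int[leb6]_(z in K) `|g z|%:E < +oo)%E.

Definition weak_deriv3 (e : R3 R) (h g : R3 R -> R) : Prop :=
  L1loc3 g /\
  forall phi : R3 R -> R, test_function phi ->
    \int[leb3]_x (h x * 'D_e phi x) = - \int[leb3]_x (g x * phi x).

Definition weak_deriv6 (e : R3 R * R3 R) (h g : R3 R * R3 R -> R) : Prop :=
  L1loc6 g /\
  forall phi : R3 R * R3 R -> R, test_function phi ->
    \int[leb6]_z (h z * 'D_e phi z) = - \int[leb6]_z (g z * phi z).

Definition weak_dx (i : 'I_3) := weak_deriv6 (basis3 i, 0).
Definition weak_dv (i : 'I_3) := weak_deriv6 (0, basis3 i).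

Definition W11loc (f : R3 R * R3 R -> R) : Prop :=
  L1loc6 f /\
  forall i, (exists g, weak_dx i f g) /\ (exists g, weak_dv i f g).

Definition W11 (Q : R3 R -> R) : Prop :=
  leb3.-integrable [set: mR3 R] (EFin \o Q) /\
  forall i, exists2 g, weak_deriv3 (basis3 i) Q g &
                       leb3.-integrable [set: mR3 R] (EFin \o g).

Definition L2 (Q : R3 R -> R) : Prop :=
  measurable_fun [set: mR3 R] Q /\ finite_norm leb3 2%:E Q.

Definition L1loc_L1 (f : R3 R * R3 R -> R) : Prop :=
  measurable_fun [set: mR3 R * mR3 R] f /\
  forall K : set (R3 R), compact K ->
    (\int[leb3]_(x in K) \int[leb3]_v `|f (x, v)|%:E < +oo)%E.

End SobolevSpaces.

Section SignedMeasures.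
Context {R : realType} d {T : measurableType d}.
Variable mu : {charge set T -> \bar R}.

Lemma hahn_pair_ex :
  exists PN : set T * set T, hahn_decomposition mu PN.1 PN.2.
Proof. by have [P [N PN]] := Hahn_decomposition mu; exists (P, N). Qed.

(* The Jordan parts do not depend on the chosen Hahn decomposition. *)
Definition hahn_dec := projT2 (cid hahn_pair_ex).

Definition charge_total_variation : \bar R := charge_variation hahn_dec [set: T].

Definition charge_integral (phi : T -> R) : R :=
  \int[jordan_pos hahn_dec]_x phi x - \int[jordan_neg hahn_dec]_x phi x.

End SignedMeasures.

Section VlasovPoisson.
Context {R : realType}.

(* dF is the derivative of F on [0, +oo[, one-sided at 0, and is continuous
   there; values at negative arguments are irrelevant. *)
Definition C1_halfline (F dF : R -> R) : Prop :=
  [/\ forall r : R, 0 < r -> is_derive r 1 F (dF r),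
      h^-1 * (F h - F 0) @[h --> 0^'+] --> dF 0 &
      {within `[0, +oo[, continuous dF}].

Definition rho (f : R3 R * R3 R -> R) (x : R3 R) : R :=
  \int[leb3]_v f (x, v).

Definition laplacian (phi : R3 R -> R) (x : R3 R) : R :=
  \sum_(i < 3) 'D_(basis3 i) ('D_(basis3 i) phi) x.

Definition vlasov (f : R3 R * R3 R -> R) (Q : R3 R -> R) : Prop :=
  exists fx fv : 'I_3 -> R3 R * R3 R -> R, exists Qx : 'I_3 -> R3 R -> R,
    (forall i, [/\ weak_dx i f (fx i), weak_dv i f (fv i) &
                   weak_deriv3 (basis3 i) Q (Qx i)]) /\
    {ae leb6, forall z : R3 R * R3 R,
       \sum_(i < 3) coord3 i z.2 * fx i z - \sum_(i < 3) Qx i z.1 * fv i z = 0}.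

Definition poisson (mu : {charge set (mR3 R) -> \bar R})
    (f : R3 R * R3 R -> R) (Q : R3 R -> R) : Prop :=
  forall phi : R3 R -> R, test_function phi ->
    - (\int[leb3]_x (Q x * laplacian phi x)) =
    \int[leb3]_x ((rho f x - 1) * phi x) + charge_integral mu phi.

(* The meaning given to the limit f(x, v) --> f0(v) as |x| --> oo. *)
Definition boundary (f0 : R3 R -> R) (f : R3 R * R3 R -> R) : Prop :=
  {ae leb3, forall v : R3 R,
     finite_norm leb3 2%:E (fun x : mR3 R => f (x, v) - f0 v)}.

Definition vp_solution (f0 : R3 R -> R) (mu : {charge set (mR3 R) -> \bar R})
    (f : R3 R * R3 R -> R) (Q : R3 R -> R) : Prop :=
  [/\ W11loc f /\ L1loc_L1 f, W11 Q /\ L2 Q,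
      vlasov f Q, poisson mu f Q & boundary f0 f].

(* Equality as elements of the function classes. *)
Definition same_solution (p q : (R3 R * R3 R -> R) * (R3 R -> R)) : Prop :=
  {ae leb6, forall z : R3 R * R3 R, p.1 z = q.1 z} /\
  {ae leb3, forall x : R3 R, p.2 x = q.2 x}.

End VlasovPoisson.

(* Main.v *)
(* The solutions have the form f(x, v) = F(|v|^2/2 + Q(x)), where F is a
   nonnegative C^1 extension of F_0 to negative energies that vanishes below
   -1.  The first equation is then the chain rule, and the second one becomes
   - Delta Q + g(Q) = mu with g(q) = 1 - \int F(|v|^2/2 + q) dv.  Polar
   coordinates turn this integral into 4 pi sqrt 2 \int sqrt((e - q)_+) F(e) de,
   from which g(0) = 0, g is nondecreasing and Lipschitz with some constant L,
   and |g(q)| >= c min(|q|, 1).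

   Write mu = mu_+ - mu_-.  The potentials W_+, W_- of mu_+, mu_- with kernel
   \int (1 + at) exp(-at) p_t dt, p_t being the heat kernel and a > 0 small,
   are integrable and square integrable, and W_+ and - W_- are a super- and a
   subsolution.  Monotone iteration of
   Q |-> (L - Delta)^-1 (L Q - g(Q) + mu) started at - W_- converges between
   them.  All operators are integrals against the heat kernel, so that the
   iteration only needs its semigroup property and Tonelli's theorem; weak
   derivatives are obtained by truncating the time integral near t = 0.

   The equation also gives \int g(Q) = theta.  The extension of F_0 can be
   modified by n (1 + e)^2 e^2 on (-1, 0), which yields functions g_n that
   decrease strictly with n at every q < 0 and agree for q >= 0.  If g_m and
   g_n, m < n, had the same solution Q, then g_m(Q) - g_n(Q) >= 0 would have
   integral theta - theta = 0, so Q >= 0 almost everywhere and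
   theta = \int g_n(Q) >= 0. *)
Require Import Defs.
From HB Require Import structures.
From mathcomp Require Import all_boot all_order all_algebra.
From mathcomp Require Import all_classical all_reals all_analysis measurable_realfun.
From mathcomp Require Import ring lra.

Set Implicit Arguments.
Unset Strict Implicit.
Unset Printing Implicit Defensive.

Import Order.TTheory GRing.Theory Num.Theory.
Import numFieldNormedType.Exports.

Local Open Scope classical_set_scope.
Local Open Scope ring_scope.

(** * Weak derivatives of differentiable functions *)

(** The delicate point is the kernel of W. With the plain weight exp(-at), W solves - Delta W + aW =
    mu and is a supersolution only where g(W) >= aW; this fails in general, because g <= 1 while W
    is unbounded, and infinite at atoms of mu. The factor 1 + at makes the derivative of the weight
    vanish at t = 0: it is - a^2 t exp(-at), whose extra t turns t^(-3/2), the size of p_t, into the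
    integrable t^(-1/2). The remainder d in - Delta W + d = mu is then bounded, besides being at
    most aW, hence at most c min(W, 1) for small a.

    Infinite values also dictate the unknown s = Q + W_- of the iteration: s and its right-hand side
    are nonnegative, so that monotone convergence in [0, +oo] applies, and W_- is subtracted only
    where W_+ + W_- is finite, that is almost everywhere.

    No regularity theory enters: |grad p_t| is bounded by a multiple of t^(-1/2) p_{2t}, which is
    integrable in (x, t) against exp(-Lt), and cutting off small times leaves bounded differentiable
    kernels. The chain rule for F(|v|^2/2 + Q) survives the dominated limit because F and F' are
    bounded and continuous. *)

Definition has_measurable_basis (V : topologicalType) (M : set (set V)) :=
  exists b : nat -> set V, (forall n, M (b n)) /\
    forall x (U : set V), nbhs x U -> exists n, b n x /\ b n `<=` U.

(** An open set is the countable union of the base sets that it contains. This links the norm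
    topology of R^3 and R^6 to their product sigma-algebras, which are built independently of it. *)
Lemma measurable_basis_open (V : topologicalType) (M : set (set V)) :
  M set0 -> (forall F : (set V)^nat, (forall n, M (F n)) -> M (\bigcup_n F n)) ->
  has_measurable_basis M -> forall U, open U -> M U.
Proof.
move=> M0 MU [b [Mb bP]] U oU.
have -> : U = \bigcup_n (if pselect (b n `<=` U) then b n else set0).
  apply/seteqP; split => [x Ux|x [n _]]; last first.
    by case: pselect => [bU /bU|].
  have [n [bnx bnU]] := bP x U (open_nbhs_nbhs (conj oU Ux)).
  by exists n => //; case: pselect.
by apply: MU => n; case: pselect => ?; rewrite //=; exact: Mb.
Qed.

Lemma measurable_basis_prod (V1 V2 : topologicalType) (M1 : set (set V1))
    (M2 : set (set V2)) (M : set (set (V1 * V2))) :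
  (forall A B, M1 A -> M2 B -> M (A `*` B)) ->
  has_measurable_basis M1 -> has_measurable_basis M2 -> has_measurable_basis M.
Proof.
move=> MX [b1 [Mb1 b1P]] [b2 [Mb2 b2P]].
(* Pairs of indices are coded as naturals; the default pair for a number that is not a code merely
   repeats a base set. *)
pose u (n : nat) := odflt (0%N, 0%N) (unpickle n : option (nat * nat)).
exists (fun n => b1 (u n).1 `*` b2 (u n).2); split=> [n|]; first exact: MX.
move=> [x y] U [[A B] /= [nA nB] ABU].
have [n [nx nU]] := b1P _ _ nA; have [m [my mU]] := b2P _ _ nB.
exists (pickle (n, m)); rewrite /u pickleK /=; split => //.
move=> [x' y'] [/= bx' by']; apply: ABU; split => /=; [exact: nU|exact: mU].
Qed.

Lemma measurable_basis_real (R : realType) :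
  @has_measurable_basis R (@measurable _ (measurableTypeR R)).
Proof.
pose u (n : nat) := odflt (0, 0) (unpickle n : option (rat * rat)).
exists (fun n => `]ratr (u n).1, ratr (u n).2[%classic); split=> [n|].
  exact: measurable_itv.
move=> x U /nbhs_ballP[e /= e0 eU].
have xe1 : x - e < x by rewrite ltrBlDr ltrDl.
have xe2 : x < x + e by rewrite ltrDl.
have [p] := rat_in_itvoo xe1; rewrite in_itv/= => /andP[p1 p2].
have [q] := rat_in_itvoo xe2; rewrite in_itv/= => /andP[q1 q2].
exists (pickle (p, q)); rewrite /u pickleK /=; split; first by rewrite in_itv/= p2 q1.
move=> y /=; rewrite in_itv/= => /andP[py yq]; apply: eU; rewrite /ball/= ltr_norml.
by apply/andP; split; lra.
Qed.

Section Measurability.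
Context {R : realType}.

Lemma measurable_basis_R3 :
  @has_measurable_basis (R3 R) (@measurable _ (mR3 R)).
Proof.
apply: (measurable_basis_prod
  (M1 := @measurable _ (measurableTypeR R * measurableTypeR R)%type)
  (M2 := @measurable _ (measurableTypeR R))) => [A B mA mB||].
- exact: measurableX.
- apply: (measurable_basis_prod (M1 := @measurable _ (measurableTypeR R))
    (M2 := @measurable _ (measurableTypeR R))) => [A B mA mB||];
    [exact: measurableX|exact: measurable_basis_real..].
- exact: measurable_basis_real.
Qed.

Lemma open_measurable3 (U : set (R3 R)) : open U -> @measurable _ (mR3 R) U.
Proof.
apply: measurable_basis_open => [|F mF|]; last exact: measurable_basis_R3.
- exact: measurable0.
- exact: bigcupT_measurable.
Qed.

Lemma open_measurable6 (U : set (R3 R * R3 R)) :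
  open U -> @measurable _ (mR3 R * mR3 R)%type U.
Proof.
apply: measurable_basis_open => [|F mF|].
- exact: measurable0.
- exact: bigcupT_measurable.
- apply: (measurable_basis_prod (M1 := @measurable _ (mR3 R))
    (M2 := @measurable _ (mR3 R))) => [A B mA mB||];
    [exact: measurableX|exact: measurable_basis_R3..].
Qed.

Lemma continuous_measurable3 (f : R3 R -> R) :
  continuous f -> measurable_fun [set: mR3 R] f.
Proof.
move=> /continuousP cf; apply: (measurability _ (RGenOInfty.measurableE R)).
move=> _ [_ [a ->] <-]; rewrite setTI; apply: open_measurable3.
apply: (cf `]a, +oo[%classic); exact: interval_open.
Qed.

Lemma continuous_measurable6 (f : R3 R * R3 R -> R) :
  continuous f -> measurable_fun [set: mR3 R * mR3 R] f.
Proof.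
move=> /continuousP cf; apply: (measurability _ (RGenOInfty.measurableE R)).
move=> _ [_ [a ->] <-]; rewrite setTI; apply: open_measurable6.
apply: (cf `]a, +oo[%classic); exact: interval_open.
Qed.

Lemma compact_measurable3 (K : set (R3 R)) :
  compact K -> @measurable _ (mR3 R) K.
Proof.
move=> cK; have oK : open (~` K).
  exact/closed_openC/(compact_closed _ cK)/norm_hausdorff.
by have /measurableC := open_measurable3 oK; rewrite setCK.
Qed.

Lemma compact_measurable6 (K : set (R3 R * R3 R)) :
  compact K -> @measurable _ (mR3 R * mR3 R)%type K.
Proof.
move=> cK; have oK : open (~` K).
  exact/closed_openC/(compact_closed _ cK)/norm_hausdorff.
by have /measurableC := open_measurable6 oK; rewrite setCK.
Qed.

End Measurability.

(** * Translation invariance of Lebesgue measure *)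

Section InvariantMap.
Local Open Scope ereal_scope.
Context {R : realType}.

(** Invariance is expressed by integrals of nonnegative functions rather than by measures of sets,
    since Tonelli's theorem carries this form to products at once. *)
Definition ge0_invariant d (T : measurableType d) (m : set T -> \bar R) (s : T -> T) :=
  measurable_fun setT s /\ forall f : T -> \bar R, measurable_fun setT f ->
   (forall x, 0 <= f x) -> \int[m]_x f (s x) = \int[m]_x f x.

Lemma ge0_invariant_integral d (T : measurableType d) (m : {measure set T -> \bar R}) s
    (f : T -> \bar R) :
  ge0_invariant m s -> measurable_fun setT f -> \int[m]_x f (s x) = \int[m]_x f x.
Proof.
move=> [ms h] mf; rewrite integralE [RHS]integralE; congr (_ - _).
  rewrite [X in integral _ _ X](funepos_comp f s)/=.
  by apply: (h (f^\+)%E) => [|x]; [exact: measurable_funepos|exact: funepos_ge0].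
rewrite [X in integral _ _ X](funeneg_comp f s)/=.
by apply: (h (f^\-)%E) => [|x]; [exact: measurable_funeneg|exact: funeneg_ge0].
Qed.

Lemma ge0_invariant_integrable d (T : measurableType d) (m : {measure set T -> \bar R}) s
    (f : T -> \bar R) :
  ge0_invariant m s -> m.-integrable setT f -> m.-integrable setT (f \o s).
Proof.
move=> [ms h] /integrableP[mf fi]; apply/integrableP; split; first exact: measurableT_comp.
by rewrite (h (fun x => `|f x|)) //; exact: measurableT_comp.
Qed.

(** The image of Lebesgue measure under a translation gives half-open intervals their length, and
    this property characterizes Lebesgue measure. *)
Lemma ge0_invariant_shift (a : R) :
  ge0_invariant lebesgue_measure ((fun x => x + a)%R : measurableTypeR R -> measurableTypeR R).
Proof.
have ms : measurable_fun setT ((fun x => x + a)%R : measurableTypeR R -> measurableTypeR R).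
  exact: measurable_funD.
split => // f mf f0.
transitivity (\int[pushforward lebesgue_measure
    ((fun x => x + a)%R : measurableTypeR R -> measurableTypeR R)]_x f x).
  by rewrite ge0_integral_pushforward //; exact/in_setP.
apply: eq_measure_integral => A mA _.
apply/esym/lebesgue_measure_unique => //= _ [[x y]] _ <-.
rewrite /pushforward (_ : _ @^-1` _ = `](x - a)%R, (y - a)%R]%classic); last first.
  by apply/seteqP; split => z /=; rewrite !in_itv/= lerBrDr ltrBlDr.
rewrite !lebesgue_measure_itv/= !lte_fin ltrD2r.
by case: ifPn => // _; rewrite -!EFinB; congr EFin; ring.
Qed.

Lemma ge0_invariant_prod d1 d2 (T1 : measurableType d1) (T2 : measurableType d2)
    (m1 : {sigma_finite_measure set T1 -> \bar R})
    (m2 : {sigma_finite_measure set T2 -> \bar R})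
    (s1 : T1 -> T1) (s2 : T2 -> T2) :
  ge0_invariant m1 s1 -> ge0_invariant m2 s2 ->
  ge0_invariant (prod_measure m1 m2) (fun z => (s1 z.1, s2 z.2)).
Proof.
move=> [ms1 h1] [ms2 h2].
have mf : measurable_fun setT (fun z : T1 * T2 => (s1 z.1, s2 z.2)).
  by apply: measurable_fun_pair; exact: measurableT_comp.
split => // f mf' f0; rewrite /prod_measure.
rewrite fubini_tonelli1 //; last exact: measurableT_comp.
rewrite [RHS](fubini_tonelli1 _ mf' f0) /fubini_F /=.
transitivity (\int[m1]_x \int[m2]_y f (s1 x, y)).
  apply: eq_integral => x _; apply: (h2 (fun y => f (s1 x, y))) => //.
  by apply: measurableT_comp => //; exact: measurable_fun_pair.
apply: (h1 (fun x => \int[m2]_y f (x, y))).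
  exact: measurable_fun_fubini_tonelli_F.
by move=> x; apply: integral_ge0.
Qed.

Lemma ge0_invariant_shift3 (a : R3 R) :
  ge0_invariant leb3 ((fun x => x + a)%R : mR3 R -> mR3 R).
Proof.
have /= := ge0_invariant_prod (ge0_invariant_prod (ge0_invariant_shift a.1.1)
  (ge0_invariant_shift a.1.2)) (ge0_invariant_shift a.2).
exact.
Qed.

Lemma ge0_invariant_shift6 (a : R3 R * R3 R) :
  ge0_invariant leb6 ((fun x => x + a)%R : mR3 R * mR3 R -> mR3 R * mR3 R).
Proof. exact: ge0_invariant_prod (ge0_invariant_shift3 a.1) (ge0_invariant_shift3 a.2). Qed.

End InvariantMap.

(** * Integration by parts along measure-preserving maps *)

Section IntegralDerivative.
Context {R : realType}.

Lemma le_mean_value (f df : R -> R) (M h : R) : 0 <= h ->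
  (forall x, 0 <= x <= h -> is_derive x 1 f (df x)) ->
  (forall x, 0 <= x <= h -> `|df x| <= M) -> `|f h - f 0| <= M * h.
Proof.
move=> h0 fd fM.
have [x||c] := @MVT_segment R f df 0 h h0.
- by rewrite in_itv/= => /andP[? ?]; apply: fd; rewrite !ltW.
- apply: derivable_within_continuous => x; rewrite in_itv/= => x0h.
  by have [] := fd x x0h.
rewrite in_itv/= => ch ->; rewrite subr0 normrM (ger0_norm h0).
exact/ler_wpM2r/fM.
Qed.

Context d (T : measurableType d) (m : {measure set T -> \bar R}).

Lemma integrable_indic_lty (S : set T) : measurable S -> (m S < +oo)%E ->
  m.-integrable setT (EFin \o (\1_S : T -> R)).
Proof.
move=> mS Sfin; apply/integrableP; split; first exact/measurable_EFinP/measurable_indic.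
rewrite (eq_integral (fun x => (\1_S x)%:E)) => [|x _]; last by rewrite /= ger0_norm.
by rewrite integral_indic // setIT.
Qed.

(** By invariance the integral of [psi (s h x) - psi x] is 0 for every [h]. The difference quotients
    with step 1/(n+1) converge to [dpsi], and the mean value inequality bounds them by [M] on the
    set [S] of finite measure outside of which they vanish, so dominated convergence applies. *)
Lemma integral_flow_derivative (s : R -> T -> T) (psi dpsi : T -> R) (S : set T) (M : R) :
  (forall h, ge0_invariant m (s h)) -> s 0 = id ->
  m.-integrable setT (EFin \o psi) ->
  (forall x (h : R), is_derive h 1 (fun k : R => psi (s k x)) (dpsi (s h x))) ->
  measurable S -> (m S < +oo)%E ->
  (forall x h, 0 <= h <= 1 -> ~ S x -> psi (s h x) = 0) ->
  (forall x, `|dpsi x| <= M) ->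
  m.-integrable setT (EFin \o dpsi) /\ \int[m]_x dpsi x = 0.
Proof.
move=> inv s0 ipsi dps mS Sfin Spsi dM.
have M0 : 0 <= M by exact: le_trans (dM point).
pose f_ n x := n.+1%:R * (psi (s n.+1%:R^-1 x) - psi x).
have mpsi : measurable_fun setT psi by exact/measurable_EFinP/(measurable_int m).
have cvgf x : f_ ^~ x @ \oo --> dpsi x.
  have [/cvg_ex[l gl] dE] := dps x 0.
  have ldx : l = dpsi x by rewrite -[dpsi x]/(dpsi (id x)) -s0 -dE; apply/esym/cvg_lim.
  rewrite ldx in gl; move/cvgr_dnbhsP : gl => /(_ (fun n => n.+1%:R^-1)) gl.
  rewrite (_ : f_ ^~ x = (fun n : nat => (n.+1%:R^-1)^-1 *:
     (psi (s (n.+1%:R^-1 *: 1 + 0) x) - psi (s 0 x)))).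
    apply: gl; split => [n|]; first by rewrite invr_eq0 pnatr_eq0.
    exact: cvg_harmonic.
  by apply/funext => n; rewrite /f_ invrK addr0 s0 -[n.+1%:R^-1%:A]/(n.+1%:R^-1 * 1) mulr1.
have fM n x : `|f_ n x| <= M * \1_S x.
  rewrite /f_ normrM ger0_norm //.
  have [Sx|Sx] := pselect (S x).
    rewrite indicE mem_set // mulr1 mulrC -ler_pdivlMr ?ltr0n //.
    rewrite -[psi x]/(psi (id x)) -s0.
    apply: (@le_mean_value (fun h => psi (s h x)) (fun h => dpsi (s h x))) => //.
  rewrite indicE memNset // mulr0 Spsi //; last by rewrite invr_ge0 ler0n invf_le1 // ler1n.
  have := Spsi x 0; rewrite s0 => -> //; last by rewrite lexx ler01.
  by rewrite subrr normr0 mulr0.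
have mf n : measurable_fun setT (f_ n).
  apply: measurable_funM => //; apply: measurable_funB => //.
  by apply: measurableT_comp => //; have [] := inv n.+1%:R^-1.
have mdpsi : measurable_fun setT dpsi.
  by apply: (measurable_fun_cvg mf) => x _; exact: cvgf.
have [||||| idpsi _ cvgI] := @dominated_convergence _ _ _ m setT measurableT
  (fun n => EFin \o f_ n) (EFin \o dpsi) (fun x => (M * \1_S x)%:E).
- by move=> n; exact/measurable_EFinP.
- exact/measurable_EFinP.
- by apply: aeW => x _; apply: cvg_EFin; [exact: nearW|exact: cvgf].
- under eq_fun do rewrite EFinM.
  by apply: (integrableZl measurableT); exact: integrable_indic_lty.
- by apply: aeW => x n _ /=; rewrite lee_fin.
split => //; rewrite /Rintegral.
suff -> : (\int[m]_x (EFin \o dpsi) x = 0)%E by [].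
have f0 n : (\int[m]_x (EFin \o f_ n) x = 0)%E.
  transitivity (\int[m]_x (n.+1%:R%:E * ((psi (s n.+1%:R^-1 x))%:E - (psi x)%:E)))%E.
    exact: eq_integral.
  have i1 := ge0_invariant_integrable (inv n.+1%:R^-1) ipsi.
  rewrite integralZl //; last exact: integrableB.
  rewrite integralB // (ge0_invariant_integral (f := EFin \o psi) (inv _)).
    by rewrite subee ?mule0 //; exact: integrable_fin_num.
  exact/measurable_EFinP.
apply/esym; apply: cvg_unique cvgI => //; rewrite [X in X @ _](_ : _ = cst 0%E).
  exact: cvg_cst.
exact/funext.
Qed.

(** This is [integral_flow_derivative] for the product of [u] and [phi]. Bounds on [u] and [du] are
    required only where [phi] or [dphi] is nonzero, so that both may grow at infinity, as velocity
    derivatives of the solutions are allowed to. *)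
Lemma integral_flow_by_parts (s : R -> T -> T) (u du phi dphi : T -> R) (S : set T) (M : R) :
  (forall h, ge0_invariant m (s h)) -> s 0 = id ->
  measurable_fun setT u -> measurable_fun setT du ->
  measurable_fun setT phi -> measurable_fun setT dphi ->
  (forall x (h : R), is_derive h 1 (fun k : R => u (s k x)) (du (s h x))) ->
  (forall x (h : R), is_derive h 1 (fun k : R => phi (s k x)) (dphi (s h x))) ->
  measurable S -> (m S < +oo)%E ->
  (forall x h, 0 <= h <= 1 -> ~ S x -> phi (s h x) = 0) ->
  (forall x, ~ S x -> dphi x = 0) ->
  (forall x, `|phi x| <= M) -> (forall x, `|dphi x| <= M) ->
  (forall x, phi x != 0 \/ dphi x != 0 -> `|u x| <= M /\ `|du x| <= M) ->
  [/\ m.-integrable setT (EFin \o (u \* dphi)),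
      m.-integrable setT (EFin \o (du \* phi)) &
      \int[m]_x (u x * dphi x) = - \int[m]_x (du x * phi x)].
Proof.
move=> inv s0 mu mdu mphi mdphi udu phidphi mS Sfin phi0 dphi0 phiM dphiM uM.
have M0 : 0 <= M by exact: le_trans (phiM point).
have phi00 x : ~ S x -> phi x = 0.
  by move=> Sx; have := phi0 x 0; rewrite s0 lexx ler01; exact.
have bd (f g : T -> R) : measurable_fun setT f -> measurable_fun setT g ->
    (forall x, ~ S x -> g x = 0) -> (forall x, `|g x| <= M) ->
    (forall x, g x != 0 -> `|f x| <= M) ->
    (forall x, `|f x * g x| <= M * M * \1_S x) /\
    m.-integrable setT (EFin \o (f \* g)).
  move=> mf mg g0 gM fM.
  have H x : `|f x * g x| <= M * M * \1_S x.
    have [gx0|gx0] := eqVneq (g x) 0.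
      by rewrite gx0 mulr0 normr0 mulr_ge0 // mulr_ge0.
    have Sx : S x by apply: contrapT => /g0 /eqP; exact/negP.
    by rewrite indicE mem_set // mulr1 normrM ler_pM //; exact: fM.
  split => //; apply: (@le_integrable _ _ _ m _ measurableT _ (fun x => (M * M * \1_S x)%:E)).
  - exact/measurable_EFinP/measurable_funM.
  - by move=> x _ /=; rewrite lee_fin (le_trans (H x)) // ler_norm.
  - under eq_fun do rewrite EFinM.
    by apply: (integrableZl measurableT); exact: integrable_indic_lty.
have [_ i1] := bd _ _ mu mdphi dphi0 dphiM (fun x h => (uM x (or_intror h)).1).
have [_ i2] := bd _ _ mdu mphi phi00 phiM (fun x h => (uM x (or_introl h)).2).
have [_ i3] := bd _ _ mu mphi phi00 phiM (fun x h => (uM x (or_introl h)).1).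
have [b1 _] := bd _ _ mu mdphi dphi0 dphiM (fun x h => (uM x (or_intror h)).1).
have [b2 _] := bd _ _ mdu mphi phi00 phiM (fun x h => (uM x (or_introl h)).2).
have [|||i4 eq0] := @integral_flow_derivative s (u \* phi) (fun x => u x * dphi x + du x * phi x)
  S (M * M + M * M) inv s0 i3 _ mS Sfin.
- move=> x h; apply: (@is_derive_eq _ _ _ _ _ _ _ _ (is_deriveM (udu x h) (phidphi x h))).
  by rewrite /= /GRing.scale /= [du _ * _]mulrC.
- by move=> x h h01 Sx /=; rewrite phi0 // mulr0.
- move=> x; apply: (le_trans (ler_normD _ _)); apply: lerD;
    [apply: le_trans (b1 x) _|apply: le_trans (b2 x) _];
    by rewrite ler_piMr ?mulr_ge0 // indicE lern1 leq_b1.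
split => //; apply/eqP; rewrite -subr_eq0 opprK -RintegralD //.
exact/eqP.
Qed.
End IntegralDerivative.

(** * Test functions and directional derivatives along lines *)

Section TestFunctions.
Context {R : realType} {E : normedModType R}.
Implicit Types (phi : E -> R) (e x : E).

Lemma is_derive_line phi x e (h : R) : derivable phi (x + h *: e) e ->
  is_derive h 1 (fun k : R => phi (x + k *: e)) ('D_e phi (x + h *: e)).
Proof.
move=> dphi.
have eqf : (fun k : R => k^-1 *: (((fun k : R => phi (x + k *: e)) \o shift h) (k *: 1) - phi (x + h *: e)))
   = (fun k : R => k^-1 *: ((phi \o shift (x + h *: e)) (k *: e) - phi (x + h *: e))).
  apply/funext => k /=; congr (_ *: (phi _ - _)).
  by rewrite -[k *: 1]/(k * 1) mulr1 scalerDl addrCA.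
split; first by rewrite /derivable eqf.
by rewrite /derive eqf.
Qed.

Lemma derive_eq0_notin_support phi e x :
  ~ closure [set y | phi y != 0] x -> 'D_e phi x = 0.
Proof.
move=> /= xK.
have nx : \forall y \near x, cst 0 y = phi y.
  have oC : open (~` closure [set y | phi y != 0]).
    by apply: closed_openC; exact: closed_closure.
  have := open_nbhs_nbhs (conj oC xK); apply: filterS => y /= yK; apply/esym/eqP; apply: contrapT => /negP y0.
  by apply: yK; exact: subset_closure.
by rewrite -(near_eq_derive e nx) derive_cst.
Qed.

Lemma test_function_derive phi e : test_function phi ->
  (forall x, derivable phi x e) /\ test_function ('D_e phi).
Proof.
move=> [Ckphi cK]; split; first by have [_ /(_ e)[]] := Ckphi 1%N.
split => [k|]; first by have [_ /(_ e)[]] := Ckphi k.+1.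
apply: (subclosed_compact _ cK); first exact: closed_closure.
rewrite [X in _ `<=` X](closure_id _).1; last exact: closed_closure.
apply: closureS => x /= Dx; apply: contrapT => /(derive_eq0_notin_support e) Dx0.
by move: Dx; rewrite Dx0 eqxx.
Qed.

Lemma test_function_continuous phi : test_function phi -> continuous phi.
Proof. by move=> [/(_ 0%N)[]]. Qed.

Lemma test_function_bounded phi : test_function phi ->
  exists2 M, 0 <= M & forall x, `|phi x| <= M.
Proof.
move=> tphi; have [_ cK] := tphi.
have cf : continuous phi by exact: test_function_continuous.
have /compact_bounded[M [Mr MP]] : compact (phi @` closure [set x | phi x != 0]).
  by apply: continuous_compact => //; exact: continuous_subspaceT.
have M1 : M < `|M| + 1 by rewrite (le_lt_trans (ler_norm _)) // ltrDl.
exists (`|M| + 1) => [|x]; first by rewrite addr_ge0.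
have [->|px] := eqVneq (phi x) 0; first by rewrite normr0 addr_ge0.
by apply: MP M1 _ _; exists x => //; exact: subset_closure.
Qed.

Lemma test_function_support phi : test_function phi ->
  exists2 N, 0 <= N & forall x, closure [set y | phi y != 0] x -> `|x| <= N.
Proof.
move=> [_ /compact_bounded[M [Mr MP]]].
have M1 : M < `|M| + 1 by rewrite (le_lt_trans (ler_norm _)) // ltrDl.
by exists (`|M| + 1) => [|x Kx]; [rewrite addr_ge0|exact: MP M1 _ Kx].
Qed.

End TestFunctions.

Section Boxes.
Context {R : realType}.
Local Open Scope ereal_scope.

Lemma leb3_bounded_set (N : R) :
  exists S : set (mR3 R), [/\ measurable S, leb3 S < +oo &
    forall x : R3 R, (`|x| <= N)%R -> S x].
Proof.
pose I : set (measurableTypeR R) := `[(- N)%R, N]%classic.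
have mI : measurable I by exact: measurable_itv.
have fI : lebesgue_measure I < +oo.
  by rewrite /I lebesgue_measure_itv /=; case: ifPn => //; rewrite -EFinB ltry.
exists (I `*` I `*` I); split.
- by apply: measurableX => //; exact: measurableX.
- rewrite /leb3 /= /prod_measure product_measure1E//; last exact: measurableX.
  have f2 : (lebesgue_measure \x lebesgue_measure) (I `*` I) < +oo.
    by rewrite product_measure1E// lte_mul_pinfty // ge0_fin_numE.
  by rewrite lte_mul_pinfty // ge0_fin_numE.
- move=> [[x1 x2] x3]; rewrite /Num.norm /= !ge_max => /andP[/andP[]].
  by rewrite !ler_norml => h1 h2 h3; rewrite /I /= !in_itv/=.
Qed.

Lemma leb6_bounded_set (N : R) :
  exists S : set (mR3 R * mR3 R), [/\ measurable S, leb6 S < +oo &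
    forall x : R3 R * R3 R, (`|x| <= N)%R -> S x].
Proof.
have [S [mS fS SP]] := leb3_bounded_set N.
exists (S `*` S); split; first exact: measurableX.
- by rewrite /leb6 /= /prod_measure product_measure1E// lte_mul_pinfty // ge0_fin_numE.
- move=> [x y]; rewrite {1}/Num.norm /= ge_max => /andP[? ?].
  by split; exact: SP.
Qed.
End Boxes.

Section IntegrationByParts.
Context {R : realType}.

(* [i] is the identity in the applications: it only reconciles the measurable
   and the normed structures carried by R^3 and R^6. *)
Lemma weak_derive_generic (E : normedModType R) d (T : measurableType d)
    (m : {measure set T -> \bar R}) (i : T -> E) (s : R -> T -> T) (e : E)
    (u phi : E -> R) (M : R) :
  (forall N : R, exists S : set T, [/\ measurable S, (m S < +oo)%E &
     forall x, `|i x| <= N -> S x]) ->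
  (forall f : E -> R, continuous f -> measurable_fun setT (f \o i)) ->
  (forall h, ge0_invariant m (s h)) -> s 0 = id ->
  (forall h x, i (s h x) = i x + h *: e) ->
  test_function phi ->
  measurable_fun setT (u \o i) -> measurable_fun setT ('D_e u \o i) ->
  (forall x, derivable u x e) ->
  (forall x, closure [set y | phi y != 0] x -> `|u x| <= M /\ `|'D_e u x| <= M) ->
  [/\ m.-integrable setT (EFin \o (fun x => u (i x) * 'D_e phi (i x))),
      m.-integrable setT (EFin \o (fun x => 'D_e u (i x) * phi (i x))) &
      \int[m]_x (u (i x) * 'D_e phi (i x)) = - \int[m]_x ('D_e u (i x) * phi (i x))].
Proof.
move=> bS cm inv s0 si tphi mu mdu du uM.
have [dphi tdphi] := test_function_derive e tphi.
have [M1 M10 M1P] := test_function_bounded tphi.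
have [M2 M20 M2P] := test_function_bounded tdphi.
have [N N0 NP] := test_function_support tphi.
(* For 0 <= h <= 1 the flow moves a point by at most the norm of [e], so a ball enlarged by that
   norm contains every point which reaches the support of [phi]. *)
have [S [mS fS SP]] := bS (N + `|e|).
have suppS x : closure [set y | phi y != 0] (i x) -> S x.
  by move=> /NP xN; apply: SP; rewrite (le_trans xN) // lerDl.
have mp : measurable_fun setT (phi \o i) by apply: cm; exact: test_function_continuous.
have mdp : measurable_fun setT ('D_e phi \o i) by apply: cm; exact: test_function_continuous.
apply: (@integral_flow_by_parts R _ T m s (u \o i) ('D_e u \o i) (phi \o i)
  ('D_e phi \o i) S (Num.max `|M| (Num.max M1 M2)) inv s0 mu mdu mp mdp _ _ mS fS).
- move=> x h /=; rewrite si; under eq_fun do rewrite si; exact/is_derive_line/du.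
- move=> x h /=; rewrite si; under eq_fun do rewrite si; exact/is_derive_line/dphi.
- move=> x h /andP[h0 h1] Sx; apply: contrapT => /eqP phix; apply: Sx; apply: SP.
  have : closure [set y | phi y != 0] (i x + h *: e).
    by apply: subset_closure; rewrite /= -si.
  move=> /NP xN; rewrite -[i x](addrK (h *: e)) (le_trans (ler_normB _ _)) // lerD //.
  by rewrite normrZ ger0_norm // ler_piMl.
- by move=> x Sx; apply: derive_eq0_notin_support => /suppS.
- by move=> x; rewrite !le_max M1P ?orbT.
- by move=> x; rewrite !le_max M2P ?orbT.
- move=> x h; have Kx : closure [set y | phi y != 0] (i x).
    case: h => [h|/eqP h]; first exact: subset_closure.
    by apply: contrapT => /(derive_eq0_notin_support e).
  have [uMx duMx] := uM _ Kx; rewrite !le_max.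
  by rewrite (le_trans uMx (ler_norm _)) (le_trans duMx (ler_norm _)).
Qed.

Lemma weak_derive3 (e : R3 R) (u : R3 R -> R) (M : R) (phi : R3 R -> R) :
  test_function phi ->
  measurable_fun [set: mR3 R] u -> measurable_fun [set: mR3 R] ('D_e u) ->
  (forall x, derivable u x e) ->
  (forall x, closure [set y | phi y != 0] x -> `|u x| <= M /\ `|'D_e u x| <= M) ->
  [/\ leb3.-integrable [set: mR3 R] (EFin \o (fun x => u x * 'D_e phi x)),
      leb3.-integrable [set: mR3 R] (EFin \o (fun x => 'D_e u x * phi x)) &
      \int[leb3]_x (u x * 'D_e phi x) = - \int[leb3]_x ('D_e u x * phi x)].
Proof.
apply: (@weak_derive_generic (R3 R) _ (mR3 R) leb3 id
  (fun h x => (x : R3 R) + h *: e)).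
- exact: leb3_bounded_set.
- exact: continuous_measurable3.
- move=> h; exact: (ge0_invariant_shift3 (h *: e)).
- by apply/funext => x; rewrite scale0r addr0.
- by [].
Qed.

Lemma weak_derive6 (e : R3 R * R3 R) (u : R3 R * R3 R -> R) (M : R) (phi : R3 R * R3 R -> R) :
  test_function phi ->
  measurable_fun [set: mR3 R * mR3 R] u -> measurable_fun [set: mR3 R * mR3 R] ('D_e u) ->
  (forall x, derivable u x e) ->
  (forall x, closure [set y | phi y != 0] x -> `|u x| <= M /\ `|'D_e u x| <= M) ->
  [/\ leb6.-integrable [set: mR3 R * mR3 R] (EFin \o (fun x => u x * 'D_e phi x)),
      leb6.-integrable [set: mR3 R * mR3 R] (EFin \o (fun x => 'D_e u x * phi x)) &
      \int[leb6]_x (u x * 'D_e phi x) = - \int[leb6]_x ('D_e u x * phi x)].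
Proof.
apply: (@weak_derive_generic (R3 R * R3 R)%type _ (mR3 R * mR3 R)%type leb6 id
  (fun h x => (x : R3 R * R3 R) + h *: e)).
- exact: leb6_bounded_set.
- exact: continuous_measurable6.
- move=> h; exact: (ge0_invariant_shift6 (h *: e)).
- by apply/funext => x; rewrite scale0r addr0.
- by [].
Qed.
End IntegrationByParts.

(** * The heat kernel *)

Section MeasurableInverse.
Context {R : realType}.

(** The inverse is continuous off 0, and 0 is split off as a single measurable point. *)
Lemma measurable_invr : measurable_fun [set: R] (@GRing.inv R).
Proof.
have -> : [set: R] = [set 0] `|` [set~ 0] by rewrite setUv.
apply/measurable_funU => //; first exact: measurableC.
split; first exact: measurable_fun_set1.
apply: open_continuous_measurable_fun; first by apply: closed_openC; rewrite -(set_itv1 0); exact: interval_closed.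
by move=> x /[!inE] /eqP x0; exact: inv_continuous.
Qed.

Lemma measurable_sqrtr : measurable_fun [set: R] (@Num.sqrt R).
Proof. exact: (continuous_measurable_fun (@sqrt_continuous R)). Qed.

End MeasurableInverse.

Section HeatKernel.
Context {R : realType}.
Implicit Types (t s : R).

Definition heat1 t (x : R) : R := (Num.sqrt (4 * pi * t))^-1 * expR (- x ^+ 2 / (4 * t)).

Definition heat t (x : R3 R) : R := (Num.sqrt (4 * pi * t))^-1 ^+ 3 * expR (- sqnorm x / (4 * t)).

Lemma sqnormE (x : R3 R) : sqnorm x = x.1.1 ^+ 2 + x.1.2 ^+ 2 + x.2 ^+ 2.
Proof. by rewrite /sqnorm !big_ord_recl big_ord0 /coord3 /= addr0 addrA. Qed.

Lemma sqnorm_ge0 (x : R3 R) : 0 <= sqnorm x.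
Proof. by rewrite sqnormE !addr_ge0 ?sqr_ge0. Qed.

Lemma heatE t (x : R3 R) : heat t x = heat1 t x.1.1 * heat1 t x.1.2 * heat1 t x.2.
Proof.
rewrite /heat /heat1 sqnormE !opprD !mulrDl !expRD.
by rewrite !exprS expr0; ring.
Qed.

Lemma heat1_ge0 t (x : R) : 0 <= heat1 t x.
Proof. by rewrite mulr_ge0 ?invr_ge0 ?sqrtr_ge0 ?expR_ge0. Qed.

Lemma heat_ge0 t (x : R3 R) : 0 <= heat t x.
Proof. by rewrite mulr_ge0 ?exprn_ge0 ?invr_ge0 ?sqrtr_ge0 ?expR_ge0. Qed.

(** Square roots of nonpositive numbers and the inverse of 0 are 0 by convention; time integrals can
    therefore run over the whole line. *)
Lemma heat_le0 t (x : R3 R) : t <= 0 -> heat t x = 0.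
Proof.
move=> t0; rewrite /heat ler0_sqrtr ?invr0 ?expr0n ?mul0r //.
by rewrite mulr_ge0_le0 // mulr_ge0 ?pi_ge0.
Qed.

Lemma heatN t (x : R3 R) : heat t (- x) = heat t x.
Proof. by rewrite /heat !sqnormE /= !sqrrN. Qed.

Lemma heat_le t (x : R3 R) : heat t x <= (Num.sqrt (4 * pi * t))^-1 ^+ 3.
Proof.
have [t0|t0] := leP t 0; first by rewrite heat_le0 // exprn_ge0 // invr_ge0 sqrtr_ge0.
rewrite /heat ler_piMr ?exprn_ge0 ?invr_ge0 ?sqrtr_ge0 // -expR0 ler_expR.
by rewrite mulNr oppr_le0 mulr_ge0 ?sqnorm_ge0 // invr_ge0 mulr_ge0 // ltW.
Qed.

Lemma measurable_coords d (T : measurableType d) (f : T -> mR3 R) :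
  measurable_fun setT f -> [/\ measurable_fun setT (fun z => (f z).1.1),
    measurable_fun setT (fun z => (f z).1.2) & measurable_fun setT (fun z => (f z).2)].
Proof.
move=> mf; have m1 : measurable_fun setT (fun z => (f z).1).
  exact: (measurableT_comp (@measurable_fst _ _ _ _) mf).
split; [exact: (measurableT_comp (@measurable_fst _ _ _ _) m1)|
  exact: (measurableT_comp (@measurable_snd _ _ _ _) m1)|
  exact: (measurableT_comp (@measurable_snd _ _ _ _) mf)].
Qed.

Lemma measurable_sqnorm d (T : measurableType d) (f : T -> mR3 R) :
  measurable_fun setT f -> measurable_fun setT (fun z => sqnorm (f z)).
Proof.
move=> /measurable_coords[m1 m2 m3]; under eq_fun do rewrite sqnormE.
apply: measurable_funD; first apply: measurable_funD; exact: measurable_funX.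
Qed.

Lemma measurable_heat d (T : measurableType d) (t : T -> R) (f : T -> mR3 R) :
  measurable_fun setT t -> measurable_fun setT f ->
  measurable_fun setT (fun z => heat (t z) (f z)).
Proof.
move=> mt mf; apply: measurable_funM.
  apply: measurable_funX; apply: (measurableT_comp measurable_invr).
  by apply: (measurableT_comp measurable_sqrtr); exact: measurable_funM.
apply: (measurableT_comp (@measurable_expR R)); apply: measurable_funM.
  by apply: measurable_funN; exact: measurable_sqnorm.
by apply: (measurableT_comp measurable_invr); exact: measurable_funM.
Qed.

Lemma measurable_heat1 d (T : measurableType d) t (f : T -> R) :
  measurable_fun setT f -> measurable_fun setT (fun z => heat1 t (f z)).
Proof.
move=> mf; apply: measurable_funM => //.
apply: (measurableT_comp (@measurable_expR R)); apply: measurable_funM => //.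
by apply: measurable_funN; exact: measurable_funX.
Qed.

(** [heat1 t] is the normal density with mean 0 and variance 2t. *)
Lemma integral_heat1 t : 0 < t -> (\int[lebesgue_measure]_x (heat1 t x)%:E = 1)%E.
Proof.
move=> t0; have s0 : Num.sqrt (2 * t) != 0 by rewrite gt_eqF // sqrtr_gt0 mulr_gt0.
rewrite -[RHS](@integral_normal_pdf R 0 (Num.sqrt (2 * t))); apply: eq_integral => x _.
congr EFin; rewrite normal_pdfE // /normal_peak /normal_fun /heat1 sqr_sqrtr; last first.
  by rewrite mulr_ge0 // ltW.
by congr (_^-1 * expR _); [congr Num.sqrt|rewrite subr0; congr (_ / _)]; ring.
Qed.

(** Completing the square in [z]: the product of two Gaussians is a Gaussian in [x] times a Gaussian
    in [z] centred at s x / (s + t). The second factor has integral 1 in [z], which gives the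
    semigroup property. *)
Lemma heat1_convolution s t (x z : R) : 0 < s -> 0 < t ->
  heat1 t (x - z) * heat1 s z =
  heat1 (s + t) x * heat1 (s * t / (s + t)) (z - s / (s + t) * x).
Proof.
move=> s0 t0; rewrite /heat1.
have st0 : 0 < s + t by exact: addr_gt0.
have E (a b c d : R) : a^-1 * expR b * (c^-1 * expR d) = (a * c)^-1 * expR (b + d).
  by rewrite expRD invfM; ring.
have pi0 : 0 < 4 * pi :> R by rewrite mulr_gt0 // pi_gt0.
rewrite !E -!sqrtrM ?mulr_ge0 ?ltW ?pi_gt0 //.
congr (_ * expR _); first congr (_^-1).
  by congr Num.sqrt; field; rewrite ?gt_eqF ?pi_gt0.
by field; rewrite ?gt_eqF ?pi_gt0.
Qed.

Local Open Scope ereal_scope.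

Lemma integral_heat1_shift t (c : R) : (0 < t)%R ->
  \int[lebesgue_measure]_x (heat1 t (x - c))%:E = 1.
Proof.
move=> t0; rewrite -(integral_heat1 t0).
apply: ((ge0_invariant_shift (- c)).2 (fun x => (heat1 t x)%:E)) => [|x].
  exact/measurable_EFinP/measurable_heat1.
by rewrite lee_fin heat1_ge0.
Qed.

Lemma ge0_integral_prod3 (f g h : R -> R) :
  measurable_fun setT f -> measurable_fun setT g -> measurable_fun setT h ->
  (forall x, 0 <= f x)%R -> (forall x, 0 <= g x)%R -> (forall x, 0 <= h x)%R ->
  \int[leb3]_(z in [set: mR3 R]) (f z.1.1 * g z.1.2 * h z.2)%:E =
  \int[lebesgue_measure]_x (f x)%:E * \int[lebesgue_measure]_x (g x)%:E *
  \int[lebesgue_measure]_x (h x)%:E.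
Proof.
have ge0_integral_prod2 d1 d2 (T1 : measurableType d1) (T2 : measurableType d2)
    (m1 : {sigma_finite_measure set T1 -> \bar R})
    (m2 : {sigma_finite_measure set T2 -> \bar R}) (u : T1 -> R) (v : T2 -> R) :
    measurable_fun setT u -> measurable_fun setT v ->
    (forall x, 0 <= u x)%R -> (forall x, 0 <= v x)%R ->
    \int[prod_measure m1 m2]_z (u z.1 * v z.2)%:E = \int[m1]_x (u x)%:E * \int[m2]_x (v x)%:E.
  move=> mu mv u0 v0; rewrite /prod_measure.
  have mU : measurable_fun setT (fun z : T1 * T2 => u z.1).
    exact: (measurableT_comp mu (@measurable_fst _ _ _ _)).
  have mV : measurable_fun setT (fun z : T1 * T2 => v z.2).
    exact: (measurableT_comp mv (@measurable_snd _ _ _ _)).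
  have mUV : measurable_fun setT (fun z : T1 * T2 => (u z.1 * v z.2)%:E).
    exact/measurable_EFinP/measurable_funM.
  have UV0 (z : T1 * T2) : 0 <= (u z.1 * v z.2)%:E by rewrite lee_fin mulr_ge0.
  rewrite (fubini_tonelli1 _ mUV UV0) /fubini_F /=.
  rewrite -ge0_integralZr //; last 3 first.
  - exact/measurable_EFinP.
  - by move=> x _; rewrite lee_fin.
  - by apply: integral_ge0 => x _; rewrite lee_fin.
  apply: eq_integral => x _; under eq_integral do rewrite EFinM.
  rewrite ge0_integralZl_EFin //; last exact/measurable_EFinP.
  by move=> y _; rewrite lee_fin.
move=> mf mg mh f0 g0 h0.
have mfg : measurable_fun setT (fun z : measurableTypeR R * measurableTypeR R => f z.1 * g z.2)%R.
  apply: measurable_funM; first exact: (measurableT_comp mf (@measurable_fst _ _ _ _)).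
  exact: (measurableT_comp mg (@measurable_snd _ _ _ _)).
have fg0 (z : measurableTypeR R * measurableTypeR R) : (0 <= f z.1 * g z.2)%R by rewrite mulr_ge0.
etransitivity.
  exact: (ge0_integral_prod2 _ _ _ (measurableTypeR R)
    (prod_measure lebesgue_measure lebesgue_measure) lebesgue_measure _ _ mfg mh fg0 h0).
congr (_ * _); exact: (ge0_integral_prod2 _ _ (measurableTypeR R) (measurableTypeR R)
  lebesgue_measure lebesgue_measure).
Qed.

Lemma integral_heat t (y : R3 R) : (0 < t)%R ->
  \int[leb3]_(x in [set: mR3 R]) (heat t ((x : R3 R) - y))%:E = 1.
Proof.
move=> t0; under eq_integral do rewrite heatE /=.
have m c : measurable_fun setT (fun x : R => heat1 t (x - c)).
  by apply: measurable_heat1; exact: measurable_funB.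
rewrite (ge0_integral_prod3 (m y.1.1) (m y.1.2) (m y.2)) => [|x|x|x]; try exact: heat1_ge0.
by rewrite !integral_heat1_shift // !mule1.
Qed.

Lemma heat_semigroup s t (x y : R3 R) : (0 < s)%R -> (0 < t)%R ->
  \int[leb3]_(z in [set: mR3 R]) (heat t (x - z) * heat s ((z : R3 R) - y))%:E =
  (heat (s + t) (x - y))%:E.
Proof.
move=> s0 t0.
(* By [heatE] the integrand factors over the three coordinates, so the one-dimensional identity,
   recentred at [b], is used three times. *)
pose k (a b c : R) := (heat1 t (a - c) * heat1 s (c - b))%R.
have mk a b : measurable_fun setT (k a b).
  by apply: measurable_funM; apply: measurable_heat1; exact: measurable_funB.
have k0 a b c : (0 <= k a b c)%R by rewrite mulr_ge0 ?heat1_ge0.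
have ik a b : \int[lebesgue_measure]_c (k a b c)%:E = (heat1 (s + t) (a - b))%:E.
  have st0 : (0 < s * t / (s + t))%R by rewrite divr_gt0 ?mulr_gt0 ?addr_gt0.
  under eq_integral.
    move=> c _; rewrite /k.
    have -> : (heat1 t (a - c) * heat1 s (c - b) = heat1 (s + t) (a - b) *
       heat1 (s * t / (s + t)) (c - (b + s / (s + t) * (a - b))))%R.
      have := heat1_convolution (a - b) (c - b) s0 t0.
      by rewrite opprB addrA subrK opprD addrA.
    rewrite EFinM; over.
  rewrite ge0_integralZl_EFin ?heat1_ge0 //; last 2 first.
  - by move=> c _; rewrite lee_fin heat1_ge0.
  - by apply/measurable_EFinP; apply: measurable_heat1; exact: measurable_funB.
  by rewrite integral_heat1_shift // mule1.
transitivity (\int[leb3]_(z in [set: mR3 R])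
   (k x.1.1 y.1.1 z.1.1 * k x.1.2 y.1.2 z.1.2 * k x.2 y.2 z.2)%:E).
  by apply: eq_integral => z _; congr EFin; rewrite !heatE /k /=; ring.
by rewrite ge0_integral_prod3 // !ik -!EFinM heatE.
Qed.
End HeatKernel.

(** * Derivatives of the heat kernel *)

Section HeatDerivatives.
Context {R : realType}.

Lemma is_derive_of_line (E : normedModType R) (phi : E -> R) (x e : E) (D : R) :
  is_derive (0 : R) 1 (fun k : R => phi (x + k *: e)) D -> is_derive x e phi D.
Proof.
have eqf : (fun k : R => k^-1 *: (((fun k : R => phi (x + k *: e)) \o shift 0) (k *: 1) - phi (x + 0 *: e)))
   = (fun k : R => k^-1 *: ((phi \o shift x) (k *: e) - phi x)).
  apply/funext => k /=; congr (_ *: (phi _ - phi _)); last by rewrite scale0r addr0.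
  by rewrite -[k *: 1]/(k * 1) mulr1 addr0 addrC.
by rewrite /derivable /derive => -[]; rewrite /derivable /derive eqf => ? ?; split.
Qed.

Lemma is_derive_mul (V : normedModType R) (f g : V -> R) x v (df dg : R) :
  is_derive x v f df -> is_derive x v g dg ->
  is_derive x v (fun y => f y * g y) (df * g x + f x * dg).
Proof.
move=> H1 H2; apply: (is_derive_eq (is_deriveM H1 H2)).
by rewrite -![_ *: _]/(_ * _) addrC; congr (_ + _); rewrite mulrC.
Qed.

Lemma is_derive_add (V : normedModType R) (f g : V -> R) x v (df dg : R) :
  is_derive x v f df -> is_derive x v g dg ->
  is_derive x v (fun y => f y + g y) (df + dg).
Proof. by move=> H1 H2; exact: is_deriveD. Qed.

Lemma is_derive_const (V : normedModType R) (c : R) (x v : V) :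
  is_derive x v (fun=> c) 0.
Proof. exact: is_derive_cst. Qed.

Lemma is_derive_scale (V : normedModType R) (c : R) (f : V -> R) x v (df : R) :
  is_derive x v f df -> is_derive x v (fun y => c * f y) (c * df).
Proof.
by move=> H; apply: (is_derive_eq (is_derive_mul (is_derive_const c x v) H)); rewrite mul0r add0r.
Qed.

Lemma is_derive_quadratic (a b d h : R) :
  is_derive h (1 : R) (fun k : R => a + k * b + k ^+ 2 * d) (b + 2 * h * d).
Proof.
have H1 : is_derive h (1 : R) (fun k : R => k * b) b.
  apply: (is_derive_eq (is_derive_mul (is_derive_id h 1) (is_derive_const b h 1))).
  by rewrite mul1r mulr0 addr0.
have H2 : is_derive h (1 : R) (fun k : R => k ^+ 2 * d) (2 * h * d).
  have H0 := is_derive_mul (is_derive_mul (is_derive_id h 1) (is_derive_id h 1)) (is_derive_const d h 1).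
  by under eq_fun do rewrite expr2; apply: (is_derive_eq H0) => /=; ring.
apply: (is_derive_eq (is_derive_add (is_derive_add (is_derive_const a h 1) H1) H2)).
by rewrite add0r.
Qed.

Definition dot3 (x y : R3 R) : R := x.1.1 * y.1.1 + x.1.2 * y.1.2 + x.2 * y.2.

Lemma sqnorm_line (x e : R3 R) (k : R) :
  sqnorm (x + k *: e) = sqnorm x + k * (2 * dot3 x e) + k ^+ 2 * sqnorm e.
Proof. by rewrite !sqnormE /dot3 /= /GRing.scale /=; ring. Qed.

Lemma is_derive_half_sqnorm (x e : R3 R) : is_derive x e (fun x => 2^-1 * sqnorm x) (dot3 x e).
Proof.
apply: is_derive_of_line.
have := is_derive_quadratic (2^-1 * sqnorm x) (dot3 x e) (2^-1 * sqnorm e) 0.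
rewrite mulr0 mul0r addr0; congr (is_derive _ _ _ _).
by apply/funext => k; rewrite sqnorm_line; field.
Qed.

Lemma is_derive_heat (t : R) (x e : R3 R) :
  is_derive x e (heat t) (- dot3 x e / (2 * t) * heat t x).
Proof.
apply: is_derive_of_line.
have [t0|t0] := leP t 0.
  rewrite (heat_le0 x t0) mulr0; under eq_fun do rewrite (heat_le0 _ t0).
  exact: is_derive_const.
rewrite /heat; under eq_fun do rewrite sqnorm_line.
have q (k : R) : - (sqnorm x + k * (2 * dot3 x e) + k ^+ 2 * sqnorm e) / (4 * t) =
   - sqnorm x / (4 * t) + k * (- dot3 x e / (2 * t)) + k ^+ 2 * (- sqnorm e / (4 * t)).
  by field; rewrite gt_eqF.
under eq_fun do rewrite q.
set c := _ ^+ 3; set a := - sqnorm x / _; set b := - dot3 x e / _; set d := - sqnorm e / _.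
have H := is_derive_quadratic a b d 0.
rewrite mulr0 mul0r addr0 in H.
have He := @is_derive1_comp R expR _ 0 _ _ (is_derive_expR _) H.
apply: (is_derive_eq (is_derive_scale c He)).
by rewrite expr2 !mul0r !addr0; ring.
Qed.

Lemma is_derive_heat2 (t : R) (x e : R3 R) :
  is_derive x e (fun x => - dot3 x e / (2 * t) * heat t x)
    (((dot3 x e / (2 * t)) ^+ 2 - sqnorm e / (2 * t)) * heat t x).
Proof.
have H : is_derive x e (fun x => - dot3 x e / (2 * t)) (- sqnorm e / (2 * t)).
  apply: is_derive_of_line.
  have := is_derive_quadratic (- dot3 x e / (2 * t)) (- sqnorm e / (2 * t)) 0 0.
  rewrite !mulr0 addr0; congr (is_derive _ _ _ _).
  apply/funext => k; rewrite mulr0 addr0 sqnormE /dot3 /= /GRing.scale /=.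
  by rewrite mulrA -mulrDl; congr (_ * _); ring.
apply: (is_derive_eq (is_derive_mul H (is_derive_heat t x e))); ring.
Qed.

(** The exponential is already that of the kernel at time 2t; the normalizations differ by the
    factor 2^(3/2), which is at most 3 because sqrt 2 <= 3/2. *)
Lemma heat_scale2 (t : R) (x : R3 R) : 0 < t ->
  (Num.sqrt (4 * pi * t))^-1 ^+ 3 * expR (- sqnorm x / (8 * t)) <= 3 * heat (2 * t) x.
Proof.
move=> t0; have p0 : 0 < 4 * pi * t by rewrite !mulr_gt0 ?pi_gt0.
rewrite /heat (_ : 4 * pi * (2 * t) = 2 * (4 * pi * t)); last by ring.
rewrite [Num.sqrt (2 * _)]sqrtrM // [(Num.sqrt 2 * _)^-1]invfM exprMn (_ : 4 * (2 * t) = 8 * t); last by ring.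
set B := _^-1 ^+ 3; set A := _^-1 ^+ 3; set E := expR _.
have BE0 : 0 <= B * E by rewrite mulr_ge0 ?expR_ge0 // exprn_ge0 // invr_ge0 sqrtr_ge0.
have -> : 3 * (A * B * E) = (3 * A) * (B * E) by ring.
rewrite -[leLHS]mul1r ler_wpM2r //.
have s0 : 0 < Num.sqrt 2 :> R by rewrite sqrtr_gt0.
rewrite /A exprVn ler_pdivlMr ?exprn_gt0 // mul1r exprS sqr_sqrtr //.
have : Num.sqrt 2 <= Num.sqrt (9 / 4) :> R by rewrite ler_sqrt //; lra.
rewrite (_ : 9 / 4 = (3 / 2) ^+ 2); last by field.
by rewrite sqrtr_sqr ger0_norm //; lra.
Qed.

(* Half of the Gaussian absorbs one power: |a| <= C sqrt t exp(a^2 / 8t). *)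
Lemma abs_mul_heat_le (t a : R) (x : R3 R) : 0 < t -> a ^+ 2 <= sqnorm x ->
  `|a| * heat t x <= 6 * Num.sqrt t * heat (2 * t) x.
Proof.
move=> t0 ax.
have st0 : 0 < Num.sqrt t by rewrite sqrtr_gt0.
set r := Num.sqrt t in st0 *.
have tr : t = r ^+ 2 by rewrite sqr_sqrtr // ltW.
have H : `|a| <= 2 * r * expR (sqnorm x / (8 * t)).
  (* The difference of the two sides is r ((|a| / 2r - 1)^2 + 1); afterwards 1 + y <= exp y is used
     with y = a^2 / 8t. *)
  have h1 : `|a| <= 2 * r * (1 + a ^+ 2 / (8 * t)).
    rewrite -[a ^+ 2]real_normK ?num_real // tr -subr_ge0.
    have -> : 2 * r * (1 + `|a| ^+ 2 / (8 * r ^+ 2)) - `|a| =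
       r * ((`|a| / (2 * r) - 1) ^+ 2 + 1) by field; rewrite gt_eqF.
    by apply: mulr_ge0; [exact: ltW|apply: addr_ge0 => //; exact: sqr_ge0].
  apply: (le_trans h1); rewrite ler_pM2l ?mulr_gt0 //.
  apply: (le_trans (expR_ge1Dx _)); rewrite ler_expR ler_pM2r ?invr_gt0 ?mulr_gt0 //.
have := heat_scale2 x t0.
have c0 : 0 <= (Num.sqrt (4 * pi * t))^-1 ^+ 3 by rewrite exprn_ge0 // invr_ge0 sqrtr_ge0.
move=> h2; have -> : 6 * r * heat (2 * t) x = 2 * r * (3 * heat (2 * t) x) by ring.
apply: (le_trans _ (_ : 2 * r * ((Num.sqrt (4 * pi * t))^-1 ^+ 3 * expR (- sqnorm x / (8 * t))) <= _)).
  rewrite /heat (_ : - sqnorm x / (4 * t) = - (sqnorm x / (8 * t)) - sqnorm x / (8 * t)); last first.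
    by field; rewrite gt_eqF.
  rewrite mulNr expRD; set E := expR _; set B := _^-1 ^+ 3 in c0 *.
  have -> : `|a| * (B * (E * E)) = (`|a| * E) * (B * E) by ring.
  rewrite ler_wpM2r ?mulr_ge0 ?expR_ge0 // /E expRN ler_pdivrMr ?expR_gt0 //.
by rewrite ler_pM2l ?mulr_gt0.
Qed.

Lemma coord3_sqr_le (i : 'I_3) (x : R3 R) : coord3 i x ^+ 2 <= sqnorm x.
Proof.
rewrite /sqnorm (bigD1 i) //= lerDl; apply: sumr_ge0 => j _; exact: sqr_ge0.
Qed.

Lemma dot3_basis3 (i : 'I_3) (x : R3 R) : dot3 x (basis3 i) = coord3 i x.
Proof.
rewrite /dot3 /basis3 /coord3 /=; case: i => -[|[|[|//]]] /= _;
by rewrite ?mulr1 ?mulr0 ?addr0 ?add0r.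
Qed.

Lemma sqnorm_basis3 (i : 'I_3) : sqnorm (basis3 i : R3 R) = 1.
Proof.
rewrite sqnormE /basis3 /=; case: i => -[|[|[|//]]] /= _;
by rewrite !expr2 ?mulr1 ?mulr0 ?addr0 ?add0r.
Qed.

(** The derivative has the factor x_i / 2t, and [abs_mul_heat_le] trades x_i for 6 sqrt t at the
    doubled time. The resulting t^(-1/2) is integrable at t = 0, which is why potentials of finite
    measures have integrable gradients. *)
Lemma derive_heat_le (t : R) (i : 'I_3) (x : R3 R) :
  `|'D_(basis3 i) (heat t) x| <= 3 * (Num.sqrt t)^-1 * heat (2 * t) x.
Proof.
have [_ ->] := is_derive_heat t x (basis3 i).
have [t0|t0] := leP t 0; first by rewrite !heat_le0 ?mulr0 ?normr0 // mulr_ge0_le0.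
rewrite dot3_basis3 normrM (ger0_norm (heat_ge0 _ _)) mulNr normrN normrM normfV.
rewrite (gtr0_norm (_ : 0 < 2 * t)) ?mulr_gt0 // mulrAC ler_pdivrMr ?mulr_gt0 //.
have := abs_mul_heat_le t0 (coord3_sqr_le i x).
move=> /le_trans; apply; rewrite le_eqVlt; apply/orP; left; apply/eqP.
have r0 : Num.sqrt t != 0 by rewrite gt_eqF // sqrtr_gt0.
set h := heat _ _; have -> : 2 * t = 2 * Num.sqrt t ^+ 2 by rewrite sqr_sqrtr // ltW.
by field.
Qed.

(** The factor is the sum of the factors in [is_derive_heat2] over the three basis vectors: this is
    the heat equation. *)
Lemma is_derive_heat_time (t : R) (x : R3 R) : 0 < t ->
  is_derive t 1 (fun t => heat t x)
    ((sqnorm x / (4 * t ^+ 2) - 3 / (2 * t)) * heat t x).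
Proof.
have E3 (y : R) : y ^+ 3 = y * y * y by ring.
move=> t0; rewrite /heat; under eq_fun do rewrite E3.
have p0 : 0 < 4 * pi * t by rewrite !mulr_gt0 ?pi_gt0.
have r0 : Num.sqrt (4 * pi * t) != 0 by rewrite gt_eqF // sqrtr_gt0.
have lin (c : R) : is_derive t 1 (fun t : R => c * t) c.
  by apply: (is_derive_eq (is_derive_scale c (is_derive_id t 1))); rewrite mulr1.
have H1 := @is_derive1_comp R (@Num.sqrt R) (fun t => 4 * pi * t) t _ _ (is_derive1_sqrt p0) (lin (4 * pi)).
have HV := @is_deriveV R (fun t => Num.sqrt (4 * pi * t)) t _ _ r0 H1.
have H2 := is_derive_mul (is_derive_mul HV HV) HV.
have t40 : 4 * t != 0 by rewrite gt_eqF // mulr_gt0.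
have H3 := is_derive_scale (- sqnorm x) (@is_deriveV R (fun t => 4 * t) t _ _ t40 (lin 4)).
have H4 := @is_derive1_comp R expR _ t _ _ (is_derive_expR _) H3.
apply: (is_derive_eq (is_derive_mul H2 H4)); rewrite /= -![_ *: _]/(_ * _) /=.
set s := Num.sqrt _; set E := expR _.
have pn : pi != 0 :> R by rewrite gt_eqF // pi_gt0.
(* In terms of s = sqrt (4 pi t) both sides are rational, with pi treated as an indeterminate, and
   [field] concludes. *)
have ts : t = s ^+ 2 / (4 * pi).
  by rewrite /s sqr_sqrtr ?(ltW p0) // [4 * pi * t]mulrC mulfK // mulf_neq0.
have s0 : s != 0 by [].
clearbody s E; rewrite ts; clear -pn s0; move: (pi : R) pn => P pn.
by field; rewrite s0 pn.
Qed.

End HeatDerivatives.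

(** * Convolutions and superpositions of heat kernels *)

Section Convolution.
Context {R : realType}.
Local Open Scope ereal_scope.

Lemma measurable_sub3 d (T : measurableType d) (f g : T -> mR3 R) :
  measurable_fun setT f -> measurable_fun setT g ->
  measurable_fun setT (fun z => ((f z : R3 R) - g z)%R : mR3 R).
Proof.
move=> /measurable_coords[f1 f2 f3] /measurable_coords[g1 g2 g3].
apply: (measurable_fun_pair (f := fun z => (((f z).1.1 - (g z).1.1)%R, ((f z).1.2 - (g z).1.2)%R))).
  by apply: measurable_fun_pair; exact: measurable_funB.
exact: measurable_funB.
Qed.

(** One definition serves two purposes: with Lebesgue measure for [nu] it convolves a function [b],
    and with [b] equal to 1 it is the potential of the measure [nu]. Values are extended reals
    because a potential may be infinite at an atom. *)
Definition conv (nu : set (mR3 R) -> \bar R) (b k : mR3 R -> \bar R) (x : mR3 R) : \bar R :=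
  \int[nu]_y (b y * k ((x : R3 R) - y)%R).

Section conv.
Variable nu : {sigma_finite_measure set (mR3 R) -> \bar R}.
Implicit Types b k : mR3 R -> \bar R.

Lemma measurable_conv_integrand b k :
  measurable_fun setT b -> measurable_fun setT k ->
  measurable_fun [set: mR3 R * mR3 R] (fun z => b z.2 * k ((z.1 : R3 R) - z.2)%R).
Proof.
move=> mb mk; apply: emeasurable_funM.
  exact: (measurableT_comp mb (@measurable_snd _ _ _ _)).
by apply: (measurableT_comp mk); exact: measurable_sub3.
Qed.

Lemma measurable_conv_integrand1 b k x :
  measurable_fun setT b -> measurable_fun setT k ->
  measurable_fun [set: mR3 R] (fun y => b y * k ((x : R3 R) - y)%R).
Proof.
move=> mb mk; apply: emeasurable_funM => //.
by apply: (measurableT_comp mk); apply: measurable_sub3 => //; exact: measurable_cst.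
Qed.

Lemma measurable_conv b k : measurable_fun setT b -> measurable_fun setT k ->
  (forall x, 0 <= b x) -> (forall x, 0 <= k x) -> measurable_fun setT (conv nu b k).
Proof.
move=> mb mk b0 k0.
apply: (@measurable_fun_fubini_tonelli_F _ _ _ _ _ nu
  (fun z : mR3 R * mR3 R => b z.2 * k ((z.1 : R3 R) - z.2)%R)) => [|z].
  exact: measurable_conv_integrand.
exact: mule_ge0.
Qed.

Lemma conv_ge0 b k x : (forall x, 0 <= b x) -> (forall x, 0 <= k x) -> 0 <= conv nu b k x.
Proof. by move=> b0 k0; apply: integral_ge0 => y _; exact: mule_ge0. Qed.

Lemma integral_conv b k (g : mR3 R -> \bar R) :
  measurable_fun setT b -> measurable_fun setT k -> measurable_fun setT g ->
  (forall x, 0 <= b x) -> (forall x, 0 <= k x) -> (forall x, 0 <= g x) ->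
  \int[leb3]_x (g x * conv nu b k x) =
  \int[nu]_y (b y * \int[leb3]_x (g x * k ((x : R3 R) - y)%R)).
Proof.
move=> mb mk mg b0 k0 g0.
pose f (z : mR3 R * mR3 R) := g z.1 * (b z.2 * k ((z.1 : R3 R) - z.2)%R).
have mf : measurable_fun setT f.
  apply: emeasurable_funM; last exact: measurable_conv_integrand.
  exact: (measurableT_comp mg (@measurable_fst _ _ _ _)).
have f0 z : 0 <= f z by rewrite !mule_ge0.
have := @fubini_tonelli _ _ _ _ _ leb3 nu f mf f0; rewrite /f /= => H.
transitivity (\int[leb3]_x \int[nu]_y (g x * (b y * k ((x : R3 R) - y)%R))).
  apply: eq_integral => x _; rewrite ge0_integralZl //.
  - exact: measurable_conv_integrand1.
  - by move=> y _; exact: mule_ge0.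
rewrite H; apply: eq_integral => y _.
under eq_integral do rewrite muleCA.
rewrite ge0_integralZl //.
- apply: emeasurable_funM => //; apply: (measurableT_comp mk).
  by apply: measurable_sub3 => //; exact: measurable_cst.
- by move=> x _; exact: mule_ge0.
Qed.

Lemma integral_conv1 b k I :
  measurable_fun setT b -> measurable_fun setT k ->
  (forall x, 0 <= b x) -> (forall x, 0 <= k x) ->
  (forall y : mR3 R, \int[leb3]_x k ((x : R3 R) - y)%R = I) ->
  \int[leb3]_x conv nu b k x = (\int[nu]_y b y) * I.
Proof.
move=> mb mk b0 k0 kI.
have := @integral_conv b k (cst 1) mb mk (measurable_cst _) b0 k0 (fun=> lee01).
under eq_integral do rewrite mul1e.
move=> ->; rewrite -ge0_integralZr //; last first.
  by rewrite -(kI point); apply: integral_ge0.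
apply: eq_integral => y _; congr (_ * _); rewrite -[RHS](kI y).
by under eq_integral do rewrite mul1e.
Qed.

Lemma conv_conv b k1 k2 k12 x :
  measurable_fun setT b -> measurable_fun setT k1 -> measurable_fun setT k2 ->
  (forall x, 0 <= b x) -> (forall x, 0 <= k1 x) -> (forall x, 0 <= k2 x) ->
  (forall x y : mR3 R, \int[leb3]_z (k1 ((x : R3 R) - z)%R * k2 ((z : R3 R) - y)%R)
     = k12 ((x : R3 R) - y)%R) ->
  conv leb3 (conv nu b k2) k1 x = conv nu b k12 x.
Proof.
move=> mb mk1 mk2 b0 k10 k20 k12E.
rewrite [LHS]/conv; under eq_integral do rewrite muleC.
rewrite integral_conv //; last first.
  by apply: (measurableT_comp mk1); apply: measurable_sub3 => //; exact: measurable_cst.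
by apply: eq_integral => y _; rewrite k12E.
Qed.

Lemma conv_le b1 b2 k1 k2 x :
  measurable_fun setT b1 -> measurable_fun setT b2 ->
  measurable_fun setT k1 -> measurable_fun setT k2 ->
  (forall x, 0 <= b1 x) -> (forall x, 0 <= k1 x) ->
  (forall y, b1 y <= b2 y) -> (forall x, k1 x <= k2 x) ->
  conv nu b1 k1 x <= conv nu b2 k2 x.
Proof.
move=> mb1 mb2 mk1 mk2 b10 k10 b12 k12.
apply: ge0_le_integral => //; try exact: measurable_conv_integrand1.
- by move=> y _; exact: mule_ge0.
- by move=> y _; exact: lee_pmul.
Qed.

Lemma conv_ae b1 b2 k x :
  measurable_fun setT b1 -> measurable_fun setT b2 -> measurable_fun setT k ->
  (forall x, 0 <= b1 x) -> (forall x, 0 <= b2 x) -> (forall x, 0 <= k x) ->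
  {ae nu, forall y, b1 y = b2 y} -> conv nu b1 k x = conv nu b2 k x.
Proof.
move=> mb1 mb2 mk b10 b20 k0 b12.
apply: ge0_ae_eq_integral => //; try exact: measurable_conv_integrand1.
- by move=> y _; exact: mule_ge0.
- by move=> y _; exact: mule_ge0.
- by apply: filterS b12 => y -> _.
Qed.

Lemma conv_addb b1 b2 k x :
  measurable_fun setT b1 -> measurable_fun setT b2 -> measurable_fun setT k ->
  (forall x, 0 <= b1 x) -> (forall x, 0 <= b2 x) -> (forall x, 0 <= k x) ->
  conv nu (b1 \+ b2) k x = conv nu b1 k x + conv nu b2 k x.
Proof.
move=> mb1 mb2 mk b10 b20 k0; rewrite /conv -ge0_integralD //;
  try exact: measurable_conv_integrand1; try by move=> y _; exact: mule_ge0.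
by apply: eq_integral => y _; rewrite ge0_muleDl.
Qed.

Lemma conv_addk b k1 k2 x :
  measurable_fun setT b -> measurable_fun setT k1 -> measurable_fun setT k2 ->
  (forall x, 0 <= b x) -> (forall x, 0 <= k1 x) -> (forall x, 0 <= k2 x) ->
  conv nu b (k1 \+ k2) x = conv nu b k1 x + conv nu b k2 x.
Proof.
move=> mb mk1 mk2 b0 k10 k20; rewrite /conv -ge0_integralD //;
  try exact: measurable_conv_integrand1; try by move=> y _; exact: mule_ge0.
by apply: eq_integral => y _; rewrite ge0_muleDr.
Qed.

Lemma conv_scalek b (c : R) k x : (0 <= c)%R ->
  measurable_fun setT b -> measurable_fun setT k ->
  (forall x, 0 <= b x) -> (forall x, 0 <= k x) ->
  conv nu b (fun x => c%:E * k x) x = c%:E * conv nu b k x.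
Proof.
move=> c0 mb mk b0 k0; rewrite /conv -ge0_integralZl_EFin //.
- by apply: eq_integral => y _; rewrite muleCA.
- by move=> y _; exact: mule_ge0.
- exact: measurable_conv_integrand1.
Qed.

Lemma conv_le_bound b k (M : \bar R) x : measurable_fun setT b -> measurable_fun setT k ->
  (forall x, 0 <= b x) -> (forall x, 0 <= k x) -> (forall x, k x <= M) ->
  conv nu b k x <= (\int[nu]_y b y) * M.
Proof.
move=> mb mk b0 k0 kM; have M0 : 0 <= M by exact: le_trans (kM point).
rewrite -ge0_integralZr //; apply: ge0_le_integral => //.
- by move=> y _; exact: mule_ge0.
- exact: measurable_conv_integrand1.
- by apply: emeasurable_funM => //; exact: measurable_cst.
- by move=> y _; rewrite lee_wpmul2l.
Qed.

End conv.

(** * Kernels obtained by integrating the heat kernel over time *)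

Section TimeKernel.
Implicit Types w : R -> R.

(** For the weight exp(-Lt) on t > 0 this is the Yukawa kernel exp(- sqrt L |x|) / (4 pi |x|), that
    is, the kernel of (L - Delta)^(-1). *)
Definition tker w (x : mR3 R) : \bar R := \int[lebesgue_measure]_t (w t * heat t x)%:E.

Definition weight w := [/\ measurable_fun setT w, forall t, (0 <= w t)%R &
  forall t, (t <= 0)%R -> w t = 0%R].

Lemma measurable_tker_integrand w : measurable_fun setT w ->
  measurable_fun [set: mR3 R * measurableTypeR R] (fun z => (w z.2 * heat z.2 z.1)%:E).
Proof.
move=> mw; apply/measurable_EFinP; apply: measurable_funM.
  exact: (measurableT_comp mw (@measurable_snd _ _ _ _)).
by apply: measurable_heat; [exact: measurable_snd|exact: measurable_fst].
Qed.

Lemma measurable_tker w : weight w -> measurable_fun setT (tker w).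
Proof.
move=> [mw w0 _].
apply: (@measurable_fun_fubini_tonelli_F _ _ (mR3 R) (measurableTypeR R) _ lebesgue_measure
  (fun z => (w z.2 * heat z.2 z.1)%:E)) => [|z]; first exact: measurable_tker_integrand.
by rewrite lee_fin mulr_ge0 // heat_ge0.
Qed.

Lemma tker_ge0 w x : weight w -> 0 <= tker w x.
Proof.
by move=> [_ w0 _]; apply: integral_ge0 => t _; rewrite lee_fin mulr_ge0 // heat_ge0.
Qed.

Lemma tkerN w x : tker w (- (x : R3 R))%R = tker w x.
Proof. by apply: eq_integral => t _; rewrite heatN. Qed.

Lemma measurable_heat_time (x : mR3 R) : measurable_fun setT (fun t : R => heat t x).
Proof. exact: (measurable_heat (t := id) (f := cst x)). Qed.

Lemma integral_tker w (y : mR3 R) : weight w ->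
  \int[leb3]_x tker w ((x : R3 R) - y)%R = \int[lebesgue_measure]_t (w t)%:E.
Proof.
move=> [mw w0 wn].
pose f (z : mR3 R * measurableTypeR R) := (w z.2 * heat z.2 ((z.1 : R3 R) - y))%:E.
have mf : measurable_fun setT f.
  apply/measurable_EFinP; apply: measurable_funM.
    exact: (measurableT_comp mw (@measurable_snd _ _ _ _)).
  apply: measurable_heat; first exact: measurable_snd.
  by apply: measurable_sub3; [exact: measurable_fst|exact: measurable_cst].
have f0 z : 0 <= f z by rewrite lee_fin mulr_ge0 // heat_ge0.
have := @fubini_tonelli _ _ _ _ _ leb3 lebesgue_measure f mf f0; rewrite /f /= => H.
rewrite [LHS]H; apply: eq_integral => t _; under eq_integral do rewrite EFinM.
rewrite ge0_integralZl_EFin //.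
- have [t0|t0] := leP t 0%R; first by rewrite wn // mul0e.
  by rewrite integral_heat // mule1.
- by move=> x _; rewrite lee_fin heat_ge0.
- apply/measurable_EFinP; apply: measurable_heat; first exact: measurable_cst.
  by apply: measurable_sub3 => //; exact: measurable_cst.
Qed.

Lemma tker_le w1 w2 x : weight w1 -> weight w2 -> (forall t, 0 < t -> w1 t <= w2 t)%R ->
  tker w1 x <= tker w2 x.
Proof.
move=> [mw1 w10 w1n] [mw2 w20 w2n] w12; apply: ge0_le_integral => //.
- by move=> t _; rewrite lee_fin mulr_ge0 // heat_ge0.
- by apply/measurable_EFinP/measurable_funM => //; exact: measurable_heat_time.
- by apply/measurable_EFinP/measurable_funM => //; exact: measurable_heat_time.
- move=> t _; rewrite lee_fin ler_wpM2r ?heat_ge0 //.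
  by have [t0|t0] := leP t 0%R; [rewrite w1n|exact: w12].
Qed.

Lemma tker_le_bound w x : weight w ->
  tker w x <= \int[lebesgue_measure]_t (w t * (Num.sqrt (4 * pi * t))^-1 ^+ 3)%:E.
Proof.
move=> [mw w0 wn]; apply: ge0_le_integral => //.
- by move=> t _; rewrite lee_fin mulr_ge0 // heat_ge0.
- by apply/measurable_EFinP/measurable_funM => //; exact: measurable_heat_time.
- apply/measurable_EFinP/measurable_funM => //; apply: measurable_funX.
  apply: (measurableT_comp measurable_invr); apply: (measurableT_comp measurable_sqrtr).
  exact: measurable_funM.
- by move=> t _; rewrite lee_fin ler_wpM2l // heat_le.
Qed.

Lemma tkerD w1 w2 x : weight w1 -> weight w2 ->
  tker (w1 \+ w2)%R x = tker w1 x + tker w2 x.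
Proof.
move=> [mw1 w10 w1n] [mw2 w20 w2n]; rewrite /tker -ge0_integralD //.
- by apply: eq_integral => t _; rewrite -EFinD -mulrDl.
- by move=> t _; rewrite lee_fin mulr_ge0 // heat_ge0.
- by apply/measurable_EFinP/measurable_funM => //; exact: measurable_heat_time.
- by move=> t _; rewrite lee_fin mulr_ge0 // heat_ge0.
- by apply/measurable_EFinP/measurable_funM => //; exact: measurable_heat_time.
Qed.

Lemma tkerZ (c : R) w x : (0 <= c)%R -> weight w ->
  tker (fun t => c * w t)%R x = c%:E * tker w x.
Proof.
move=> c0 [mw w0 wn]; rewrite /tker -ge0_integralZl_EFin //.
- by apply: eq_integral => t _; rewrite -EFinM; congr EFin; ring.
- by move=> t _; rewrite lee_fin mulr_ge0 // heat_ge0.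
- by apply/measurable_EFinP/measurable_funM => //; exact: measurable_heat_time.
Qed.

(** Tonelli's theorem moves the integral over [z] inside, where the semigroup property evaluates it.
    Both the resolvent identity and the L^2 bound of the potentials start from this formula. *)
Lemma tker_tker w1 w2 (x y : mR3 R) : weight w1 -> weight w2 ->
  \int[leb3]_z (tker w1 ((x : R3 R) - z)%R * tker w2 ((z : R3 R) - y)%R) =
  \int[lebesgue_measure]_s \int[lebesgue_measure]_t
    (w1 t * w2 s * heat (s + t) ((x : R3 R) - y))%:E.
Proof.
move=> [mw1 w10 w1n] [mw2 w20 w2n].
pose f (z : mR3 R * (measurableTypeR R * measurableTypeR R)%type) :=
  (w1 z.2.2 * heat z.2.2 ((x : R3 R) - z.1) * (w2 z.2.1 * heat z.2.1 ((z.1 : R3 R) - y)))%:E.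
have m21 : measurable_fun [set: mR3 R * (measurableTypeR R * measurableTypeR R)%type] (fun z => z.2.1).
  exact: (measurableT_comp (@measurable_fst _ _ _ _) (@measurable_snd _ _ _ _)).
have m22 : measurable_fun [set: mR3 R * (measurableTypeR R * measurableTypeR R)%type] (fun z => z.2.2).
  exact: (measurableT_comp (@measurable_snd _ _ _ _) (@measurable_snd _ _ _ _)).
have mf : measurable_fun setT f.
  apply/measurable_EFinP; apply: measurable_funM; apply: measurable_funM.
  - exact: (measurableT_comp mw1 m22).
  - by apply: measurable_heat => //; apply: measurable_sub3; [exact: measurable_cst|exact: measurable_fst].
  - exact: (measurableT_comp mw2 m21).
  - by apply: measurable_heat => //; apply: measurable_sub3; [exact: measurable_fst|exact: measurable_cst].
have f0 z : 0 <= f z by rewrite lee_fin !mulr_ge0 // heat_ge0.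
pose L : {sigma_finite_measure set (measurableTypeR R) -> \bar R} := lebesgue_measure.
have H := @fubini_tonelli _ _ _ _ _ leb3 (prod_measure L L) f mf f0.
transitivity (\int[leb3]_z \int[prod_measure L L]_u f (z, u)).
  apply: eq_integral => z _.
  rewrite /prod_measure fubini_tonelli1 //; last first.
    by apply: (measurableT_comp mf); apply: measurable_fun_pair => //; exact: measurable_cst.
  rewrite /fubini_F /f /= muleC.
  have h0 s : (0 <= heat s ((z : R3 R) - y))%R by exact: heat_ge0.
  rewrite [X in X * _]/tker -ge0_integralZr //; last 3 first.
  - by apply/measurable_EFinP/measurable_funM => //; exact: measurable_heat_time.
  - by move=> s _; rewrite lee_fin mulr_ge0.
  - by apply: tker_ge0.
  apply: eq_integral => s _; rewrite -ge0_integralZl_EFin.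
  - by apply: eq_integral => t _; rewrite -EFinM mulrC.
  - exact: measurableT.
  - by move=> t _; rewrite lee_fin mulr_ge0 // heat_ge0.
  - by apply/measurable_EFinP/measurable_funM => //; exact: measurable_heat_time.
  - exact: mulr_ge0.
rewrite H /= /prod_measure fubini_tonelli1; last 2 first.
- exact: (measurable_fun_fubini_tonelli_G (m1 := leb3)).
- by move=> u; exact: integral_ge0.
apply: eq_integral => s _; apply: eq_integral => t _; rewrite /fubini_G /f /=.
transitivity (\int[leb3]_z ((w1 t * w2 s)%:E *
    (heat t ((x : R3 R) - z) * heat s ((z : R3 R) - y))%:E)).
  by apply: eq_integral => z _; rewrite -EFinM; congr EFin; ring.
rewrite ge0_integralZl_EFin ?mulr_ge0 //; last 2 first.
- by move=> z _; rewrite lee_fin mulr_ge0 // heat_ge0.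
- apply/measurable_EFinP; apply: measurable_funM.
  + by apply: measurable_heat; [exact: measurable_cst|apply: measurable_sub3 => //; exact: measurable_cst].
  + by apply: measurable_heat; [exact: measurable_cst|apply: measurable_sub3 => //; exact: measurable_cst].
have [t0|t0] := leP t 0%R; first by rewrite w1n // !mul0r mul0e.
have [s0|s0] := leP s 0%R; first by rewrite (w2n s) // !mulr0 !mul0r mul0e.
by rewrite heat_semigroup // -EFinM.
Qed.

(* Additive convolution of the weights: substitute t = r - s. *)
Lemma tker_comp w1 w2 w12 (x y : mR3 R) : weight w1 -> weight w2 ->
  (forall r : R, \int[lebesgue_measure]_s (w1 (r - s) * w2 s)%:E = (w12 r)%:E) ->
  \int[leb3]_z (tker w1 ((x : R3 R) - z)%R * tker w2 ((z : R3 R) - y)%R) =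
  tker w12 ((x : R3 R) - y)%R.
Proof.
move=> W1 W2 w12E; rewrite tker_tker //; have [mw1 w10 w1n] := W1; have [mw2 w20 w2n] := W2.
pose f (z : measurableTypeR R * measurableTypeR R) :=
  (w1 (z.2 - z.1) * w2 z.1 * heat z.2 ((x : R3 R) - y))%:E.
have mf : measurable_fun setT f.
  apply/measurable_EFinP; apply: measurable_funM; first apply: measurable_funM.
  - by apply: (measurableT_comp mw1); apply: measurable_funB; [exact: measurable_snd|exact: measurable_fst].
  - exact: (measurableT_comp mw2 (@measurable_fst _ _ _ _)).
  - by apply: measurable_heat; [exact: measurable_snd|exact: measurable_cst].
have f0 z : 0 <= f z by rewrite lee_fin !mulr_ge0 // heat_ge0.
transitivity (\int[lebesgue_measure]_s \int[lebesgue_measure]_r f (s, r)).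
  apply: eq_integral => s _.
  rewrite -((ge0_invariant_shift s).2 (fun r => f (s, r))).
  - by apply: eq_integral => t _; rewrite /f /= addrK addrC.
  - by apply: (measurableT_comp mf); apply: measurable_fun_pair => //; exact: measurable_cst.
  - by move=> r; exact: f0.
pose L : {sigma_finite_measure set (measurableTypeR R) -> \bar R} := lebesgue_measure.
rewrite [LHS](@fubini_tonelli _ _ _ _ _ L L f mf f0).
apply: eq_integral => r _; rewrite /f /=.
under eq_integral do rewrite EFinM.
rewrite ge0_integralZr ?lee_fin ?heat_ge0 //.
- by rewrite w12E.
- apply/measurable_EFinP; apply: measurable_funM => //.
  by apply: (measurableT_comp mw1); exact: measurable_funB.
- by move=> s _; rewrite lee_fin mulr_ge0.
Qed.

End TimeKernel.
End Convolution.

(** * Weights in time and their integrals *)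

Section Weights.
Context {R : realType}.

Lemma integral_is_derive (f F : R -> R) (a b : R) : a < b ->
  (forall x, a <= x <= b -> is_derive x 1 F (f x)) ->
  (forall x, a <= x <= b -> {for x, continuous f}) ->
  (\int[lebesgue_measure]_(x in `[a, b]) (f x)%:E = (F b - F a)%:E)%E.
Proof.
move=> ab dF cf.
have cF x : a <= x <= b -> {for x, continuous F}.
  by move=> /dF [dFx _]; apply/differentiable_continuous/derivable1_diffP.
rewrite EFinB; apply: continuous_FTC2 => //.
- apply: continuous_in_subspaceT => x /[!inE] /=; rewrite in_itv/=; exact: cf.
- split.
  + by move=> x; rewrite in_itv/= => /andP[ax xb]; have [] := dF x; rewrite ?ltW.
  + by apply: cvg_at_right_filter; apply: cF; rewrite lexx ltW.
  + by apply: cvg_at_left_filter; apply: cF; rewrite lexx ltW.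
- move=> x; rewrite in_itv/= => /andP[ax xb]; rewrite derive1E.
  have h : a <= x <= b by rewrite !ltW.
  by have [_ ->] := dF x h.
Qed.

Definition expw (c t : R) : R := if 0 < t then expR (- c * t) else 0.

Lemma expw_weight c : weight (expw c).
Proof.
split.
- apply: measurable_fun_ifT => //; first exact: measurable_fun_ltr.
  by apply: (measurableT_comp (@measurable_expR R)); exact: measurable_funM.
- by move=> t; rewrite /expw; case: ifP => // _; exact: expR_ge0.
- by move=> t; rewrite /expw ltNge => ->.
Qed.

Lemma integral_expw c : 0 < c -> (\int[lebesgue_measure]_t (expw c t)%:E = (c^-1)%:E)%E.
Proof.
move=> c0.
have me : measurable_fun setT (expw c) by have [] := expw_weight c.
have [mp p0 _] : [/\ measurable_fun setT (exponential_pdf c),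
    forall t, 0 <= exponential_pdf c t & True].
  by split => // [|t]; [exact: measurable_exponential_pdf|exact/exponential_pdf_ge0/ltW].
transitivity ((c^-1)%:E * \int[lebesgue_measure]_t (exponential_pdf c t)%:E)%E; last first.
  by rewrite integral_exponential_pdf // mule1.
rewrite -ge0_integralZl_EFin //; last 3 first.
- by move=> t _; rewrite lee_fin.
- exact/measurable_EFinP.
- by rewrite invr_ge0 ltW.
apply: ge0_ae_eq_integral => //.
- exact/measurable_EFinP.
- by apply: emeasurable_funM => //; exact/measurable_EFinP.
- by move=> t _; rewrite lee_fin; have [_ -> _] := expw_weight c.
- by move=> t _; apply: mule_ge0; rewrite lee_fin // invr_ge0 ltW.
exists [set 0]; split => //; first exact: lebesgue_measure_set1.
move=> t /= h; apply: contrapT => t0; apply: h => _.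
rewrite /expw; have [tp|tn] := ltP 0 t.
  by rewrite exponential_pdfE ?ltW //= -EFinM mulrA mulVf ?gt_eqF ?mul1r.
by rewrite lt0_exponential_pdf ?mule0 // lt_neqAle tn andbT; exact/eqP.
Qed.

(** This is t^(-1/4) for t > 0. Its square t^(-1/2) occurs in the gradient bound, and its cube
    t^(-3/4) in the L^2 bound; both are controlled by the integral of the cube, thanks to
    [qroot_sqr_le]. *)
Definition qroot (t : R) : R := (Num.sqrt (Num.sqrt t))^-1.

Lemma qroot_ge0 t : 0 <= qroot t. Proof. by rewrite invr_ge0 sqrtr_ge0. Qed.

Lemma qroot_sqr t : qroot t ^+ 2 = (Num.sqrt t)^-1.
Proof. by rewrite /qroot exprVn sqr_sqrtr // sqrtr_ge0. Qed.

Lemma measurable_qroot : measurable_fun setT qroot.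
Proof.
apply: (measurableT_comp measurable_invr); apply: (measurableT_comp measurable_sqrtr).
exact: measurable_sqrtr.
Qed.

Lemma qroot_sqr_le t : qroot t ^+ 2 <= qroot t ^+ 3 + 1.
Proof.
have q0 := qroot_ge0 t; set q := qroot t in q0 *.
have [q1|/ltW q1] := leP q 1.
  have : q ^+ 2 <= 1 by rewrite expr_le1.
  by move=> /le_trans; apply; rewrite lerDr exprn_ge0.
by rewrite [q ^+ 3]exprS (le_trans (ler_peMl _ q1)) ?exprn_ge0 // lerDl.
Qed.

Lemma is_derive_qroot (t : R) : 0 < t ->
  is_derive t 1 (fun t => 4 * Num.sqrt (Num.sqrt t)) (qroot t ^+ 3).
Proof.
move=> t0; have s0 : 0 < Num.sqrt t by rewrite sqrtr_gt0.
have s1 : Num.sqrt (Num.sqrt t) != 0 by rewrite gt_eqF // sqrtr_gt0.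
have H := @is_derive1_comp R (@Num.sqrt R) (@Num.sqrt R) t _ _ (is_derive1_sqrt s0) (is_derive1_sqrt t0).
apply: (is_derive_eq (is_derive_scale 4 H)).
rewrite /qroot; set r := Num.sqrt (Num.sqrt t) in s1 *.
have -> : Num.sqrt t = r ^+ 2 by rewrite sqr_sqrtr // ltW.
by field.
Qed.

Lemma qroot_continuous (t : R) : 0 < t -> {for t, continuous (fun t => qroot t ^+ 3)}.
Proof.
move=> t0; apply: (@continuous_comp _ _ _ qroot (fun x : R => x ^+ 3)); last exact: exprn_continuous.
apply: (@continuous_comp _ _ _ (fun t : R => Num.sqrt (Num.sqrt t)) GRing.inv); last first.
  by apply: inv_continuous; rewrite gt_eqF // !sqrtr_gt0.
by apply: (@continuous_comp _ _ _ (@Num.sqrt R) (@Num.sqrt R)); exact: sqrt_continuous.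
Qed.

(** The integrand t^(-3/4) has the primitive 4 t^(1/4), but is singular at 0: the integral is the
    limit of those over compact intervals, each of which is at most 4. *)
Lemma integral_qroot : (\int[lebesgue_measure]_(t in `]0%R, 1%R]) (qroot t ^+ 3)%:E <= 4%:E)%E.
Proof.
(* The offset 2 makes the left end smaller than 1, as the fundamental theorem on a nondegenerate
   interval requires. *)
pose I n : set R := `[n.+2%:R^-1, 1]%classic.
have IE : \bigcup_n I n = `]0, 1]%classic.
  apply/seteqP; split => [t [n _]|t] /=; rewrite /I /= !in_itv/=.
    by move=> /andP[nt ->]; rewrite (lt_le_trans _ nt).
  move=> /andP[t0 t1]; exists (Num.truncn t^-1) => //=; rewrite in_itv/= t1 andbT.
  rewrite invf_ple ?posrE // (le_trans (ltW (truncnS_gt _))) // ler_nat.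
  exact: leqnSn.
have mq : measurable_fun setT (fun t => (qroot t ^+ 3)%:E).
  by apply/measurable_EFinP; apply: measurable_funX; exact: measurable_qroot.
have H : (\int[lebesgue_measure]_(x in I i) (qroot x ^+ 3)%:E @[i --> \oo] -->
    \int[lebesgue_measure]_(x in \bigcup_i I i) (qroot x ^+ 3)%:E)%E.
  apply: ge0_nondecreasing_set_cvg_integral.
  - move=> m n mn; apply/subsetPset => t; rewrite /I /= !in_itv/= => /andP[h ->]; rewrite andbT.
    by rewrite (le_trans _ h) // lef_pV2 ?posrE // ler_nat !ltnS.
  - by move=> i; exact: measurable_itv.
  - by move=> i; exact: measurable_funTS.
  - by move=> i x _; rewrite lee_fin exprn_ge0 // qroot_ge0.
rewrite IE in H; rewrite -(cvg_lim _ H) //; apply: lime_le; first by apply/cvg_ex; eexists; exact: H.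
apply: nearW => n.
have n0 : 0 < n.+2%:R^-1 :> R by rewrite invr_gt0.
have n1 : n.+2%:R^-1 < 1 :> R by rewrite invf_lt1 // ltr1n.
have dq (t : R) : n.+2%:R^-1 <= t <= 1 -> is_derive t 1 (fun t => 4 * Num.sqrt (Num.sqrt t)) (qroot t ^+ 3).
  by move=> /andP[nt _]; apply: is_derive_qroot; exact: lt_le_trans nt.
have cq (t : R) : n.+2%:R^-1 <= t <= 1 -> {for t, continuous (fun t => qroot t ^+ 3)}.
  by move=> /andP[nt _]; apply: qroot_continuous; exact: lt_le_trans nt.
rewrite (integral_is_derive n1 dq cq).
by rewrite !sqrtr1 mulr1 lee_fin gerBl mulr_ge0 // sqrtr_ge0.
Qed.

Lemma expw_ge0 c t : 0 <= expw c t. Proof. by have [_ h _] := expw_weight c. Qed.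
Lemma measurable_expw c : measurable_fun setT (expw c). Proof. by have [] := expw_weight c. Qed.

(** The integrand is at most t^(-3/4) on (0, 1] and at most exp(-ct) beyond; the two parts
    contribute 4 and 1/c. *)
Lemma integral_expw_qroot c : 0 < c ->
  (\int[lebesgue_measure]_t (expw c t * qroot t ^+ 3)%:E <= (4 + c^-1)%:E)%E.
Proof.
move=> c0; have mq : measurable_fun setT (fun t => qroot t ^+ 3).
  by apply: measurable_funX; exact: measurable_qroot.
have q0 t : 0 <= qroot t ^+ 3 by rewrite exprn_ge0 // qroot_ge0.
pose J : set R := `]0, 1]%classic.
have mJ : measurable (J : set (measurableTypeR R)) by exact: measurable_itv.
have mJq : measurable_fun setT (fun t => (\1_J t * qroot t ^+ 3)%:E).
  by apply/measurable_EFinP/measurable_funM => //; exact: measurable_indic.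
apply: (@le_trans _ _ (\int[lebesgue_measure]_t ((\1_J t * qroot t ^+ 3)%:E + (expw c t)%:E))%E).
  apply: ge0_le_integral => //.
  - by move=> t _; rewrite lee_fin mulr_ge0 // expw_ge0.
  - by apply/measurable_EFinP/measurable_funM => //; exact: measurable_expw.
  - by apply: emeasurable_funD => //; apply/measurable_EFinP; exact: measurable_expw.
  - move=> t _; rewrite -EFinD lee_fin; have [t0|t0] := leP t 0.
      have [_ _ ->] := expw_weight c; rewrite // mul0r addr0 mulr_ge0 //.
    have e1 : expw c t <= 1.
      by rewrite /expw t0 -expR0 ler_expR mulNr oppr_le0 mulr_ge0 // ltW.
    have [t1|t1] := leP t 1.
      rewrite indicE mem_set /J /= ?in_itv/= ?t0 // mul1r.
      by rewrite (le_trans (ler_piMl _ e1)) // lerDl expw_ge0.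
    have q1 : qroot t <= 1.
      rewrite invf_le1 ?sqrtr_gt0 ?sqrtr_gt0 //.
      by rewrite -[leLHS]sqrtr1 ler_sqrt ?sqrtr_gt0 // -[leLHS]sqrtr1 ler_sqrt // ltW.
    apply: (@le_trans _ _ (expw c t)); last by rewrite lerDr mulr_ge0.
    by rewrite ler_piMr ?expw_ge0 // exprn_ile1 // qroot_ge0.
rewrite ge0_integralD //; last 3 first.
- by move=> t _; rewrite lee_fin mulr_ge0.
- by move=> t _; rewrite lee_fin expw_ge0.
- by apply/measurable_EFinP; exact: measurable_expw.
rewrite integral_expw // EFinD leeD // (le_trans _ integral_qroot) //.
rewrite [leRHS]integral_mkcond le_eqVlt; apply/orP; left; apply/eqP.
apply: eq_integral => t _; rewrite patchE indicE -/J; case: ifPn => _;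
  by rewrite ?mul1r ?mul0r.
Qed.

(* If [k(x) = \int w(t) p_t(x) dt] for the heat kernel [p], then formally
   [- Delta k = w(0+) delta + \int w'(t) p_t dt].  For [w = kapw a] this reads
   [- Delta k + d = delta] with [0 <= d <= min(a k, constant)], so that the
   potential of a positive measure with kernel [k] is a supersolution of the
   semilinear equation.  The weight [resw L a] is that of [(L - Delta) k]
   without its singular part. *)
Definition kapw (a t : R) : R := (1 + a * t) * expw a t.
Definition dkapw (a t : R) : R := a ^+ 2 * t * expw a t.

Lemma kapw_weight a : 0 < a -> weight (kapw a).
Proof.
move=> a0; have [me e0 en] := expw_weight a; split.
- by apply: measurable_funM => //; apply: measurable_funD => //; exact: measurable_funM.
- move=> t; have [t0|t0] := leP t 0; first by rewrite /kapw en // mulr0.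
  by rewrite mulr_ge0 // addr_ge0 // mulr_ge0 // ltW.
- by move=> t t0; rewrite /kapw en // mulr0.
Qed.

Lemma dkapw_weight a : 0 < a -> weight (dkapw a).
Proof.
move=> a0; have [me e0 en] := expw_weight a; split.
- by apply: measurable_funM => //; exact: measurable_funM.
- move=> t; have [t0|t0] := leP t 0; first by rewrite /dkapw en // mulr0.
  by rewrite !mulr_ge0 // ?sqr_ge0 // ltW.
- by move=> t t0; rewrite /dkapw en // mulr0.
Qed.

Lemma dkapw_le a t : 0 < a -> dkapw a t <= a * kapw a t.
Proof.
move=> a0; rewrite /dkapw /kapw mulrA ler_wpM2r ?expw_ge0 //.
by rewrite mulrDr mulr1 mulrA -expr2 lerDr ltW.
Qed.

Definition resw (L a t : R) : R := L * kapw a t - dkapw a t.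

Lemma resw_weight L a : 0 < a -> a <= L -> weight (resw L a).
Proof.
move=> a0 aL; have [mk k0 kn] := kapw_weight a0; have [md d0 dn] := dkapw_weight a0; split.
- by apply: measurable_funB => //; exact: measurable_funM.
- by move=> t; rewrite subr_ge0 (le_trans (dkapw_le t a0)) // ler_wpM2r.
- by move=> t t0; rewrite /resw kn // dn // mulr0 subr0.
Qed.

(** Half of the exponential absorbs the polynomial: 1 + at <= 2 (1 + at/2) <= 2 exp(at/2). Integrals
    of [kapw] thus reduce to integrals of [expw]. *)
Lemma kapw_le a t : 0 < a -> kapw a t <= 2 * expw (a / 2) t.
Proof.
move=> a0; rewrite /kapw /expw; case: ifPn => t0; last by rewrite !mulr0.
have -> : - a * t = - (a / 2) * t + (- (a / 2 * t)) by field.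
rewrite expRD mulrCA [leRHS]mulrC ler_wpM2l ?expR_ge0 // expRN ler_pdivrMr ?expR_gt0 //.
apply: (@le_trans _ _ (2 * (1 + a / 2 * t))); last by rewrite ler_pM2l // expR_ge1Dx.
by rewrite mulrDr mulr1 (_ : 2 * (a / 2 * t) = a * t) ?lerD2r ?ler1n //; field.
Qed.

Lemma integral_kapw_qroot a : 0 < a ->
  (\int[lebesgue_measure]_t (kapw a t * qroot t ^+ 3)%:E <= (2 * (4 + (a / 2)^-1))%:E)%E.
Proof.
move=> a0; have [mk k0 kn] := kapw_weight a0.
have mq : measurable_fun setT (fun t => qroot t ^+ 3).
  by apply: measurable_funX; exact: measurable_qroot.
have q0 t : 0 <= qroot t ^+ 3 by rewrite exprn_ge0 // qroot_ge0.
have me := measurable_expw (a / 2).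
apply: (@le_trans _ _ (\int[lebesgue_measure]_t (2%:E * (expw (a / 2) t * qroot t ^+ 3)%:E))%E).
  apply: ge0_le_integral => //.
  - by move=> t _; rewrite lee_fin mulr_ge0.
  - exact/measurable_EFinP/measurable_funM.
  - by apply: emeasurable_funM => //; exact/measurable_EFinP/measurable_funM.
  - by move=> t _; rewrite -EFinM lee_fin [leRHS]mulrA; apply: ler_wpM2r => //; exact: kapw_le.
rewrite ge0_integralZl_EFin //.
- by rewrite EFinM lee_pmul2l // integral_expw_qroot // divr_gt0.
- by move=> t _; rewrite lee_fin mulr_ge0 // expw_ge0.
- exact/measurable_EFinP/measurable_funM.
Qed.

Lemma integral_kapw a : 0 < a ->
  (\int[lebesgue_measure]_t (kapw a t)%:E <= (2 * (a / 2)^-1)%:E)%E.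
Proof.
move=> a0; have [mk k0 kn] := kapw_weight a0.
have me := measurable_expw (a / 2).
apply: (@le_trans _ _ (\int[lebesgue_measure]_t (2%:E * (expw (a / 2) t)%:E))%E).
  apply: ge0_le_integral => //.
  - by move=> t _; rewrite lee_fin.
  - exact/measurable_EFinP.
  - by apply: emeasurable_funM => //; exact/measurable_EFinP.
  - by move=> t _; rewrite -EFinM lee_fin kapw_le.
rewrite ge0_integralZl_EFin //.
- by rewrite integral_expw ?divr_gt0 // EFinM.
- by move=> t _; rewrite lee_fin expw_ge0.
- exact/measurable_EFinP.
Qed.

Lemma heat_constant_le (t : R) : 0 < t -> (Num.sqrt (4 * pi * t))^-1 <= (Num.sqrt t)^-1.
Proof.
move=> t0; have p1 : 1 <= 4 * pi :> R by have := pi_ge2 R; lra.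
rewrite lef_pV2 ?posrE ?sqrtr_gt0 ?mulr_gt0 ?pi_gt0 //.
apply: ler_wsqrtr; rewrite -[leLHS]mul1r; apply: ler_wpM2r => //; exact: ltW.
Qed.

(** Here the factor t of [dkapw] pays off: t times t^(-3/2) is t^(-1/2), which is integrable at 0.
    Bounding it by t^(-3/4) + 1 gives a^2 (4 + 1/a + 1/a). The estimate bounds [dkernel] uniformly
    in x. *)
Lemma integral_dkapw_heat a : 0 < a ->
  (\int[lebesgue_measure]_t (dkapw a t * (Num.sqrt (4 * pi * t))^-1 ^+ 3)%:E
   <= (4 * a ^+ 2 + 2 * a)%:E)%E.
Proof.
move=> a0; have [md d0 dn] := dkapw_weight a0.
have mq : measurable_fun setT (fun t => qroot t ^+ 3).
  by apply: measurable_funX; exact: measurable_qroot.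
have q0 t : 0 <= qroot t ^+ 3 by rewrite exprn_ge0 // qroot_ge0.
have me := measurable_expw a; have e0 := expw_ge0 a.
have mc : measurable_fun setT (fun t : R => (Num.sqrt (4 * pi * t))^-1 ^+ 3).
  apply: measurable_funX; apply: (measurableT_comp measurable_invr).
  by apply: (measurableT_comp measurable_sqrtr); exact: measurable_funM.
apply: (@le_trans _ _ (\int[lebesgue_measure]_t ((a ^+ 2)%:E *
    ((expw a t * qroot t ^+ 3)%:E + (expw a t)%:E)))%E).
  apply: ge0_le_integral => //.
  - by move=> t _; rewrite lee_fin mulr_ge0 // exprn_ge0 // invr_ge0 sqrtr_ge0.
  - exact/measurable_EFinP/measurable_funM.
  - apply: emeasurable_funM => //; apply: emeasurable_funD; first exact/measurable_EFinP/measurable_funM.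
    exact/measurable_EFinP.
  - move=> t _; rewrite -EFinD -EFinM lee_fin; have [t0|t0] := leP t 0.
      by rewrite dn // mul0r mulr_ge0 ?sqr_ge0 // addr_ge0 // mulr_ge0.
    set H := _^-1 ^+ 3.
    have -> : dkapw a t * H = a ^+ 2 * (expw a t * (t * H)) by rewrite /dkapw; ring.
    have -> : expw a t * qroot t ^+ 3 + expw a t = expw a t * (qroot t ^+ 3 + 1) by ring.
    apply: ler_wpM2l; first exact: sqr_ge0.
    apply: ler_wpM2l => //; rewrite (le_trans _ (qroot_sqr_le t)) // qroot_sqr.
    have s0 : 0 < Num.sqrt t by rewrite sqrtr_gt0.
    apply: (@le_trans _ _ (t * (Num.sqrt t)^-1 ^+ 3)).
      apply: ler_wpM2l; first exact: ltW.
      apply: lerXn2r; rewrite ?nnegrE ?invr_ge0 ?sqrtr_ge0 //.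
      exact: heat_constant_le.
    rewrite -{1}[t]sqr_sqrtr; last exact: ltW.
    rewrite le_eqVlt; apply/orP; left; apply/eqP.
    by field; rewrite gt_eqF.
rewrite ge0_integralZl_EFin ?sqr_ge0 //; last 2 first.
- by move=> t _; rewrite -EFinD lee_fin addr_ge0 // mulr_ge0.
- by apply: emeasurable_funD; [exact/measurable_EFinP/measurable_funM|exact/measurable_EFinP].
rewrite ge0_integralD //; last 4 first.
- by move=> t _; rewrite lee_fin mulr_ge0.
- exact/measurable_EFinP/measurable_funM.
- by move=> t _; rewrite lee_fin.
- exact/measurable_EFinP.
apply: (@le_trans _ _ ((a ^+ 2)%:E * ((4 + a^-1)%:E + (a^-1)%:E))%E).
  rewrite lee_pmul2l ?lte_fin ?exprn_gt0 //.
  by rewrite integral_expw // leeD // integral_expw_qroot.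
rewrite -EFinD -EFinM lee_fin le_eqVlt; apply/orP; left; apply/eqP; field.
by rewrite gt_eqF.
Qed.

(* Variation of constants for [kapw' = - dkapw], [kapw a 0 = 1]. *)
Lemma expw_resw L a r : 0 < a -> a <= L ->
  (\int[lebesgue_measure]_s (expw L (r - s) * resw L a s)%:E = (kapw a r - expw L r)%:E)%E.
Proof.
move=> a0 aL; have [mr r0 rn] := resw_weight a0 aL.
have [me e0 en] := expw_weight L.
have [rle|rgt] := leP r 0.
  have [_ _ kn] := kapw_weight a0; rewrite kn // en // subr0.
  apply: integral0_eq => s _; have [s0|s0] := leP s 0; first by rewrite rn // mulr0.
  by rewrite en ?mul0r // subr_le0 (le_trans rle) // ltW.
pose F s := expR (- L * (r - s)) * ((1 + a * s) * expR (- a * s)).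
pose f s := expR (- L * (r - s)) * (L * ((1 + a * s) * expR (- a * s)) - a ^+ 2 * s * expR (- a * s)).
have lin (c d s : R) : is_derive s 1 (fun s => c + s * d) d.
  apply: (is_derive_eq (is_derive_add (is_derive_const c s 1)
    (is_derive_mul (is_derive_id s 1) (is_derive_const d s 1)))).
  by rewrite mulr0 addr0 add0r mul1r.
have dex (c d s : R) : is_derive s 1 (fun s => expR (c + s * d)) (d * expR (c + s * d)).
  by apply: (is_derive_eq (@is_derive1_comp R expR _ s _ _ (is_derive_expR _) (lin c d s))); rewrite mulrC.
have dF (s : R) : is_derive s 1 F (f s).
  have E1 : (fun s : R => expR (- L * (r - s))) = (fun s => expR (- L * r + s * L)).
    by apply/funext => u; congr expR; ring.
  have E2 : (fun s : R => expR (- a * s)) = (fun s => expR (0 + s * (- a))).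
    by apply/funext => u; congr expR; ring.
  have H1 := dex (- L * r) L s; have H2 := dex 0 (- a) s; rewrite -E1 in H1; rewrite -E2 in H2.
  have E3 : (fun s : R => 1 + a * s) = (fun s => 1 + s * a).
    by apply/funext => u; rewrite [a * u]mulrC.
  have H3 := lin 1 a s; rewrite -E3 in H3.
  apply: (is_derive_eq (is_derive_mul H1 (is_derive_mul H3 H2))).
  rewrite /f (_ : - L * r + s * L = - L * (r - s)); last by ring.
  rewrite (_ : 0 + s * - a = - a * s); last by ring.
  by ring.
have cf (s : R) : {for s, continuous f}.
  have cl (c d : R) : {for s, continuous (fun s => expR (c * (d - s)))}.
    apply: continuous_comp; last exact: continuous_expR.
    apply: continuousM; first exact: cst_continuous.
    by apply: continuousB; [exact: cst_continuous|exact: id].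
  have ce : {for s, continuous (fun s => expR (- a * s))}.
    apply: continuous_comp; last exact: continuous_expR.
    by apply: continuousM; [exact: cst_continuous|exact: id].
  apply: continuousM; first exact: cl.
  apply: continuousB.
    apply: continuousM; first exact: cst_continuous.
    apply: continuousM => //; apply: continuousD; first exact: cst_continuous.
    by apply: continuousM; [exact: cst_continuous|exact: id].
  apply: continuousM => //.
  by apply: continuousM; [exact: cst_continuous|exact: id].
transitivity (\int[lebesgue_measure]_(s in `]0%R, r[) (f s)%:E)%E.
  rewrite [RHS]integral_mkcond; apply: eq_integral => s _.
  rewrite patchE; case: ifPn; rewrite ?notin_setE ?inE /= in_itv/=.
    move=> /andP[s0 sr]; rewrite /f /expw subr_gt0 sr /resw /kapw /dkapw /expw s0.
    by congr EFin; ring.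
  move=> /negP; rewrite negb_and -!leNgt => /orP[s0|sr]; first by rewrite rn // mulr0.
  by rewrite en ?mul0r // subr_le0.
have mf : measurable_fun setT f by apply: continuous_measurable_fun => s; exact: cf.
rewrite integral_itv_bndo_bndc; last by apply: measurable_funTS; exact/measurable_EFinP.
rewrite integral_itv_obnd_cbnd; last by apply: measurable_funTS; exact/measurable_EFinP.
rewrite (@integral_is_derive f F 0 r rgt (fun s _ => dF s) (fun s _ => cf s)).
by rewrite /F /kapw /expw rgt subrr !mulr0 subr0 expR0 addr0 !mul1r mulr1.
Qed.

End Weights.

(** * Polar coordinates *)

Section BallVolume.
Context {R : realType}.

(** Substitute x = sqrt s sin y with y between - pi/2 and pi/2. The integrand becomes 2 s cos^2 y,
    with primitive s (y + sin y cos y). Outside [- sqrt s, sqrt s] the square root is 0. *)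
Lemma integral_half_disc (s : R) : 0 < s ->
  (\int[lebesgue_measure]_x (2 * Num.sqrt (s - x ^+ 2))%:E = (pi * s)%:E)%E.
Proof.
move=> s0; set r := Num.sqrt s.
have r0 : 0 < r by rewrite sqrtr_gt0.
have rs : r ^+ 2 = s by rewrite sqr_sqrtr // ltW.
have pi2 : - (pi / 2) < pi / 2 :> R by rewrite gtrN // divr_gt0 // pi_gt0.
pose F (x : R) : R := r * sin x.
have dF (x : R) : is_derive x 1 F (r * cos x) by apply: is_derive_scale.
have cG : continuous (fun x : R => 2 * Num.sqrt (s - x ^+ 2)).
  move=> x; apply: cvgM; first exact: cvg_cst.
  apply: (@continuous_comp _ _ _ (fun x : R => s - x ^+ 2) (@Num.sqrt R)); last exact: sqrt_continuous.
  by apply: cvgB; [exact: cvg_cst|exact: exprn_continuous].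
have mG : measurable_fun setT (fun x : R => 2 * Num.sqrt (s - x ^+ 2)).
  exact: continuous_measurable_fun.
have F'E : F^`()%classic = (fun x => r * cos x).
  by apply/funext => x; rewrite derive1E; have [_ ->] := dF x.
have cF' : continuous F^`()%classic.
  rewrite F'E => x; apply: cvgM; first exact: cvg_cst.
  exact: continuous_cos.
have cF : continuous F.
  by move=> x; apply: cvgM; [exact: cvg_cst|exact: continuous_sin].
transitivity (\int[lebesgue_measure]_(x in `[F (- (pi / 2))%R, F (pi / 2)%R]) (2 * Num.sqrt (s - x ^+ 2))%:E)%E.
  rewrite [RHS]integral_mkcond; apply: eq_integral => x _.
  rewrite patchE; case: ifPn => //; rewrite notin_setE /= in_itv/= /F sinN sin_pihalf mulrN mulr1.
  move=> /negP; rewrite -ler_norml -ltNge => rx.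
  rewrite ler0_sqrtr ?mulr0 // subr_le0 -rs -[leRHS]real_normK ?num_real //.
  by rewrite lerXn2r ?nnegrE // ltW.
rewrite integration_by_substitution_increasing.
- have dH (x : R) : is_derive x 1 (fun x => s * (x + sin x * cos x)) (2 * s * cos x ^+ 2).
    have H := is_derive_scale s (is_derive_add (is_derive_id x 1)
      (is_derive_mul (is_derive_sin x) (is_derive_cos x))).
    apply: (is_derive_eq H); rewrite mulrN -!expr2 sin2cos2.
    by move: (cos x) => C; ring.
  have cH (x : R) : {for x, continuous (fun x => 2 * s * cos x ^+ 2)}.
    apply: continuousM; first exact: cst_continuous.
    apply: (@continuous_comp _ _ _ (@cos R) (fun x : R => x ^+ 2)); last exact: exprn_continuous.
    exact: continuous_cos.
  transitivity (\int[lebesgue_measure]_(x in `[(- (pi / 2))%R, (pi / 2)%R]) (2 * s * cos x ^+ 2)%:E)%E.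
    apply: eq_integral => x /[!inE] /=; rewrite in_itv/= => xpi.
    have c0 := cos_ge0_pihalf xpi.
    congr EFin; rewrite F'E /= fctE /F /= exprMn rs.
    rewrite (_ : s - s * sin x ^+ 2 = (r * cos x) ^+ 2); last first.
      by rewrite exprMn rs cos2sin2 mulrBr mulr1.
    rewrite sqrtr_sqr ger0_norm ?mulr_ge0 ?(ltW r0) //.
    by rewrite -rs; ring.
  rewrite (integral_is_derive pi2 (fun x _ => dH x) (fun x _ => cH x)).
  by rewrite cosN sinN cos_pihalf !mulr0 !addr0; congr EFin; field.
- exact: ltW.
- move=> x y xi yi xy; rewrite /F ltr_pM2l // ltr_sin //.
- by move=> x _; exact: cF'.
- by apply/cvg_ex; eexists; apply: cvg_at_right_filter; exact: cF'.
- by apply/cvg_ex; eexists; apply: cvg_at_left_filter; exact: cF'.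
- split.
  + by move=> x _; have [] := dF x.
  + by apply: cvg_at_right_filter; exact: cF.
  + by apply: cvg_at_left_filter; exact: cF.
- exact: continuous_subspaceT.
Qed.

Definition energy (v : R3 R) : R := 2^-1 * sqnorm v.

Lemma measurable_energy : measurable_fun [set: mR3 R] energy.
Proof. by apply: measurable_funM => //; exact: (measurable_sqnorm (f := id)). Qed.

Let L : {sigma_finite_measure set (measurableTypeR R) -> \bar R} := lebesgue_measure.

Lemma lebesgue_sqr_le (s : R) :
  (L [set x : measurableTypeR R | ((x : R) ^+ 2 <= s)%R] = (2 * Num.sqrt s)%:E)%E.
Proof.
have [s0|s0] := ltP s 0.
  rewrite (_ : [set _ | _] = set0) ?measure0 ?ltr0_sqrtr ?mulr0 //.
  by apply/seteqP; split => // x /= xs; have := sqr_ge0 x; rewrite leNgt (le_lt_trans xs).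
rewrite (_ : [set _ | _] = `[- Num.sqrt s, Num.sqrt s]%classic); last first.
  apply/seteqP; split => x /=; rewrite in_itv/= -ler_norml.
    by move=> xs; rewrite -sqrtr_sqr ler_wsqrtr.
  by move=> xs; rewrite -[s]sqr_sqrtr // -real_normK ?num_real // lerXn2r ?nnegrE ?sqrtr_ge0.
rewrite /L /= lebesgue_measure_itv /= lte_fin; case: ifPn => h.
  by rewrite -EFinB; congr EFin; ring.
have -> : Num.sqrt s = 0.
  by apply/eqP; rewrite eq_le sqrtr_ge0 andbT; move: h; rewrite -leNgt; lra.
by rewrite mulr0.
Qed.

Lemma measurable_disc (s : R) :
  measurable [set z : measurableTypeR R * measurableTypeR R | ((z.1 : R) ^+ 2 + (z.2 : R) ^+ 2 <= s)%R].
Proof.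
have m : measurable_fun setT (fun z : measurableTypeR R * measurableTypeR R => (z.1 : R) ^+ 2 + (z.2 : R) ^+ 2).
  by apply: measurable_funD; apply: measurable_funX; [exact: measurable_fst|exact: measurable_snd].
have := m measurableT `]-oo, s]%classic (measurable_itv _).
by rewrite setTI; congr measurable; apply/seteqP; split => z /=; rewrite in_itv.
Qed.

Lemma disc_area (s : R) :
  (prod_measure L L [set z | ((z.1 : R) ^+ 2 + (z.2 : R) ^+ 2 <= s)%R] = (pi * Num.max s 0)%:E)%E.
Proof.
transitivity (\int[L]_x (2 * Num.sqrt (s - x ^+ 2))%:E)%E.
  rewrite /prod_measure /= /product_measure1; apply: eq_integral => x _ /=.
  rewrite -lebesgue_sqr_le; congr (_ _); apply/seteqP; split => y; rewrite /xsection /= ?inE /=.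
    by rewrite lerBrDl.
  by rewrite lerBrDl.
have [s0|s0] := ltP 0 s.
  by rewrite integral_half_disc.
rewrite mulr0; apply: integral0_eq => x _.
by rewrite ler0_sqrtr ?mulr0 // subr_le0 (le_trans s0) // sqr_ge0.
Qed.

Lemma measurable_energy_le (r : R) : measurable [set v : mR3 R | (energy v <= r)%R].
Proof.
have := measurable_energy measurableT (measurable_itv `]-oo, r]).
by rewrite setTI; congr measurable; apply/seteqP; split => z /=; rewrite in_itv.
Qed.

(** The slice at height z is a disc of area pi (2r - z^2)_+, and this polynomial is integrated
    between - sqrt (2r) and sqrt (2r). *)
Lemma ball_volume (r : R) : 0 <= r ->
  (leb3 [set v : mR3 R | (energy v <= r)%R] = (4 / 3 * pi * Num.sqrt (2 * r) ^+ 3)%:E)%E.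
Proof.
move=> r0; set S := [set v | _]; have mS : measurable S by exact: measurable_energy_le.
rewrite -(setIT S) -integral_indic // /leb3 /prod_measure.
rewrite (@fubini_tonelli2 _ _ _ _ _ (prod_measure L L) L (fun z => (\1_S z)%:E)); last 2 first.
- by apply/measurable_EFinP; exact: measurable_indic.
- by move=> z; rewrite lee_fin.
transitivity (\int[L]_z (pi * Num.max (2 * r - z ^+ 2) 0)%:E)%E.
  apply: eq_integral => z _; rewrite /fubini_G.
  rewrite -disc_area; set D := [set _ | _].
  rewrite -[in RHS](setIT D) -integral_indic //; last exact: measurable_disc.
  apply: eq_integral => -[x y] _; congr EFin; rewrite !indicE; congr (_ %:R); congr nat_of_bool.
  apply/idP/idP; rewrite !inE /S /D /= /energy sqnormE /=; lra.
set q := Num.sqrt (2 * r).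
have q0 : 0 <= q by exact: sqrtr_ge0.
have q2 : q ^+ 2 = 2 * r by rewrite sqr_sqrtr // mulr_ge0.
transitivity (\int[lebesgue_measure]_(z in `[(- q)%R, q]) (pi * (q ^+ 2 - z ^+ 2))%:E)%E.
  rewrite [RHS]integral_mkcond; apply: eq_integral => z _.
  rewrite patchE -q2; case: ifPn; rewrite ?notin_setE ?inE /= in_itv/= -ler_norml.
    move=> zq; rewrite max_l // subr_ge0 -real_normK ?num_real //.
    by apply: lerXn2r; rewrite ?nnegrE.
  move=> /negP; rewrite -ltNge => zq; rewrite max_r ?mulr0 // subr_le0.
  rewrite -[leRHS]real_normK ?num_real //.
  by apply: lerXn2r; rewrite ?nnegrE // ltW.
have [q00|qn0] := eqVneq q 0.
  by rewrite q00 oppr0 set_itv1 integral_set1 expr0n mulr0.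
have qp : 0 < q by rewrite lt_neqAle eq_sym qn0.
have dH (z : R) : is_derive z 1 (fun z => pi * (q ^+ 2 * z + - 3^-1 * (z * z * z))) (pi * (q ^+ 2 - z ^+ 2)).
  have H := is_derive_scale pi (is_derive_add (is_derive_scale (q ^+ 2) (is_derive_id z 1))
      (is_derive_scale (- 3^-1) (is_derive_mul (is_derive_mul (is_derive_id z 1) (is_derive_id z 1)) (is_derive_id z 1)))).
  by apply: (is_derive_eq H) => /=; move: (pi : R) => P; field.
have cH (z : R) : {for z, continuous (fun z : R => pi * (q ^+ 2 - z ^+ 2))}.
  apply: cvgM; first exact: cvg_cst.
  by apply: cvgB; [exact: cvg_cst|exact: exprn_continuous].
have qq : - q < q by rewrite gtrN.
rewrite (integral_is_derive qq (fun z _ => dH z) (fun z _ => cH z)).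
by congr EFin; move: (pi : R) => P; field.
Qed.

Lemma ball_volume_neg (r : R) : r < 0 -> (leb3 [set v : mR3 R | (energy v <= r)%R] = 0)%E.
Proof.
move=> r0; rewrite (_ : [set _ | _] = set0) ?measure0 //.
apply/seteqP; split => // v /= vr; have := sqnorm_ge0 v; rewrite /energy in vr; lra.
Qed.

Let c : R := 4 * pi * Num.sqrt 2.

(** The image of Lebesgue measure on velocities under v |-> |v|^2/2; the square root restricts it to
    nonnegative energies by itself. *)
Definition energy_measure (A : set (measurableTypeR R)) : \bar R :=
  (\int[L]_(r in A) (4 * pi * Num.sqrt 2 * Num.sqrt r)%:E)%E.

Lemma energy_density_ge0 (r : R) : 0 <= 4 * pi * Num.sqrt 2 * Num.sqrt r.
Proof. by rewrite !mulr_ge0 ?pi_ge0 ?sqrtr_ge0. Qed.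

Lemma measurable_energy_density : measurable_fun setT (fun r : R => 4 * pi * Num.sqrt 2 * Num.sqrt r).
Proof. by apply: measurable_funM => //; exact: measurable_sqrtr. Qed.

Let energy_measure0 : energy_measure set0 = 0%E.
Proof. by rewrite /energy_measure integral_set0. Qed.

Let energy_measure_ge0 A : (0 <= energy_measure A)%E.
Proof. by apply: integral_ge0 => r _; rewrite lee_fin energy_density_ge0. Qed.

Let energy_measure_sigma_additive : semi_sigma_additive energy_measure.
Proof.
move=> F mF tF mUF; rewrite /energy_measure ge0_integral_bigcup //.
- apply: is_cvg_ereal_nneg_natsum_cond => n _ _; exact: energy_measure_ge0.
- by apply: measurable_funTS; apply/measurable_EFinP; exact: measurable_energy_density.
- by move=> r _; rewrite lee_fin energy_density_ge0.
Qed.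

HB.instance Definition _ := isMeasure.Build _ _ _
  energy_measure energy_measure0 energy_measure_ge0 energy_measure_sigma_additive.

Lemma energy_measure_itv (a b : R) : 0 <= a -> a < b ->
  energy_measure `]a, b]%classic =
  (4 / 3 * pi * Num.sqrt (2 * b) ^+ 3 - 4 / 3 * pi * Num.sqrt (2 * a) ^+ 3)%:E.
Proof.
move=> a0 ab; rewrite /energy_measure.
have p0 : 0 <= 4 / 3 * pi * Num.sqrt 2 :> R by rewrite !mulr_ge0 ?pi_ge0 ?sqrtr_ge0.
have e3 (r : R) : 0 <= r -> 4 / 3 * pi * Num.sqrt (2 * r) ^+ 3 =
    4 / 3 * pi * Num.sqrt 2 * 2 * (Num.sqrt r * Num.sqrt r * Num.sqrt r).
  move=> r0; rewrite sqrtrM // exprMn [Num.sqrt 2 ^+ 3]exprS sqr_sqrtr //.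
  by move: (pi : R) => P; ring.
pose F (r : R) : R := 4 / 3 * pi * Num.sqrt 2 * 2 * (Num.sqrt r * Num.sqrt r * Num.sqrt r).
have b0 : 0 < b by exact: le_lt_trans ab.
have cF : continuous F.
  move=> r; apply: cvgM; first exact: cvg_cst.
  by apply: cvgM; [apply: cvgM|]; exact: sqrt_continuous.
have dF (r : R) : 0 < r -> is_derive r 1 F (4 * pi * Num.sqrt 2 * Num.sqrt r).
  move=> r0; have D := is_derive1_sqrt r0.
  have H := is_derive_scale (4 / 3 * pi * Num.sqrt 2 * 2) (is_derive_mul (is_derive_mul D D) D).
  apply: (is_derive_eq H); have s0 : Num.sqrt r != 0 by rewrite gt_eqF // sqrtr_gt0.
  by move: (pi : R) (Num.sqrt r) s0 => P s s0; field.
rewrite integral_itv_obnd_cbnd; last first.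
  by apply: measurable_funTS; apply/measurable_EFinP; exact: measurable_energy_density.
rewrite (@continuous_FTC2 _ _ F) //.
- by rewrite -EFinB /F !e3 // ltW.
- apply: continuous_subspaceT => r; apply: cvgM; first exact: cvg_cst.
  exact: sqrt_continuous.
- split.
  + by move=> r; rewrite in_itv/= => /andP[ar _]; have [] := dF r (le_lt_trans a0 ar).
  + by apply: cvg_at_right_filter; exact: cF.
  + by apply: cvg_at_left_filter; exact: cF.
- move=> r; rewrite in_itv/= => /andP[ar _]; rewrite derive1E.
  by have [_ ->] := dF r (le_lt_trans a0 ar).
Qed.

HB.instance Definition _ := isMeasurableFun.Build _ _ _ _
  (energy : mR3 R -> measurableTypeR R) measurable_energy.

(** On a half-open interval both sides are differences of ball volumes. Half-open intervals form a
    generating pi-system which contains an exhausting sequence of finite measure, so the measures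
    coincide. *)
Lemma energy_measureE (A : set (measurableTypeR R)) : measurable A ->
  pushforward leb3 (energy : mR3 R -> measurableTypeR R) A = energy_measure A.
Proof.
have le0 (b : R) : b <= 0 -> leb3 [set v : mR3 R | energy v <= b] = 0%E.
  rewrite le_eqVlt => /predU1P[->|]; last exact: ball_volume_neg.
  by rewrite ball_volume // mulr0 sqrtr0 expr0n mulr0.
have fin (b : R) : (leb3 [set v : mR3 R | energy v <= b]%R < +oo)%E.
  have [b0|/ltW b0] := leP 0 b; first by rewrite ball_volume // ltry.
  by rewrite le0.
have pE (a b : R) : a < b -> pushforward leb3 (energy : mR3 R -> measurableTypeR R) `]a, b]%classic =
    (leb3 [set v : mR3 R | energy v <= b]%R - leb3 [set v : mR3 R | energy v <= a]%R)%E.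
  move=> ab; rewrite /pushforward.
  have mD := measurable_energy_le.
  have HD := @measureD _ _ _ leb3 _ _ (mD b) (mD a) (fin b).
  rewrite (_ : _ `&` _ = [set v : mR3 R | (energy v <= a)%R]) in HD; last first.
    by apply/seteqP; split => v /= => [[]//|va]; split => //; rewrite (le_trans va) // ltW.
  rewrite -HD; congr (leb3 _); apply/seteqP; split => v /=; rewrite in_itv/=.
    by move=> /andP[av vb]; split => //; apply/negP; rewrite -ltNge.
  by move=> [vb /negP]; rewrite -ltNge => ->.
have emax (a b : R) : energy_measure `]a, b]%classic = energy_measure `]Num.max a 0, b]%classic.
  rewrite /energy_measure [LHS]integral_mkcond [RHS]integral_mkcond; apply: eq_integral => r _.
  rewrite !patchE !mem_setE !in_itv/= gt_max.
  have [r0|r0] := ltP 0 r; first by rewrite andbT.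
  by rewrite andbF /= (ler0_sqrtr r0) mulr0; case: ifP.
have eE (a b : R) : a < b -> pushforward leb3 (energy : mR3 R -> measurableTypeR R) `]a, b]%classic = energy_measure `]a, b]%classic.
  move=> ab; rewrite pE // emax.
  have [b0|b0] := leP b 0.
    rewrite !le0 ?(le_trans (ltW ab)) // sube0.
    rewrite (_ : `]Num.max a 0, b]%classic = set0) ?measure0 //.
    apply/seteqP; split => // r /=; rewrite in_itv/= gt_max => /andP[/andP[_ r0] rb].
    by have := lt_le_trans r0 (le_trans rb b0); rewrite ltxx.
  have [a0|a0] := leP a 0.
    by rewrite (le0 a a0) sube0 energy_measure_itv // ball_volume ?(ltW b0) // mulr0 sqrtr0 expr0n mulr0 subr0.
  by rewrite energy_measure_itv ?(ltW a0) // !ball_volume ?(ltW a0) ?(ltW b0).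
move=> mA.
pose g (k : nat) : set (measurableTypeR R) := `]- k%:R, k%:R]%classic.
pose P : {measure set (measurableTypeR R) -> \bar R} :=
  measure_function_pushforward__canonical__measure_function_Measure leb3
    (measurable_energy : measurable_fun setT (energy : mR3 R -> measurableTypeR R)).
refine (@measure_unique _ R (measurableTypeR R) (@ocitv R) g erefl _ _ _ P energy_measure _ _ A mA).
- exact: ocitvI.
- by move=> i; exact: is_ocitv.
- apply/seteqP; split => // r _; exists (Num.truncn `|r|).+1 => //.
  rewrite /g /= in_itv/=; have := truncnS_gt `|r|; rewrite ltr_norml => /andP[-> h].
  exact: ltW.
- move=> X /ocitvP[->|[[a b] /= ab ->]]; first by rewrite !measure0.
  exact: eE.
- move=> k; rewrite /g; have [k0|k0] := ltP (- k%:R : R) k%:R; last first.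
    rewrite (_ : `]_, _]%classic = set0) ?measure0 //.
    by apply/seteqP; split => // r /=; rewrite in_itv/= => /andP[h1 h2]; have := lt_le_trans h1 (le_trans h2 k0); rewrite ltxx.
  have -> : P `]- k%:R, k%:R]%classic = energy_measure `]- k%:R, k%:R]%classic by exact: eE.
  rewrite -eE // pE //; apply: le_lt_trans (fin k%:R).
  by rewrite leeBlDr ?leeDl // ge0_fin_numE.
Qed.

(** Layer cake: [Phi] is the integral over s of the indicators of 0 < s < [Phi]. Tonelli's theorem
    reduces the claim to the level sets, where it is [energy_measureE], and then reassembles
    [Phi]. *)
Lemma polar (Phi : R -> R) : measurable_fun setT Phi -> (forall r, 0 <= Phi r) ->
  (\int[leb3]_(v in [set: mR3 R]) (Phi (energy v))%:E =
   \int[lebesgue_measure]_r (4 * pi * Num.sqrt 2 * Num.sqrt r * Phi r)%:E)%E.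
Proof.
move=> mPhi Phi0.
pose A (s : R) : set (measurableTypeR R) := [set r | (0 < s) && (s < Phi r)].
have mA s : measurable (A s).
  have [s0|s0] := ltP 0 s; last first.
    by rewrite (_ : A s = set0) //; apply/seteqP; split => // r; rewrite /A /= ltNge s0.
  have := mPhi measurableT _ (measurable_itv `]s, +oo[); rewrite setTI.
  by congr measurable; apply/seteqP; split => r; rewrite /A /= s0 in_itv/= andbT.
have layer (x : R) : (0 <= x)%R -> (\int[lebesgue_measure]_s (((0 < s) && (s < x))%:R : R)%:E = x%:E)%E.
  move=> x0; transitivity (\int[lebesgue_measure]_s (\1_(`]0%R, x[%classic : set (measurableTypeR R)) s)%:E)%E.
    by apply: eq_integral => s _; rewrite indicE mem_setE in_itv.
  rewrite integral_indic // setIT.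
  etransitivity; first exact: (lebesgue_measure_itv `]0, x[).
  rewrite /= lte_fin; case: ifPn => h.
    by rewrite sube0.
  by congr EFin; apply/eqP; rewrite eq_le x0 /= leNgt h.
have mind d (T : measurableType d) (f : T -> R) : measurable_fun setT f ->
    measurable_fun setT (fun z : T * measurableTypeR R => (((0 < (z.2 : R)) && ((z.2 : R) < f z.1))%:R : R)).
  move=> mf; rewrite (_ : (fun _ => _) = (fun z => if (0 < (z.2 : R)) && ((z.2 : R) < f z.1) then 1 else 0)).
    apply: measurable_fun_ifT => //; apply: measurable_and.
      by apply: measurable_fun_ltr => //; exact: measurable_snd.
    apply: measurable_fun_ltr; first exact: measurable_snd.
    exact: (measurableT_comp mf (@measurable_fst _ _ _ _)).
  by apply/funext => z; case: ifP.
have i0 (b : bool) : (0 <= (b%:R : R)%:E)%E by rewrite lee_fin ler0n.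
transitivity (\int[leb3]_(v in [set: mR3 R]) \int[lebesgue_measure]_s (((0 < s) && (s < Phi (energy v)))%:R : R)%:E)%E.
  by apply: eq_integral => v _; rewrite layer.
pose h1 (z : mR3 R * measurableTypeR R) : \bar R := (((0 < (z.2 : R)) && ((z.2 : R) < Phi (energy z.1)))%:R : R)%:E.
have mh1 : measurable_fun setT h1.
  by apply/measurable_EFinP; apply: (mind _ _ (fun v => Phi (energy v))); exact: (measurableT_comp mPhi measurable_energy).
rewrite [LHS](@fubini_tonelli _ _ _ _ _ leb3 L h1 mh1 (fun=> i0 _)) /h1 /=.
pose h2 (z : measurableTypeR R * measurableTypeR R) : \bar R :=
  ((4 * pi * Num.sqrt 2 * Num.sqrt z.1) * (((0 < (z.2 : R)) && ((z.2 : R) < Phi z.1))%:R : R))%:E.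
have mh2 : measurable_fun setT h2.
  apply/measurable_EFinP; apply: measurable_funM; last exact: mind.
  exact: (measurableT_comp measurable_energy_density (@measurable_fst _ _ _ _)).
have h20 z : (0 <= h2 z)%E by rewrite lee_fin mulr_ge0 // energy_density_ge0.
transitivity (\int[L]_s \int[L]_r h2 (r, s))%E.
  apply: eq_integral => s _.
  transitivity (leb3 (energy @^-1` A s)).
    rewrite -[X in leb3 X](setIT) -integral_indic //; last first.
      by have := measurable_energy measurableT (mA s); rewrite setTI.
    by apply: eq_integral => v _; rewrite indicE /A mem_setE.
  rewrite -[LHS]/(pushforward leb3 (energy : mR3 R -> measurableTypeR R) (A s)) energy_measureE //.
  rewrite /energy_measure integral_mkcond; apply: eq_integral => r _.
  rewrite patchE /h2 /A mem_setE /= -topredE /=.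
  by case: ifP => _; rewrite ?mulr1 ?mulr0.
rewrite -[LHS](@fubini_tonelli _ _ _ _ _ L L h2 mh2 h20).
apply: eq_integral => r _; rewrite /h2 /=.
under eq_integral do rewrite EFinM.
rewrite ge0_integralZl_EFin //.
- by rewrite layer.
- apply/measurable_EFinP.
  have := mind _ (measurableTypeR R) (cst (Phi r)) (measurable_cst _).
  move=> H; apply: (measurableT_comp H (g := fun s : measurableTypeR R => (s, s))).
  exact: measurable_fun_pair.
- exact: energy_density_ge0.
Qed.

End BallVolume.

(** * Extensions to negative energies *)

Section Glue.
Context {R : realType}.
Variables (a : R) (f df g dg : R -> R).
Hypothesis fg : f a = g a.
Hypothesis dfg : df a = dg a.

Definition glue (u v : R -> R) (x : R) : R := if x < a then u x else v x.

(** On the right piece only the one-sided derivative at [a] is assumed, because [F0] is controlled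
    only on the half-line; the left piece must be differentiable up to and including [a]. *)
Lemma is_derive_glue :
  (forall x : R, x <= a -> is_derive x 1 f (df x)) ->
  (forall x : R, a < x -> is_derive x 1 g (dg x)) ->
  h^-1 * (g (a + h) - g a) @[h --> 0^'+] --> dg a ->
  forall x : R, is_derive x 1 (glue f g) (glue df dg x).
Proof.
move=> hf hg hga x; have [xa|ax|->] := ltgtP x a.
- rewrite /glue xa; apply: (near_eq_is_derive _ (hf x (ltW xa))).
  by near=> y; rewrite ifT //; near: y; exact: lt_nbhsl.
- rewrite /glue ltNge (ltW ax) /=; apply: (near_eq_is_derive _ (hg x ax)).
  by near=> y; rewrite ifF // ltNge ltW //; near: y; exact: lt_nbhsr.
have D : (fun h => h^-1 *: ((glue f g \o shift a) (h *: (1 : R)) - glue f g a)) @ 0^' --> dg a.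
  have ga : glue f g a = g a by rewrite /glue ltxx.
  apply: (@cvg_at_right_left_dnbhs R R^o).
    apply: cvg_trans hga; apply: near_eq_cvg; near=> h.
    have h0 : 0 < h by near: h; exact: nbhs_right_gt.
    by rewrite /= ga /glue -[h *: _]/(h * 1) mulr1 ltNge ltW /= ?ltrDr // [h + a]addrC.
  have [d1 d2] := hf a (lexx a).
  have L : h^-1 *: ((f \o shift a) (h *: (1 : R)) - f a) @[h --> 0^'-] --> dg a.
    by rewrite -dfg -d2; exact: (cvg_dnbhs_at_left d1).
  apply: cvg_trans L; apply: near_eq_cvg; near=> h.
  have h0 : h < 0 by near: h; exact: nbhs_left_lt.
  by rewrite /= ga -fg /glue -[h *: _]/(h * 1) mulr1 ifT // gtrDr.
rewrite /glue ltxx; split; first by apply/cvg_ex; exists (dg a).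
exact: cvg_lim D.
Unshelve. all: by end_near. Qed.

Lemma continuous_glue :
  (forall x, x <= a -> {for x, continuous f}) ->
  (forall x, a < x -> {for x, continuous g}) ->
  g x @[x --> a^'+] --> g a -> continuous (glue f g).
Proof.
move=> hf hg hga x; have [xa|ax|->] := ltgtP x a.
- rewrite /glue /continuous_at xa; apply: cvg_trans (hf x (ltW xa)).
  by apply: near_eq_cvg; near=> y; rewrite ifT //; near: y; exact: lt_nbhsl.
- rewrite /glue /continuous_at ltNge (ltW ax) /=; apply: cvg_trans (hg x ax).
  by apply: near_eq_cvg; near=> y; rewrite ifF // ltNge ltW //; near: y; exact: lt_nbhsr.
have ga : glue f g a = g a by rewrite /glue ltxx.
rewrite /continuous_at; apply/left_right_continuousP; rewrite ga; split.
  have L : f y @[y --> a^'-] --> g a by rewrite -fg; apply: cvg_at_left_filter; exact: hf.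
  apply: cvg_trans L; apply: near_eq_cvg; near=> y; rewrite /glue ifT //.
apply: cvg_trans hga; apply: near_eq_cvg; near=> y; rewrite /glue ifF //.
by apply/negbTE; rewrite -leNgt ltW //; near: y; exact: nbhs_right_gt.
Unshelve. all: by end_near. Qed.

End Glue.

Section ExtendedProfile.
Context {R : realType}.
Variables (F0 dF0 : R -> R).
Hypothesis hC1 : C1_halfline F0 dF0.
Hypothesis hF0 : forall r : R, 0 <= r -> 0 <= F0 r.
Hypothesis hdecay : exists2 C : R, 0 < C &
  forall r : R, 0 <= r -> `|F0 r| + `|dF0 r| <= C / (1 + r ^+ 3).
Hypothesis hdecr : forall r : R, 0 <= r -> dF0 r < 0.
Variable n : nat.

(* The cubic interpolation data at 0 are F0 0 and dF0 0; the term in n is the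
   free parameter on the negative energies. *)
Let p (e : R) : R := F0 0 + (dF0 0 - 2 * F0 0) * e + n%:R * (e * e).
Let dp (e : R) : R := (dF0 0 - 2 * F0 0) + n%:R * (e + e).

(** The double zero at -1 makes the junction with 0 of class C^1. At 0 the value is F0 0 and the
    derivative is 2 p(0) + p'(0) = dF0 0, whatever [n] is. *)
Definition profile_neg (e : R) : R := (1 + e) * (1 + e) * p e.
Definition dprofile_neg (e : R) : R :=
  ((1 + e) + (1 + e)) * p e + (1 + e) * (1 + e) * dp e.

Definition profile : R -> R := glue 0 (glue (-1) (cst 0) profile_neg) F0.
Definition dprofile : R -> R := glue 0 (glue (-1) (cst 0) dprofile_neg) dF0.

Lemma is_derive_profile_neg (e : R) : is_derive e 1 profile_neg (dprofile_neg e).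
Proof.
have I := is_derive_id e (1 : R).
have J := is_derive_add (is_derive_cst (1 : R) e 1) I.
have P : is_derive e 1 p (dp e).
  have H := is_derive_add (is_derive_add (is_derive_cst (F0 0) e 1)
    (is_derive_scale (dF0 0 - 2 * F0 0) I)) (is_derive_scale n%:R (is_derive_mul I I)).
  by apply: (is_derive_eq H); rewrite /dp; ring.
have H := is_derive_mul (is_derive_mul J J) P.
by apply: (is_derive_eq H); rewrite /dprofile_neg /=; ring.
Qed.

Lemma continuous_dprofile_neg (e : R) : {for e, continuous dprofile_neg}.
Proof.
have c1 : {for e, continuous (fun e : R => 1 + e)}.
  by apply: continuousD; [exact: cst_continuous|exact: cvg_id].
have cid : {for e, continuous (fun e : R => e)} by exact: cvg_id.
have cc (c : R) : {for e, continuous (fun _ : R => c)} by exact: cst_continuous.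
apply: continuousD; apply: continuousM.
- exact: continuousD.
- apply: continuousD; last by apply: continuousM => //; exact: continuousM.
  by apply: continuousD => //; exact: continuousM.
- exact: continuousM.
- by apply: continuousD => //; apply: continuousM => //; exact: continuousD.
Qed.

Lemma is_derive_profile (e : R) : is_derive e 1 profile (dprofile e).
Proof.
have [h1 h2 h3] := hC1.
rewrite /profile /dprofile; apply: is_derive_glue => {e}.
- by rewrite /glue ltNge lerN10 /= /profile_neg /p addr0 !mul1r !mulr0 !addr0.
- rewrite /glue ltNge lerN10 /= /dprofile_neg /p /dp !addr0 !mulr0 !addr0 !mul1r.
  by ring.
- move=> x _; apply: is_derive_glue => [||y _|].
  + by rewrite /profile_neg subrr !mul0r.
  + by rewrite /dprofile_neg subrr addr0 !mul0r addr0.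
  + exact: is_derive_profile_neg.
  + have [d1 d2] := is_derive_profile_neg (-1).
    rewrite -d2; apply: cvg_trans (cvg_dnbhs_at_right d1).
    by apply: near_eq_cvg; near=> h; rewrite /= -[h *: _]/(h * 1) mulr1 [h + _]addrC.
- by under eq_fun do rewrite add0r.
Unshelve. all: by end_near. Qed.

Lemma continuous_dprofile : continuous dprofile.
Proof.
have [_ _ /continuous_within_itvcyP[h1 h2]] := hC1.
apply: continuous_glue => //.
- rewrite /glue ltNge lerN10 /= /dprofile_neg /p /dp !addr0 !mulr0 !addr0 !mul1r.
  by ring.
- move=> x _; apply: continuous_glue => [|y _|y _|].
  + by rewrite /dprofile_neg subrr addr0 !mul0r addr0.
  + exact: cst_continuous.
  + exact: continuous_dprofile_neg.
  + by apply: cvg_at_right_filter; exact: continuous_dprofile_neg.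
- by move=> x x0; apply: h1; rewrite in_itv/= x0.
Qed.

Lemma continuous_profile : continuous profile.
Proof.
move=> x; apply: differentiable_continuous; apply/derivable1_diffP.
by have [] := is_derive_profile x.
Qed.

Lemma profileE (e : R) : 0 <= e -> profile e = F0 e.
Proof. by move=> e0; rewrite /profile /glue ltNge e0. Qed.

Lemma dprofileE (e : R) : 0 <= e -> dprofile e = dF0 e.
Proof. by move=> e0; rewrite /dprofile /glue ltNge e0. Qed.

Lemma profile_eq0 (e : R) : e <= -1 -> profile e = 0.
Proof.
move=> e1; have e0 : e < 0 by apply: le_lt_trans e1 _; exact: ltrN10.
rewrite /profile /glue e0; case: ltP => // e2.
have -> : e = -1 by apply/eqP; rewrite eq_le e1.
by rewrite /profile_neg subrr !mul0r.
Qed.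

Lemma dprofile_eq0 (e : R) : e <= -1 -> dprofile e = 0.
Proof.
move=> e1; have e0 : e < 0 by apply: le_lt_trans e1 _; exact: ltrN10.
rewrite /dprofile /glue e0; case: ltP => // e2.
have -> : e = -1 by apply/eqP; rewrite eq_le e1.
by rewrite /dprofile_neg subrr addr0 !mul0r addr0.
Qed.

Lemma profile_negE (e : R) : -1 <= e -> e < 0 -> profile e = profile_neg e.
Proof. by move=> e1 e0; rewrite /profile /glue e0 ltNge e1. Qed.

(** Between -1 and 0 every term of [p] is nonnegative: the linear one is a product of the two
    nonpositive numbers dF0 0 - 2 F0 0 and e. *)
Lemma profile_ge0 (e : R) : 0 <= profile e.
Proof.
have [e0|e0] := leP 0 e; first by rewrite profileE // hF0.
have [e1|/ltW e1] := leP e (-1); first by rewrite profile_eq0.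
rewrite profile_negE // /profile_neg -expr2 mulr_ge0 ?sqr_ge0 //.
have := hdecr (lexx 0); have := hF0 (lexx 0) => a b.
have := sqr_ge0 e; rewrite expr2 => c; have n0 : 0 <= n%:R :> R by [].
have h := mulr_ge0 n0 c.
have h2 : 0 <= (dF0 0 - 2 * F0 0) * e by apply: mulr_le0; lra.
by rewrite /p; lra.
Qed.

Lemma continuous_half_bounded (h : R -> R) (C : R) : continuous h ->
  (forall r, 0 <= r -> `|h r| <= C) -> (forall r, r <= -1 -> h r = 0) ->
  exists K, 0 < K /\ forall r, `|h r| <= K.
Proof.
move=> ch h1 h2.
have cK : compact [set h x | x in `[-1, 0]].
  by apply: continuous_compact; [exact: continuous_subspaceT|exact: segment_compact].
have [M [_ hM]] := compact_bounded cK.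
exists (`|C| + `|M| + 1); split; first by rewrite ltr_wpDl.
move=> r; have [r0|r0] := leP 0 r.
  by apply: le_trans (h1 _ r0) _; have := ler_norm C; have := normr_ge0 M; lra.
have [r1|/ltW r1] := leP r (-1); first by rewrite h2 // normr0 !addr_ge0.
apply: (hM (`|C| + `|M| + 1)).
  by have := ler_norm M; have := normr_ge0 C; lra.
by exists r => //=; rewrite in_itv/= r1 ltW.
Qed.

Lemma profile_bounded : exists K : R, [/\ 0 < K, forall e, `|profile e| <= K & forall e, `|dprofile e| <= K].
Proof.
have [C C0 hC] := hdecay.
have hC' r : 0 <= r -> `|F0 r| + `|dF0 r| <= C.
  move=> r0; apply: le_trans (hC r r0) _; rewrite ler_pdivrMr; last first.
    by rewrite ltr_pwDl // exprn_ge0.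
  by rewrite ler_peMr ?(ltW C0) // lerDl exprn_ge0.
have [K1 [K10 h1]] : exists K, 0 < K /\ forall r, `|profile r| <= K.
  apply: (@continuous_half_bounded _ C continuous_profile); last exact: profile_eq0.
  by move=> r r0; rewrite profileE //; have := hC' r r0; have := normr_ge0 (dF0 r); lra.
have [K2 [K20 h2]] : exists K, 0 < K /\ forall r, `|dprofile r| <= K.
  apply: (@continuous_half_bounded _ C continuous_dprofile); last exact: dprofile_eq0.
  move=> r r0; rewrite /dprofile /glue ltNge r0 /=.
  by have := hC' r r0; have := normr_ge0 (F0 r); lra.
exists (K1 + K2); split; first exact: addr_gt0.
- by move=> e; apply: le_trans (h1 e) _; rewrite lerDl ltW.
- by move=> e; apply: le_trans (h2 e) _; rewrite lerDr ltW.
Qed.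

Lemma profile_lower (e : R) : 0 <= e -> e <= 1 -> profile 1 <= profile e.
Proof.
move=> e0; rewrite le_eqVlt => /predU1P[->//|e1].
have [c ci h] : exists2 c : R, c \in `]e, 1[ & profile 1 - profile e = dprofile c * (1 - e).
  apply: MVT => // [x _|]; first exact: is_derive_profile.
  by apply: continuous_subspaceT; exact: continuous_profile.
move: ci; rewrite in_itv/= => /andP[ec c1].
have c0 : 0 <= c by exact: le_trans (ltW ec).
have : dprofile c * (1 - e) <= 0.
  rewrite mulr_le0_ge0 ?subr_ge0 ?(ltW e1) //.
  by rewrite dprofileE // ltW // hdecr.
by rewrite -h subr_le0.
Qed.

(** [F0] decreases strictly and is nonnegative at 2. The value at 1 serves as the positive lower
    bound of the profile on [0, 1]. *)
Lemma profile1_gt0 : 0 < profile 1.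
Proof.
have l : (1 : R) < 2 by rewrite ltr1n.
have [c ci h] : exists2 c : R, c \in `]1, 2[ & profile 2 - profile 1 = dprofile c * (2 - 1).
  apply: MVT => // [x _|]; first exact: is_derive_profile.
  by apply: continuous_subspaceT; exact: continuous_profile.
move: ci; rewrite in_itv/= => /andP[ec c1].
have c0 : 0 <= c by apply: le_trans (ltW ec).
have d0 : dprofile c < 0 by rewrite dprofileE // hdecr.
by have := profile_ge0 2; move: h d0; lra.
Qed.

End ExtendedProfile.

(** * The charge density as a function of the potential *)

Section ChargeDensity.
Context {R : realType}.
Variables (F : R -> R) (K c0 : R).
Hypothesis cF : continuous F.
Hypothesis F_ge0 : forall e, 0 <= F e.
Hypothesis F_le : forall e, F e <= K.
Hypothesis F_eq0 : forall e, e <= -1 -> F e = 0.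
Hypothesis F_int : (\int[lebesgue_measure]_e (4 * pi * Num.sqrt 2 * Num.sqrt e * F e)%:E = 1)%E.
Hypothesis c0_gt0 : 0 < c0.
Hypothesis F_low : forall e, 0 <= e -> e <= 1 -> c0 <= F e.

Let c : R := 4 * pi * Num.sqrt 2.
Let c_gt0 : 0 < c.
Proof. by rewrite /c !mulr_gt0 ?pi_gt0 ?sqrtr_gt0. Qed.

Let mF : measurable_fun setT F.
Proof. exact: continuous_measurable_fun. Qed.

Let msq (q : R) : measurable_fun setT (fun e : R => Num.sqrt (e - q)).
Proof. by apply: (measurableT_comp measurable_sqrtr); exact: measurable_funB. Qed.

(** The substitution e = r + q puts the potential into sqrt (e - q) alone. Monotonicity in q is then
    evident although [F] itself is not monotone on negative energies, and energies below q drop out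
    because the square root is 0 there. *)
Definition density (q : R) : \bar R :=
  (\int[lebesgue_measure]_e (4 * pi * Num.sqrt 2 * Num.sqrt (e - q) * F e)%:E)%E.

Let mdens (q : R) : measurable_fun setT (fun e : R => 4 * pi * Num.sqrt 2 * Num.sqrt (e - q) * F e).
Proof. by apply: measurable_funM => //; apply: measurable_funM => //; exact: msq. Qed.

Let dens0 (q e : R) : 0 <= 4 * pi * Num.sqrt 2 * Num.sqrt (e - q) * F e.
Proof. by rewrite mulr_ge0 // energy_density_ge0. Qed.

Lemma density_ge0 q : (0 <= density q)%E.
Proof. by apply: integral_ge0 => e _; rewrite lee_fin dens0. Qed.

Lemma density_energy (q : R) :
  (\int[leb3]_(v in [set: mR3 R]) (F (energy v + q))%:E = density q)%E.
Proof.
have mFq : measurable_fun setT (fun r : R => F (r + q)).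
  by apply: (measurableT_comp mF); exact: measurable_funD.
rewrite (polar mFq) // /density.
have [_ h] := ge0_invariant_shift q.
rewrite -(h (fun e => (4 * pi * Num.sqrt 2 * Num.sqrt (e - q) * F e)%:E)).
- by apply: eq_integral => r _; rewrite addrK.
- by apply/measurable_EFinP; exact: mdens.
- by move=> e; rewrite lee_fin dens0.
Qed.

Lemma density0 : density 0 = 1%E.
Proof. by rewrite /density -F_int; apply: eq_integral => e _; rewrite subr0. Qed.

Definition inv_root (r : R) : R := if (0 < r) && (r <= 1) then (Num.sqrt r)^-1 else 0.

Lemma inv_root_ge0 r : 0 <= inv_root r.
Proof. by rewrite /inv_root; case: ifP => // _; rewrite invr_ge0. Qed.

Lemma measurable_inv_root : measurable_fun setT inv_root.
Proof.
apply: measurable_fun_ifT => //.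
- by apply: measurable_and; [exact: measurable_fun_ltr|exact: measurable_fun_ler].
- exact: (measurableT_comp measurable_invr measurable_sqrtr).
Qed.

(** On (0, 1] one has r^(-1/2) <= r^(-3/4) + 1, which gives 4 + 1. *)
Lemma integral_inv_root : (\int[lebesgue_measure]_r (inv_root r)%:E <= 5%:E)%E.
Proof.
have m3 : measurable_fun setT (fun t : R => qroot t ^+ 3).
  by apply: measurable_funX; exact: measurable_qroot.
apply: (@le_trans _ _ (\int[lebesgue_measure]_(t in `]0%R, 1%R]) ((qroot t ^+ 3)%:E + 1))%E).
  rewrite [leRHS]integral_mkcond; apply: ge0_le_integral => //.
  - by move=> r _; rewrite lee_fin inv_root_ge0.
  - by apply/measurable_EFinP; exact: measurable_inv_root.
  - apply/(measurable_restrictT _ _).1 => //; apply: measurable_funTS.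
    by apply: emeasurable_funD => //; apply/measurable_EFinP; exact: m3.
  - move=> r _; rewrite patchE mem_setE in_itv/= /inv_root; case: ifP => // _.
    by rewrite -EFinD lee_fin -qroot_sqr qroot_sqr_le.
rewrite ge0_integralD //.
- rewrite (_ : 5%:E = 4%:E + 1%:E)%E; last by rewrite -EFinD; congr EFin; ring.
  apply: leeD; first exact: integral_qroot.
  rewrite integral_cst // mul1e.
  have E : (lebesgue_measure : set (measurableTypeR R) -> \bar R) `]0%R, 1%R]%classic = 1%:E.
    by etransitivity; [exact: (lebesgue_measure_itv `]0, 1])|rewrite /= lte_fin ltr01 sube0].
  by rewrite -[leRHS]E.
- by move=> r _; rewrite lee_fin exprn_ge0 ?qroot_ge0.
- by apply: measurable_funTS; apply/measurable_EFinP; exact: m3.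
Qed.

(** The square root is not Lipschitz at 0, but the difference is at most (q' - q) (e - q)^(-1/2),
    whose singularity is integrable in e. The bounded part of (e - q)^(-1/2) is absorbed by the
    summand 1. *)
Lemma sqrt_sub_le (q q' e : R) : q <= q' ->
  Num.sqrt (e - q) <= Num.sqrt (e - q') + (q' - q) * (inv_root (e - q) + 1).
Proof.
move=> qq; have d0 : 0 <= q' - q by rewrite subr_ge0.
have [h|h] := leP (e - q) 0.
  rewrite (ler0_sqrtr h) addr_ge0 ?sqrtr_ge0 // mulr_ge0 // addr_ge0 //.
  exact: inv_root_ge0.
have s0 : 0 < Num.sqrt (e - q) by rewrite sqrtr_gt0.
have le1 : (Num.sqrt (e - q))^-1 <= inv_root (e - q) + 1.
  rewrite /inv_root h andTb; case: ifPn => [_|]; first by rewrite lerDl.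
  rewrite -ltNge => h1; rewrite add0r invf_le1 // -sqrtr1 ler_wsqrtr ?(ltW h1) //.
apply: (@le_trans _ _ (Num.sqrt (e - q') + (q' - q) * (Num.sqrt (e - q))^-1)); last first.
  by rewrite lerD2l ler_wpM2l.
rewrite -lerBlDl -[leLHS](mulfK (lt0r_neq0 s0)) ler_wpM2r ?invr_ge0 ?(ltW s0) //.
have e1 : Num.sqrt (e - q) * Num.sqrt (e - q) = e - q by rewrite -expr2 sqr_sqrtr // ltW.
have [h'|h'] := leP (e - q') 0.
  by rewrite (ler0_sqrtr h') subr0 e1; lra.
have e2 : Num.sqrt (e - q') * Num.sqrt (e - q') = e - q' by rewrite -expr2 sqr_sqrtr // ltW.
have m : Num.sqrt (e - q') <= Num.sqrt (e - q) by rewrite ler_wsqrtr //; lra.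
have := ler_wpM2l (sqrtr_ge0 (e - q')) m.
by rewrite mulrBl e1; move: e2; lra.
Qed.

(** On [-1, 1] the bound c K is used. Above 1 the factor sqrt e is at least 1, so the total mass 1
    dominates; below -1 the function vanishes. *)
Let F_mass : (\int[lebesgue_measure]_e (c * F e)%:E <= (2 * (c * K) + 1)%:E)%E.
Proof.
have K0 : 0 <= c * K by rewrite mulr_ge0 ?(ltW c_gt0) // (le_trans (F_ge0 0)).
pose I : set (measurableTypeR R) := `[-1, 1]%classic.
have mI' : measurable I by exact: measurable_itv.
apply: (@le_trans _ _ (\int[lebesgue_measure]_e ((c * K * \1_I e)%:E + (c * Num.sqrt e * F e)%:E))%E).
  apply: ge0_le_integral => //.
  - by move=> e _; rewrite lee_fin mulr_ge0 // ltW.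
  - by apply/measurable_EFinP; exact: measurable_funM.
  - apply: emeasurable_funD; apply/measurable_EFinP.
      by apply: measurable_funM => //; exact: measurable_indic.
    by have := mdens 0; under eq_fun do rewrite subr0.
  - move=> e _; rewrite -EFinD lee_fin indicE mem_setE in_itv/=.
    have [e1|/ltW e1] := leP e (-1).
      rewrite F_eq0 // !mulr0 addr0 mulr_ge0 //.
    rewrite e1 /=; have [e2|/ltW e2] := leP e 1.
      rewrite mulr1 -[leLHS]addr0 lerD ?ler_wpM2l ?(ltW c_gt0) //.
      by have := dens0 0 e; rewrite subr0.
    rewrite mulr0 add0r ler_wpM2r // -[leLHS]mulr1 ler_wpM2l ?(ltW c_gt0) //.
    by rewrite -sqrtr1 ler_wsqrtr.
rewrite ge0_integralD //.
- rewrite EFinD; apply: leeD; last by rewrite F_int.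
  under eq_integral do rewrite EFinM.
  rewrite ge0_integralZl_EFin //.
  + have E : (lebesgue_measure : set (measurableTypeR R) -> \bar R) I = 2%:E.
      etransitivity; first exact: (lebesgue_measure_itv `[-1, 1]).
      by rewrite /= lte_fin ifT; [rewrite -EFinB; congr EFin; ring|rewrite gtrN].
    by rewrite integral_indic // setIT [X in (_ * X)%E]E -EFinM mulrC.
  + by apply/measurable_EFinP; exact: measurable_indic.
- by move=> e _; rewrite lee_fin mulr_ge0 // indicE.
- by apply/measurable_EFinP; apply: measurable_funM => //; exact: measurable_indic.
- by move=> e _; have := dens0 0 e; rewrite subr0 lee_fin.
- by apply/measurable_EFinP; have := mdens 0; under eq_fun do rewrite subr0.
Qed.

(** With c = 4 pi sqrt 2, the part 5 c K comes from [integral_inv_root] and 2 c K + 1 from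
    [F_mass]. *)
Definition density_slope : R := 7 * (4 * pi * Num.sqrt 2 * K) + 1.

Lemma density_slope_gt0 : 0 < density_slope.
Proof.
by rewrite /density_slope ltr_wpDl // mulr_ge0 // mulr_ge0 ?(ltW c_gt0) // (le_trans (F_ge0 0)).
Qed.

(** Integrate [sqrt_sub_le] against c F. The estimate is an addition of extended reals, because the
    finiteness of [density] at negative q is deduced from it. *)
Lemma density_le (q q' : R) : q <= q' ->
  (density q <= density q' + (density_slope * (q' - q))%:E)%E.
Proof.
move=> qq; have d0 : 0 <= q' - q by rewrite subr_ge0.
have cK0 : 0 <= c * K by rewrite mulr_ge0 ?(ltW c_gt0) // (le_trans (F_ge0 0)).
have mir : measurable_fun setT (fun e : R => inv_root (e - q)).
  by apply: (measurableT_comp measurable_inv_root); exact: measurable_funB.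
pose h (e : R) := (q' - q) * (c * K * inv_root (e - q) + c * F e).
have mh : measurable_fun setT h.
  by apply: measurable_funM => //; apply: measurable_funD; exact: measurable_funM.
have h0 e : 0 <= h e.
  by rewrite mulr_ge0 // addr_ge0 // mulr_ge0 ?inv_root_ge0 // ltW.
apply: (@le_trans _ _ (density q' + \int[lebesgue_measure]_e (h e)%:E)%E).
  rewrite /density -ge0_integralD //.
  - apply: ge0_le_integral => //.
    + by move=> e _; rewrite lee_fin dens0.
    + by apply/measurable_EFinP; exact: mdens.
    + apply: emeasurable_funD; apply/measurable_EFinP; [exact: mdens|exact: mh].
    + move=> e _; rewrite -EFinD lee_fin /h.
      have H := sqrt_sub_le e qq.
      have := ler_wpM2l (mulr_ge0 (ltW c_gt0) (F_ge0 e)) H.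
      have H2 : 0 <= c * (K - F e) * (q' - q) * inv_root (e - q).
        apply: mulr_ge0; last exact: inv_root_ge0.
        by apply: mulr_ge0 => //; apply: mulr_ge0; [exact: ltW|rewrite subr_ge0].
      rewrite -/c; move: (Num.sqrt (e - q)) (Num.sqrt (e - q')) (inv_root (e - q)) H2 => u v w H2.
      by move: c H2 => C; nra.
  - by move=> e _; rewrite lee_fin dens0.
  - by apply/measurable_EFinP; exact: mdens.
  - by move=> e _; rewrite lee_fin.
  - by apply/measurable_EFinP; exact: mh.
apply: leeD => //; rewrite /h.
under eq_integral do rewrite EFinM (EFinD (_ * _)).
have m1 : measurable_fun setT (fun e : R => (c * K * inv_root (e - q))%:E).
  by apply/measurable_EFinP; exact: measurable_funM.
have m2 : measurable_fun setT (fun e : R => (c * F e)%:E).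
  by apply/measurable_EFinP; exact: measurable_funM.
have p1 e : (0 <= (c * K * inv_root (e - q))%:E)%E.
  by rewrite lee_fin mulr_ge0 // inv_root_ge0.
have p2 e : (0 <= (c * F e)%:E)%E by rewrite lee_fin mulr_ge0 // ltW.
rewrite ge0_integralZl_EFin //; last 2 first.
- by move=> e _; exact: adde_ge0.
- exact: emeasurable_funD.
rewrite ge0_integralD // [density_slope * _]mulrC EFinM lee_wpmul2l //.
have -> : density_slope%:E = ((c * K)%:E * 5%:E + (2 * (c * K) + 1)%:E)%E.
  by rewrite -EFinM -EFinD /density_slope -/c; congr EFin; move: c => C; ring.
apply: leeD; last exact: F_mass.
under eq_integral do rewrite EFinM.
rewrite ge0_integralZl_EFin //; last 2 first.
- by move=> e _; rewrite lee_fin inv_root_ge0.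
- by apply/measurable_EFinP; exact: mir.
rewrite lee_wpmul2l //; apply: le_trans integral_inv_root.
have [_ H] := ge0_invariant_shift (- q).
rewrite -(H (fun e => (inv_root e)%:E)) //.
- by apply/measurable_EFinP; exact: measurable_inv_root.
- by move=> e; rewrite lee_fin inv_root_ge0.
Qed.

Lemma density_fin q : (density q < +oo)%E.
Proof.
have d0 : (density 0 < +oo)%E by rewrite density0 ltry.
have mono (p : R) : 0 <= p -> (density p <= density 0)%E.
  move=> p0; apply: ge0_le_integral => //.
  - by move=> e _; rewrite lee_fin dens0.
  - by apply/measurable_EFinP; exact: mdens.
  - by apply/measurable_EFinP; exact: mdens.
  - move=> e _; rewrite lee_fin ler_wpM2r // ler_wpM2l ?(ltW c_gt0) // ler_wsqrtr //; lra.
have [q0|/ltW q0] := leP 0 q; first exact: le_lt_trans (mono _ q0) d0.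
apply: le_lt_trans (density_le q0) _.
by rewrite density0 -EFinD ltry.
Qed.

(** Only the energies in [1/2, 1] are exploited: there [F] is at least [c0], and the length 1/2
    accounts for the division by 2. Elsewhere monotonicity of the square root suffices. *)
Lemma density_ge (q q' d : R) : q <= q' -> 0 <= d ->
  (forall e, 2^-1 <= e -> e <= 1 -> Num.sqrt (e - q') + d <= Num.sqrt (e - q)) ->
  (density q' + (c * c0 * d / 2)%:E <= density q)%E.
Proof.
move=> qq d0 hd.
pose I : set (measurableTypeR R) := `[2^-1, 1]%classic.
have mI' : measurable I by exact: measurable_itv.
have cc0 : 0 <= c * c0 * d by apply: mulr_ge0 => //; apply: mulr_ge0; exact: ltW.
have mI : measurable_fun setT (fun e => (c * c0 * d * \1_I e)%:E).
  by apply/measurable_EFinP; apply: measurable_funM => //; exact: measurable_indic.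
have I0 e : (0 <= (c * c0 * d * \1_I e)%:E)%E by rewrite lee_fin mulr_ge0 // indicE.
apply: (@le_trans _ _ (density q' + \int[lebesgue_measure]_e (c * c0 * d * \1_I e)%:E)%E).
  apply: leeD => //; under eq_integral do rewrite EFinM.
  rewrite ge0_integralZl_EFin //; last first.
    by apply/measurable_EFinP; exact: measurable_indic.
  have E : (lebesgue_measure : set (measurableTypeR R) -> \bar R) I = 2^-1%:E.
    etransitivity; first exact: (lebesgue_measure_itv `[2^-1, 1]).
    rewrite /= lte_fin ifT; last by lra.
    by rewrite -EFinB; congr EFin; field.
  by rewrite integral_indic // setIT [X in (_ * X)%E]E -EFinM.
rewrite /density -ge0_integralD //; last 2 first.
- by move=> e _; rewrite lee_fin dens0.
- by apply/measurable_EFinP; exact: mdens.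
apply: ge0_le_integral => //.
- by move=> e _; rewrite adde_ge0 // lee_fin dens0.
- by apply: emeasurable_funD => //; apply/measurable_EFinP; exact: mdens.
- by apply/measurable_EFinP; exact: mdens.
move=> e _; rewrite -EFinD lee_fin indicE mem_setE in_itv/=.
have [/andP[e1 e2]|_] := boolP (2^-1 <= e <= 1); rewrite ?mulr1 ?mulr0 ?addr0; last first.
  by rewrite ler_wpM2r // ler_wpM2l ?(ltW c_gt0) // ler_wsqrtr //; lra.
have e0 : 0 <= e by lra.
have := ler_wpM2l (mulr_ge0 (ltW c_gt0) (F_ge0 e)) (hd e e1 e2).
have := ler_wpM2l (mulr_ge0 (ltW c_gt0) d0) (F_low e0 e2).
rewrite -/c; move: (Num.sqrt (e - q)) (Num.sqrt (e - q')) c => u v C; lra.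
Qed.

(** This is the nonlinearity g of - Delta Q + g(Q) = mu. *)
Definition defect (q : R) : R := 1 - fine (density q).

Lemma defectE q : density q = (1 - defect q)%:E.
Proof. by rewrite /defect subKr fineK // ge0_fin_numE ?density_ge0 ?density_fin. Qed.

Lemma defect0 : defect 0 = 0.
Proof. by rewrite /defect density0 subrr. Qed.

Lemma defect_nondecreasing q q' : q <= q' -> defect q <= defect q'.
Proof.
move=> qq; have H : (density q' + (c * c0 * 0 / 2)%:E <= density q)%E.
  by apply: density_ge => // e _ _; rewrite addr0 ler_wsqrtr //; lra.
by move: H; rewrite !defectE -EFinD lee_fin; lra.
Qed.

Lemma defect_lipschitz q q' : q <= q' -> defect q' <= defect q + density_slope * (q' - q).
Proof. by move=> qq; have := density_le qq; rewrite !defectE -EFinD lee_fin; lra. Qed.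

(** Taking d = min(|q|, 1) / 3 in [density_ge] yields the factor 1/6. *)
Definition defect_low : R := 4 * pi * Num.sqrt 2 * c0 / 6.

Lemma defect_low_gt0 : 0 < defect_low.
Proof. by rewrite /defect_low divr_gt0 // mulr_gt0. Qed.

Lemma defect_ge q : 0 <= q -> defect_low * Num.min q 1 <= defect q.
Proof.
move=> q0; set m := Num.min q 1.
have m0 : 0 <= m by rewrite le_min q0 ler01.
have mq : m <= q by rewrite ge_min lexx.
have m1 : m <= 1 by rewrite ge_min lexx orbT.
have H : (density q + (c * c0 * (m / 3) / 2)%:E <= density 0)%E.
  apply: density_ge => //; first by rewrite divr_ge0.
  move=> e e1 e2; rewrite subr0; have s1 : Num.sqrt e <= 1 by rewrite -sqrtr1 ler_wsqrtr.
  have s0 := sqrtr_ge0 e; have s2 : Num.sqrt e * Num.sqrt e = e by rewrite -expr2 sqr_sqrtr //; lra.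
  have [h|h] := leP (e - q) 0; first by rewrite (ler0_sqrtr h); nra.
  have t0 := sqrtr_ge0 (e - q).
  have t2 : Num.sqrt (e - q) * Num.sqrt (e - q) = e - q by rewrite -expr2 sqr_sqrtr // ltW.
  have ts : Num.sqrt (e - q) <= Num.sqrt e by rewrite ler_wsqrtr //; lra.
  move: (Num.sqrt e) (Num.sqrt (e - q)) s0 s1 s2 t0 t2 ts => s t; nra.
move: H; rewrite !defectE defect0 -EFinD lee_fin /defect_low -/c; lra.
Qed.

Lemma defect_le q : q <= 0 -> defect q <= - (defect_low * Num.min (- q) 1).
Proof.
move=> q0; set m := Num.min (- q) 1.
have m0 : 0 <= m by rewrite le_min oppr_ge0 q0 ler01.
have mq : m <= - q by rewrite ge_min lexx.
have m1 : m <= 1 by rewrite ge_min lexx orbT.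
have H : (density 0 + (c * c0 * (m / 3) / 2)%:E <= density q)%E.
  apply: density_ge => //; first by rewrite divr_ge0.
  move=> e e1 e2; rewrite subr0; have s1 : Num.sqrt e <= 1 by rewrite -sqrtr1 ler_wsqrtr.
  have s0 := sqrtr_ge0 e; have s2 : Num.sqrt e * Num.sqrt e = e by rewrite -expr2 sqr_sqrtr //; lra.
  (* The gain sqrt (e + m) - sqrt e equals m divided by sqrt (e + m) + sqrt e, which is at most sqrt
     2 + 1 < 3; hence m / 3. *)
  apply: (@le_trans _ _ (Num.sqrt (e + m))); last by rewrite ler_wsqrtr //; lra.
  have t0 := sqrtr_ge0 (e + m).
  have t2 : Num.sqrt (e + m) * Num.sqrt (e + m) = e + m by rewrite -expr2 sqr_sqrtr //; lra.
  move: (Num.sqrt e) (Num.sqrt (e + m)) s0 s1 s2 t0 t2 => s t; nra.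
move: H; rewrite !defectE defect0 -EFinD lee_fin /defect_low -/c; lra.
Qed.

End ChargeDensity.

(** * Monotone iteration *)

Section ResolventKernels.
Context {R : realType}.
Variables (L a : R).
Hypothesis a_gt0 : 0 < a.
Hypothesis aL : a <= L.
Local Open Scope ereal_scope.

Let one : mR3 R -> \bar R := cst 1.
Let mone : measurable_fun setT one. Proof. exact: measurable_cst. Qed.
Let one0 x : 0 <= one x. Proof. by []. Qed.

Definition ykernel := tker (expw L).
Definition kkernel := tker (kapw a).
Definition rkernel := tker (resw L a).
Definition dkernel := tker (dkapw a).

Let wy := expw_weight L.
Let wk := kapw_weight a_gt0.
Let wr := resw_weight a_gt0 aL.
Let wd := dkapw_weight a_gt0.

Lemma measurable_ykernel : measurable_fun setT ykernel. Proof. exact: measurable_tker. Qed.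
Lemma measurable_kkernel : measurable_fun setT kkernel. Proof. exact: measurable_tker. Qed.
Lemma measurable_rkernel : measurable_fun setT rkernel. Proof. exact: measurable_tker. Qed.
Lemma measurable_dkernel : measurable_fun setT dkernel. Proof. exact: measurable_tker. Qed.
Lemma ykernel_ge0 x : 0 <= ykernel x. Proof. exact: tker_ge0. Qed.
Lemma kkernel_ge0 x : 0 <= kkernel x. Proof. exact: tker_ge0. Qed.
Lemma rkernel_ge0 x : 0 <= rkernel x. Proof. exact: tker_ge0. Qed.
Lemma dkernel_ge0 x : 0 <= dkernel x. Proof. exact: tker_ge0. Qed.

Section potentials.
Variable nu : {sigma_finite_measure set (mR3 R) -> \bar R}.

(** With W, V the potentials of [nu] for [kkernel] and [rkernel], this is (L - Delta) W = V + nu in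
    integrated form. It follows from the convolution identity [expw_resw] of the weights by
    [tker_comp]. *)
Lemma conv_resolvent x :
  conv leb3 (conv nu one rkernel) ykernel x + conv nu one ykernel x = conv nu one kkernel x.
Proof.
have w12 : weight (fun r => kapw a r - expw L r)%R.
  have [mk k0 kn] := wk; have [me e0 en] := wy; split.
  - exact: measurable_funB.
  - move=> r; rewrite -lee_fin -(expw_resw r a_gt0 aL); apply: integral_ge0 => s _.
    by rewrite lee_fin mulr_ge0 // ?expw_ge0 //; have [_ + _] := wr; exact.
  - by move=> t t0; rewrite kn // en // subr0.
rewrite (@conv_conv _ nu one ykernel rkernel (tker (fun r => kapw a r - expw L r)%R)) //.
- rewrite -conv_addk //.
  + congr (conv nu one _ x); apply/funext => y; rewrite /= -(tkerD y w12 wy).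
    by congr (tker _ y); apply/funext => t /=; rewrite subrK.
  + exact: measurable_tker.
  + exact: measurable_ykernel.
  + by move=> y; exact: tker_ge0.
  + exact: ykernel_ge0.
- exact: measurable_ykernel.
- exact: measurable_rkernel.
- exact: ykernel_ge0.
- exact: rkernel_ge0.
- by move=> x' y; apply: tker_comp => // r; exact: expw_resw.
Qed.

(** The weights satisfy L [kapw] = [resw] + [dkapw]. Together with [conv_resolvent] this expresses -
    Delta W + H = nu, H being the potential for [dkernel], without subtracting possibly infinite
    values. *)
Lemma conv_splitting x :
  L%:E * conv nu one kkernel x = conv nu one rkernel x + conv nu one dkernel x.
Proof.
have L0 : (0 <= L)%R by exact: le_trans (ltW a_gt0) aL.
rewrite -conv_scalek //; last 2 first.
- exact: measurable_kkernel.
- exact: kkernel_ge0.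
rewrite -conv_addk //.
- congr (conv nu one _ x); apply/funext => y; rewrite /= -(tkerZ y L0 wk) -(tkerD y wr wd).
  by congr (tker _ y); apply/funext => t; rewrite /= /resw subrK.
- exact: measurable_rkernel.
- exact: measurable_dkernel.
- exact: rkernel_ge0.
- exact: dkernel_ge0.
Qed.

Lemma conv_dkernel_le x : conv nu one dkernel x <= a%:E * conv nu one kkernel x.
Proof.
have a0 := ltW a_gt0.
rewrite -conv_scalek //; last 2 first.
- exact: measurable_kkernel.
- exact: kkernel_ge0.
apply: conv_le => //.
- exact: measurable_dkernel.
- by apply: measurable_funeM; exact: measurable_kkernel.
- exact: dkernel_ge0.
- move=> y; rewrite -tkerZ //; apply: tker_le => //.
    have [mk k0 kn] := wk; split.
    + exact: measurable_funM.
    + by move=> t; rewrite mulr_ge0.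
    + by move=> t t0; rewrite kn // mulr0.
  by move=> t _; exact: dkapw_le.
Qed.

Lemma integral_one : \int[nu]_y one y = nu setT.
Proof. by rewrite /one integral_cst // mul1e. Qed.

Lemma conv_dkernel_bound x : conv nu one dkernel x <= nu setT * (4 * a ^+ 2 + 2 * a)%:E.
Proof.
rewrite -integral_one; apply: conv_le_bound => //.
- exact: measurable_dkernel.
- exact: dkernel_ge0.
- by move=> y; apply: le_trans (tker_le_bound _ wd) _; exact: integral_dkapw_heat.
Qed.

Lemma integral_conv_kkernel :
  \int[leb3]_x conv nu one kkernel x <= nu setT * (2 * (a / 2)^-1)%:E.
Proof.
have H := @integral_conv1 _ nu _ _ _ mone measurable_kkernel one0 kkernel_ge0
  (fun y => integral_tker y wk).
by rewrite H integral_one lee_wpmul2l //; exact: integral_kapw.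
Qed.

Lemma measurable_conv_kkernel : measurable_fun setT (conv nu one kkernel).
Proof. apply: measurable_conv => //; [exact: measurable_kkernel|exact: kkernel_ge0]. Qed.

Lemma conv_kkernel_ge0 x : 0 <= conv nu one kkernel x.
Proof. by apply: conv_ge0 => //; exact: kkernel_ge0. Qed.

Let C : R := (2 * (4 + (a / 2)^-1))%R.

(** The maximum of p_{s+t} is at most (s + t)^(-3/2), and s + t >= sqrt (s t). The bound separates
    the two times with exponents -3/4 that are integrable at 0. *)
Lemma heat_qroot (s t : R) (x : R3 R) : (0 < s)%R -> (0 < t)%R ->
  (heat (s + t) x <= qroot t ^+ 3 * qroot s ^+ 3)%R.
Proof.
move=> s0 t0; have st0 : (0 < s + t)%R by exact: addr_gt0.
apply: le_trans (heat_le _ _) _; rewrite -exprMn.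
apply: lerXn2r; rewrite ?nnegrE ?mulr_ge0 ?qroot_ge0 ?invr_ge0 ?sqrtr_ge0 //.
apply: le_trans (heat_constant_le st0) _.
rewrite /qroot -invfM lef_pV2 ?posrE ?mulr_gt0 ?sqrtr_gt0 //.
rewrite -sqrtrM ?sqrtr_ge0 //; apply: ler_wsqrtr.
have p := sqr_sqrtr (ltW s0); have q := sqr_sqrtr (ltW t0).
rewrite -[X in (_ <= X + _)%R]p -[X in (_ <= _ + X)%R]q.
by have := sqrtr_ge0 s; have := sqrtr_ge0 t; move: (Num.sqrt s) (Num.sqrt t) => u v; nra.
Qed.

Lemma kkernel2_bound (z : mR3 R) :
  \int[lebesgue_measure]_s \int[lebesgue_measure]_t
    (kapw a t * kapw a s * heat (s + t) z)%:E <= (C ^+ 2)%:E.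
Proof.
have [mk k0 kn] := wk.
have mq : measurable_fun setT (fun t : R => (kapw a t * qroot t ^+ 3)%:E).
  apply/measurable_EFinP; apply: measurable_funM => //; apply: measurable_funX; exact: measurable_qroot.
have q0 t : (0 <= kapw a t * qroot t ^+ 3)%R by rewrite mulr_ge0 ?exprn_ge0 ?qroot_ge0.
have I0 : 0 <= \int[lebesgue_measure]_t (kapw a t * qroot t ^+ 3)%:E.
  by apply: integral_ge0 => t _; rewrite lee_fin.
have mh : measurable_fun [set: measurableTypeR R * measurableTypeR R]
    (fun z' => (kapw a z'.2 * kapw a z'.1 * heat ((z'.1 : R) + z'.2) z)%:E).
  apply/measurable_EFinP; apply: measurable_funM.
    by apply: measurable_funM; exact: (measurableT_comp mk).
  by apply: measurable_heat => //; exact: measurable_funD.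
have h0 (z' : measurableTypeR R * measurableTypeR R) :
    0 <= (kapw a z'.2 * kapw a z'.1 * heat ((z'.1 : R) + z'.2) z)%:E.
  by rewrite lee_fin mulr_ge0 ?heat_ge0 // mulr_ge0.
apply: (@le_trans _ _ (\int[lebesgue_measure]_s ((kapw a s * qroot s ^+ 3)%:E *
    \int[lebesgue_measure]_t (kapw a t * qroot t ^+ 3)%:E))).
  apply: ge0_le_integral => //.
  - move=> s _; apply: integral_ge0 => t _; rewrite lee_fin mulr_ge0 ?heat_ge0 //.
    by rewrite mulr_ge0.
  - exact: (@measurable_fun_fubini_tonelli_F _ _ _ _ _ lebesgue_measure _ mh h0).
  - by apply: emeasurable_funM => //; exact: measurable_cst.
  - move=> s _; rewrite -ge0_integralZl_EFin //; last by move=> t _; rewrite lee_fin.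
    apply: ge0_le_integral => //.
    + by move=> t _; rewrite lee_fin mulr_ge0 ?heat_ge0 // mulr_ge0.
    + exact: (measurableT_comp mh (pair1_measurable s)).
    + exact: measurable_funeM.
    + move=> t _; rewrite -EFinM lee_fin.
      have [s0|s0] := leP s 0%R; first by rewrite (kn s) // !mulr0 !mul0r.
      have [t0|t0] := leP t 0%R; first by rewrite (kn t) // !mul0r mulr0.
      have := ler_wpM2l (mulr_ge0 (k0 t) (k0 s)) (heat_qroot z s0 t0).
      by move/le_trans; apply; rewrite le_eqVlt; apply/orP; left; apply/eqP; ring.
have Ik := integral_kapw_qroot a_gt0.
rewrite ge0_integralZr //; last by move=> s _; rewrite lee_fin.
by rewrite expr2 EFinM; apply: lee_pmul.
Qed.

(** Since the kernel k is even, the integral of W^2 equals that of k * W = (k * k) * nu against nu.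
    By [kkernel2_bound] the kernel k * k is bounded by C^2, so each of the two integrations against
    nu contributes a factor nu(R^3). *)
Lemma integral_conv_kkernel_sqr :
  \int[leb3]_x (conv nu one kkernel x * conv nu one kkernel x) <=
  nu setT * (nu setT * (C ^+ 2)%:E).
Proof.
have mK := measurable_kkernel; have K0 := kkernel_ge0.
pose k12 := conv leb3 kkernel kkernel.
have k120 z : 0 <= k12 z by exact: conv_ge0.
have mk12 : measurable_fun setT k12 by exact: measurable_conv.
have k12E (z : mR3 R) : k12 z = \int[lebesgue_measure]_s \int[lebesgue_measure]_t
    (kapw a t * kapw a s * heat (s + t) z)%:E.
  have H := tker_tker z (0 : R3 R)%R wk wk; rewrite subr0 in H; rewrite -H -/kkernel /k12 /conv.
  by apply: eq_integral => y _; rewrite muleC (subr0 (y : R3 R)).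
have KK (x y : mR3 R) : \int[leb3]_z (kkernel ((x : R3 R) - z)%R * kkernel ((z : R3 R) - y)%R)
    = k12 ((x : R3 R) - y)%R.
  by rewrite k12E; exact: (tker_tker x y wk wk).
have E (y : mR3 R) : \int[leb3]_x (conv nu one kkernel x * kkernel ((x : R3 R) - y)%R) =
    conv nu one k12 y.
  rewrite -(@conv_conv _ nu _ _ _ _ y mone mK mK one0 K0 K0 KK).
  have KN (z : R3 R) : kkernel (- z)%R = kkernel z by exact: tkerN.
  by apply: eq_integral => x _; rewrite -(KN ((x : R3 R) - y)%R) opprB.
rewrite (@integral_conv _ nu _ _ _ mone mK measurable_conv_kkernel one0 K0 conv_kkernel_ge0).
apply: (@le_trans _ _ (\int[nu]_y (nu setT * (C ^+ 2)%:E))); last first.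
  by rewrite integral_cst // muleC.
apply: ge0_le_integral => //.
- by move=> y _; rewrite E /one mul1e; exact: conv_ge0.
- rewrite (_ : (fun y => _) = conv nu one k12); last by apply/funext => y; rewrite E /one mul1e.
  exact: measurable_conv.
- move=> y _; rewrite E /one mul1e -integral_one; apply: conv_le_bound => //.
  by move=> z; rewrite k12E; exact: kkernel2_bound.
Qed.

End potentials.
End ResolventKernels.

Section MonotoneConvolution.
Context {R : realType}.
Local Open Scope ereal_scope.

(** Only the product of 0 and +oo could spoil the limit; but if the limit [l] is 0, all terms below
    it are 0 as well. *)
Lemma cvg_mule_ndecr (u : (\bar R)^nat) (l c : \bar R) :
  u n @[n --> \oo] --> l -> (forall n, 0 <= u n) -> (forall n, u n <= l) -> 0 <= c ->
  u n * c @[n --> \oo] --> l * c.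
Proof.
move=> ul u0 uleq c0; have [l0|l0] := eqVneq l 0.
  have uE n : u n = 0 by apply/eqP; rewrite eq_le u0 -l0 uleq.
  rewrite l0 mul0e; under eq_fun do rewrite uE mul0e; exact: cvg_cst.
have [c00|cn0] := eqVneq c 0.
  by rewrite c00 mule0; under eq_fun do rewrite mule0; exact: cvg_cst.
apply: cvgeM => //; last exact: cvg_cst.
by apply: neq0_mule_def; rewrite mule_eq0 negb_or l0.
Qed.

Lemma cvg_conv (nu : {sigma_finite_measure set (mR3 R) -> \bar R})
    (b : (mR3 R -> \bar R)^nat) (l k : mR3 R -> \bar R) (x : mR3 R) :
  (forall n, measurable_fun setT (b n)) -> measurable_fun setT k ->
  (forall n y, 0 <= b n y) -> (forall y, 0 <= k y) ->
  (forall y, {homo b^~ y : n m / (n <= m)%N >-> n <= m}) ->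
  (forall y, b n y @[n --> \oo] --> l y) ->
  conv nu (b n) k x @[n --> \oo] --> conv nu l k x.
Proof.
move=> mb mk b0 k0 nd bl.
have H := @cvg_monotone_convergence _ _ R nu setT measurableT
  (fun n y => b n y * k ((x : R3 R) - y)%R)
  (fun n => measurable_conv_integrand1 x (mb n) mk)
  (fun n y _ => mule_ge0 (b0 n y) (k0 _)).
have nd' y : {homo (fun n => b n y * k ((x : R3 R) - y)%R) : n m / (n <= m)%N >-> n <= m}.
  by move=> n m nm; rewrite lee_wpmul2r //; exact: nd.
have {}H := H (fun y _ => nd' y).
rewrite /conv; suff -> : \int[nu]_y (l y * k ((x : R3 R) - y)%R) =
   \int[nu]_(y in setT) (fun y => limn (fun n => b n y * k ((x : R3 R) - y)%R)) y by exact: H.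
apply: eq_integral => y _; apply/esym/cvg_lim => //.
apply: cvg_mule_ndecr => // n.
have -> : l y = limn (b^~ y) by apply/esym/cvg_lim => //; exact: bl.
apply: lime_ge; first by apply/cvg_ex; exists (l y); exact: bl.
by exists n => // m /= nm; exact: nd.
Qed.

End MonotoneConvolution.

(** * The iteration between sub- and supersolution *)

Section Iteration.
Context {R : realType}.
Variables (g : R -> R) (L a c1 M : R).
Hypothesis g_nd : forall q q', q <= q' -> g q <= g q'.
Hypothesis g_lip : forall q q', q <= q' -> g q' <= g q + L * (q' - q).
Hypothesis g_ge : forall q, 0 <= q -> c1 * Num.min q 1 <= g q.
Hypothesis g_le : forall q, q <= 0 -> g q <= - (c1 * Num.min (- q) 1).
Hypothesis a_gt0 : 0 < a.
Hypothesis aL : a <= L.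
Hypothesis ac1 : a <= c1.
Hypothesis Mc1 : M * (4 * a ^+ 2 + 2 * a) <= c1.
Variables np nn : {sigma_finite_measure set (mR3 R) -> \bar R}.
Hypothesis npM : (np setT <= M%:E)%E.
Hypothesis nnM : (nn setT <= M%:E)%E.

Local Notation Y := (ykernel L).
Local Notation one := (cst 1%E : mR3 R -> \bar R).

(** Formally, with W = [pot_w nu]: [pot_v nu] is (L - Delta) W - nu, [pot_h nu] is Delta W + nu, and
    [pot_u nu] is (L - Delta)^(-1) nu. *)
Definition pot_w (nu : {sigma_finite_measure set (mR3 R) -> \bar R}) : mR3 R -> \bar R :=
  conv nu one (kkernel a).
Definition pot_v (nu : {sigma_finite_measure set (mR3 R) -> \bar R}) : mR3 R -> \bar R :=
  conv nu one (rkernel L a).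
Definition pot_h (nu : {sigma_finite_measure set (mR3 R) -> \bar R}) : mR3 R -> \bar R :=
  conv nu one (dkernel a).
Definition pot_u (nu : {sigma_finite_measure set (mR3 R) -> \bar R}) : mR3 R -> \bar R :=
  conv nu one Y.

Let mY := measurable_ykernel L.
Let Y0 := ykernel_ge0 L.
Let one0 : forall x, (0 <= one x)%E. Proof. by []. Qed.
Let mone : measurable_fun setT one. Proof. exact: measurable_cst. Qed.

Lemma measurable_pot_w (nu : {sigma_finite_measure set (mR3 R) -> \bar R}) : measurable_fun setT (pot_w nu).
Proof. exact: measurable_conv mone (measurable_kkernel a_gt0) one0 (kkernel_ge0 a_gt0). Qed.
Lemma measurable_pot_v (nu : {sigma_finite_measure set (mR3 R) -> \bar R}) : measurable_fun setT (pot_v nu).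
Proof. exact: measurable_conv mone (measurable_rkernel a_gt0 aL) one0 (rkernel_ge0 a_gt0 aL). Qed.
Lemma measurable_pot_h (nu : {sigma_finite_measure set (mR3 R) -> \bar R}) : measurable_fun setT (pot_h nu).
Proof. exact: measurable_conv mone (measurable_dkernel a_gt0) one0 (dkernel_ge0 a_gt0). Qed.
Lemma measurable_pot_u (nu : {sigma_finite_measure set (mR3 R) -> \bar R}) : measurable_fun setT (pot_u nu).
Proof. exact: measurable_conv mone mY one0 Y0. Qed.
Lemma pot_w_ge0 (nu : {sigma_finite_measure set (mR3 R) -> \bar R}) x : (0 <= pot_w nu x)%E.
Proof. exact: conv_ge0 one0 (kkernel_ge0 a_gt0). Qed.
Lemma pot_v_ge0 (nu : {sigma_finite_measure set (mR3 R) -> \bar R}) x : (0 <= pot_v nu x)%E.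
Proof. exact: conv_ge0 one0 (rkernel_ge0 a_gt0 aL). Qed.
Lemma pot_h_ge0 (nu : {sigma_finite_measure set (mR3 R) -> \bar R}) x : (0 <= pot_h nu x)%E.
Proof. exact: conv_ge0 one0 (dkernel_ge0 a_gt0). Qed.
Lemma pot_u_ge0 (nu : {sigma_finite_measure set (mR3 R) -> \bar R}) x : (0 <= pot_u nu x)%E.
Proof. exact: conv_ge0 one0 Y0. Qed.

Lemma ereal_splitting (W V H : \bar R) :
  (0 <= W)%E -> (0 <= V)%E -> (0 <= H)%E -> (W < +oo)%E -> (H <= a%:E * W)%E ->
  (H <= c1%:E)%E -> (L%:E * W = V + H)%E -> exists w v h : R,
  [/\ W = w%:E, V = v%:E, H = h%:E &
   [/\ 0 <= w, 0 <= v, L * w = v + h & h <= c1 * Num.min w 1]].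
Proof.
case: W => [w| |] //; rewrite lee_fin => w0 V0 H0 _.
case: H H0 => [h| |] // h0 Hw hc; case: V V0 => [v| |] //.
rewrite lee_fin => v0; rewrite -EFinM -EFinD => -[E].
exists w, v, h; split => //; split => //.
rewrite /Num.min; case: ifP => _; last by rewrite mulr1 -lee_fin.
by move: Hw; rewrite -EFinM lee_fin => /le_trans; apply; rewrite ler_wpM2r.
Qed.

(** The bounds H <= a W <= c1 W and H <= c1 combine to H <= c1 min(W, 1). Compared with [g_ge] and
    [g_le] this is what makes W and - W a super- and a subsolution. *)
Lemma pot_fin (nu : {sigma_finite_measure set (mR3 R) -> \bar R}) x : (nu setT <= M%:E)%E -> (pot_w nu x < +oo)%E -> exists w v h : R,
  [/\ pot_w nu x = w%:E, pot_v nu x = v%:E, pot_h nu x = h%:E &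
   [/\ 0 <= w, 0 <= v, L * w = v + h & h <= c1 * Num.min w 1]].
Proof.
move=> nuM wfin; apply: ereal_splitting.
- exact: pot_w_ge0.
- exact: pot_v_ge0.
- exact: pot_h_ge0.
- exact: wfin.
- exact: conv_dkernel_le.
- apply: le_trans (conv_dkernel_bound a_gt0 nu x) _.
  apply: (@le_trans _ _ (M * (4 * a ^+ 2 + 2 * a))%:E); last by rewrite lee_fin.
  rewrite EFinM; apply: lee_wpmul2r => //; rewrite lee_fin.
  by apply: addr_ge0; apply: mulr_ge0 => //; [exact: sqr_ge0|exact: ltW].
- exact: conv_splitting.
Qed.

Let Wp := pot_w np.
Let Wn := pot_w nn.

(** Adding L q makes the nonlinear term monotone: [g_lip] says that this function is nondecreasing,
    hence the iteration preserves order. *)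
Definition shifted (q : R) : R := L * q - g q.

Lemma shifted_nd q q' : q <= q' -> shifted q <= shifted q'.
Proof. by move=> qq; rewrite /shifted; have := g_lip qq; lra. Qed.

Lemma shifted_lip q q' : q <= q' -> shifted q' <= shifted q + L * (q' - q).
Proof. by move=> qq; rewrite /shifted; have := g_nd qq; lra. Qed.

Lemma continuous_shifted : continuous shifted.
Proof.
have L0 : 0 < L by exact: lt_le_trans aL.
move=> q; apply/cvgrPdist_le => e e0.
near=> t.
have tq : `|q - t| <= e / L.
  near: t; apply: (@cvgr_dist_le _ _ _ (nbhs q) _ id q) => //; exact: divr_gt0.
have [h|/ltW h] := leP q t.
  rewrite distrC ger0_norm ?subr_ge0 ?shifted_nd //.
  have := shifted_lip h; rewrite distrC ger0_norm ?subr_ge0 // in tq.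
  by move: tq; rewrite ler_pdivlMr // [_ * L]mulrC; lra.
rewrite ger0_norm ?subr_ge0 ?shifted_nd //.
have := shifted_lip h; rewrite ger0_norm ?subr_ge0 // in tq.
by move: tq; rewrite ler_pdivlMr // [_ * L]mulrC; lra.
Unshelve. all: by end_near. Qed.

(** For s = Q + W_- the fixed point equation is (L - Delta) s = (L Q - g(Q) + V_-) + mu_+, with V_-
    written as L W_- - H_-. The bracket is this function. On the null set where a potential is
    infinite it is set to 0. *)
Definition source (x : mR3 R) (s : R) : R :=
  if (Wp x + Wn x < +oo)%E
  then shifted (s - fine (Wn x)) + L * fine (Wn x) - fine (pot_h nn x) else 0.

Lemma source_nd x s s' : s <= s' -> source x s <= source x s'.
Proof.
move=> ss; rewrite /source; case: ifP => // _.
by rewrite !lerD2r; apply: shifted_nd; rewrite lerD2r.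
Qed.

Lemma good_split x : (Wp x + Wn x < +oo)%E -> (Wp x < +oo)%E /\ (Wn x < +oo)%E.
Proof.
move=> h; split; apply: le_lt_trans h.
- by rewrite leeDl // pot_w_ge0.
- by rewrite leeDr // pot_w_ge0.
Qed.

(** The subsolution inequality: at s = 0 the value is - g(- W_-) - H_-, which is nonnegative by
    [g_le] and the bound on H_-; monotonicity in s does the rest. *)
Lemma source_ge0 x s : 0 <= s -> 0 <= source x s.
Proof.
move=> s0; apply: le_trans (source_nd x s0); rewrite /source; case: ifP => // /good_split[_ wn].
have [w [v [h [we _ he [w0 _ _ hm]]]]] := pot_fin nnM wn.
rewrite [Wn x]we he /= /shifted sub0r.
have H : - w <= 0 by rewrite oppr_le0.
by have := g_le H; rewrite opprK; lra.
Qed.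

(** The supersolution inequality: at s = W_+ + W_- the value is V_+ + V_- + (H_+ - g(W_+)), and
    [g_ge] makes the last bracket nonpositive. *)
Lemma source_le x (s : \bar R) : (0 <= s)%E -> (s <= Wp x + Wn x)%E ->
  ((source x (fine s))%:E <= pot_v np x + pot_v nn x)%E.
Proof.
move=> s0 sW; have [gd|gd] := boolP (Wp x + Wn x < +oo)%E; last first.
  by rewrite /source (negbTE gd) adde_ge0 // pot_v_ge0.
have [wp wn] := good_split gd.
have [w [v [h [we ve _ [w0 v0 S hm]]]]] := pot_fin npM wp.
have [w' [v' [h' [we' ve' he' [w0' v0' S' hm']]]]] := pot_fin nnM wn.
have sf : (s < +oo)%E by exact: le_lt_trans sW gd.
have sle : fine s <= w + w'.
  rewrite -lee_fin fineK; last by rewrite ge0_fin_numE.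
  by apply: le_trans sW _; rewrite /Wp /Wn we we'.
rewrite ve ve' -EFinD lee_fin; apply: le_trans (source_nd x sle) _.
rewrite /source gd [Wn x]we' he' /= addrK /shifted.
by have := g_ge w0; lra.
Qed.

Lemma measurable_source (s : mR3 R -> \bar R) : measurable_fun setT s ->
  measurable_fun setT (fun x => (source x (fine (s x)))%:E).
Proof.
move=> ms; apply/measurable_EFinP; apply: measurable_fun_ifT => //.
  apply: measurable_fun_lte => //; apply: emeasurable_funD; exact: measurable_pot_w.
have mf (f : mR3 R -> \bar R) : measurable_fun setT f -> measurable_fun setT (fun x => fine (f x)).
  by move=> mf; exact: (measurableT_comp (@fine_measurable _ _ _) mf).
have mW : measurable_fun setT (fun x => fine (Wn x)) by apply: mf; exact: measurable_pot_w.
apply: measurable_funB; last by apply: mf; exact: measurable_pot_h.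
apply: measurable_funD; last exact: measurable_funM.
apply: (measurableT_comp (continuous_measurable_fun continuous_shifted)).
by apply: measurable_funB => //; exact: mf.
Qed.

Definition step (s : mR3 R -> \bar R) (x : mR3 R) : \bar R :=
  (conv leb3 (fun y => (source y (fine (s y)))%:E) Y x + pot_u np x)%E.

Definition admissible (s : mR3 R -> \bar R) :=
  measurable_fun setT s /\ forall x, (0 <= s x <= Wp x + Wn x)%E.

Lemma admissible_source_ge0 s : admissible s -> forall x, (0 <= (source x (fine (s x)))%:E)%E.
Proof.
move=> [_ h] x; rewrite lee_fin source_ge0 // fine_ge0 //.
by have /andP[] := h x.
Qed.

(** By [source_le] the new function is at most Y * (V_+ + V_-) + Y * mu_+. Here Y * V_+ + Y * mu_+ =
    W_+ and Y * V_- <= W_- by [conv_resolvent]. *)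
Lemma admissible_step s : admissible s -> admissible (step s).
Proof.
move=> As; have [ms sb] := As; have B0 := admissible_source_ge0 As.
have mB := measurable_source ms.
split.
  by apply: emeasurable_funD; [exact: measurable_conv mB mY B0 Y0|exact: measurable_pot_u].
move=> x; rewrite adde_ge0 ?pot_u_ge0 ?(conv_ge0 _ _ B0 Y0) //=.
have mv := measurable_pot_v; have v0 := pot_v_ge0.
apply: (@le_trans _ _ (conv leb3 (pot_v np \+ pot_v nn)%E Y x + pot_u np x)%E).
  apply: leeD => //.
  apply: (@conv_le _ leb3 _ _ _ _ x mB (emeasurable_funD (mv np) (mv nn)) mY mY B0 Y0) => // y.
  have /andP[s0 s1] := sb y; exact: source_le.
rewrite (conv_addb _ x (mv np) (mv nn) mY (v0 np) (v0 nn) Y0).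
rewrite addeAC; apply: leeD.
  by rewrite (conv_resolvent a_gt0 aL).
rewrite -[leRHS](conv_resolvent a_gt0 aL nn x) leeDl //.
exact: pot_u_ge0.
Qed.

Lemma step_le s s' : admissible s -> admissible s' -> (forall x, (s x <= s' x)%E) ->
  forall x, (step s x <= step s' x)%E.
Proof.
move=> As As' ss x; have [ms sb] := As; have [ms' sb'] := As'.
apply: leeD => //.
apply: (@conv_le _ leb3 _ _ _ _ x (measurable_source ms) (measurable_source ms') mY mY
  (admissible_source_ge0 As) Y0) => // y.
rewrite lee_fin; have [gd|gd] := boolP (Wp y + Wn y < +oo)%E; last by rewrite /source (negbTE gd).
have /andP[s0 s1] := sb y; have /andP[s0' s1'] := sb' y.
by apply: source_nd; rewrite fine_le // ge0_fin_numE // (le_lt_trans _ gd).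
Qed.

(** The value s = 0 corresponds to the subsolution Q = - W_-. *)
Definition iterates (n : nat) : mR3 R -> \bar R := iter n step (cst 0%E).

Lemma admissible_iterates n : admissible (iterates n).
Proof.
elim: n => [|n IH]; last exact: admissible_step.
split; first exact: measurable_cst.
by move=> x /=; rewrite lexx adde_ge0 // pot_w_ge0.
Qed.

Lemma iterates_nd x : {homo iterates^~ x : n m / (n <= m)%N >-> (n <= m)%E}.
Proof.
apply: homo_leq => //; first exact: le_trans.
move=> n; elim: n x => [|n IH] x.
  by have [_ h] := admissible_iterates 1; have /andP[] := h x.
exact: (step_le (admissible_iterates n) (admissible_iterates n.+1) IH).
Qed.

Definition limit (x : mR3 R) : \bar R := limn (iterates^~ x).

Lemma cvg_iterates x : iterates n x @[n --> \oo] --> limit x.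
Proof.
apply: ereal_nondecreasing_is_cvgn; exact: iterates_nd.
Qed.

Lemma admissible_limit : admissible limit.
Proof.
split.
  apply: (emeasurable_fun_cvg iterates) => [n|x _]; last exact: cvg_iterates.
  by have [] := admissible_iterates n.
move=> x; apply/andP; split.
  apply: lime_ge; first by apply/cvg_ex; exists (limit x); exact: cvg_iterates.
  by near=> n; have [_ h] := admissible_iterates n; have /andP[] := h x.
apply: lime_le; first by apply/cvg_ex; exists (limit x); exact: cvg_iterates.
by near=> n; have [_ h] := admissible_iterates n; have /andP[] := h x.
Unshelve. all: by end_near. Qed.

(** The sources increase with n and converge pointwise since [shifted] is continuous; monotone
    convergence then passes to the limit in the convolution. *)
Lemma limit_fixed x : limit x = step limit x.
Proof.
have [ml lb] := admissible_limit.
have H : step (iterates n) x @[n --> \oo] --> step limit x.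
  rewrite /step; apply: cvgeD; [|apply: cvg_conv|exact: cvg_cst].
  - apply: ge0_adde_def; rewrite inE ?pot_u_ge0 //.
    exact: conv_ge0 (admissible_source_ge0 admissible_limit) Y0.
  - by move=> n; apply: measurable_source; have [] := admissible_iterates n.
  - exact: mY.
  - by move=> n y; exact: admissible_source_ge0 (admissible_iterates n) y.
  - exact: Y0.
  - move=> y n m nm; rewrite lee_fin.
    have [gd|gd] := boolP (Wp y + Wn y < +oo)%E; last by rewrite /source (negbTE gd).
    have [_ b1] := admissible_iterates n; have [_ b2] := admissible_iterates m.
    have /andP[s0 s1] := b1 y; have /andP[s0' s1'] := b2 y.
    apply: source_nd; rewrite fine_le ?iterates_nd // ge0_fin_numE // (le_lt_trans _ gd) //.
  - move=> y; apply: cvg_EFin; first by near=> n.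
    rewrite /source; case: ifPn => [gd|_]; last exact: cvg_cst.
    have /andP[l0 l1] := lb y.
    have lf : limit y \is a fin_num by rewrite ge0_fin_numE // (le_lt_trans l1).
    have C : fine (iterates n y) @[n --> \oo] --> fine (limit y).
      by apply: fine_cvg; rewrite fineK //; exact: cvg_iterates.
    apply: cvgB; last exact: cvg_cst.
    apply: cvgD; last exact: cvg_cst.
    apply: (@continuous_cvg _ _ _ _ _ _ shifted); first exact: continuous_shifted.
    by apply: cvgB => //; exact: cvg_cst.
apply/esym; rewrite -(cvg_lim _ H) //.
have H2 : (fun n => iterates (n + 1)%N x) @ \oo --> limit x.
  have := @cvg_iterates x; by rewrite -(cvg_shiftn 1).
apply: cvg_lim => //; move: H2; rewrite (_ : (fun n => _) = (fun n => step (iterates n) x)) //.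
by apply/funext => n; rewrite addn1.
Unshelve. all: by end_near. Qed.

Hypothesis M_ge0 : 0 <= M.

Let mWpn : measurable_fun setT (fun x => Wp x + Wn x)%E.
Proof. by apply: emeasurable_funD; exact: measurable_pot_w. Qed.

Let Wpn_ge0 x : (0 <= Wp x + Wn x)%E.
Proof. by apply: adde_ge0; exact: pot_w_ge0. Qed.

Lemma integral_pot_w (nu : {sigma_finite_measure set (mR3 R) -> \bar R}) :
  (nu setT <= M%:E)%E -> (\int[leb3]_x pot_w nu x < +oo)%E.
Proof.
move=> nuM; apply: le_lt_trans (integral_conv_kkernel a_gt0 nu) _.
apply: (@le_lt_trans _ _ (M * (2 * (a / 2)^-1))%:E); last exact: ltry.
rewrite [leRHS]EFinM; apply: lee_wpmul2r => //; rewrite lee_fin.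
by apply: mulr_ge0 => //; rewrite invr_ge0; apply: divr_ge0 => //; exact: ltW.
Qed.

Lemma integral_pot_w2 : (\int[leb3]_x (Wp x + Wn x) < +oo)%E.
Proof.
rewrite (ge0_integralD leb3 measurableT (fun x _ => pot_w_ge0 np x) (measurable_pot_w np)
  (fun x _ => pot_w_ge0 nn x) (measurable_pot_w nn)).
by apply: lte_add_pinfty; exact: integral_pot_w.
Qed.

Lemma good_ae : {ae leb3, forall x, (Wp x + Wn x < +oo)%E}.
Proof.
have I : leb3.-integrable setT (fun x => Wp x + Wn x)%E.
  apply/integrableP; split; first exact: mWpn.
  under eq_integral => x _ do rewrite (gee0_abs (Wpn_ge0 x)).
  exact: integral_pot_w2.
have := integrable_ae measurableT I; apply: filterS => x /= /(_ Logic.I).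
by rewrite ge0_fin_numE // Wpn_ge0.
Qed.

Definition screened (x : mR3 R) : R :=
  if (Wp x + Wn x < +oo)%E then fine (limit x) - fine (Wn x) else 0.

Definition screening (x : mR3 R) : \bar R := (source x (fine (limit x)))%:E.

Lemma measurable_screened : measurable_fun setT screened.
Proof.
have mf (f : mR3 R -> \bar R) : measurable_fun setT f -> measurable_fun setT (fun x => fine (f x)).
  by move=> mf; exact: (measurableT_comp (@fine_measurable _ _ _) mf).
apply: measurable_fun_ifT; last exact: measurable_cst.
  by apply: measurable_fun_lte; [exact: mWpn|exact: measurable_cst].
apply: measurable_funB; apply: mf; last exact: measurable_pot_w.
by have [] := admissible_limit.
Qed.

Lemma screened_le x : (`|screened x|%:E <= Wp x + Wn x)%E.
Proof.
rewrite /screened; case: ifPn => [gd|_]; last by rewrite normr0 Wpn_ge0.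
have [_ lb] := admissible_limit; have /andP[] := lb x.
have [] := good_split gd.
have := pot_w_ge0 np x; have := pot_w_ge0 nn x; rewrite -/Wp -/Wn.
case: (Wp x) => [p| |] // n0 p0 _; case: (Wn x) n0 => [n| |] // n0 _.
case: (limit x) => [l| |] //; rewrite /= -EFinD !lee_fin => l0 l1.
rewrite lee_fin in n0; rewrite lee_fin in p0.
by rewrite ler_norml; apply/andP; split; lra.
Qed.

Lemma integral_screening : (\int[leb3]_x screening x < +oo)%E.
Proof.
have [ml lb] := admissible_limit.
have L0 : 0 <= L by exact: le_trans (ltW a_gt0) aL.
apply: (@le_lt_trans _ _ (\int[leb3]_x (L%:E * (Wp x + Wn x)))%E).
  apply: (@ge0_le_integral _ _ _ leb3 setT measurableT).
  - by move=> x _; exact: (admissible_source_ge0 admissible_limit).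
  - exact: measurable_source.
  - by apply: measurable_funeM; exact: mWpn.
  - move=> x _; have /andP[l0 l1] := lb x.
    apply: le_trans (source_le l0 l1) _.
    rewrite ge0_muleDr ?pot_w_ge0 //; apply: leeD.
      by rewrite [leRHS](conv_splitting a_gt0 aL) leeDl // pot_h_ge0.
    by rewrite [leRHS](conv_splitting a_gt0 aL) leeDl // pot_h_ge0.
rewrite (ge0_integralZl_EFin leb3 measurableT (fun x _ => Wpn_ge0 x) mWpn L0).
by apply: lte_mul_pinfty => //; exact: integral_pot_w2.
Qed.

Lemma integral_pot_v (nu : {sigma_finite_measure set (mR3 R) -> \bar R}) :
  (nu setT <= M%:E)%E -> (\int[leb3]_x pot_v nu x < +oo)%E.
Proof.
move=> nuM; have L0 : 0 <= L by exact: le_trans (ltW a_gt0) aL.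
apply: (@le_lt_trans _ _ (\int[leb3]_x (L%:E * pot_w nu x))%E).
  apply: (@ge0_le_integral _ _ _ leb3 setT measurableT).
  - by move=> x _; exact: pot_v_ge0.
  - exact: measurable_pot_v.
  - by apply: measurable_funeM; exact: measurable_pot_w.
  - by move=> x _; rewrite [leRHS](conv_splitting a_gt0 aL) leeDl // pot_h_ge0.
rewrite (ge0_integralZl_EFin leb3 measurableT (fun x _ => pot_w_ge0 nu x) (measurable_pot_w nu) L0).
by apply: lte_mul_pinfty => //; exact: integral_pot_w.
Qed.

Lemma integral_pot_w_sqr (nu : {sigma_finite_measure set (mR3 R) -> \bar R}) :
  (nu setT <= M%:E)%E -> (\int[leb3]_x (pot_w nu x * pot_w nu x) < +oo)%E.
Proof.
move=> nuM; apply: le_lt_trans (integral_conv_kkernel_sqr a_gt0 nu) _.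
have nf : (nu setT < +oo)%E by exact: le_lt_trans nuM (ltry _).
apply: lte_mul_pinfty => //; first by rewrite ge0_fin_numE.
by apply: lte_mul_pinfty => //; [rewrite ge0_fin_numE|exact: ltry].
Qed.

Lemma integral_screened_sqr : (\int[leb3]_x (screened x ^+ 2)%:E < +oo)%E.
Proof.
pose sq (nu : {sigma_finite_measure set (mR3 R) -> \bar R}) x := (2%:E * (pot_w nu x * pot_w nu x))%E.
have sq0 nu x : (0 <= sq nu x)%E by apply: mule_ge0 => //; apply: mule_ge0; exact: pot_w_ge0.
have msq nu : measurable_fun setT (sq nu).
  by apply: measurable_funeM; apply: emeasurable_funM; exact: measurable_pot_w.
apply: (@le_lt_trans _ _ (\int[leb3]_x (sq np x + sq nn x))%E).
  apply: (@ge0_le_integral _ _ _ leb3 setT measurableT).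
  - by move=> x _; rewrite lee_fin sqr_ge0.
  - by apply/measurable_EFinP; apply: measurable_funX; exact: measurable_screened.
  - by apply: emeasurable_funD; exact: msq.
  (* For finite potentials p and n this is (p + n)^2 <= 2 p^2 + 2 n^2; otherwise the right-hand side
     is infinite. *)
  - have inf2 : (2%:E * (+oo * +oo) = +oo :> \bar R)%E by rewrite mulyy gt0_muley // lte_fin.
    move=> x _; have := screened_le x; rewrite /sq -/(Wp x) -/(Wn x).
    have := pot_w_ge0 np x; have := pot_w_ge0 nn x; rewrite -/(Wp x) -/(Wn x).
    case: (Wp x) => [p| |] // n0 p0; case: (Wn x) n0 => [n| |] //.
    + rewrite -!EFinM -!EFinD !lee_fin => n0 h; rewrite lee_fin in p0.
      rewrite -real_normK ?num_real // expr2.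
      have := ler_pM (normr_ge0 (screened x)) (normr_ge0 (screened x)) h h.
      by have := sqr_ge0 (p - n); rewrite expr2; move: (`|screened x|) => s; lra.
    + by move=> _ _; rewrite inf2 -!EFinM addey // leey.
    + by move=> _ _; rewrite inf2 -!EFinM addye // leey.
    + by move=> _ _; rewrite inf2 addye // leey.
rewrite (ge0_integralD leb3 measurableT (fun x _ => sq0 np x) (msq np)
  (fun x _ => sq0 nn x) (msq nn)).
have fin (nu : {sigma_finite_measure set (mR3 R) -> \bar R}) : (nu setT <= M%:E)%E -> (\int[leb3]_x sq nu x < +oo)%E.
  move=> nuM; rewrite (@ge0_integralZl_EFin _ _ _ leb3 setT measurableT).
  - by apply: lte_mul_pinfty => //; exact: integral_pot_w_sqr.
  - by move=> x _; apply: mule_ge0; exact: pot_w_ge0.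
  - by apply: emeasurable_funM; exact: measurable_pot_w.
  - by [].
by apply: lte_add_pinfty; exact: fin.
Qed.

(** Writing Q as a difference of Yukawa potentials with nonnegative data lets every later statement
    about Q reduce to potentials. The identity [conv_resolvent] supplies such a form for W_-, with
    density V_- and measure mu_-. *)
Lemma screened_ae : {ae leb3, forall x, [/\
  (conv leb3 screening Y x + pot_u np x < +oo)%E,
  (conv leb3 (pot_v nn) Y x + pot_u nn x < +oo)%E,
  screened x = fine (conv leb3 screening Y x + pot_u np x)%E -
    fine (conv leb3 (pot_v nn) Y x + pot_u nn x)%E,
  (pot_v nn x < +oo)%E &
  fine (screening x) - fine (pot_v nn x) = L * screened x - g (screened x)]}.
Proof.
have := good_ae; apply: filterS => x gd.
have [wp wn] := good_split gd.
have [w [v [h [we ve he [w0 v0 S hm]]]]] := pot_fin nnM wn.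
have [_ lb] := admissible_limit; have /andP[l0 l1] := lb x.
have E1 : (conv leb3 screening Y x + pot_u np x = limit x)%E by rewrite [RHS]limit_fixed.
have E2 : (conv leb3 (pot_v nn) Y x + pot_u nn x = Wn x)%E by exact: conv_resolvent.
rewrite E1 E2; split.
- exact: le_lt_trans gd.
- exact: wn.
- by rewrite /screened gd.
- by rewrite ve ltry.
- rewrite /screening /screened /source gd [Wn x]we ve he /= /shifted; lra.
Qed.

End Iteration.

(** The auxiliary kernels disappear from this statement: beta is the source at the fixed point and
    eta is V_-. Formally (L - Delta) Q = beta + mu_+ - eta - mu_-, where beta - eta = L Q - g(Q). *)
Lemma screened_poisson (R : realType) (g : R -> R) (L c1 M : R)
    (np nn : {sigma_finite_measure set (mR3 R) -> \bar R}) :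
  0 < L -> 0 < c1 -> 0 <= M ->
  (forall q q', q <= q' -> g q <= g q') ->
  (forall q q', q <= q' -> g q' <= g q + L * (q' - q)) ->
  (forall q, 0 <= q -> c1 * Num.min q 1 <= g q) ->
  (forall q, q <= 0 -> g q <= - (c1 * Num.min (- q) 1)) ->
  (np setT <= M%:E)%E -> (nn setT <= M%:E)%E ->
  exists (beta eta : mR3 R -> \bar R) (Q : mR3 R -> R),
  [/\ measurable_fun setT beta, measurable_fun setT eta, measurable_fun setT Q,
      forall x, (0 <= beta x)%E & forall x, (0 <= eta x)%E] /\
  [/\ (\int[leb3]_x beta x < +oo)%E, (\int[leb3]_x eta x < +oo)%E,
      (\int[leb3]_x (Q x ^+ 2)%:E < +oo)%E &
  {ae leb3, forall x, [/\
  (conv leb3 beta (ykernel L) x + conv np (cst 1%E) (ykernel L) x < +oo)%E,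
  (conv leb3 eta (ykernel L) x + conv nn (cst 1%E) (ykernel L) x < +oo)%E,
  Q x = fine (conv leb3 beta (ykernel L) x + conv np (cst 1%E) (ykernel L) x)%E -
    fine (conv leb3 eta (ykernel L) x + conv nn (cst 1%E) (ykernel L) x)%E,
  (eta x < +oo)%E &
  fine (beta x) - fine (eta x) = L * Q x - g (Q x)]}].
Proof.
move=> L0 c0 M0 gnd glip gge gle npM nnM.
(* For a <= 1 one has M (4 a^2 + 2 a) <= 6 M a, so a <= c1 / (6 M + 1) suffices; the summand 1 keeps
   the denominator positive when M = 0. *)
pose a := Num.min (Num.min 1 L) (Num.min c1 (c1 / (6 * M + 1))).
have p6 : 0 < 6 * M + 1 by rewrite ltr_wpDl // mulr_ge0.
have a0 : 0 < a by rewrite !lt_min ltr01 L0 c0 divr_gt0.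
have a1 : a <= 1 by rewrite !ge_min lexx.
have aL : a <= L by rewrite !ge_min lexx !orbT.
have ac : a <= c1 by rewrite !ge_min lexx !orbT.
have am : a * (6 * M + 1) <= c1 by rewrite -ler_pdivlMr // !ge_min lexx !orbT.
have Mc : M * (4 * a ^+ 2 + 2 * a) <= c1.
  apply: le_trans am; have : a ^+ 2 <= a by rewrite expr2 ler_piMr // ltW.
  by move=> h; have := ler_wpM2l M0 h; nra.
exists (screening g L a np nn), (pot_v L a nn), (screened g L a np nn).
have Al := admissible_limit gnd glip gge gle a0 aL ac Mc npM nnM.
split; split.
- by apply: measurable_source => //; case: Al.
- exact: measurable_pot_v.
- exact: (measurable_screened gnd glip gge gle a0 aL ac Mc npM nnM).
- exact: (admissible_source_ge0 glip gle a0 aL ac Mc nnM Al).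
- by move=> x; exact: pot_v_ge0.
- exact: (integral_screening gnd glip gge gle a0 aL ac Mc npM nnM).
- by apply: integral_pot_v; eassumption.
- by apply: integral_screened_sqr; eassumption.
- by apply: screened_ae; eassumption.
Qed.

(** * Weak derivatives and the chain rule *)

Section RealIntegrals.
Context d (T : measurableType d) (R : realType) (m : {measure set T -> \bar R}).

Lemma dominated_Rintegral (f_ : nat -> T -> R) (f g : T -> R) :
  (forall n, measurable_fun setT (f_ n)) -> measurable_fun setT f ->
  {ae m, forall x, f_ n x @[n --> \oo] --> f x} ->
  m.-integrable setT (EFin \o g) ->
  {ae m, forall x, forall n, `|f_ n x| <= g x} ->
  m.-integrable setT (EFin \o f) /\
  \int[m]_x f_ n x @[n --> \oo] --> \int[m]_x f x.
Proof.
move=> mf_ mf cf ig fg.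
have H1 : {ae m, forall x, setT x -> (EFin \o f_ n) x @[n --> \oo] --> (EFin \o f) x}.
  apply: filterS cf => x cx _; apply: cvg_EFin; [exact: nearW|exact: cx].
have H2 : {ae m, forall x n, setT x -> (`|(EFin \o f_ n) x| <= (EFin \o g) x)%E}.
  by apply: filterS fg => x cx n _; rewrite /= lee_fin.
have [i _ c] := @dominated_convergence _ T R m setT measurableT
  (fun n => EFin \o f_ n) (EFin \o f) (EFin \o g)
  (fun n => proj2 (measurable_EFinP _ _) (mf_ n)) (proj2 (measurable_EFinP _ _) mf)
  H1 ig H2.
split => //; apply: fine_cvg; rewrite fineK //; exact: integrable_fin_num.
Qed.

Lemma integrable_fine (F : T -> \bar R) : measurable_fun setT F -> (forall x, 0 <= F x)%E ->
  (\int[m]_x F x < +oo)%E -> m.-integrable setT (EFin \o (fine \o F)).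
Proof.
move=> mF F0 iF; apply/integrableP.
have mf : measurable_fun setT (fine \o F).
  exact: (measurableT_comp (@fine_measurable _ _ _) mF).
split; first exact/measurable_EFinP.
apply: le_lt_trans iF; apply: (@ge0_le_integral _ _ _ m setT measurableT).
- by [].
- by apply/measurable_EFinP; exact: measurableT_comp.
- by [].
- move=> x _ /=; rewrite ger0_norm ?fine_ge0 //.
  by have := F0 x; case: (F x) => [r| |] //= _; rewrite leey.
Qed.

Lemma integrable_le (f g : T -> R) : measurable_fun setT f -> m.-integrable setT (EFin \o g) ->
  (forall x, `|f x| <= g x) -> m.-integrable setT (EFin \o f).
Proof.
move=> mf ig fg; apply: (le_integrable measurableT _ _ ig); first exact/measurable_EFinP.
by move=> x _; rewrite /= lee_fin (le_trans (fg x)) // ler_norm.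
Qed.

Lemma integrable_addr (f g : T -> R) : m.-integrable setT (EFin \o f) ->
  m.-integrable setT (EFin \o g) -> m.-integrable setT (EFin \o (fun x => f x + g x)).
Proof. exact: (integrableD measurableT). Qed.

Lemma integrable_mulr (f : T -> R) (c : R) : m.-integrable setT (EFin \o f) ->
  m.-integrable setT (EFin \o (fun x => f x * c)).
Proof. exact: (integrableZr measurableT). Qed.

End RealIntegrals.

(** Tonelli's theorem gives measurability for the positive and the negative part, and [fine] turns
    their extended difference into a real number everywhere. *)
Lemma measurable_Rintegral d1 d2 (T1 : measurableType d1) (T2 : measurableType d2) (R : realType)
    (m2 : {sigma_finite_measure set T2 -> \bar R}) (f : T1 * T2 -> R) :
  measurable_fun setT f -> measurable_fun setT (fun x => \int[m2]_y f (x, y)).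
Proof.
move=> mf; have mE : measurable_fun setT (EFin \o f) by exact/measurable_EFinP.
rewrite /Rintegral; apply: (measurableT_comp (@fine_measurable _ _ measurableT)).
rewrite (_ : (fun x => _) = (fun x => (\int[m2]_y (EFin \o f)^\+ (x, y) -
    \int[m2]_y (EFin \o f)^\- (x, y))%E)); last first.
  apply/funext => x; rewrite integralE.
  by congr (_ - _)%E; apply: eq_integral => y _; rewrite !(funeposE, funenegE).
apply: emeasurable_funB.
- apply: (@measurable_fun_fubini_tonelli_F _ _ _ _ _ m2 (EFin \o f)^\+%E) => //.
  exact: measurable_funepos.
- apply: (@measurable_fun_fubini_tonelli_F _ _ _ _ _ m2 (EFin \o f)^\-%E) => //.
  exact: measurable_funeneg.
Qed.

Section Approximable.
Context {R : realType}.

Lemma ae_fst (P : R3 R -> Prop) : {ae leb3, forall x : mR3 R, P x} ->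
  {ae leb6, forall z : mR3 R * mR3 R, P z.1}.
Proof.
move=> [A [mA A0 PA]]; exists (A `*` setT); split.
- exact: measurableX.
(* The second factor is infinite, and 0 times +oo is 0. *)
- have E : ((leb3 \x leb3) (A `*` setT) = leb3 A * leb3 setT)%E by exact: product_measure1E.
  by move: E; rewrite A0 mul0e.
- by move=> z /= Pz; split => //; exact: PA.
Qed.

(* A substitute for the weak derivative of [Q] along [e] being [Qe], stable
   under composition with C^1 functions: classical derivatives that converge
   almost everywhere and in a dominated way. *)
Definition approximable (e : R3 R) (Q Qe : R3 R -> R) : Prop :=
  [/\ measurable_fun [set: mR3 R] Q, measurable_fun [set: mR3 R] Qe &
  exists (q dq : nat -> R3 R -> R) (P D : R3 R -> R) (M : nat -> R),
  [/\ forall n x, is_derive x e (q n) (dq n x),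
      forall n, measurable_fun [set: mR3 R] (q n) /\ measurable_fun [set: mR3 R] (dq n),
      forall n x, `|q n x| <= M n /\ `|dq n x| <= M n,
      leb3.-integrable [set: mR3 R] (EFin \o P) /\ leb3.-integrable [set: mR3 R] (EFin \o D) &
      {ae leb3, forall x : mR3 R, [/\ q n x @[n --> \oo] --> Q x, dq n x @[n --> \oo] --> Qe x,
        forall n, `|q n x| <= P x & forall n, `|dq n x| <= D x]}]].

Lemma approximableD e Q1 Q2 Qe1 Qe2 : approximable e Q1 Qe1 -> approximable e Q2 Qe2 ->
  approximable e (fun x => Q1 x + Q2 x) (fun x => Qe1 x + Qe2 x).
Proof.
move=> [m1 n1 [q1 [d1 [P1 [D1 [M1 [a1 b1 c1 [e1 f1] g1]]]]]]].
move=> [m2 n2 [q2 [d2 [P2 [D2 [M2 [a2 b2 c2 [e2 f2] g2]]]]]]].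
split; [exact: measurable_funD|exact: measurable_funD|].
exists (fun n x => q1 n x + q2 n x), (fun n x => d1 n x + d2 n x),
  (fun x => P1 x + P2 x), (fun x => D1 x + D2 x), (fun n => M1 n + M2 n); split.
- by move=> n x; exact: is_derive_add (a1 n x) (a2 n x).
- move=> n; have [? ?] := b1 n; have [? ?] := b2 n; split; exact: measurable_funD.
- move=> n x; have [? ?] := c1 n x; have [? ?] := c2 n x.
  by split; apply: le_trans (ler_normD _ _) _; exact: lerD.
- by split; exact: integrable_addr.
- move: g1 g2; apply: filterS2 => x [h1 h2 h3 h4] [h5 h6 h7 h8]; split.
  + exact: cvgD.
  + exact: cvgD.
  + by move=> n; apply: le_trans (ler_normD _ _) _; exact: lerD.
  + by move=> n; apply: le_trans (ler_normD _ _) _; exact: lerD.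
Qed.

Lemma approximableN e Q Qe : approximable e Q Qe ->
  approximable e (fun x => - Q x) (fun x => - Qe x).
Proof.
move=> [m1 n1 [q1 [d1 [P1 [D1 [M1 [a1 b1 c1 e1 g1]]]]]]].
split; [exact: measurable_funN|exact: measurable_funN|].
exists (fun n x => - q1 n x), (fun n x => - d1 n x), P1, D1, M1; split => //.
- move=> n x; rewrite (_ : (fun x => _) = (fun x => -1 * q1 n x)); last first.
    by apply/funext => y; rewrite mulN1r.
  by apply: (is_derive_eq (is_derive_scale (-1) (a1 n x))); rewrite mulN1r.
- by move=> n; have [? ?] := b1 n; split; exact: measurable_funN.
- by move=> n x; rewrite !normrN.
- apply: filterS g1 => x [h1 h2 h3 h4]; split.
  + exact: cvgN.
  + exact: cvgN.
  + by move=> n; rewrite normrN.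
  + by move=> n; rewrite normrN.
Qed.

Lemma approximable_ae e Q Q' Qe : measurable_fun [set: mR3 R] Q' ->
  {ae leb3, forall x : mR3 R, Q' x = Q x} ->
  approximable e Q Qe -> approximable e Q' Qe.
Proof.
move=> mQ QQ [m1 n1 [q1 [d1 [P1 [D1 [M1 [a1 b1 c1 e1 g1]]]]]]].
split => //; exists q1, d1, P1, D1, M1; split => //.
by move: QQ g1; apply: filterS2 => x ->.
Qed.

Lemma approximable_integrable e Q Qe : approximable e Q Qe ->
  leb3.-integrable [set: mR3 R] (EFin \o Q) /\ leb3.-integrable [set: mR3 R] (EFin \o Qe).
Proof.
move=> [m1 n1 [q1 [d1 [P1 [D1 [M1 [a1 b1 c1 [e1 f1] g1]]]]]]]; split.
- apply: (proj1 (@dominated_Rintegral _ _ _ leb3 q1 Q P1 _ m1 _ e1 _)).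
  + by move=> n; have [] := b1 n.
  + by apply: filterS g1 => x [].
  + by apply: filterS g1 => x [].
- apply: (proj1 (@dominated_Rintegral _ _ _ leb3 d1 Qe D1 _ n1 _ f1 _)).
  + by move=> n; have [] := b1 n.
  + by apply: filterS g1 => x [].
  + by apply: filterS g1 => x [].
Qed.

Lemma L1loc3_integrable (h : R3 R -> R) :
  leb3.-integrable [set: mR3 R] (EFin \o h) -> L1loc3 h.
Proof.
move=> ih; have mh : measurable_fun [set: mR3 R] h.
  by apply/measurable_EFinP; exact: measurable_int ih.
split => // K /compact_measurable3 mK; have /integrableP[_] := ih.
apply: le_lt_trans; apply: (@ge0_subset_integral _ _ _ leb3 K setT mK measurableT) => //.
by apply/measurable_EFinP; exact: measurableT_comp.
Qed.

(** Integrate by parts for the differentiable approximants, whose bounds [M1 n] may depend on n,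
    then pass to the limit by dominated convergence on both sides. *)
Lemma approximable_weak e Q Qe : approximable e Q Qe -> weak_deriv3 e Q Qe.
Proof.
move=> A; have [iQ iQe] := approximable_integrable A.
split; first exact: L1loc3_integrable.
move=> phi tphi; move: A => [m1 n1 [q1 [d1 [P1 [D1 [M1 [a1 b1 c1 [e1 f1] g1]]]]]]].
have [_ tD] := test_function_derive e tphi.
have mphi : measurable_fun [set: mR3 R] phi.
  exact: continuous_measurable3 (test_function_continuous tphi).
have mD : measurable_fun [set: mR3 R] ('D_e phi).
  exact: continuous_measurable3 (test_function_continuous tD).
have [B1 B10 hB1] := test_function_bounded tphi.
have [B2 B20 hB2] := test_function_bounded tD.
have c1' : \int[leb3]_x (q1 n x * 'D_e phi x) @[n --> \oo] --> \int[leb3]_x (Q x * 'D_e phi x).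
  apply: (proj2 (@dominated_Rintegral _ _ _ leb3 (fun n x => q1 n x * 'D_e phi x)
    (fun x => Q x * 'D_e phi x) (fun x => P1 x * B2) _ _ _ _ _)).
  + by move=> n; apply: measurable_funM => //; have [] := b1 n.
  + exact: measurable_funM.
  + apply: filterS g1 => x [h1 _ _ _]; apply: cvgM => //; exact: cvg_cst.
  + exact: integrable_mulr.
  + by apply: filterS g1 => x [_ _ h1 _] n; rewrite normrM ler_pM.
have c2' : (- (\int[leb3]_x (d1 n x * phi x))) @[n --> \oo] --> - \int[leb3]_x (Qe x * phi x).
  apply: cvgN; apply: (proj2 (@dominated_Rintegral _ _ _ leb3 (fun n x => d1 n x * phi x)
    (fun x => Qe x * phi x) (fun x => D1 x * B1) _ _ _ _ _)).
  + by move=> n; apply: measurable_funM => //; have [] := b1 n.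
  + exact: measurable_funM.
  + apply: filterS g1 => x [_ h1 _ _]; apply: cvgM => //; exact: cvg_cst.
  + exact: integrable_mulr.
  + by apply: filterS g1 => x [_ _ _ h1] n; rewrite normrM ler_pM.
have E : (fun n => \int[leb3]_x (q1 n x * 'D_e phi x)) = (fun n => - \int[leb3]_x (d1 n x * phi x)).
  apply/funext => n.
  have dE : 'D_e (q1 n) = d1 n by apply/funext => x; have [_ ->] := a1 n x.
  have [mq md] := b1 n.
  have [_ _ ->] := @weak_derive3 R e (q1 n) (M1 n) phi tphi mq (eq_ind_r _ md dE)
    (fun x => @ex_derive _ _ _ _ _ _ _ (a1 n x))
    (fun x _ => eq_ind_r (fun d : R3 R -> R => `|q1 n x| <= M1 n /\ `|d x| <= M1 n) (c1 n x) dE).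
  by congr (- _); apply: eq_Rintegral => x _; have [_ ->] := a1 n x.
rewrite E in c1'; have := cvg_lim (@Rhausdorff R) c1'.
by rewrite (cvg_lim (@Rhausdorff R) c2') => ->.
Qed.

Lemma is_derive_comp1 (E : normedModType R) (F dF : R -> R) (u : E -> R) (x e : E) (du : R) :
  (forall r : R, is_derive r 1 F (dF r)) -> is_derive x e u du ->
  is_derive x e (fun y => F (u y)) (dF (u x) * du).
Proof.
move=> hF hu; apply: is_derive_of_line.
have hl : is_derive (0 : R) 1 (fun k : R => u (x + k *: e)) du.
  have [d1 d2] := hu.
  have e0 : x + 0 *: e = x by rewrite scale0r addr0.
  have H : derivable u (x + 0 *: e) e by rewrite e0.
  by have := is_derive_line H; rewrite e0 d2.
have dk : derivable (fun k : R => u (x + k *: e)) 0 1 by have [] := hl.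
have E0 : (fun k : R => u (x + k *: e)) 0 = u x by rewrite scale0r addr0.
have := @is_derive1_comp _ F (fun k : R => u (x + k *: e)) 0 (dF (u x)) du.
rewrite E0; apply => //; exact: hF.
Qed.

Lemma tonelli6 (f : mR3 R * mR3 R -> \bar R) : measurable_fun setT f -> (forall z, 0 <= f z)%E ->
  (\int[leb6]_z f z = \int[leb3]_x \int[leb3]_y f (x, y))%E.
Proof. by move=> mf f0; exact: (@fubini_tonelli1 _ _ _ _ _ leb3 leb3 f mf f0). Qed.

Section Chain.
Variables (F dF : R -> R) (K : R).
Hypothesis hF : forall r : R, is_derive r 1 F (dF r).
Hypothesis cdF : continuous dF.
Hypothesis FK : forall r, `|F r| <= K.
Hypothesis dFK : forall r, `|dF r| <= K.

Let cF : continuous F.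
Proof.
move=> x; apply: differentiable_continuous; apply/derivable1_diffP.
by have [] := hF x.
Qed.

Let K0 : 0 <= K. Proof. exact: le_trans (normr_ge0 _) (FK 0). Qed.

Definition gibbs (Q : R3 R -> R) (z : R3 R * R3 R) : R := F (energy z.2 + Q z.1).

Lemma measurable_total_energy (Q : R3 R -> R) : measurable_fun [set: mR3 R] Q ->
  measurable_fun [set: mR3 R * mR3 R] (fun z => energy z.2 + Q z.1).
Proof.
move=> mQ; apply: measurable_funD.
  exact: (measurableT_comp measurable_energy (@measurable_snd _ _ _ _)).
exact: (measurableT_comp mQ (@measurable_fst _ _ _ _)).
Qed.

Lemma measurable_comp_energy (H : R -> R) (Q : R3 R -> R) : continuous H ->
  measurable_fun [set: mR3 R] Q ->
  measurable_fun [set: mR3 R * mR3 R] (fun z => H (energy z.2 + Q z.1)).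
Proof.
move=> cH mQ; exact: (measurableT_comp (continuous_measurable_fun cH) (measurable_total_energy mQ)).
Qed.

Lemma compact_bounded_set6 (C : set (R3 R * R3 R)) : compact C ->
  exists S T : set (mR3 R), [/\ measurable S, measurable T, (leb3 S < +oo)%E, (leb3 T < +oo)%E &
    forall z, C z -> S z.1 /\ T z.2].
Proof.
move=> cC; have [N [_ hN]] := compact_bounded cC.
have [S [mS S1 hS]] := leb3_bounded_set (N + 1).
exists S, S; split => // z Cz.
have := hN (N + 1) _ z Cz; rewrite ltrDl ltr01 => /(_ isT).
by rewrite /= ge_max => /andP[h1 h2]; split; exact: hS.
Qed.

Lemma integrable_fst_indic (h : mR3 R -> R) (T : set (mR3 R)) :
  leb3.-integrable [set: mR3 R] (EFin \o h) -> measurable T -> (leb3 T < +oo)%E ->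
  leb6.-integrable [set: mR3 R * mR3 R] (EFin \o (fun z => h z.1 * \1_T z.2)).
Proof.
move=> ih mT T1.
have mh : measurable_fun [set: mR3 R] h by apply/measurable_EFinP; exact: measurable_int ih.
have m6 : measurable_fun [set: mR3 R * mR3 R] (fun z => h z.1 * \1_T z.2).
  apply: measurable_funM; first exact: (measurableT_comp mh (@measurable_fst _ _ _ _)).
  apply: (@measurableT_comp _ _ _ _ _ _ (\1_T : mR3 R -> R) _ snd); last exact: measurable_snd.
  exact: measurable_indic.
apply/integrableP; split; first exact/measurable_EFinP.
have ma : measurable_fun [set: mR3 R * mR3 R] (abse \o (EFin \o (fun z => h z.1 * \1_T z.2))).
  by apply: measurableT_comp => //; exact/measurable_EFinP.
rewrite (tonelli6 ma (fun=> abse_ge0 _)) /=.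
have T_fin : (leb3 T) \is a fin_num by rewrite ge0_fin_numE.
have E x : (\int[leb3]_v `|(h x * \1_T v)%:E| = `|h x|%:E * (fine (leb3 T))%:E)%E.
  transitivity (\int[leb3]_v (`|h x|%:E * (\1_T v)%:E))%E.
    by apply: eq_integral => v _; rewrite -EFinM /= normrM (ger0_norm (_ : 0 <= \1_T v)).
  rewrite ge0_integralZl_EFin //; last by apply/measurable_EFinP; exact: measurable_indic.
  by congr (_ * _)%E; etransitivity; [exact: integral_indic|rewrite setIT fineK].
under eq_integral do rewrite E.
rewrite ge0_integralZr //; first last.
- by rewrite lee_fin fine_ge0.
- by apply/measurable_EFinP; exact: measurableT_comp.
have /integrableP[_ H] := ih.
rewrite muleC; apply: lte_mul_pinfty => //; last by rewrite lee_fin fine_ge0.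
Qed.

(** A compact set lies in a product of two sets of finite measure, and on such a product a function
    integrable in x alone, or a constant, is integrable. *)
Lemma L1loc6_dominated (f : R3 R * R3 R -> R) (h : R3 R -> R) :
  measurable_fun [set: mR3 R * mR3 R] f -> leb3.-integrable [set: mR3 R] (EFin \o h) ->
  (forall C : set (R3 R * R3 R), compact C -> exists M, forall z, C z -> `|f z| <= M * h z.1 + M) ->
  L1loc6 f.
Proof.
move=> mf ih hC; split => // C cC.
have [S [T [mS mT S1 T1 CST]]] := compact_bounded_set6 cC.
have [M hM] := hC C cC; have mC := compact_measurable6 cC.
have I1 := integrable_mulr M (integrable_fst_indic ih mT T1).
have I2 := integrable_mulr M (integrable_fst_indic (integrable_indic_lty mS S1) mT T1).
have /integrableP[_] := integrable_addr I1 I2; apply: le_lt_trans.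
rewrite [leLHS]integral_mkcond; apply: (@ge0_le_integral _ _ _ leb6 setT measurableT).
- by move=> z _; apply: erestrict_ge0 => y _; rewrite lee_fin.
- apply/(measurable_restrictT _ mC); apply: measurable_funTS.
  by apply/measurable_EFinP; exact: measurableT_comp.
- by apply: measurableT_comp => //; have /integrableP[] := integrable_addr I1 I2.
- move=> z _; rewrite patchE; case: ifPn; rewrite ?inE ?notin_setE => Cz; last exact: abse_ge0.
  have [Sz Tz] := CST z Cz.
  rewrite /= lee_fin !indicE !mem_set // !mulr1 mul1r.
  by apply: le_trans (hM z Cz) (le_trans _ (ler_norm _)); rewrite [M * _]mulrC.
Qed.

(** The classical chain rule holds for F(|v|^2/2 + q_n(x)). As F and dF are bounded and continuous,
    the integrands against [phi] converge almost everywhere and are dominated by a constant,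
    respectively by K D(x), on a set of finite measure in v. *)
Lemma approximable_chain (e : R3 R) (Q Qe : R3 R -> R) : approximable e Q Qe ->
  weak_deriv6 (e, 0) (gibbs Q) (fun z => dF (energy z.2 + Q z.1) * Qe z.1).
Proof.
move=> A; have [iQ iQe] := approximable_integrable A.
have [mQ mQe _] := A.
have mQe6 : measurable_fun [set: mR3 R * mR3 R] (fun z => Qe z.1).
  exact: (measurableT_comp mQe (@measurable_fst _ _ _ _)).
have mg : measurable_fun [set: mR3 R * mR3 R] (fun z => dF (energy z.2 + Q z.1) * Qe z.1).
  by apply: measurable_funM => //; exact: (measurable_comp_energy cdF mQ).
have iaQe : leb3.-integrable [set: mR3 R] (EFin \o (fun x => `|Qe x|)).
  exact: (integrable_norm iQe).
split.
  apply: (L1loc6_dominated mg iaQe) => C _; exists K => z _.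
  by rewrite normrM -[leLHS]addr0 lerD // ler_pM.
move=> phi tphi; move: A => [m1 n1 [q1 [d1 [P1 [D1 [M1 [a1 b1 c1 [e1 f1] g1]]]]]]].
have [_ tD] := test_function_derive (e, 0) tphi.
have mphi : measurable_fun [set: mR3 R * mR3 R] phi.
  exact: continuous_measurable6 (test_function_continuous tphi).
have mD : measurable_fun [set: mR3 R * mR3 R] ('D_(e, 0) phi).
  exact: continuous_measurable6 (test_function_continuous tD).
have [B1 B10 hB1] := test_function_bounded tphi.
have [B2 B20 hB2] := test_function_bounded tD.
have [S [T [mS mT S1 T1 CST]]] := compact_bounded_set6 (proj2 tphi).
have out z : ~ (S z.1 /\ T z.2) -> phi z = 0 /\ 'D_(e, 0) phi z = 0.
  move=> nz; have nC : ~ closure [set y | phi y != 0] z by move=> /CST.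
  split; last exact: derive_eq0_notin_support.
  by apply/eqP; apply: contra_notT nC => h; exact: subset_closure.
have ind (u : R) (z : R3 R * R3 R) (a b c : R) : `|a| <= b -> `|u| <= c -> 0 <= c ->
    (~ (S z.1 /\ T z.2) -> u = 0) -> (S z.1 -> 0 <= b) ->
    `|a * u| <= b * \1_S z.1 * \1_T z.2 * c.
  move=> ab uc c0 u0 b0; rewrite normrM !indicE.
  have [Sz|Sz] := boolP (z.1 \in S); last first.
    by rewrite u0 ?normr0 ?mulr0 ?mul0r // => -[/mem_set h]; rewrite h in Sz.
  have [Tz|Tz] := boolP (z.2 \in T); last first.
    by rewrite u0 ?normr0 ?mulr0 ?mul0r // => -[_ /mem_set h]; rewrite h in Tz.
  by rewrite !mulr1 ler_pM.
have cv : {ae leb6, forall z : mR3 R * mR3 R, q1 n z.1 @[n --> \oo] --> Q z.1 /\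
   (d1 n z.1 @[n --> \oo] --> Qe z.1 /\ forall n, `|d1 n z.1| <= D1 z.1)}.
  apply: (@ae_fst (fun x => q1 n x @[n --> \oo] --> Q x /\
     (d1 n x @[n --> \oo] --> Qe x /\ forall n, `|d1 n x| <= D1 x))).
  by apply: filterS g1 => x [].
have c1' : \int[leb6]_z (gibbs (q1 n) z * 'D_(e, 0) phi z) @[n --> \oo] -->
    \int[leb6]_z (gibbs Q z * 'D_(e, 0) phi z).
  apply: (proj2 (@dominated_Rintegral _ _ _ leb6 (fun n z => gibbs (q1 n) z * 'D_(e, 0) phi z)
    (fun z => gibbs Q z * 'D_(e, 0) phi z) (fun z => K * \1_S z.1 * \1_T z.2 * B2) _ _ _ _ _)).
  + by move=> n; apply: measurable_funM => //; apply: (measurable_comp_energy cF); have [] := b1 n.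
  + by apply: measurable_funM => //; exact: (measurable_comp_energy cF mQ).
  + apply: filterS cv => z [h1 _]; apply: cvgM; last exact: cvg_cst.
    apply: (@continuous_cvg _ _ _ _ _ _ F); first exact: cF.
    by apply: cvgD => //; exact: cvg_cst.
  + apply: integrable_mulr; apply: (@integrable_fst_indic (fun x => K * \1_S x)) => //.
    by under eq_fun do rewrite mulrC; apply: integrable_mulr; exact: integrable_indic_lty.
  + apply: nearW => z n; apply: ind => //; first exact: FK.
    by move=> /out[].
have c2' : (- (\int[leb6]_z (dF (energy z.2 + q1 n z.1) * d1 n z.1 * phi z))) @[n --> \oo] -->
    - \int[leb6]_z (dF (energy z.2 + Q z.1) * Qe z.1 * phi z).
  apply: cvgN; apply: (proj2 (@dominated_Rintegral _ _ _ leb6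
    (fun n z => dF (energy z.2 + q1 n z.1) * d1 n z.1 * phi z)
    (fun z => dF (energy z.2 + Q z.1) * Qe z.1 * phi z)
    (fun z => K * D1 z.1 * \1_T z.2 * B1) _ _ _ _ _)).
  + move=> n; have [mq md] := b1 n; apply: measurable_funM => //; apply: measurable_funM.
      exact: (measurable_comp_energy cdF mq).
    exact: (measurableT_comp md (@measurable_fst _ _ _ _)).
  + exact: measurable_funM.
  + apply: filterS cv => z [h1 [h2 _]]; apply: cvgM; last exact: cvg_cst.
    apply: cvgM => //; apply: (@continuous_cvg _ _ _ _ _ _ dF); first exact: cdF.
    by apply: cvgD => //; exact: cvg_cst.
  + apply: integrable_mulr; apply: (@integrable_fst_indic (fun x => K * D1 x)) => //.
    by under eq_fun do rewrite mulrC; exact: integrable_mulr.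
  + apply: filterS cv => z [_ [_ h]] n.
    have D0 : 0 <= D1 z.1 by apply: le_trans (h n).
    rewrite normrM indicE; have [Tz|Tz] := boolP (z.2 \in T); last first.
      have [-> _] : phi z = 0 /\ 'D_(e, 0) phi z = 0.
        by apply: out => -[_ /mem_set h']; rewrite h' in Tz.
      by rewrite normr0 !mulr0 mul0r.
    by rewrite mulr1 ler_pM // normrM ler_pM.
have E : (fun n => \int[leb6]_z (gibbs (q1 n) z * 'D_(e, 0) phi z)) =
    (fun n => - \int[leb6]_z (dF (energy z.2 + q1 n z.1) * d1 n z.1 * phi z)).
  apply/funext => n; have [mq md] := b1 n.
  have dg z : is_derive z (e, 0) (gibbs (q1 n)) (dF (energy z.2 + q1 n z.1) * d1 n z.1).
    apply: (is_derive_comp1 (u := fun z : R3 R * R3 R => energy z.2 + q1 n z.1)) => //.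
    apply: is_derive_of_line.
    have e0 : z.1 + 0 *: e = z.1 by rewrite scale0r addr0.
    have [dq1 dq2] := a1 n z.1.
    have H : derivable (q1 n) (z.1 + 0 *: e) e by rewrite e0.
    have HL := is_derive_line H; rewrite e0 dq2 in HL.
    have := is_derive_add (is_derive_const (energy z.2) (0 : R) 1) HL; rewrite add0r.
    congr is_derive; apply/funext => k /=.
    by rewrite scaler0 addr0.
  have dE z : 'D_(e, 0) (gibbs (q1 n)) z = dF (energy z.2 + q1 n z.1) * d1 n z.1.
    by have [_ ->] := dg z.
  have mdE : measurable_fun [set: mR3 R * mR3 R] ('D_(e, 0) (gibbs (q1 n))).
    rewrite (_ : 'D_(e, 0) _ = (fun z => dF (energy z.2 + q1 n z.1) * d1 n z.1)); last exact/funext.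
    apply: measurable_funM; first exact: (measurable_comp_energy cdF mq).
    exact: (measurableT_comp md (@measurable_fst _ _ _ _)).
  have bd z : closure [set y | phi y != 0] z -> `|gibbs (q1 n) z| <= K + K * M1 n /\
      `|'D_(e, 0) (gibbs (q1 n)) z| <= K + K * M1 n.
    move=> _; rewrite dE; have [h1 h2] := c1 n z.1.
    have M0 : 0 <= M1 n by exact: le_trans h2.
    split; first by apply: le_trans (FK _) _; rewrite lerDl mulr_ge0.
    by rewrite normrM; apply: (@le_trans _ _ (K * M1 n)); [rewrite ler_pM|rewrite lerDr].
  have [_ _ ->] := @weak_derive6 R (e, 0) (gibbs (q1 n)) (K + K * M1 n) phi tphi
    (measurable_comp_energy cF mq) mdE (fun z => @ex_derive _ _ _ _ _ _ _ (dg z)) bd.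
  by congr (- _); apply: eq_Rintegral => z _; rewrite dE.
rewrite E in c1'; have := cvg_lim (@Rhausdorff R) c1'.
by rewrite (cvg_lim (@Rhausdorff R) c2') => ->.
Qed.

End Chain.
End Approximable.

(** * Differentiation of singular parameter integrals by truncation *)

Section KernelApproximable.
Context {R : realType} d (T : measurableType d) (m : {sigma_finite_measure set T -> \bar R}).
Variables (e : R3 R) (c : T -> R) (k dk : R3 R * T -> R) (S : nat -> set T) (M : nat -> R).
Hypothesis mc : measurable_fun setT c.
Hypothesis c0 : forall z, 0 <= c z.
Hypothesis ic : m.-integrable setT (EFin \o c).
Hypothesis mk : measurable_fun [set: mR3 R * T] k.
Hypothesis mdk : measurable_fun [set: mR3 R * T] dk.
Hypothesis hk : forall x z, is_derive x e (fun x => k (x, z)) (dk (x, z)).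
Hypothesis mS : forall n, measurable (S n).
Hypothesis cS : forall z, c z != 0 -> \forall n \near \oo, S n z.
Hypothesis kM : forall n x z, S n z -> `|k (x, z)| <= M n /\ `|dk (x, z)| <= M n.
Hypothesis ik : (\int[leb3]_(x in [set: mR3 R]) \int[m]_z (c z * `|k (x, z)|)%:E < +oo)%E.
Hypothesis idk : (\int[leb3]_(x in [set: mR3 R]) \int[m]_z (c z * `|dk (x, z)|)%:E < +oo)%E.

Let M0 n : 0 <= `|M n|. Proof. by []. Qed.

Let mcut n (h : R3 R * T -> R) : measurable_fun [set: mR3 R * T] h ->
  measurable_fun [set: mR3 R * T] (fun p => c p.2 * \1_(S n) p.2 * h p).
Proof.
move=> mh; apply: measurable_funM => //; apply: measurable_funM.
  exact: (measurableT_comp mc (@measurable_snd _ _ _ _)).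
apply: (@measurableT_comp _ _ _ _ _ _ (\1_(S n) : T -> R) _ snd); last exact: measurable_snd.
exact: measurable_indic.
Qed.

Let cut n (h : R3 R * T -> R) (x : R3 R) : R := \int[m]_z (c z * \1_(S n) z * h (x, z)).

Let msec (h : R3 R * T -> R) (x : R3 R) : measurable_fun [set: mR3 R * T] h ->
  measurable_fun setT (fun z => h (x, z)).
Proof. by move=> mh; exact: (measurableT_comp mh (pair1_measurable (x : mR3 R))). Qed.

Let hbound n (h : R3 R * T -> R) x z : (forall x z, S n z -> `|h (x, z)| <= M n) ->
  `|c z * \1_(S n) z * h (x, z)| <= c z * `|M n|.
Proof.
move=> hM; rewrite !normrM (ger0_norm (c0 z)) -mulrA ler_wpM2l // indicE.
have [Sz|Sz] := boolP (z \in S n).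
  by rewrite normr1 mul1r; apply: le_trans (ler_norm _); apply: hM; rewrite inE in Sz.
by rewrite normr0 mul0r.
Qed.

Let icut n (h : R3 R * T -> R) x : measurable_fun [set: mR3 R * T] h ->
  (forall x z, S n z -> `|h (x, z)| <= M n) ->
  m.-integrable setT (EFin \o (fun z => c z * \1_(S n) z * h (x, z))).
Proof.
move=> mh hM; apply: (integrable_le (g := fun z => c z * `|M n|)).
- exact: (msec x (mcut n mh)).
- exact: integrable_mulr.
- by move=> z; exact: hbound.
Qed.

Let cut_bound n (h : R3 R * T -> R) x : measurable_fun [set: mR3 R * T] h ->
  (forall x z, S n z -> `|h (x, z)| <= M n) ->
  `|cut n h x| <= \int[m]_z (c z * `|M n|).
Proof.
move=> mh hM; have i := icut x mh hM.
apply: le_trans (le_normr_Rintegral measurableT i) _.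
apply: le_Rintegral => //.
- exact: (integrable_norm i).
- exact: integrable_mulr.
- by move=> z _; exact: hbound.
Qed.

(** On [S n] the derivative of the kernel is bounded by [M n], uniformly in x; times the integrable
    [c] this justifies differentiation under the integral along the line through x. *)
Let is_derive_cut n x : is_derive x e (cut n k) (cut n dk x).
Proof.
have kM1 x' z : S n z -> `|k (x', z)| <= M n by move=> /(kM x')[].
have kM2 x' z : S n z -> `|dk (x', z)| <= M n by move=> /(kM x')[].
pose f (h : R) (z : T) : R := c z * \1_(S n) z * k (x + h *: e, z).
have df z (h : R) : is_derive h 1 (f ^~ z) (c z * \1_(S n) z * dk (x + h *: e, z)).
  apply: is_derive_scale; have [d1 d2] := hk (x + h *: e) z.
  by have := is_derive_line d1; rewrite d2.
have dfE z (h : R) : partial1of2 f h z = c z * \1_(S n) z * dk (x + h *: e, z).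
  by rewrite partial1of2E; have [_ ->] := df z h.
have I0 : `]-1, 1[%classic (0 : R) by rewrite /= in_itv/= ltrN10 ltr01.
have H1 (h : R) : `]-1, 1[%classic h -> m.-integrable setT (EFin \o f h).
  by move=> _; exact: (icut _ mk kM1).
have H2 (h : R) z : `]-1, 1[%classic h -> setT z -> derivable (f ^~ z) h 1.
  by move=> _ _; have [] := df z h.
have H3 z : 0 <= c z * `|M n| by exact: mulr_ge0.
have H4 : m.-integrable setT (EFin \o (fun z => c z * `|M n|)) by exact: integrable_mulr.
have H5 (h : R) z : `]-1, 1[%classic h -> setT z -> `|partial1of2 f h z| <= c z * `|M n|.
  by move=> _ _; rewrite dfE; exact: hbound.
apply: is_derive_of_line.
have D := derivable_under_integral measurableT I0 H1 H2 H3 H4 H5.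
have E := differentiation_under_integral measurableT I0 H1 H2 H3 H4 H5.
split; first exact: D.
rewrite -derive1E; etransitivity; first exact: E.
by apply: eq_Rintegral => z _; rewrite dfE scale0r addr0.
Qed.

Let cut_ae (h : R3 R * T -> R) (hM : forall n x z, S n z -> `|h (x, z)| <= M n) :
  measurable_fun [set: mR3 R * T] h ->
  (\int[leb3]_(x in [set: mR3 R]) \int[m]_z (c z * `|h (x, z)|)%:E < +oo)%E ->
  {ae leb3, forall x : mR3 R, cut n h x @[n --> \oo] --> \int[m]_z (c z * h (x, z)) /\
    forall n, `|cut n h x| <= fine (\int[m]_z (c z * `|h (x, z)|)%:E)%E}.
Proof.
move=> mh ih.
have ma : measurable_fun [set: mR3 R * T] (fun p => (c p.2 * `|h p|)%:E).
  apply/measurable_EFinP; apply: measurable_funM; last exact: measurableT_comp.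
  exact: (measurableT_comp mc (@measurable_snd _ _ _ _)).
have a0 p : (0 <= (c p.2 * `|h p|)%:E)%E by rewrite lee_fin mulr_ge0.
have mF := @measurable_fun_fubini_tonelli_F _ _ _ _ _ m _ ma a0.
have iF : leb3.-integrable [set: mR3 R] (fun x => \int[m]_z (c z * `|h (x, z)|)%:E)%E.
  apply/integrableP; split; first exact: mF.
  apply: le_lt_trans ih; apply: (@ge0_le_integral _ _ _ leb3 setT measurableT) => //.
  - by apply: measurableT_comp => //; exact: mF.
  - by move=> x _; rewrite gee0_abs //; apply: integral_ge0 => z _; exact: (a0 (x, z)).
have := integrable_ae measurableT iF; apply: filterS => x /(_ Logic.I) xf.
have ix : m.-integrable setT (EFin \o (fun z => c z * `|h (x, z)|)).
  apply/integrableP; split; first exact: (measurableT_comp ma (pair1_measurable (x : mR3 R))).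
  under eq_integral => z _ do rewrite (gee0_abs (a0 (x, z))).
  rewrite ge0_fin_numE in xf; first exact: xf.
  by apply: integral_ge0 => z _; exact: (a0 (x, z)).
have bz n z : `|c z * \1_(S n) z * h (x, z)| <= c z * `|h (x, z)|.
  rewrite !normrM (ger0_norm (c0 z)) -mulrA ler_wpM2l // indicE.
  by case: (z \in S n); rewrite ?normr1 ?mul1r ?normr0 ?mul0r.
split.
  apply: (proj2 (@dominated_Rintegral _ _ _ m (fun n z => c z * \1_(S n) z * h (x, z))
    (fun z => c z * h (x, z)) (fun z => c z * `|h (x, z)|) _ _ _ ix _)).
  - by move=> n; exact: (msec x (mcut n mh)).
  - by apply: measurable_funM => //; exact: msec.
  - apply: nearW => z; have [cz|cz] := eqVneq (c z) 0.
      by rewrite cz mul0r; under eq_fun do rewrite mul0r mul0r; exact: cvg_cst.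
    apply: cvg_near_cst; near=> n; rewrite indicE mem_set ?mulr1 //.
    by near: n; exact: cS.
  - by apply: nearW => z n; exact: bz.
move=> n; have i := icut x mh (hM n).
apply: le_trans (le_normr_Rintegral measurableT i) _.
by apply: le_Rintegral => //; first exact: (integrable_norm i).
Unshelve. all: by end_near. Qed.

(** The approximants are the integrals over [S n]. They are dominated by the integrals of the
    absolute values, which are integrable in x by [ik] and [idk] and therefore finite almost
    everywhere. *)
Lemma kernel_approximable : approximable e (fun x => \int[m]_z (c z * k (x, z)))
  (fun x => \int[m]_z (c z * dk (x, z))).
Proof.
have mR (h : R3 R * T -> R) : measurable_fun [set: mR3 R * T] h ->
    measurable_fun [set: mR3 R] (fun x => \int[m]_z (c z * h (x, z))).
  move=> mh; apply: (@measurable_Rintegral _ _ (mR3 R) T R m (fun p => c p.2 * h p)).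
  apply: measurable_funM => //; exact: (measurableT_comp mc (@measurable_snd _ _ _ _)).
have iP (h : R3 R * T -> R) : measurable_fun [set: mR3 R * T] h ->
    (\int[leb3]_(x in [set: mR3 R]) \int[m]_z (c z * `|h (x, z)|)%:E < +oo)%E ->
    leb3.-integrable [set: mR3 R] (EFin \o (fine \o (fun x => \int[m]_z (c z * `|h (x, z)|)%:E)))%E.
  move=> mh ih; have a0 p : (0 <= (c p.2 * `|h p|)%:E)%E by rewrite lee_fin mulr_ge0.
  apply: integrable_fine => //.
  - apply: (@measurable_fun_fubini_tonelli_F _ _ _ _ _ m (fun p => (c p.2 * `|h p|)%:E) _ a0).
    apply/measurable_EFinP; apply: measurable_funM; last exact: measurableT_comp.
    exact: (measurableT_comp mc (@measurable_snd _ _ _ _)).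
  - by move=> x; apply: integral_ge0 => z _; exact: (a0 (x, z)).
split; [exact: mR|exact: mR|].
exists (fun n => cut n k), (fun n => cut n dk),
  (fine \o (fun x => \int[m]_z (c z * `|k (x, z)|)%:E))%E,
  (fine \o (fun x => \int[m]_z (c z * `|dk (x, z)|)%:E))%E,
  (fun n => \int[m]_z (c z * `|M n|)); split.
- by move=> n x; exact: is_derive_cut.
- move=> n; split; first exact: (@measurable_Rintegral _ _ (mR3 R) T R m _ (mcut n mk)).
  exact: (@measurable_Rintegral _ _ (mR3 R) T R m _ (mcut n mdk)).
- move=> n x; split; apply: cut_bound => //.
    by move=> x' z /(kM x')[].
  by move=> x' z /(kM x')[].
- by split; exact: iP.
have A1 := @cut_ae k (fun n x z h => proj1 (kM x h)) mk ik.
have A2 := @cut_ae dk (fun n x z h => proj2 (kM x h)) mdk idk.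
by move: A1 A2; apply: filterS2 => x [? ?] [? ?]; split.
Qed.

End KernelApproximable.

Section RealFubini.
Context d1 d2 (T1 : measurableType d1) (T2 : measurableType d2) (R : realType).
Variables (m1 : {sigma_finite_measure set T1 -> \bar R})
  (m2 : {sigma_finite_measure set T2 -> \bar R}) (f : T1 * T2 -> R).
Hypothesis mf : measurable_fun setT f.
Hypothesis fin : (\int[m1]_x \int[m2]_y `|f (x, y)|%:E < +oo)%E.

Let mE : measurable_fun setT (EFin \o f). Proof. exact/measurable_EFinP. Qed.
Let iE : (m1 \x m2)%E.-integrable setT (EFin \o f).
Proof. by apply/(integrable12ltyP m1 m2 mE). Qed.

Let RE1 : \int[m1]_x \int[m2]_y f (x, y) = fine (\int[m1]_x \int[m2]_y (f (x, y))%:E)%E.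
Proof.
congr fine; apply: (@ae_eq_integral _ _ _ m1) => //.
- have mR := measurable_Rintegral m2 mf; exact/measurable_EFinP.
- exact: measurable_fubini_F iE.
by have := ae_integrable1 iE; apply: filterS => x h _; rewrite /= /Rintegral fineK // integrable_fin_num.
Qed.

Let RE2 : \int[m2]_y \int[m1]_x f (x, y) = fine (\int[m2]_y \int[m1]_x (f (x, y))%:E)%E.
Proof.
congr fine; apply: (@ae_eq_integral _ _ _ m2) => //.
- have mR := @measurable_Rintegral _ _ T2 T1 R m1 (fun z => f (z.2, z.1)) _.
  apply/measurable_EFinP; apply: mR; apply: (measurableT_comp mf).
  by apply: measurable_fun_pair; [exact: measurable_snd|exact: measurable_fst].
- exact: measurable_fubini_G iE.
by have := ae_integrable2 iE; apply: filterS => x h _; rewrite /= /Rintegral fineK // integrable_fin_num.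
Qed.

Lemma Rintegral_swap : \int[m1]_x \int[m2]_y f (x, y) = \int[m2]_y \int[m1]_x f (x, y).
Proof. by rewrite RE1 RE2 (Fubini iE). Qed.

Lemma Rintegral_prod : \int[prod_measure m1 m2]_z f z = \int[m1]_x \int[m2]_y f (x, y).
Proof. by rewrite RE1; congr fine; rewrite -(integral12_prod_meas1 iE). Qed.

End RealFubini.

Lemma ae_eq_Rintegral d (T : measurableType d) (R : realType) (m : {measure set T -> \bar R})
    (f g : T -> R) : measurable_fun setT f -> measurable_fun setT g ->
  {ae m, forall x, f x = g x} -> \int[m]_x f x = \int[m]_x g x.
Proof.
move=> mf mg fg; congr fine; apply: (@ae_eq_integral _ _ _ m) => //; try exact/measurable_EFinP.
by apply: filterS fg => x /= -> _.
Qed.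

(** * Yukawa potentials: gradients, total mass and duality *)

Section Potential.
Context {R : realType}.
Variables (L : R) (nu : {sigma_finite_measure set (mR3 R) -> \bar R}) (b : R3 R -> R).
Hypothesis L0 : 0 < L.
Hypothesis mb : measurable_fun [set: mR3 R] b.
Hypothesis b0 : forall y, 0 <= b y.
Hypothesis ib : nu.-integrable [set: mR3 R] (EFin \o b).

Let leb : {sigma_finite_measure set (measurableTypeR R) -> \bar R} := lebesgue_measure.
Local Notation T := (mR3 R * measurableTypeR R)%type.
Let m : {sigma_finite_measure set T -> \bar R} := prod_measure nu leb.

Let c (z : T) : R := b z.1 * expw L z.2.
Let k (p : R3 R * T) : R := heat p.2.2 (p.1 - p.2.1).
Let dk (i : 'I_3) (p : R3 R * T) : R :=
  - dot3 (p.1 - p.2.1) (basis3 i) / (2 * p.2.2) * heat p.2.2 (p.1 - p.2.1).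

(** The Yukawa potential of b nu, written as one integral over source point and time so that the
    truncation can act on the time variable; [potentialE] identifies it with the convolution. *)
Definition potential (x : R3 R) : R := \int[m]_z (c z * k (x, z)).
Definition dpotential (i : 'I_3) (x : R3 R) : R := \int[m]_z (c z * dk i (x, z)).

Let c0 z : 0 <= c z. Proof. by rewrite mulr_ge0 ?expw_ge0. Qed.

Let mc : measurable_fun setT c.
Proof.
apply: measurable_funM; first exact: (measurableT_comp mb (@measurable_fst _ _ _ _)).
exact: (measurableT_comp (measurable_expw L) (@measurable_snd _ _ _ _)).
Qed.

Let msub : measurable_fun [set: mR3 R * T] (fun p => ((p.1 : R3 R) - p.2.1)%R : mR3 R).
Proof.
apply: measurable_sub3; first exact: measurable_fst.
by apply: (measurableT_comp (@measurable_fst _ _ _ _)); exact: measurable_snd.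
Qed.

Let mtime : measurable_fun [set: mR3 R * T] (fun p => p.2.2 : R).
Proof. by apply: (measurableT_comp (@measurable_snd _ _ _ _)); exact: measurable_snd. Qed.

Let mk : measurable_fun [set: mR3 R * T] k.
Proof. exact: measurable_heat mtime msub. Qed.

Let mdk i : measurable_fun [set: mR3 R * T] (dk i).
Proof.
apply: measurable_funM; last exact: mk.
apply: measurable_funM; last first.
  by apply: (measurableT_comp measurable_invr); exact: measurable_funM.
apply: measurable_funN; rewrite (_ : (fun p => _) = (fun p => coord3 i (p.1 - p.2.1))); last first.
  by apply/funext => p; rewrite dot3_basis3.
have [m1 m2 m3] := measurable_coords msub.
by case: i => -[|[|[|//]]] ? /=.
Qed.

Let integral_c (w : R -> R) (I : R) : measurable_fun setT w -> (forall t, 0 <= w t) ->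
  (\int[leb]_t (expw L t * w t)%:E <= I%:E)%E ->
  (\int[m]_z (c z * w z.2)%:E < +oo)%E.
Proof.
move=> mw w0 wI.
have mf : measurable_fun setT (fun z : T => (c z * w z.2)%:E).
  apply/measurable_EFinP; apply: measurable_funM => //.
  exact: (measurableT_comp mw (@measurable_snd _ _ _ _)).
have f0 z : (0 <= (c z * w z.2)%:E)%E by rewrite lee_fin mulr_ge0.
have -> : (\int[m]_z (c z * w z.2)%:E = \int[nu]_y \int[leb]_t (c (y, t) * w t)%:E)%E.
  exact: (@fubini_tonelli1 _ _ _ _ _ nu leb _ mf f0).
have mew : measurable_fun setT (fun t => (expw L t * w t)%:E).
  by apply/measurable_EFinP; apply: measurable_funM => //; exact: measurable_expw.
have ew0 t : (0 <= (expw L t * w t)%:E)%E by rewrite lee_fin mulr_ge0 ?expw_ge0.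
apply: (@le_lt_trans _ _ (\int[nu]_y ((b y)%:E * I%:E))%E).
  apply: (@ge0_le_integral _ _ _ nu setT measurableT).
  - by move=> y _; apply: integral_ge0 => t _; exact: (f0 (y, t)).
  - exact: (@measurable_fun_fubini_tonelli_F _ _ _ _ _ leb _ mf f0).
  - by apply/measurable_EFinP; exact: measurable_funM.
  - move=> y _; rewrite /c /=; under eq_integral do rewrite -mulrA EFinM.
    rewrite ge0_integralZl_EFin //.
    by apply: lee_wpmul2l => //; rewrite lee_fin.
have I0 : (0 <= I)%R.
  by rewrite -lee_fin; apply: le_trans wI; apply: integral_ge0.
rewrite ge0_integralZr //; last by move=> y _; rewrite lee_fin.
  rewrite muleC; apply: lte_mul_pinfty => //.
  have /integrableP[_] := ib; apply: le_lt_trans.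
  by apply: (@ge0_le_integral _ _ _ nu setT measurableT) => //;
     [move=> y _; rewrite lee_fin|exact/measurable_EFinP|
      apply/measurable_EFinP; exact: measurableT_comp|move=> y _; rewrite lee_fin ler_norm].
by apply/measurable_EFinP.
Qed.

Let ic : m.-integrable setT (EFin \o c).
Proof.
apply/integrableP; split; first exact/measurable_EFinP.
have := @integral_c (cst 1) L^-1 (measurable_cst _) (fun=> ler01).
under eq_integral do rewrite mulr1.
rewrite (integral_expw L0) lexx => /(_ isT); apply: le_lt_trans.
rewrite le_eqVlt; apply/orP; left; apply/eqP; apply: eq_integral => z _ /=.
by rewrite mulr1 ger0_norm.
Qed.

Let heat_mass (t : R) (y : R3 R) : 0 < t ->
  (\int[leb3]_(x in [set: mR3 R]) (heat t ((x : R3 R) - y))%:E = 1)%E.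
Proof. exact: integral_heat. Qed.

Let c_le0 (z : T) : (z.2 : R) <= 0 -> c z = 0.
Proof. by move=> z0; rewrite /c /expw ltNge z0 mulr0. Qed.

Let swap (h : R3 R * T -> R) : measurable_fun [set: mR3 R * T] h ->
  (\int[leb3]_(x in [set: mR3 R]) \int[m]_z (c z * `|h (x, z)|)%:E =
   \int[m]_z ((c z)%:E * \int[leb3]_(x in [set: mR3 R]) `|h (x, z)|%:E))%E.
Proof.
move=> mh.
have mf : measurable_fun [set: mR3 R * T] (fun p => (c p.2 * `|h p|)%:E).
  apply/measurable_EFinP; apply: measurable_funM; last exact: measurableT_comp.
  exact: (measurableT_comp mc (@measurable_snd _ _ _ _)).
have f0 p : (0 <= (c p.2 * `|h p|)%:E)%E by rewrite lee_fin mulr_ge0.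
etransitivity; first exact: (@fubini_tonelli _ _ _ _ _ leb3 m _ mf f0).
apply: eq_integral => z _ /=; under eq_integral do rewrite EFinM.
rewrite ge0_integralZl_EFin //.
apply/measurable_EFinP; apply: measurableT_comp => //.
exact: (measurableT_comp mh (pair2_measurable z)).
Qed.

Let ik : (\int[leb3]_(x in [set: mR3 R]) \int[m]_z (c z * `|k (x, z)|)%:E < +oo)%E.
Proof.
rewrite (swap mk).
have /integrableP[_] := ic; apply: le_lt_trans.
rewrite le_eqVlt; apply/orP; left; apply/eqP; apply: eq_integral => z _ /=.
rewrite ger0_norm //; have [z0|z0] := leP (z.2 : R) 0; first by rewrite c_le0 // mul0e.
under eq_integral do rewrite /k /= ger0_norm ?heat_ge0 //.
by rewrite heat_mass // mule1.
Qed.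

Let dk_le i (x : R3 R) (z : T) : `|dk i (x, z)| <= 3 * (Num.sqrt z.2)^-1 * heat (2 * z.2) (x - z.1).
Proof.
have [_ E] := is_derive_heat z.2 (x - z.1) (basis3 i).
by have := derive_heat_le z.2 i (x - z.1); rewrite E.
Qed.

(** By [derive_heat_le] and the unit mass of p_{2t}, the x-integral of |d p_t| is at most 3
    t^(-1/2). Against exp(-Lt) this is integrable, with t^(-1/2) <= t^(-3/4) + 1 producing the
    constant. *)
Let idk i : (\int[leb3]_(x in [set: mR3 R]) \int[m]_z (c z * `|dk i (x, z)|)%:E < +oo)%E.
Proof.
rewrite (swap (mdk i)).
have mq : measurable_fun setT (fun t : R => 3 * qroot t ^+ 2).
  by apply: measurable_funM => //; apply: measurable_funX; exact: measurable_qroot.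
have q0 (t : R) : 0 <= 3 * qroot t ^+ 2 by rewrite mulr_ge0 ?sqr_ge0.
have H := @integral_c (fun t => 3 * qroot t ^+ 2) (3 * (4 + L^-1 + L^-1)) mq q0.
apply: le_lt_trans (H _).
  apply: (@ge0_le_integral _ _ _ m setT measurableT).
  - by move=> z _; apply: mule_ge0; rewrite ?lee_fin //; apply: integral_ge0.
  - apply: emeasurable_funM; first exact/measurable_EFinP.
    have mf : measurable_fun [set: mR3 R * T] (fun p => `|dk i p|%:E).
      by apply/measurable_EFinP; apply: measurableT_comp => //; exact: mdk.
    have f0 (p : R3 R * T) : (0 <= `|dk i p|%:E)%E by rewrite lee_fin.
    exact: (@measurable_fun_fubini_tonelli_G _ _ _ _ _ leb3 _ mf f0).
  - apply/measurable_EFinP; apply: measurable_funM => //.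
    exact: (measurableT_comp mq (@measurable_snd _ _ _ _)).
  move=> z _; have [z0|z0] := leP (z.2 : R) 0; first by rewrite c_le0 // mul0e mul0r.
  rewrite [leRHS]EFinM; apply: lee_wpmul2l; first by rewrite lee_fin.
  have mh : measurable_fun [set: mR3 R] (fun x => (heat (2 * z.2) ((x : R3 R) - z.1))%:E).
    apply/measurable_EFinP; apply: measurable_heat; first exact: measurable_cst.
    by apply: measurable_sub3; [exact: measurable_id|exact: measurable_cst].
  apply: (@le_trans _ _ (\int[leb3]_(x in [set: mR3 R]) ((3 * qroot z.2 ^+ 2)%:E * (heat (2 * z.2) ((x : R3 R) - z.1))%:E))%E).
    apply: (@ge0_le_integral _ _ _ leb3 setT measurableT).
    - by [].
    - apply/measurable_EFinP; apply: measurableT_comp => //.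
      exact: (measurableT_comp (mdk i) (pair2_measurable z)).
    - exact: measurable_funeM.
    - by move=> x _; rewrite -EFinM lee_fin qroot_sqr; exact: dk_le.
  rewrite ge0_integralZl_EFin //; last by move=> x _; rewrite lee_fin heat_ge0.
  by rewrite heat_mass ?mulr_gt0 // mule1.
have mq3 : measurable_fun setT (fun t => (expw L t * qroot t ^+ 3)%:E).
  by apply/measurable_EFinP; apply: measurable_funM; [exact: measurable_expw|apply: measurable_funX; exact: measurable_qroot].
have me : measurable_fun setT (fun t => (expw L t)%:E).
  by apply/measurable_EFinP; exact: measurable_expw.
have e0 t : (0 <= (expw L t)%:E)%E by rewrite lee_fin expw_ge0.
have e30 t : (0 <= (expw L t * qroot t ^+ 3)%:E)%E.
  by rewrite lee_fin mulr_ge0 ?expw_ge0 ?exprn_ge0 ?qroot_ge0.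
apply: (@le_trans _ _ (\int[leb]_t (3%:E * ((expw L t * qroot t ^+ 3)%:E + (expw L t)%:E)))%E).
  apply: (@ge0_le_integral _ _ _ leb setT measurableT).
  - by move=> t _; rewrite lee_fin mulr_ge0 ?expw_ge0.
  - by apply/measurable_EFinP; apply: measurable_funM => //; exact: measurable_expw.
  - by apply: measurable_funeM; exact: emeasurable_funD.
  - move=> t _; rewrite -EFinD -EFinM lee_fin.
    have := ler_wpM2l (expw_ge0 L t) (qroot_sqr_le t).
    by move: (expw L t) (qroot t) => u v; lra.
rewrite ge0_integralZl_EFin //; last 2 first.
- by move=> t _; exact: adde_ge0.
- exact: emeasurable_funD.
rewrite EFinM lee_wpmul2l //.
by rewrite ge0_integralD // EFinD (integral_expw L0); apply: leeD => //; exact: integral_expw_qroot.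
Qed.

Let S (n : nat) : set T := [set z | n.+1%:R^-1 <= (z.2 : R)].

Let mS n : measurable (S n).
Proof.
have := @measurable_snd _ _ (mR3 R) (measurableTypeR R) measurableT _ (measurable_itv `[n.+1%:R^-1, +oo[).
by rewrite setTI; congr measurable; apply/seteqP; split => z; rewrite /S /= in_itv/= andbT.
Qed.

Let r (n : nat) : R := (Num.sqrt n.+1%:R^-1)^-1.

Let heat_le_r n (t : R) (x : R3 R) : n.+1%:R^-1 <= t -> heat t x <= r n ^+ 3 /\ (Num.sqrt t)^-1 <= r n.
Proof.
move=> nt; have n0 : (0 : R) < n.+1%:R^-1 by rewrite invr_gt0.
have t0 : 0 < t by exact: lt_le_trans nt.
have tr : (Num.sqrt t)^-1 <= r n.
  by rewrite /r lef_pV2 ?posrE ?sqrtr_gt0 // ler_wsqrtr.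
split => //; apply: le_trans (heat_le _ _) _.
apply: lerXn2r; rewrite ?nnegrE ?invr_ge0 ?sqrtr_ge0 //.
exact: le_trans (heat_constant_le t0) tr.
Qed.

(** The truncation keeps the times t >= 1/(n+1). With r = sqrt (n+1) the kernel is at most r^3
    there, and its derivative at most 3 r r^3; every positive time is eventually kept, and the
    weight vanishes at the others. *)
Lemma potential_approximable i : approximable (basis3 i) potential (dpotential i).
Proof.
apply: (@kernel_approximable R _ T m (basis3 i) c k (dk i) S (fun n => r n ^+ 3 + 3 * r n * r n ^+ 3)
  mc c0 ic mk (mdk i) _ mS _ _ ik (idk i)).
- move=> x z; rewrite /k /dk /=.
  have [d1 d2] := is_derive_heat z.2 (x - z.1) (basis3 i).
  apply: is_derive_of_line.
  have e0 : (x - z.1) + 0 *: (basis3 i : R3 R) = x - z.1 by rewrite scale0r addr0.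
  have d1' : derivable (heat z.2) ((x - z.1) + 0 *: (basis3 i : R3 R)) (basis3 i) by rewrite e0.
  have := is_derive_line d1'; rewrite e0 d2; congr is_derive.
  by apply/funext => h; rewrite addrAC.
- move=> z cz; have z0 : 0 < (z.2 : R) by rewrite ltNge; apply: contra_neqN cz; exact: c_le0.
  exists (Num.truncn (z.2 : R)^-1) => // n /= hn; rewrite /S /= invf_ple ?posrE //.
  by apply: le_trans (ltW (truncnS_gt _)) _; rewrite ler_nat ltnS.
- move=> n x z Sz; have r0 : 0 <= r n by rewrite invr_ge0 sqrtr_ge0.
  have [h1 h2] := heat_le_r (x - z.1) Sz.
  have n0 : (0 : R) < n.+1%:R^-1 by rewrite invr_gt0.
  have Sz2 : n.+1%:R^-1 <= 2 * (z.2 : R).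
    have z0 : 0 < (z.2 : R) := lt_le_trans n0 Sz.
    by apply: le_trans Sz _; lra.
  have [h3 _] := heat_le_r (x - z.1) Sz2.
  split.
    rewrite /k /= ger0_norm ?heat_ge0 //; apply: le_trans h1 _.
    by rewrite lerDl !mulr_ge0 ?exprn_ge0.
  apply: le_trans (dk_le _ _ _) _; apply: (@le_trans _ _ (3 * r n * r n ^+ 3)).
    by apply: ler_pM; rewrite ?heat_ge0 ?mulr_ge0 ?invr_ge0 ?sqrtr_ge0 ?ler_wpM2l.
  by rewrite lerDr exprn_ge0.
Qed.

Lemma conv_potential (x : R3 R) :
  conv nu (EFin \o b) (ykernel L) x = (\int[m]_z (c z * k (x, z))%:E)%E.
Proof.
have mf : measurable_fun setT (fun z : T => (c z * k (x, z))%:E).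
  apply/measurable_EFinP; apply: measurable_funM => //.
  exact: (measurableT_comp mk (pair1_measurable (x : mR3 R))).
have f0 z : (0 <= (c z * k (x, z))%:E)%E by rewrite lee_fin mulr_ge0 // heat_ge0.
transitivity (\int[nu]_y \int[leb]_t (c (y, t) * k (x, (y, t)))%:E)%E; last first.
  by apply/esym; exact: (@fubini_tonelli1 _ _ _ _ _ nu leb _ mf f0).
apply: eq_integral => y _; rewrite /= /ykernel /tker /c /k /=.
under [RHS]eq_integral do rewrite -mulrA EFinM.
rewrite ge0_integralZl_EFin //.
- by move=> t _; rewrite lee_fin mulr_ge0 ?heat_ge0 ?expw_ge0.
- apply/measurable_EFinP; apply: measurable_funM; first exact: measurable_expw.
  exact: measurable_heat_time.
Qed.

Lemma potentialE (x : R3 R) : potential x = fine (conv nu (EFin \o b) (ykernel L) x).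
Proof. by rewrite conv_potential. Qed.

(** Each p_t has mass 1 and exp(-Lt) has integral 1/L. The identity stands in for testing the
    Poisson equation with the constant 1, which has no compact support. *)
Lemma integral_potential : \int[leb3]_(x in [set: mR3 R]) potential x = L^-1 * \int[nu]_y b y.
Proof.
have mck : measurable_fun [set: mR3 R * T] (fun p => c p.2 * k p).
  apply: measurable_funM => //; exact: (measurableT_comp mc (@measurable_snd _ _ _ _)).
have nck : (\int[leb3]_(x in [set: mR3 R]) \int[m]_z `|c z * k (x, z)|%:E < +oo)%E.
  by under eq_integral => x _ do under eq_integral => z _ do rewrite normrM (ger0_norm (c0 z)).
rewrite (Rintegral_swap mck nck).
transitivity (\int[m]_z c z).
  apply: eq_Rintegral => z _; have [z0|z0] := leP (z.2 : R) 0.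
    by under eq_Rintegral do rewrite (c_le0 z0) mul0r; rewrite (c_le0 z0) Rintegral_cst // mul0r.
  have h : leb3.-integrable [set: mR3 R] (EFin \o (fun x => k (x, z))).
    apply/integrableP; split.
      by apply/measurable_EFinP; exact: (measurableT_comp mk (pair2_measurable z)).
    under eq_integral do rewrite /= ger0_norm ?heat_ge0 //.
    by rewrite heat_mass // ltry.
  rewrite -[LHS]/(\int[leb3]_(x in [set: mR3 R]) (c z * k (x, z))).
  by rewrite (RintegralZl _ measurableT h) /Rintegral heat_mass // mulr1.
have mc' : measurable_fun setT c by exact: mc.
have nc : (\int[nu]_y \int[leb]_t `|c (y, t)|%:E < +oo)%E.
  have /integrableP[_] := ic; apply: le_lt_trans.
  rewrite le_eqVlt; apply/orP; left; apply/eqP/esym.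
  by apply: (@fubini_tonelli1 _ _ _ _ _ nu leb (fun z => `|c z|%:E)) => //; apply/measurable_EFinP; exact: measurableT_comp.
rewrite (Rintegral_prod mc' nc) mulrC.
have ie : leb.-integrable setT (EFin \o expw L).
  apply/integrableP; split; first by apply/measurable_EFinP; exact: measurable_expw.
  under eq_integral do rewrite /= ger0_norm ?expw_ge0 //.
  by rewrite (integral_expw L0) ltry.
rewrite -RintegralZr //; apply: eq_Rintegral => y _; rewrite /c /= RintegralZl //.
by congr (_ * _); rewrite /Rintegral (integral_expw L0).
Qed.

(** Fubini's theorem shifts the heat kernel onto [psi]. With psi = (L - Delta) phi the inner time
    integral is the resolvent applied to [psi], evaluated in [heat_resolvent]. *)
Lemma potential_pairing (psi : R3 R -> R) (B : R) : measurable_fun [set: mR3 R] psi ->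
  (forall x, `|psi x| <= B) ->
  \int[leb3]_(x in [set: mR3 R]) (potential x * psi x) =
  \int[nu]_y (b y * \int[leb]_t (expw L t * \int[leb3]_(x in [set: mR3 R]) (heat t ((x : R3 R) - y) * psi x))).
Proof.
move=> mpsi Bpsi; have B0 : 0 <= B by exact: le_trans (Bpsi 0).
have mck : measurable_fun [set: mR3 R * T] (fun p => c p.2 * k p).
  apply: measurable_funM => //; exact: (measurableT_comp mc (@measurable_snd _ _ _ _)).
have mckp : measurable_fun [set: mR3 R * T] (fun p => c p.2 * k p * psi p.1).
  by apply: measurable_funM; last exact: (measurableT_comp mpsi (@measurable_fst _ _ _ _)).
have mac : measurable_fun [set: mR3 R * T] (fun p => (c p.2 * `|k p|)%:E).
  apply/measurable_EFinP; apply: measurable_funM; last exact: measurableT_comp.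
  exact: (measurableT_comp mc (@measurable_snd _ _ _ _)).
have ac0 p : (0 <= (c p.2 * `|k p|)%:E)%E by rewrite lee_fin mulr_ge0.
have mF := @measurable_fun_fubini_tonelli_F _ _ _ _ _ m _ mac ac0.
have F0 (x : mR3 R) : (0 <= \int[m]_z (c z * `|k (x, z)|)%:E)%E.
  by apply: integral_ge0 => z _; exact: (ac0 (x, z)).
have fin : (\int[leb3]_(x in [set: mR3 R]) \int[m]_z `|c z * k (x, z) * psi x|%:E < +oo)%E.
  apply: (@le_lt_trans _ _ (\int[leb3]_(x in [set: mR3 R]) (B%:E * \int[m]_z (c z * `|k (x, z)|)%:E))%E).
    apply: (@ge0_le_integral _ _ _ leb3 setT measurableT).
    - by move=> x _; apply: integral_ge0.
    - have ma : measurable_fun [set: mR3 R * T] (fun p => `|c p.2 * k p * psi p.1|%:E).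
        by apply/measurable_EFinP; exact: measurableT_comp.
      have a0 (p : R3 R * T) : (0 <= `|c p.2 * k p * psi p.1|%:E)%E by rewrite lee_fin.
      exact: (@measurable_fun_fubini_tonelli_F _ _ _ _ _ m _ ma a0).
    - exact: measurable_funeM mF.
    - move=> x _; rewrite -ge0_integralZl_EFin //; last 2 first.
      + by move=> z _; exact: (ac0 (x, z)).
      + exact: (measurableT_comp mac (pair1_measurable (x : mR3 R))).
      apply: (@ge0_le_integral _ _ _ m setT measurableT).
      + by [].
      + apply/measurable_EFinP; apply: measurableT_comp => //.
        exact: (measurableT_comp mckp (pair1_measurable (x : mR3 R))).
      + apply: measurable_funeM; exact: (measurableT_comp mac (pair1_measurable (x : mR3 R))).
      + move=> z _; rewrite -EFinM lee_fin (normrM (c z * k (x, z))) (normrM (c z)) (ger0_norm (c0 z)) mulrC.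
        by rewrite ler_wpM2r ?(mulr_ge0 (c0 z)).
  rewrite (ge0_integralZl_EFin leb3 measurableT (fun x _ => F0 x) mF B0).
  by apply: lte_mul_pinfty.
transitivity (\int[leb3]_(x in [set: mR3 R]) \int[m]_z (c z * k (x, z) * psi x)).
  have iF : leb3.-integrable [set: mR3 R] (fun x => \int[m]_z (c z * `|k (x, z)|)%:E)%E.
    apply/integrableP; split; first exact: mF.
    by rewrite (eq_integral _ _ (fun x _ => gee0_abs (F0 x))); exact: ik.
  apply: ae_eq_Rintegral.
  - have mpot := measurable_Rintegral m mck; exact: measurable_funM.
  - exact: (@measurable_Rintegral _ _ (mR3 R) T R m _ mckp).
  have := integrable_ae measurableT iF; apply: filterS => x /(_ Logic.I) xf.
  rewrite /potential RintegralZr //.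
  apply/integrableP; split; first by apply/measurable_EFinP; exact: (measurableT_comp mck (pair1_measurable (x : mR3 R))).
  rewrite ge0_fin_numE // in xf; apply: le_lt_trans xf.
  rewrite le_eqVlt; apply/orP; left; apply/eqP; apply: eq_integral => z _ /=.
  by rewrite normrM (ger0_norm (c0 z)).
rewrite (Rintegral_swap mckp fin).
pose G (z : T) : R := \int[leb3]_(x in [set: mR3 R]) (k (x, z) * psi x).
have ikz (z : T) : leb3.-integrable [set: mR3 R] (EFin \o (fun x => k (x, z))).
  have mkz := measurableT_comp mk (pair2_measurable z).
  apply/integrableP; split; first by apply/measurable_EFinP; exact: mkz.
  under eq_integral do rewrite /= ger0_norm ?heat_ge0 //.
  have [z0|z0] := leP (z.2 : R) 0; last by rewrite heat_mass // ltry.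
  by rewrite integral0_eq ?ltry // => x _; rewrite /k heat_le0.
have ikp (z : T) : leb3.-integrable [set: mR3 R] (EFin \o (fun x => k (x, z) * psi x)).
  apply: (@integrable_le _ (mR3 R) R leb3 (fun x => k (x, z) * psi x) (fun x => k (x, z) * B)).
  - by apply: measurable_funM => //; exact: (measurableT_comp mk (pair2_measurable z)).
  - exact: integrable_mulr.
  - by move=> x; rewrite normrM (ger0_norm (heat_ge0 _ _)) ler_wpM2l ?heat_ge0.
have Gle z : `|G z| <= B.
  apply: le_trans (le_normr_Rintegral measurableT (ikp z)) _.
  apply: (@le_trans _ _ (\int[leb3]_(x in [set: mR3 R]) (k (x, z) * B))).
    apply: le_Rintegral => //; [exact: (integrable_norm (ikp z))|exact: integrable_mulr|].
    by move=> x _; rewrite /= normrM (ger0_norm (heat_ge0 _ _)) ler_wpM2l ?heat_ge0.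
  rewrite RintegralZr // -[leRHS]mul1r ler_wpM2r //.
  have [z0|z0] := leP (z.2 : R) 0.
    by rewrite /Rintegral integral0_eq // => x _; rewrite /k heat_le0.
  by rewrite /Rintegral heat_mass.
have mG : measurable_fun setT G.
  apply: (@measurable_Rintegral _ _ T (mR3 R) R leb3 (fun p => k (p.2, p.1) * psi p.2)).
  apply: measurable_funM; last exact: (measurableT_comp mpsi (@measurable_snd _ _ _ _)).
  apply: (measurableT_comp mk).
  by apply: measurable_fun_pair; [exact: measurable_snd|exact: measurable_fst].
transitivity (\int[m]_z (c z * G z)).
  apply: eq_Rintegral => z _; rewrite /G -RintegralZl //.
  by apply: eq_Rintegral => x _; rewrite mulrA.
have mcG : measurable_fun setT (fun z => c z * G z) by exact: measurable_funM.
have ncG : (\int[nu]_y \int[leb]_t `|c (y, t) * G (y, t)|%:E < +oo)%E.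
  have ma : measurable_fun setT (fun z => `|c z * G z|%:E).
    by apply/measurable_EFinP; exact: measurableT_comp.
  have a0 (z : T) : (0 <= `|c z * G z|%:E)%E by rewrite lee_fin.
  rewrite -[X in (X < _)%E](@fubini_tonelli1 _ _ _ _ _ nu leb _ ma a0).
  have i : m.-integrable setT (EFin \o (fun z => c z * G z)).
    apply: (integrable_le (g := fun z => c z * B)) => //; first exact: integrable_mulr.
    by move=> z; rewrite normrM (ger0_norm (c0 z)) ler_wpM2l.
  by have /integrableP[] := i.
rewrite (Rintegral_prod mcG ncG); apply: eq_Rintegral => y _.
have ie : leb.-integrable setT (EFin \o expw L).
  apply/integrableP; split; first by apply/measurable_EFinP; exact: measurable_expw.
  under eq_integral do rewrite /= ger0_norm ?expw_ge0 //.
  by rewrite (integral_expw L0) ltry.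
rewrite -RintegralZl //.
  by apply: eq_Rintegral => t _; rewrite /c /G /k /= mulrA.
apply: (@integrable_le _ _ R leb (fun t => expw L t * G (y, t)) (fun t => expw L t * B)).
- apply: measurable_funM; first exact: measurable_expw.
  exact: (measurableT_comp mG (pair1_measurable (y : mR3 R))).
- exact: integrable_mulr.
- by move=> t; rewrite normrM (ger0_norm (expw_ge0 _ _)) ler_wpM2l ?expw_ge0 //; exact: (Gle (y, t)).
Qed.

End Potential.

(** * The Poisson equation *)

Lemma integrable_subr d (T : measurableType d) (R : realType) (m : {measure set T -> \bar R})
    (f g : T -> R) : m.-integrable setT (EFin \o f) ->
  m.-integrable setT (EFin \o g) -> m.-integrable setT (EFin \o (fun x => f x - g x)).
Proof. exact: (integrableB measurableT). Qed.

Lemma integrable_mull d (T : measurableType d) (R : realType) (m : {measure set T -> \bar R})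
    (c : R) (f : T -> R) : m.-integrable setT (EFin \o f) ->
  m.-integrable setT (EFin \o (fun x => c * f x)).
Proof. exact: (integrableZl measurableT). Qed.

Lemma sum_ord3 (R : realType) (F : 'I_3 -> R) :
  \sum_(i < 3) F i = F (@Ordinal 3 0 isT) + F (@Ordinal 3 1 isT) + F (@Ordinal 3 2 isT).
Proof.
rewrite !big_ord_recl big_ord0 addr0 addrA; congr (F _ + F _ + F _); exact: val_inj.
Qed.

(** * The resolvent inverts L - Delta on test functions *)

Section HeatResolvent.
Context {R : realType}.
Variables (L : R) (phi : R3 R -> R).
Hypothesis L0 : 0 < L.
Hypothesis tphi : test_function phi.

Let leb : {sigma_finite_measure set (measurableTypeR R) -> \bar R} := lebesgue_measure.

Let mphi : measurable_fun [set: mR3 R] phi.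
Proof. exact: continuous_measurable3 (test_function_continuous tphi). Qed.

Lemma laplacian_bounded : measurable_fun [set: mR3 R] (laplacian phi) /\
  exists2 B, 0 <= B & forall x, `|laplacian phi x| <= B.
Proof.
have t2 i : test_function ('D_(basis3 i) ('D_(basis3 i) phi)).
  by apply: (proj2 (test_function_derive _ _)); exact: (proj2 (test_function_derive _ _)).
split.
  apply: measurable_sum => i; exact: continuous_measurable3 (test_function_continuous (t2 i)).
have H i : exists B, 0 <= B /\ forall x, `|'D_(basis3 i) ('D_(basis3 i) phi) x| <= B.
  by have [B B0 hB] := test_function_bounded (t2 i); exists B.
have [B hB] := boolp.choice H.
exists (\sum_i B i); first by apply: sumr_ge0 => i _; have [] := hB i.
move=> x; apply: le_trans (ler_norm_sum _ _ _) _; apply: ler_sum => i _.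
by have [_] := hB i.
Qed.

Let coord_lip : exists2 M, 0 <= M & forall i (x : R3 R) (h : R), `|phi (x + h *: basis3 i) - phi x| <= M * `|h|.
Proof.
have t1 i : test_function ('D_(basis3 i) phi) by exact: (proj2 (test_function_derive _ _)).
have H i : exists B, 0 <= B /\ forall x, `|'D_(basis3 i) phi x| <= B.
  by have [B B0 hB] := test_function_bounded (t1 i); exists B.
have [B hB] := boolp.choice H.
have B0 i : 0 <= B i by have [] := hB i.
exists (\sum_i B i); first by apply: sumr_ge0.
have Bi i : B i <= \sum_i B i by rewrite (bigD1 i) //= lerDl; apply: sumr_ge0.
have pos i (x : R3 R) (h : R) : 0 <= h -> `|phi (x + h *: basis3 i) - phi x| <= (\sum_i B i) * h.
  move=> h0; apply: (@le_trans _ _ (B i * h)); last exact: ler_wpM2r.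
  have := @le_mean_value R (fun k => phi (x + k *: basis3 i)) (fun k => 'D_(basis3 i) phi (x + k *: basis3 i)) (B i) h h0.
  rewrite scale0r addr0; apply => y _; last by have [_] := hB i.
  by apply: is_derive_line; have [+ _] := test_function_derive (basis3 i) tphi.
move=> i x h; have [h0|/ltW h0] := leP 0 h; first by rewrite (ger0_norm h0); exact: pos.
rewrite (ler0_norm h0) distrC.
have := pos i (x + h *: basis3 i) (- h); rewrite oppr_ge0 => /(_ h0).
by rewrite scaleNr addrK.
Qed.

(** Pass from y to x by changing one coordinate at a time. *)
Let lip : exists2 M, 0 <= M & forall x y : R3 R,
  `|phi x - phi y| <= M * (`|(x - y).1.1| + `|(x - y).1.2| + `|(x - y).2|).
Proof.
have [M M0 hM] := coord_lip; exists M => // x y.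
pose i0 : 'I_3 := @Ordinal 3 0 isT; pose i1 : 'I_3 := @Ordinal 3 1 isT; pose i2 : 'I_3 := @Ordinal 3 2 isT.
set d := x - y.
pose y1 := y + d.1.1 *: basis3 i0; pose y2 := y1 + d.1.2 *: basis3 i1; pose y3 := y2 + d.2 *: basis3 i2.
have -> : x = y3.
  rewrite /y3 /y2 /y1 /d /basis3; case: x y {d y1 y2 y3} => [[x1 x2] x3] [[z1 z2] z3].
  by congr (_, _, _) => /=; rewrite -[LHS]/(_ : R) /GRing.scale /=; ring.
have := hM i0 y d.1.1; have := hM i1 y1 d.1.2; have := hM i2 y2 d.2; rewrite -/y1 -/y2 -/y3.
move=> h1 h2 h3; have -> : phi y3 - phi y = (phi y3 - phi y2) + (phi y2 - phi y1) + (phi y1 - phi y) by ring.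
apply: le_trans (ler_normD _ _) _; apply: le_trans (lerD (ler_normD _ _) (lexx _)) _.
by rewrite !mulrDr; lra.
Qed.

Let mheat (t : R) (y : R3 R) : measurable_fun [set: mR3 R] (fun x => heat t ((x : R3 R) - y)).
Proof.
apply: measurable_heat; first exact: measurable_cst.
by apply: measurable_sub3; [exact: measurable_id|exact: measurable_cst].
Qed.

Let iheat (t : R) (y : R3 R) : leb3.-integrable [set: mR3 R] (EFin \o (fun x => heat t ((x : R3 R) - y))).
Proof.
apply/integrableP; split; first by apply/measurable_EFinP; exact: mheat.
under eq_integral do rewrite /= ger0_norm ?heat_ge0 //.
have [t0|t0] := leP t 0; last by rewrite integral_heat // ltry.
by rewrite integral0_eq ?ltry // => x _; rewrite heat_le0.
Qed.

Let iheatM (t : R) (y : R3 R) (psi : R3 R -> R) (B : R) : measurable_fun [set: mR3 R] psi ->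
  (forall x, `|psi x| <= B) ->
  leb3.-integrable [set: mR3 R] (EFin \o (fun x => heat t ((x : R3 R) - y) * psi x)).
Proof.
move=> mp hp; apply: (@integrable_le _ (mR3 R) R leb3 _ (fun x => heat t ((x : R3 R) - y) * B)).
- by apply: measurable_funM.
- exact: integrable_mulr.
- by move=> x; rewrite normrM (ger0_norm (heat_ge0 _ _)) ler_wpM2l ?heat_ge0.
Qed.

Let heat_avg (t : R) (y : R3 R) (psi : R3 R -> R) (B : R) : measurable_fun [set: mR3 R] psi ->
  (forall x, `|psi x| <= B) ->
  `|\int[leb3]_(x in [set: mR3 R]) (heat t ((x : R3 R) - y) * psi x)| <= B.
Proof.
move=> mp hp; have i := iheatM t y mp hp.
have B0 : 0 <= B by exact: le_trans (hp 0).
apply: le_trans (le_normr_Rintegral measurableT i) _.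
apply: (@le_trans _ _ (\int[leb3]_(x in [set: mR3 R]) (heat t ((x : R3 R) - y) * B))).
  apply: le_Rintegral => //; [exact: (integrable_norm i)|exact: integrable_mulr|].
  by move=> x _; rewrite /= normrM (ger0_norm (heat_ge0 _ _)) ler_wpM2l ?heat_ge0.
rewrite RintegralZr // -[leRHS]mul1r ler_wpM2r //.
have [t0|t0] := leP t 0; last by rewrite /Rintegral integral_heat.
by rewrite /Rintegral integral0_eq // => x _; rewrite heat_le0.
Qed.

(** The Lipschitz bound leaves the first moments of p_t in the three coordinates. Each is at most 6
    sqrt t by [abs_mul_heat_le], which gives 18; the rate makes the limit s -> 0 in [heat_resolvent]
    quantitative. *)
Lemma heat_approximate_identity (y : R3 R) : exists2 C, 0 <= C & forall t, 0 < t ->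
  `|\int[leb3]_(x in [set: mR3 R]) (heat t ((x : R3 R) - y) * phi x) - phi y| <= C * Num.sqrt t.
Proof.
have [M M0 hM] := lip; exists (M * 18); first exact: mulr_ge0.
move=> t t0; have [B B0 hB] := test_function_bounded tphi.
have E : phi y = \int[leb3]_(x in [set: mR3 R]) (heat t ((x : R3 R) - y) * phi y).
  by rewrite RintegralZr // /Rintegral integral_heat // mul1r.
have ic : leb3.-integrable [set: mR3 R] (EFin \o (fun x => heat t ((x : R3 R) - y) * phi y)).
  exact: integrable_mulr.
have ip := iheatM t y mphi hB.
rewrite [X in `|_ - X|]E -RintegralB //.
have mB : measurable_fun [set: mR3 R] (fun x => heat t ((x : R3 R) - y) * phi x - heat t ((x : R3 R) - y) * phi y).
  by apply: measurable_funB; apply: measurable_funM.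
have i2 : leb3.-integrable [set: mR3 R] (EFin \o (fun x => heat (2 * t) ((x : R3 R) - y) * (M * 18 * Num.sqrt t))).
  exact: integrable_mulr.
have le x : `|heat t (x - y) * phi x - heat t (x - y) * phi y| <= heat (2 * t) (x - y) * (M * 18 * Num.sqrt t).
  rewrite -mulrBr normrM (ger0_norm (heat_ge0 _ _)).
  apply: le_trans (ler_wpM2l (heat_ge0 _ _) (hM x y)) _.
  have sq := sqnormE (x - y).
  have p1 := sqr_ge0 (x - y).1.1; have p2 := sqr_ge0 (x - y).1.2; have p3 := sqr_ge0 (x - y).2.
  have h1 := @abs_mul_heat_le R t (x - y).1.1 (x - y) t0 _.
  have h2 := @abs_mul_heat_le R t (x - y).1.2 (x - y) t0 _.
  have h3 := @abs_mul_heat_le R t (x - y).2 (x - y) t0 _.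
  have {}h1 : `|(x - y).1.1| * heat t (x - y) <= 6 * Num.sqrt t * heat (2 * t) (x - y) by apply: h1; lra.
  have {}h2 : `|(x - y).1.2| * heat t (x - y) <= 6 * Num.sqrt t * heat (2 * t) (x - y) by apply: h2; lra.
  have {}h3 : `|(x - y).2| * heat t (x - y) <= 6 * Num.sqrt t * heat (2 * t) (x - y) by apply: h3; lra.
  have := ler_wpM2l M0 (lerD (lerD h1 h2) h3).
  by move: (heat t (x - y)) (heat (2 * t) (x - y)) (Num.sqrt t) => u v w; lra.
have iB : leb3.-integrable [set: mR3 R] (EFin \o (fun x => heat t ((x : R3 R) - y) * phi x - heat t ((x : R3 R) - y) * phi y)).
  exact: (@integrable_le _ (mR3 R) R leb3 _ (fun x => heat (2 * t) ((x : R3 R) - y) * (M * 18 * Num.sqrt t)) mB i2 le).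
apply: le_trans (le_normr_Rintegral measurableT iB) _.
apply: (@le_trans _ _ (\int[leb3]_(x in [set: mR3 R]) (heat (2 * t) ((x : R3 R) - y) * (M * 18 * Num.sqrt t)))).
  by apply: le_Rintegral => //; exact: (integrable_norm iB).
by rewrite RintegralZr // /Rintegral integral_heat ?mulr_gt0 // mul1r.
Qed.

Let is_derive_shift (f : R3 R -> R) (x y e : R3 R) (D : R) :
  is_derive (x - y) e f D -> is_derive x e (fun x => f (x - y)) D.
Proof.
move=> [d1 d2]; apply: is_derive_of_line.
have e0 : (x - y) + 0 *: e = x - y by rewrite scale0r addr0.
have d1' : derivable f ((x - y) + 0 *: e) e by rewrite e0.
have := is_derive_line d1'; rewrite e0 d2; congr is_derive.
by apply/funext => h; rewrite addrAC.
Qed.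

Let support_bounded (y : R3 R) : exists2 N, 0 <= N & forall x, closure [set y | phi y != 0] x ->
  sqnorm (x - y) <= N.
Proof.
have [N N0 hN] := test_function_support tphi.
exists (3 * (N + `|y|) ^+ 2); first by rewrite mulr_ge0 ?sqr_ge0.
move=> x /hN xN; have h : `|x - y| <= N + `|y| by apply: le_trans (ler_normB _ _) _; rewrite lerD2r.
have H (a : R) : `|a| <= `|x - y| -> a ^+ 2 <= (N + `|y|) ^+ 2.
  move=> /le_trans/(_ h) aN; rewrite -real_normK ?num_real //.
  by apply: lerXn2r => //; rewrite nnegrE // addr_ge0.
have nm : `|x - y| = Num.max (Num.max `|(x - y).1.1| `|(x - y).1.2|) `|(x - y).2| by [].
have := H (x - y).1.1; have := H (x - y).1.2; have := H (x - y).2; rewrite nm !le_max !lexx !orbT /=.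
move=> /(_ isT) h1 /(_ isT) h2 /(_ isT) h3; rewrite sqnormE; lra.
Qed.

Let mdot (i : 'I_3) (y : R3 R) : measurable_fun [set: mR3 R] (fun x => dot3 ((x : R3 R) - y) (basis3 i)).
Proof.
rewrite (_ : (fun x => _) = (fun x => coord3 i ((x : R3 R) - y))); last first.
  by apply/funext => p; rewrite dot3_basis3.
have ms : measurable_fun [set: mR3 R] (fun x => ((x : R3 R) - y)%R : mR3 R).
  by apply: measurable_sub3; [exact: measurable_id|exact: measurable_cst].
have [m1 m2 m3] := measurable_coords ms.
by case: i => -[|[|[|//]]] ? /=.
Qed.

(** Two integrations by parts. The second derivative of the kernel carries a quadratic polynomial,
    which is estimated only on the support of [phi]. *)
Let heat_second (i : 'I_3) (t : R) (y : R3 R) : 0 < t ->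
  [/\ leb3.-integrable [set: mR3 R] (EFin \o (fun x => heat t ((x : R3 R) - y) * 'D_(basis3 i) ('D_(basis3 i) phi) x)),
   leb3.-integrable [set: mR3 R] (EFin \o (fun x => ((dot3 ((x : R3 R) - y) (basis3 i) / (2 * t)) ^+ 2 - 1 / (2 * t)) * heat t ((x : R3 R) - y) * phi x)) &
  \int[leb3]_(x in [set: mR3 R]) (heat t ((x : R3 R) - y) * 'D_(basis3 i) ('D_(basis3 i) phi) x) =
  \int[leb3]_(x in [set: mR3 R]) (((dot3 ((x : R3 R) - y) (basis3 i) / (2 * t)) ^+ 2 - 1 / (2 * t)) * heat t ((x : R3 R) - y) * phi x)].
Proof.
move=> t0; set e := basis3 i.
have [d1 t1] := test_function_derive e tphi.
pose u1 (x : R3 R) := heat t (x - y).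
pose u2 (x : R3 R) := - dot3 (x - y) e / (2 * t) * heat t (x - y).
pose u3 (x : R3 R) := ((dot3 (x - y) e / (2 * t)) ^+ 2 - 1 / (2 * t)) * heat t (x - y).
have D1 x : is_derive x e u1 (u2 x) by apply: is_derive_shift; exact: is_derive_heat.
have D2 x : is_derive x e u2 (u3 x).
  have := @is_derive_shift (fun x => - dot3 x e / (2 * t) * heat t x) x y e _ (is_derive_heat2 t (x - y) e).
  by rewrite /e sqnorm_basis3.
have E1 : 'D_e u1 = u2 by apply/funext => x; have [_ ->] := D1 x.
have E2 : 'D_e u2 = u3 by apply/funext => x; have [_ ->] := D2 x.
have m2 : measurable_fun [set: mR3 R] u2.
  apply: measurable_funM; last exact: mheat.
  by apply: measurable_funM => //; apply: measurable_funN; exact: mdot.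
have m3 : measurable_fun [set: mR3 R] u3.
  apply: measurable_funM; last exact: mheat.
  apply: measurable_funB => //; apply: measurable_funX.
  by apply: measurable_funM => //; exact: mdot.
pose H1 := (Num.sqrt (4 * pi * t))^-1 ^+ 3; pose H2 := (Num.sqrt (4 * pi * (2 * t)))^-1 ^+ 3.
have H10 : 0 <= H1 by rewrite exprn_ge0 // invr_ge0 sqrtr_ge0.
have H20 : 0 <= H2 by rewrite exprn_ge0 // invr_ge0 sqrtr_ge0.
have b1 x : `|u1 x| <= H1 by rewrite ger0_norm ?heat_ge0 //; exact: heat_le.
have q0 : 0 <= 3 * (Num.sqrt t)^-1 by rewrite mulr_ge0 ?invr_ge0 ?sqrtr_ge0.
have b2 x : `|u2 x| <= 3 * (Num.sqrt t)^-1 * H2.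
  have [_ E] := is_derive_heat t (x - y) e.
  have := derive_heat_le t i (x - y); rewrite -/e E => /le_trans; apply.
  by rewrite ler_wpM2l //; exact: heat_le.
have [N N0 hN] := support_bounded y.
pose K := N / (2 * t) ^+ 2 + 1 / (2 * t).
have t20 : 0 <= 1 / (2 * t) by rewrite divr_ge0 // mulr_ge0 // ltW.
have K0 : 0 <= K by rewrite addr_ge0 // divr_ge0 ?sqr_ge0.
have b3 x : closure [set y | phi y != 0] x -> `|u3 x| <= K * H1.
  move=> /hN xN; rewrite normrM (ger0_norm (heat_ge0 _ _)); apply: ler_pM; rewrite ?heat_ge0 //; last exact: heat_le.
  apply: le_trans (ler_normB _ _) _; rewrite (ger0_norm t20) ger0_norm ?sqr_ge0 // lerD2r.
  rewrite exprMn exprVn ler_wpM2r ?invr_ge0 ?sqr_ge0 // dot3_basis3.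
  exact: le_trans (coord3_sqr_le _ _) xN.
pose M := H1 + 3 * (Num.sqrt t)^-1 * H2 + K * H1.
have p1 : 0 <= 3 * (Num.sqrt t)^-1 * H2 by exact: mulr_ge0.
have p2 : 0 <= K * H1 by exact: mulr_ge0.
have B1 x : closure [set y | 'D_e phi y != 0] x -> `|u1 x| <= M /\ `|'D_e u1 x| <= M.
  by move=> _; have [_ ->] := D1 x; split; [have := b1 x|have := b2 x]; rewrite /M; lra.
have B2 x : closure [set y | phi y != 0] x -> `|u2 x| <= M /\ `|'D_e u2 x| <= M.
  by move=> cx; have [_ ->] := D2 x; split; [have := b2 x|have := b3 x cx]; rewrite /M; lra.
have [I1 _ F1] := @weak_derive3 R e u1 M _ t1 (mheat t y) (eq_ind_r _ m2 E1) (fun x => @ex_derive _ _ _ _ _ _ _ (D1 x)) B1.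
have [_ I2 F2] := @weak_derive3 R e u2 M _ tphi m2 (eq_ind_r _ m3 E2) (fun x => @ex_derive _ _ _ _ _ _ _ (D2 x)) B2.
split; first exact: I1.
  by move: I2; rewrite (_ : (fun x => 'D_e u2 x * phi x) = (fun x => u3 x * phi x)) //; apply/funext => x; have [_ ->] := D2 x.
rewrite F1; transitivity (- \int[leb3]_(x in [set: mR3 R]) (u2 x * 'D_e phi x)).
    by congr (- _); apply: eq_Rintegral => x _; have [_ ->] := D1 x.
  rewrite F2 opprK; apply: eq_Rintegral => x _; by have [_ ->] := D2 x.
Qed.

Lemma heat_laplacian (t : R) (y : R3 R) : 0 < t ->
  [/\ leb3.-integrable [set: mR3 R] (EFin \o (fun x => heat t ((x : R3 R) - y) * laplacian phi x)),
  leb3.-integrable [set: mR3 R] (EFin \o (fun x => (sqnorm ((x : R3 R) - y) / (4 * t ^+ 2) - 3 / (2 * t)) * heat t ((x : R3 R) - y) * phi x)) &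
  \int[leb3]_(x in [set: mR3 R]) (heat t ((x : R3 R) - y) * laplacian phi x) =
  \int[leb3]_(x in [set: mR3 R]) ((sqnorm ((x : R3 R) - y) / (4 * t ^+ 2) - 3 / (2 * t)) * heat t ((x : R3 R) - y) * phi x)].
Proof.
move=> t0.
set i0 : 'I_3 := @Ordinal 3 0 isT; set i1 : 'I_3 := @Ordinal 3 1 isT; set i2 : 'I_3 := @Ordinal 3 2 isT.
have [a1 b1 c1] := heat_second i0 y t0.
have [a2 b2 c2] := heat_second i1 y t0.
have [a3 b3 c3] := heat_second i2 y t0.
have E1 (x : R3 R) : heat t (x - y) * laplacian phi x = heat t (x - y) * 'D_(basis3 i0) ('D_(basis3 i0) phi) x +
    heat t (x - y) * 'D_(basis3 i1) ('D_(basis3 i1) phi) x + heat t (x - y) * 'D_(basis3 i2) ('D_(basis3 i2) phi) x.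
  by rewrite /laplacian sum_ord3 !mulrDr.
have t2 : t != 0 by rewrite gt_eqF.
have E2 (x : R3 R) : (sqnorm (x - y) / (4 * t ^+ 2) - 3 / (2 * t)) * heat t (x - y) * phi x =
  ((dot3 (x - y) (basis3 i0) / (2 * t)) ^+ 2 - 1 / (2 * t)) * heat t (x - y) * phi x +
  ((dot3 (x - y) (basis3 i1) / (2 * t)) ^+ 2 - 1 / (2 * t)) * heat t (x - y) * phi x +
  ((dot3 (x - y) (basis3 i2) / (2 * t)) ^+ 2 - 1 / (2 * t)) * heat t (x - y) * phi x.
  rewrite -!mulrDl; congr (_ * _ * _); rewrite !dot3_basis3 sqnormE /coord3 /=.
  by field.
have I1 := integrable_addr (integrable_addr a1 a2) a3.
have I2 := integrable_addr (integrable_addr b1 b2) b3.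
have F1 := funext E1; have F2 := funext E2.
split.
- by move: I1; rewrite -F1.
- by move: I2; rewrite -F2.
etransitivity; first by apply: eq_Rintegral => x _; exact: E1.
etransitivity; last by apply/esym; apply: eq_Rintegral => x _; exact: E2.
rewrite (RintegralD measurableT (integrable_addr a1 a2) a3) (RintegralD measurableT a1 a2).
rewrite (RintegralD measurableT (integrable_addr b1 b2) b3) (RintegralD measurableT b1 b2).
exact: (congr2 +%R (congr2 +%R c1 c2) c3).
Qed.

Let psi (x : R3 R) : R := L * phi x - laplacian phi x.

Let psi_bounded : measurable_fun [set: mR3 R] psi /\ exists2 B, 0 <= B & forall x, `|psi x| <= B.
Proof.
have [ml [B1 B10 h1]] := laplacian_bounded; have [B2 B20 h2] := test_function_bounded tphi.
split; first by apply: measurable_funB => //; exact: measurable_funM.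
exists (L * B2 + B1); first by rewrite addr_ge0 // mulr_ge0 // ltW.
move=> x; apply: le_trans (ler_normB _ _) _; apply: lerD => //.
by rewrite normrM (gtr0_norm L0) ler_wpM2l // ltW.
Qed.

(** By the heat equation this is exp(-Lt) (L - Delta) p_t(x - y), the time derivative of - exp(-Lt)
    p_t(x - y). *)
Let flow (y : R3 R) (t : R) (x : R3 R) : R :=
  expR (- L * t) * ((L - (sqnorm (x - y) / (4 * t ^+ 2) - 3 / (2 * t))) * heat t (x - y)).

Let is_derive_flow (y x : R3 R) (t : R) : 0 < t ->
  is_derive t 1 (fun t => - expR (- L * t) * heat t (x - y)) (flow y t x).
Proof.
move=> t0.
have E : is_derive t 1 (fun t : R => - expR (- L * t)) (L * expR (- L * t)).
  have := @is_derive1_comp R expR (fun t => - L * t) t (expR (- L * t)) (- L) (is_derive_expR _).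
  have I : is_derive t 1 (fun t : R => - L * t) (- L).
    by apply: (is_derive_eq (is_derive_scale (- L) (is_derive_id t 1))); rewrite mulr1.
  move=> /(_ I) H; have H' := is_derive_scale (-1) H.
  have -> : (fun t : R => - expR (- L * t)) = (fun t : R => -1 * (expR \o (fun t => - L * t)) t).
    by apply/funext => u; rewrite mulN1r.
  by apply: (is_derive_eq H'); ring.
have H := is_derive_mul E (is_derive_heat_time (x - y) t0).
apply: (is_derive_eq H); rewrite /flow.
by move: (expR _) (heat t (x - y)) (sqnorm _ / _ - _) => u v w; ring.
Qed.

Let flow_continuous (y x : R3 R) (t : R) : 0 < t -> {for t, continuous (fun t => flow y t x)}.
Proof.
move=> t0.
have cid : {for t, continuous (fun t : R => t)} by exact: cvg_id.
have cc (u : R) : {for t, continuous (fun _ : R => u)} by exact: cst_continuous.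
apply: continuousM.
  apply: (@continuous_comp _ _ _ (fun t : R => - L * t) expR); last exact: continuous_expR.
  exact: continuousM.
apply: continuousM; last first.
  have [d _] := is_derive_heat_time (x - y) t0.
  by apply: differentiable_continuous; apply/derivable1_diffP.
apply: continuousB => //; apply: continuousB; apply: continuousM => //.
  apply: continuousV; first by rewrite mulf_neq0 // ?gt_eqF // exprn_gt0.
  by apply: continuousM => //; exact: exprn_continuous.
apply: continuousV; first by rewrite mulf_neq0 // ?gt_eqF.
exact: continuousM.
Qed.

Let mflow (y : R3 R) : measurable_fun [set: measurableTypeR R * mR3 R] (fun p => flow y p.1 p.2).
Proof.
have mt : measurable_fun [set: measurableTypeR R * mR3 R] (fun p => p.1 : R) by exact: measurable_fst.
have ms : measurable_fun [set: measurableTypeR R * mR3 R] (fun p => ((p.2 : R3 R) - y)%R : mR3 R).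
  by apply: measurable_sub3; [exact: measurable_snd|exact: measurable_cst].
apply: measurable_funM.
  by apply: (measurableT_comp (@measurable_expR R)); exact: measurable_funM.
apply: measurable_funM; last exact: measurable_heat.
apply: measurable_funB => //; apply: measurable_funB; apply: measurable_funM => //.
- exact: measurable_sqnorm.
- apply: (measurableT_comp measurable_invr); apply: measurable_funM => //.
  exact: measurable_funX.
- by apply: (measurableT_comp measurable_invr); exact: measurable_funM.
Qed.

Let avg (y : R3 R) (t : R) : R := \int[leb3]_(x in [set: mR3 R]) (heat t ((x : R3 R) - y) * phi x).

(** Move L - Delta from [phi] to the kernel by [heat_laplacian], exchange the integrals over x and
    t, and integrate the exact time derivative. For t >= s > 0 and x in the support of [phi] the
    integrand is bounded, so Fubini's theorem applies. *)
Let heat_flow (y : R3 R) (s r : R) : 0 < s -> s < r ->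
  \int[leb]_t (\1_(`[s, r]%classic : set (measurableTypeR R)) t *
     (expw L t * \int[leb3]_(x in [set: mR3 R]) (heat t ((x : R3 R) - y) * psi x))) =
  expR (- L * s) * avg y s - expR (- L * r) * avg y r.
Proof.
move=> s0 sr; pose I : set (measurableTypeR R) := `[s, r]%classic.
have mI : measurable I by exact: measurable_itv.
have tI t : t \in I -> 0 < t /\ s <= t <= r.
  by rewrite inE /I /= in_itv/= => h; split => //; case/andP: h => /(lt_le_trans s0).
have [B B0 hB] := test_function_bounded tphi.
pose f (p : measurableTypeR R * mR3 R) : R := \1_I p.1 * flow y p.1 p.2 * phi p.2.
have mf : measurable_fun setT f.
  apply: measurable_funM; last exact: (measurableT_comp mphi (@measurable_snd _ _ _ _)).
  apply: measurable_funM; last exact: mflow.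
  apply: (@measurableT_comp _ _ _ _ _ _ (\1_I : measurableTypeR R -> R) _ fst); last exact: measurable_fst.
  exact: measurable_indic.
have [N N0 hN] := support_bounded y.
have [N' N'0 hN'] := test_function_support tphi.
have [S [mS S1 hS]] := leb3_bounded_set N'.
pose C : R := (L + (N / (4 * s ^+ 2) + 3 / (2 * s))) * (Num.sqrt s)^-1 ^+ 3 * B.
have C0 : 0 <= C.
  have p1 : 0 <= N / (4 * s ^+ 2) by rewrite divr_ge0 // mulr_ge0 // sqr_ge0.
  have p2 : 0 <= 3 / (2 * s) by rewrite divr_ge0 // mulr_ge0 // ltW.
  apply: mulr_ge0 => //; apply: mulr_ge0; first by rewrite addr_ge0 ?addr_ge0 // ltW.
  by rewrite exprn_ge0 // invr_ge0 sqrtr_ge0.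
have fle p : `|f p| <= C * \1_I p.1 * \1_S p.2.
  case: p => t x; rewrite /f /= (normrM (\1_I t * flow y t x)) (normrM (\1_I t)).
  have [p0|p0] := eqVneq (phi x) 0.
    by rewrite p0 normr0 mulr0 mulr_ge0 ?indicE ?ler0n // mulr_ge0.
  have cx : closure [set y | phi y != 0] x by exact: subset_closure.
  rewrite !indicE (mem_set (hS _ (hN' _ cx))) mulr1.
  have [/tI[t0 /andP[st tr]]|_] := boolP (t \in I); last by rewrite normr0 !mul0r mulr0.
  rewrite normr1 mul1r mulr1; apply: (ler_pM _ _ _ (hB x)) => //; rewrite /flow.
  rewrite normrM (ger0_norm (expR_ge0 _)) normrM (ger0_norm (heat_ge0 _ _)) -[leRHS]mul1r.
  apply: ler_pM; first exact: expR_ge0.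
    by rewrite mulr_ge0 ?heat_ge0.
    by rewrite -expR0 ler_expR mulNr oppr_le0 mulr_ge0 // ltW.
  apply: ler_pM; [exact: normr_ge0|exact: heat_ge0| |].
    apply: le_trans (ler_normB _ _) _; rewrite (gtr0_norm L0) lerD2l.
    apply: le_trans (ler_normB _ _) _; apply: lerD.
      have t4 : 0 < 4 * t ^+ 2 by rewrite mulr_gt0 // exprn_gt0.
      have s4 : 0 < 4 * s ^+ 2 by rewrite mulr_gt0 // exprn_gt0.
      rewrite ger0_norm; last by rewrite divr_ge0 ?sqnorm_ge0 // (ltW t4).
      apply: ler_pM; [exact: sqnorm_ge0|by rewrite invr_ge0 (ltW t4)|exact: hN|].
      rewrite lef_pV2 ?posrE // ler_wpM2l //.
      by apply: lerXn2r => //; rewrite nnegrE ltW.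
    rewrite ger0_norm; last by rewrite divr_ge0 // mulr_ge0 // ltW.
    by rewrite ler_wpM2l // lef_pV2 ?posrE ?mulr_gt0 // ler_wpM2l.
  apply: le_trans (heat_le _ _) _; apply: lerXn2r; rewrite ?nnegrE ?invr_ge0 ?sqrtr_ge0 //.
  apply: le_trans (heat_constant_le t0) _.
  by rewrite lef_pV2 ?posrE ?sqrtr_gt0 // ler_wsqrtr.
have fin : (\int[leb]_t \int[leb3]_(x in [set: mR3 R]) `|f (t, x)|%:E < +oo)%E.
  have I1 : (leb I < +oo)%E.
    have -> : leb I = (if (s%:E < r%:E)%E then r%:E - s%:E else 0)%E by exact: (lebesgue_measure_itv `[s, r]).
    by case: ifP => _; rewrite ltry.
  have ma : measurable_fun setT (fun p => `|f p|%:E) by apply/measurable_EFinP; exact: measurableT_comp.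
  have a0 p : (0 <= `|f p|%:E)%E by rewrite lee_fin.
  have mS' : measurable_fun [set: mR3 R] (fun x => (\1_S x : R)%:E).
    by apply/measurable_EFinP; exact: measurable_indic.
  have Sf : leb3 S \is a fin_num by rewrite ge0_fin_numE.
  have iC := integrable_mulr (C * fine (leb3 S)) (integrable_indic_lty mI I1).
  have /integrableP[mC] := iC; apply: le_lt_trans.
  apply: (@ge0_le_integral _ _ _ leb setT measurableT).
  - by move=> t _; apply: integral_ge0.
  - exact: (@measurable_fun_fubini_tonelli_F _ _ _ _ _ leb3 _ ma a0).
  - by apply: measurableT_comp.
  move=> t _; apply: (@le_trans _ _ (\int[leb3]_(x in [set: mR3 R]) ((C * \1_I t)%:E * (\1_S x)%:E))%E).
    apply: (@ge0_le_integral _ _ _ leb3 setT measurableT).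
    - by [].
    - exact: (measurableT_comp ma (pair1_measurable t)).
    - exact: measurable_funeM.
    - by move=> x _; rewrite -EFinM lee_fin; exact: (fle (t, x)).
  have Ct : 0 <= C * \1_I t by rewrite mulr_ge0 // indicE.
  rewrite ge0_integralZl_EFin //.
  have -> : (\int[leb3]_(x in [set: mR3 R]) (\1_S x)%:E = (fine (leb3 S))%:E)%E.
    by rewrite fineK //; etransitivity; [exact: integral_indic|rewrite setIT].
  by rewrite -EFinM /= lee_fin; apply: le_trans (ler_norm _); rewrite mulrAC mulrC.
have H := Rintegral_swap mf fin.
transitivity (\int[leb]_t \int[leb3]_(x in [set: mR3 R]) f (t, x)).
  apply: eq_Rintegral => t _; rewrite /f /= indicE.
  have [/tI[t0 _]|_] := boolP (t \in I); last first.
    rewrite mul0r /Rintegral integral0_eq // => x _; by rewrite mul0r mul0r.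
  have [i1 i2 e] := heat_laplacian y t0.
  have ip := iheatM t y mphi hB.
  rewrite mul1r /expw t0.
  transitivity (expR (- L * t) * (L * avg y t - \int[leb3]_(x in [set: mR3 R]) (heat t ((x : R3 R) - y) * laplacian phi x))).
    congr (_ * _); rewrite /avg -RintegralZl // -RintegralB //; last first.
      exact: integrable_mull.
    by apply: eq_Rintegral => x _; rewrite /psi mulrBr mulrCA.
  rewrite e /avg -(RintegralZl L measurableT ip) -RintegralB //; last first.
    exact: integrable_mull.
  rewrite -RintegralZl //; last first.
    exact: (integrable_subr (integrable_mull L ip) i2).
  by apply: eq_Rintegral => x _; rewrite /flow mulr1n mul1r; ring.
rewrite H.
transitivity (\int[leb3]_(x in [set: mR3 R]) (expR (- L * s) * (heat s ((x : R3 R) - y) * phi x) -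
    expR (- L * r) * (heat r ((x : R3 R) - y) * phi x))).
  apply: eq_Rintegral => x _; rewrite /f /=.
  transitivity (phi x * \int[leb]_(t in `[s, r]) flow y t x).
    rewrite Rintegral_mkcond -RintegralZl //.
      apply: eq_Rintegral => t _; rewrite patchE indicE /I.
      by case: (t \in _); rewrite ?mul1r ?mul0r ?mulr0 // mulrC.
    rewrite -restrict_EFin; apply: (iffLR (integrable_mkcond _ mI)).
    apply: continuous_compact_integrable; first exact: segment_compact.
    apply: continuous_in_subspaceT => t /tI[t0 _]; exact: flow_continuous.
  pose Phi (t : R) := - expR (- L * t) * heat t (x - y).
  have dPhi (t : R) : s <= t <= r -> is_derive t 1 Phi (flow y t x).
    by move=> /andP[st _]; apply: is_derive_flow; exact: lt_le_trans st.
  have cPhi (t : R) : s <= t <= r -> {for t, continuous (fun t => flow y t x)}.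
    by move=> /andP[st _]; apply: flow_continuous; exact: lt_le_trans st.
  have -> : \int[leb]_(t in `[s, r]) flow y t x = Phi r - Phi s.
    by apply: (congr1 fine (integral_is_derive sr dPhi cPhi)).
  by rewrite /Phi; ring.
have r0 : 0 < r by exact: lt_trans sr.
have is_ := iheatM s y mphi hB; have ir := iheatM r y mphi hB.
rewrite RintegralB //; last 2 first.
- exact: integrable_mull.
- exact: integrable_mull.
by rewrite (RintegralZl _ measurableT is_) (RintegralZl _ measurableT ir).
Qed.

(** Take s = 1/(n+2) and r = n+2 in [heat_flow]: the boundary term at s tends to phi(y) by the
    approximate identity, the one at r decays exponentially, and the left-hand side converges by
    domination. *)
Lemma heat_resolvent (y : R3 R) :
  \int[leb]_t (expw L t * \int[leb3]_(x in [set: mR3 R])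
    (heat t ((x : R3 R) - y) * (L * phi x - laplacian phi x))) = phi y.
Proof.
have [mpsi [B B0 hB]] := psi_bounded.
have [B' B'0 hB'] := test_function_bounded tphi.
pose h (t : R) : R := \int[leb3]_(x in [set: mR3 R]) (heat t ((x : R3 R) - y) * psi x).
pose s (n : nat) : R := n.+2%:R^-1.
pose I (n : nat) : set (measurableTypeR R) := `[s n, n.+2%:R]%classic.
have mI n : measurable (I n) by exact: measurable_itv.
have mh : measurable_fun setT h.
  apply: (@measurable_Rintegral _ _ (measurableTypeR R) (mR3 R) R leb3 (fun p => heat p.1 ((p.2 : R3 R) - y) * psi p.2)).
  apply: measurable_funM; last exact: (measurableT_comp mpsi (@measurable_snd _ _ _ _)).
  apply: measurable_heat; first exact: measurable_fst.
  by apply: measurable_sub3; [exact: measurable_snd|exact: measurable_cst].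
have me := measurable_expw L.
have ie : leb.-integrable setT (EFin \o expw L).
  apply/integrableP; split; first by apply/measurable_EFinP; exact: me.
  under eq_integral do rewrite /= ger0_norm ?expw_ge0 //.
  by rewrite (integral_expw L0) ltry.
have c1 : \int[leb]_t (\1_(I n) t * (expw L t * h t)) @[n --> \oo] --> \int[leb]_t (expw L t * h t).
  apply: (proj2 (@dominated_Rintegral _ _ _ leb (fun n t => \1_(I n) t * (expw L t * h t))
    (fun t => expw L t * h t) (fun t => expw L t * B) _ _ _ _ _)).
  - by move=> n; apply: measurable_funM; [exact: measurable_indic|exact: measurable_funM].
  - exact: measurable_funM.
  - apply: nearW => t; have [t0|t0] := leP t 0.
      by rewrite /expw ltNge t0 /= mul0r; under eq_fun do rewrite mulr0; exact: cvg_cst.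
    apply: cvg_near_cst; exists (maxn (Num.truncn t^-1) (Num.truncn t)) => // n /=.
    rewrite geq_max => /andP[h1 h2]; rewrite indicE mem_set ?mul1r //.
    rewrite /I /= in_itv/=; apply/andP; split.
      rewrite /s invf_ple ?posrE //; apply: le_trans (ltW (truncnS_gt _)) _.
      by rewrite ler_nat ltnS (leq_trans h1).
    apply: le_trans (ltW (truncnS_gt _)) _; by rewrite ler_nat ltnS (leq_trans h2).
  - exact: integrable_mulr.
  - apply: nearW => t n; rewrite normrM indicE; apply: (@le_trans _ _ (1 * (expw L t * B))); last by rewrite mul1r.
    apply: ler_pM => //; first by case: (t \in _); rewrite ?normr1 ?normr0.
    by rewrite normrM (ger0_norm (expw_ge0 _ _)) ler_wpM2l ?expw_ge0 //; exact: heat_avg.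
have [C C0 hC] := heat_approximate_identity y.
have c2 : \int[leb]_t (\1_(I n) t * (expw L t * h t)) @[n --> \oo] --> phi y.
  have s0 n : 0 < s n by rewrite invr_gt0.
  have sr n : s n < n.+2%:R by apply: (@lt_trans _ _ 1); rewrite ?ltr1n // invf_lt1 // ltr1n.
  (* The three summands account for the approximate identity, for 1 - exp(-Ls) <= L s, and for
     exp(-Lr) <= 1/(L r) = s / L; finally s <= sqrt s. *)
  pose D : R := C + L * B' + B' / L.
  have bd n : `|phi y - \int[leb]_t (\1_(I n) t * (expw L t * h t))| <= D * Num.sqrt (s n).
    rewrite (heat_flow y (s0 n) (sr n)) distrC.
    have q0 := sqrtr_ge0 (s n).
    have qs : s n <= Num.sqrt (s n).
      rewrite -{1}[s n]sqr_sqrtr ?(ltW (s0 n)) // expr2 ler_piMl // -sqrtr1 ler_wsqrtr //.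
      by rewrite invf_le1 // ler1n.
    set u := expR (- L * s n); set v := expR (- L * n.+2%:R).
    have u1 : u <= 1 by rewrite -expR0 ler_expR mulNr oppr_le0 mulr_ge0 // ltW.
    have u2 : 1 - u <= L * s n by have := expR_ge1Dx (- L * s n); rewrite -/u; lra.
    have u0 : 0 <= u by exact: expR_ge0.
    have v0 : 0 <= v by exact: expR_ge0.
    have v1 : v <= L^-1 * s n.
      rewrite /v mulNr expRN -invfM lef_pV2 ?posrE ?expR_gt0 ?mulr_gt0 //.
      by apply: le_trans (expR_ge1Dx _); rewrite lerDr.
    have a1 := hC _ (s0 n); have a2 := heat_avg n.+2%:R y mphi hB'.
    rewrite -/(avg y (s n)) in a1; rewrite -/(avg y n.+2%:R) in a2.
    have -> : u * avg y (s n) - v * avg y n.+2%:R - phi y =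
      u * (avg y (s n) - phi y) - (1 - u) * phi y - v * avg y n.+2%:R by ring.
    apply: le_trans (ler_normB _ _) _; apply: le_trans (lerD (ler_normB _ _) (lexx _)) _.
    rewrite !normrM (ger0_norm u0) (ger0_norm v0).
    have -> : `|1 - u| = 1 - u by rewrite ger0_norm // subr_ge0.
    have e1 : u * `|avg y (s n) - phi y| <= C * Num.sqrt (s n).
      by apply: le_trans a1; rewrite ler_piMl.
    have e2 : (1 - u) * `|phi y| <= L * Num.sqrt (s n) * B'.
      apply: ler_pM; rewrite ?subr_ge0 //; apply: le_trans u2 _; by rewrite ler_wpM2l // ltW.
    have e3 : v * `|avg y n.+2%:R| <= L^-1 * Num.sqrt (s n) * B'.
      apply: ler_pM => //; apply: le_trans v1 _; by rewrite ler_wpM2l // invr_ge0 ltW.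
    by apply: le_trans (lerD (lerD e1 e2) e3) _; rewrite /D; lra.
  have cs : D * Num.sqrt (s n) @[n --> \oo] --> 0.
    rewrite -[X in _ --> X](mulr0 D) -[X in D * X]sqrtr0; apply: cvgM; first exact: cvg_cst.
    apply: (@continuous_cvg _ _ _ _ _ _ (@Num.sqrt R)); first exact: sqrt_continuous.
    by have := @cvg_harmonic R; rewrite -(cvg_shiftS (@harmonic R)).
  apply/cvgrPdist_le => e e0; move/cvgrPdist_le: cs => /(_ e e0); apply: filterS => n hn.
  apply: le_trans (bd n) _; apply: le_trans hn; rewrite sub0r normrN; exact: ler_norm.
have := cvg_lim (@Rhausdorff R) c1.
by rewrite (cvg_lim (@Rhausdorff R) c2) => <-.
Qed.

End HeatResolvent.

(** A is the integral of Q (L phi - Delta phi); B, C, P, N are the pairings of phi with beta, eta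
    and the two measures; G is that with g(Q), D that with L Q, and X is the integral of Q Delta
    phi. *)
Lemma eliminate_potential (R : realType) (A B C P N G D X : R) :
  A = B + P - (C + N) -> B - C = D - G -> A = D - X -> - X = - G + (P - N).
Proof. lra. Qed.

Lemma eliminate_mass (R : realType) (L A B C P N G : R) : 0 < L ->
  A = L^-1 * B + L^-1 * P - (L^-1 * C + L^-1 * N) -> B - C = L * A - G -> G = P - N.
Proof. by move=> L0 ->; rewrite -!mulrDr -mulrBr mulrA divff ?gt_eqF // mul1r; lra. Qed.

(** * Existence for the semilinear Poisson equation *)

Section Existence.
Context {R : realType}.
Variables (F : R -> R) (K c0 : R).
Hypothesis cF : continuous F.
Hypothesis F_ge0 : forall e, 0 <= F e.
Hypothesis F_le : forall e, F e <= K.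
Hypothesis F_eq0 : forall e, e <= -1 -> F e = 0.
Hypothesis F_int : (\int[lebesgue_measure]_e (4 * pi * Num.sqrt 2 * Num.sqrt e * F e)%:E = 1)%E.
Hypothesis c0_gt0 : 0 < c0.
Hypothesis F_low : forall e, 0 <= e -> e <= 1 -> c0 <= F e.
Variables np nn : {sigma_finite_measure set (mR3 R) -> \bar R}.
Hypothesis np_fin : (np setT < +oo)%E.
Hypothesis nn_fin : (nn setT < +oo)%E.

Local Notation g := (defect F).
Local Notation L := (density_slope K).

Let L0 : 0 < L. Proof. by apply: (density_slope_gt0 (F := F)). Qed.

Let g_nd q q' : q <= q' -> g q <= g q'.
Proof. by move=> qq; apply: (defect_nondecreasing (K := K) (c0 := c0)). Qed.

Let g_lip q q' : q <= q' -> g q' <= g q + L * (q' - q).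
Proof. by move=> qq; apply: (defect_lipschitz (K := K)). Qed.

Let g0 : g 0 = 0. Proof. exact: defect0. Qed.

Lemma measurable_defect : measurable_fun setT g.
Proof. by apply: nondecreasing_measurable => // x y; exact: g_nd. Qed.

Lemma defect_abs_le q : `|g q| <= L * `|q|.
Proof.
have [q0|/ltW q0] := leP 0 q.
  have h1 := g_nd q0; have h2 := g_lip q0; rewrite g0 in h1 h2.
  by rewrite (ger0_norm q0) ger0_norm; move: h1 h2; lra.
have h1 := g_nd q0; have h2 := g_lip q0; rewrite g0 in h1 h2.
by rewrite (ler0_norm q0) ler0_norm; move: h1 h2; lra.
Qed.

(** Duality: [potential_pairing] shifts the resolvent onto (L - Delta) phi, and [heat_resolvent]
    returns phi. *)
Lemma potential_poisson (nu : {sigma_finite_measure set (mR3 R) -> \bar R}) (b phi : R3 R -> R) :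
  measurable_fun [set: mR3 R] b -> (forall y, 0 <= b y) ->
  nu.-integrable [set: mR3 R] (EFin \o b) -> test_function phi ->
  \int[leb3]_(x in [set: mR3 R]) (potential L nu b x * (L * phi x - laplacian phi x)) =
  \int[nu]_y (b y * phi y).
Proof.
move=> mb b0 ib tphi.
have [ml [B1 B10 h1]] := laplacian_bounded tphi; have [B2 B20 h2] := test_function_bounded tphi.
have mphi : measurable_fun [set: mR3 R] phi.
  exact: continuous_measurable3 (test_function_continuous tphi).
rewrite (@potential_pairing R L nu b L0 mb b0 ib (fun x => L * phi x - laplacian phi x) (L * B2 + B1)).
- by apply: eq_Rintegral => y _; rewrite heat_resolvent.
- by apply: measurable_funB => //; exact: measurable_funM.
- move=> x; apply: le_trans (ler_normB _ _) _; apply: lerD => //.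
  by rewrite normrM (gtr0_norm L0) ler_wpM2l // ltW.
Qed.

Let integrable_one (nu : {sigma_finite_measure set (mR3 R) -> \bar R}) : (nu setT < +oo)%E ->
  nu.-integrable [set: mR3 R] (EFin \o cst (1 : R)).
Proof.
move=> fnu; apply/integrableP; split; first exact/measurable_EFinP.
by under eq_integral do rewrite /= normr1; rewrite integral_cst // mul1e.
Qed.

Let conv_fine (b : mR3 R -> \bar R) (x : mR3 R) : measurable_fun setT b -> (forall y, 0 <= b y)%E ->
  (\int[leb3]_y b y < +oo)%E -> conv leb3 b (ykernel L) x = conv leb3 (EFin \o (fine \o b)) (ykernel L) x.
Proof.
move=> mb b0 ib.
have ib' : leb3.-integrable setT b.
  by apply/integrableP; split => //; under eq_integral do rewrite gee0_abs //.
apply: conv_ae => //.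
- apply/measurable_EFinP; exact: (measurableT_comp (@fine_measurable _ _ _) mb).
- exact: measurable_ykernel.
- by move=> y; rewrite lee_fin fine_ge0.
- exact: ykernel_ge0.
by have := integrable_ae measurableT ib'; apply: filterS => y /(_ Logic.I) h; rewrite /= fineK.
Qed.

(** Almost everywhere Q is a signed sum of four Yukawa potentials, those of beta and mu_+ minus
    those of eta and mu_-. Gradients, the weak equation and the total charge are each computed
    potential by potential. *)
Lemma exists_screened_potential : exists (Q : R3 R -> R) (Qx : 'I_3 -> R3 R -> R),
  [/\ forall i, approximable (basis3 i) Q (Qx i),
     (\int[leb3]_(x in [set: mR3 R]) (Q x ^+ 2)%:E < +oo)%E,
     forall phi, test_function phi ->
       - (\int[leb3]_(x in [set: mR3 R]) (Q x * laplacian phi x)) =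
       - (\int[leb3]_(x in [set: mR3 R]) (g (Q x) * phi x)) + (\int[np]_y phi y - \int[nn]_y phi y),
     leb3.-integrable [set: mR3 R] (EFin \o (fun x => g (Q x))) &
     \int[leb3]_(x in [set: mR3 R]) g (Q x) = fine (np setT) - fine (nn setT)].
Proof.
have npE : np setT = (fine (np setT))%:E by rewrite fineK // ge0_fin_numE.
have nnE : nn setT = (fine (nn setT))%:E by rewrite fineK // ge0_fin_numE.
have p0 : 0 <= fine (np setT) by exact: fine_ge0.
have q0 : 0 <= fine (nn setT) by exact: fine_ge0.
pose M := fine (np setT) + fine (nn setT).
have [beta [eta [Q [[mbe met mQ be0 et0] [ibe iet iQ2 hQ]]]]] :
  exists (beta eta : mR3 R -> \bar R) (Q : mR3 R -> R),
  [/\ measurable_fun setT beta, measurable_fun setT eta, measurable_fun setT Q,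
      forall x, (0 <= beta x)%E & forall x, (0 <= eta x)%E] /\
  [/\ (\int[leb3]_x beta x < +oo)%E, (\int[leb3]_x eta x < +oo)%E,
      (\int[leb3]_x (Q x ^+ 2)%:E < +oo)%E &
  {ae leb3, forall x, [/\
  (conv leb3 beta (ykernel L) x + conv np (cst 1%E) (ykernel L) x < +oo)%E,
  (conv leb3 eta (ykernel L) x + conv nn (cst 1%E) (ykernel L) x < +oo)%E,
  Q x = fine (conv leb3 beta (ykernel L) x + conv np (cst 1%E) (ykernel L) x)%E -
    fine (conv leb3 eta (ykernel L) x + conv nn (cst 1%E) (ykernel L) x)%E,
  (eta x < +oo)%E &
  fine (beta x) - fine (eta x) = L * Q x - g (Q x)]}].
  apply: (@screened_poisson R g L (defect_low c0) M np nn) => //.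
  - exact: defect_low_gt0.
  - exact: addr_ge0.
  - by move=> q hq; apply: (defect_ge (K := K)).
  - by move=> q hq; apply: (defect_le (K := K)).
  - by rewrite npE lee_fin lerDl.
  - by rewrite nnE lee_fin lerDr.
pose b1 : R3 R -> R := fine \o beta; pose b2 : R3 R -> R := fine \o eta.
pose u : R3 R -> R := cst 1.
have mb1 : measurable_fun [set: mR3 R] b1 by exact: (measurableT_comp (@fine_measurable _ _ _) mbe).
have mb2 : measurable_fun [set: mR3 R] b2 by exact: (measurableT_comp (@fine_measurable _ _ _) met).
have mu : measurable_fun [set: mR3 R] u by exact: measurable_cst.
have b10 y : 0 <= b1 y by exact: fine_ge0.
have b20 y : 0 <= b2 y by exact: fine_ge0.
have u0 y : 0 <= u y by exact: ler01.
have ib1 : leb3.-integrable [set: mR3 R] (EFin \o b1) by exact: integrable_fine.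
have ib2 : leb3.-integrable [set: mR3 R] (EFin \o b2) by exact: integrable_fine.
have iup : np.-integrable [set: mR3 R] (EFin \o u) by exact: integrable_one.
have iun : nn.-integrable [set: mR3 R] (EFin \o u) by exact: integrable_one.
pose V1 := potential L leb3 b1; pose V2 := potential L np u.
pose V3 := potential L leb3 b2; pose V4 := potential L nn u.
have A1 i := potential_approximable L0 mb1 b10 ib1 i.
have A2 i := potential_approximable L0 mu u0 iup i.
have A3 i := potential_approximable L0 mb2 b20 ib2 i.
have A4 i := potential_approximable L0 mu u0 iun i.
have QV : {ae leb3, forall x : mR3 R, Q x = V1 x + V2 x + - (V3 x + V4 x)}.
  apply: filterS hQ => x [f1 f2 -> _ _].
  have y0 := ykernel_ge0 L.
  have o0 (y : mR3 R) : (0 <= (cst 1%E : mR3 R -> \bar R) y)%E by [].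
  have c1 := @conv_ge0 _ leb3 _ _ x be0 y0; have c2 := @conv_ge0 _ np _ _ x o0 y0.
  have c3 := @conv_ge0 _ leb3 _ _ x et0 y0; have c4 := @conv_ge0 _ nn _ _ x o0 y0.
  have e1 : (conv leb3 beta (ykernel L) x < +oo)%E by apply: le_lt_trans f1; rewrite leeDl.
  have e2 : (conv np (cst 1%E) (ykernel L) x < +oo)%E by apply: le_lt_trans f1; rewrite leeDr.
  have e3 : (conv leb3 eta (ykernel L) x < +oo)%E by apply: le_lt_trans f2; rewrite leeDl.
  have e4 : (conv nn (cst 1%E) (ykernel L) x < +oo)%E by apply: le_lt_trans f2; rewrite leeDr.
  rewrite -(ge0_fin_numE c1) in e1; rewrite -(ge0_fin_numE c2) in e2.
  rewrite -(ge0_fin_numE c3) in e3; rewrite -(ge0_fin_numE c4) in e4.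
  rewrite (fineD e1 e2) (fineD e3 e4) /V1 /V2 /V3 /V4.
  rewrite (potentialE L leb3 mb1 b10) (potentialE L np mu u0) (potentialE L leb3 mb2 b20) (potentialE L nn mu u0).
  by rewrite (conv_fine x mbe be0 ibe) (conv_fine x met et0 iet).
pose Qx i (x : R3 R) := dpotential L leb3 b1 i x + dpotential L np u i x +
  - (dpotential L leb3 b2 i x + dpotential L nn u i x).
have AQ i : approximable (basis3 i) Q (Qx i).
  apply: (approximable_ae mQ QV).
  by apply: approximableD; [exact: approximableD|apply: approximableN; exact: approximableD].
have [iQ _] := approximable_integrable (AQ ord0).
have [i1 _] := approximable_integrable (A1 ord0).
have [i2 _] := approximable_integrable (A2 ord0).
have [i3 _] := approximable_integrable (A3 ord0).
have [i4 _] := approximable_integrable (A4 ord0).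
have m (f : R3 R -> R) : leb3.-integrable [set: mR3 R] (EFin \o f) -> measurable_fun [set: mR3 R] f.
  by move=> i; apply/measurable_EFinP; exact: measurable_int i.
have bounded_mul (f h : R3 R -> R) (B : R) : leb3.-integrable [set: mR3 R] (EFin \o f) ->
    measurable_fun [set: mR3 R] h -> (forall x, `|h x| <= B) ->
    leb3.-integrable [set: mR3 R] (EFin \o (fun x => f x * h x)).
  move=> i mh hB; apply: (@integrable_le _ (mR3 R) R leb3 _ (fun x => `|f x| * B)).
  - by apply: measurable_funM => //; exact: m.
  - exact: integrable_mulr (integrable_norm i).
  - by move=> x; rewrite normrM ler_wpM2l.
have mgQ : measurable_fun [set: mR3 R] (fun x => g (Q x)) by exact: (measurableT_comp measurable_defect mQ).
have igQ : leb3.-integrable [set: mR3 R] (EFin \o (fun x => g (Q x))).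
  apply: (@integrable_le _ (mR3 R) R leb3 _ (fun x => L * `|Q x|)) => //.
    exact: integrable_mull (integrable_norm iQ).
  by move=> x; exact: defect_abs_le.
have bg : {ae leb3, forall x : mR3 R, b1 x - b2 x = L * Q x - g (Q x)}.
  by apply: filterS hQ => x [].
exists Q, Qx; split => //.
- move=> phi tphi.
  have [ml [B1 B10 h1]] := laplacian_bounded tphi; have [B2 B20 h2] := test_function_bounded tphi.
  have mphi : measurable_fun [set: mR3 R] phi.
    exact: continuous_measurable3 (test_function_continuous tphi).
  pose psi x := L * phi x - laplacian phi x.
  have mpsi : measurable_fun [set: mR3 R] psi by apply: measurable_funB => //; exact: measurable_funM.
  have hpsi x : `|psi x| <= L * B2 + B1.
    apply: le_trans (ler_normB _ _) _; apply: lerD => //.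
    by rewrite normrM (gtr0_norm L0) ler_wpM2l // ltW.
  have P1 := potential_poisson mb1 b10 ib1 tphi.
  have P2 := potential_poisson mu u0 iup tphi.
  have P3 := potential_poisson mb2 b20 ib2 tphi.
  have P4 := potential_poisson mu u0 iun tphi.
  have j1 := bounded_mul _ _ _ i1 mpsi hpsi; have j2 := bounded_mul _ _ _ i2 mpsi hpsi.
  have j3 := bounded_mul _ _ _ i3 mpsi hpsi; have j4 := bounded_mul _ _ _ i4 mpsi hpsi.
  have k1 := bounded_mul _ _ _ ib1 mphi h2; have k2 := bounded_mul _ _ _ ib2 mphi h2.
  have l1 := bounded_mul _ _ _ iQ mphi h2; have l2 := bounded_mul _ _ _ igQ mphi h2.
  have l3 := bounded_mul _ _ _ iQ ml h1.
  have X1 : \int[leb3]_(x in [set: mR3 R]) (Q x * psi x) =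
      \int[leb3]_(x in [set: mR3 R]) ((V1 x * psi x + V2 x * psi x) - (V3 x * psi x + V4 x * psi x)).
    apply: ae_eq_Rintegral.
    - exact: measurable_funM.
    - by apply: measurable_funB; apply: measurable_funD; exact: m.
    by apply: filterS QV => x ->; ring.
  rewrite (RintegralB measurableT (integrable_addr j1 j2) (integrable_addr j3 j4)) in X1.
  rewrite (RintegralD measurableT j1 j2) (RintegralD measurableT j3 j4) in X1.
  have X2 : \int[leb3]_(x in [set: mR3 R]) (b1 x * phi x - b2 x * phi x) =
      \int[leb3]_(x in [set: mR3 R]) (L * (Q x * phi x) - g (Q x) * phi x).
    apply: ae_eq_Rintegral.
    - by apply: measurable_funB; exact: measurable_funM.
    - by apply: measurable_funB; [apply: measurable_funM => //; exact: measurable_funM|exact: measurable_funM].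
    by apply: filterS bg => x h; rewrite -mulrBl h; ring.
  rewrite (RintegralB measurableT k1 k2) (RintegralB measurableT (integrable_mull L l1) l2) in X2.
  rewrite (RintegralZl L measurableT l1) in X2.
  have X3 : \int[leb3]_(x in [set: mR3 R]) (Q x * psi x) =
     L * \int[leb3]_(x in [set: mR3 R]) (Q x * phi x) - \int[leb3]_(x in [set: mR3 R]) (Q x * laplacian phi x).
    rewrite -(RintegralZl L measurableT l1) -(RintegralB measurableT (integrable_mull L l1) l3).
    by apply: eq_Rintegral => x _; rewrite /psi; ring.
  have U (nu : {sigma_finite_measure set (mR3 R) -> \bar R}) : \int[nu]_y (u y * phi y) = \int[nu]_y phi y.
    by apply: eq_Rintegral => y _; rewrite /u mul1r.
  rewrite /V1 /V2 /V3 /V4 P1 P2 P3 P4 !U in X1.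
  exact: (eliminate_potential X1 X2 X3).
(* L times the integral of Q is the integral of beta - eta plus the total charge; comparison with
   beta - eta = L Q - g(Q) leaves the integral of g(Q). *)
- have E1 := integral_potential L0 mb1 b10 ib1; have E2 := integral_potential L0 mu u0 iup.
  have E3 := integral_potential L0 mb2 b20 ib2; have E4 := integral_potential L0 mu u0 iun.
  have X1 : \int[leb3]_(x in [set: mR3 R]) Q x =
      \int[leb3]_(x in [set: mR3 R]) ((V1 x + V2 x) - (V3 x + V4 x)).
    apply: ae_eq_Rintegral => //.
    by apply: measurable_funB; apply: measurable_funD; exact: m.
  rewrite (RintegralB measurableT (integrable_addr i1 i2) (integrable_addr i3 i4)) in X1.
  rewrite (RintegralD measurableT i1 i2) (RintegralD measurableT i3 i4) in X1.
  have X2 : \int[leb3]_(x in [set: mR3 R]) (b1 x - b2 x) =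
      \int[leb3]_(x in [set: mR3 R]) (L * Q x - g (Q x)).
    apply: ae_eq_Rintegral => //.
    - exact: measurable_funB.
    - by apply: measurable_funB => //; exact: measurable_funM.
  rewrite (RintegralB measurableT ib1 ib2) (RintegralB measurableT (integrable_mull L iQ) igQ) in X2.
  rewrite (RintegralZl L measurableT iQ) in X2.
  have U (nu : {sigma_finite_measure set (mR3 R) -> \bar R}) : (nu setT < +oo)%E -> \int[nu]_y u y = fine (nu setT).
    by move=> fnu; rewrite /u Rintegral_cst // mul1r.
  rewrite /V1 /V2 /V3 /V4 E1 E2 E3 E4 !U // in X1.
  exact: (eliminate_mass L0 X1 X2).
Qed.

End Existence.

(** * Solutions of the Vlasov-Poisson problem *)

Section GibbsSolution.
Context {R : realType}.
Variables (F dF : R -> R) (K c0 : R).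
Hypothesis hF : forall r : R, is_derive r 1 F (dF r).
Hypothesis cdF : continuous dF.
Hypothesis FK : forall r, `|F r| <= K.
Hypothesis dFK : forall r, `|dF r| <= K.
Hypothesis F_ge0 : forall e, 0 <= F e.
Hypothesis F_eq0 : forall e, e <= -1 -> F e = 0.
Hypothesis F_int : (\int[lebesgue_measure]_e (4 * pi * Num.sqrt 2 * Num.sqrt e * F e)%:E = 1)%E.
Hypothesis c0_gt0 : 0 < c0.
Hypothesis F_low : forall e, 0 <= e -> e <= 1 -> c0 <= F e.
Variables (f0 : R3 R -> R) (mu : {charge set (mR3 R) -> \bar R}).
Variables (Q : R3 R -> R) (Qx : 'I_3 -> R3 R -> R).
Hypothesis f0E : forall v, f0 v = F (energy v).
Hypothesis AQ : forall i, approximable (basis3 i) Q (Qx i).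
Hypothesis Q2 : (\int[leb3]_(x in [set: mR3 R]) (Q x ^+ 2)%:E < +oo)%E.
Hypothesis Qpoisson : forall phi, test_function phi ->
  - (\int[leb3]_(x in [set: mR3 R]) (Q x * laplacian phi x)) =
  - (\int[leb3]_(x in [set: mR3 R]) (defect F (Q x) * phi x)) +
    (\int[jordan_pos (hahn_dec mu)]_y phi y - \int[jordan_neg (hahn_dec mu)]_y phi y).

Let cF : continuous F.
Proof.
by move=> x; apply: differentiable_continuous; apply/derivable1_diffP; have [] := hF x.
Qed.
Let F_le e : F e <= K. Proof. exact: le_trans (ler_norm _) (FK e). Qed.
Let K0 : 0 <= K. Proof. exact: le_trans (normr_ge0 _) (FK 0). Qed.
Let mQ : measurable_fun [set: mR3 R] Q. Proof. by have [] := AQ ord0. Qed.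
Let iQ : leb3.-integrable [set: mR3 R] (EFin \o Q).
Proof. by have [] := approximable_integrable (AQ ord0). Qed.
Let mf : measurable_fun [set: mR3 R * mR3 R] (gibbs F Q).
Proof. exact: (measurable_comp_energy cF mQ). Qed.

Let izero : leb3.-integrable [set: mR3 R] (EFin \o (fun=> 0 : R)).
Proof. exact: (integrable0 leb3 setT). Qed.

Lemma coord3_norm_le (i : 'I_3) (v : R3 R) : `|coord3 i v| <= `|v|.
Proof.
have -> : `|v| = Num.max (Num.max `|v.1.1| `|v.1.2|) `|v.2| by [].
case: i => -[|[|[|//]]] ? ; rewrite /coord3 /= !le_max lexx ?orbT //.
Qed.

Let D_v (i : 'I_3) (z : R3 R * R3 R) :
  is_derive z (0, basis3 i) (gibbs F Q) (dF (energy z.2 + Q z.1) * coord3 i z.2).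
Proof.
apply: (is_derive_comp1 (u := fun z : R3 R * R3 R => energy z.2 + Q z.1)) => //.
apply: is_derive_of_line.
have [d1 d2] := is_derive_half_sqnorm z.2 (basis3 i).
have e0 : z.2 + 0 *: (basis3 i : R3 R) = z.2 by rewrite scale0r addr0.
have H : derivable (fun x : R3 R => 2^-1 * sqnorm x) (z.2 + 0 *: (basis3 i : R3 R)) (basis3 i) by rewrite e0.
have HL := is_derive_line H; rewrite e0 d2 dot3_basis3 in HL.
have := is_derive_add HL (is_derive_const (Q z.1) (0 : R) 1); rewrite addr0.
by congr is_derive; apply/funext => k /=; rewrite scaler0 addr0.
Qed.

Let mDv (i : 'I_3) : measurable_fun [set: mR3 R * mR3 R] (fun z => dF (energy z.2 + Q z.1) * coord3 i z.2).
Proof.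
apply: measurable_funM; first exact: (measurable_comp_energy cdF mQ).
have [m1 m2 m3] := measurable_coords (@measurable_snd _ _ (mR3 R) (mR3 R)).
by case: i => -[|[|[|//]]] ? /=.
Qed.

(** In v the function is classically differentiable, with a derivative of at most linear growth; it
    is bounded on the compact sets that matter, uniformly in Q. *)
Lemma gibbs_weak_dv (i : 'I_3) : weak_dv i (gibbs F Q) (fun z => dF (energy z.2 + Q z.1) * coord3 i z.2).
Proof.
split.
  apply: (L1loc6_dominated (mDv i) izero) => C cC.
  have [N [_ hN]] := compact_bounded cC; exists (K * (`|N| + 1)) => z Cz.
  have Nz : `|z.2| <= `|N| + 1.
    have := hN (`|N| + 1) _ z Cz; rewrite (le_lt_trans (ler_norm N)) ?ltrDl // => /(_ isT).
      by rewrite /= ge_max => /andP[].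
  rewrite mulr0 add0r normrM; apply: ler_pM => //; exact: le_trans (coord3_norm_le i _) Nz.
move=> phi tphi.
have DE : 'D_(0, basis3 i) (gibbs F Q) = (fun z => dF (energy z.2 + Q z.1) * coord3 i z.2).
  by apply/funext => z; have [_ ->] := D_v i z.
have [N N0 hN] := test_function_support tphi.
have bd z : closure [set y | phi y != 0] z -> `|gibbs F Q z| <= K + K * N /\
    `|'D_(0, basis3 i) (gibbs F Q) z| <= K + K * N.
  move=> /hN; rewrite ge_max => /andP[_ Nz].
  split; first by apply: le_trans (FK _) _; rewrite lerDl mulr_ge0.
  have [_ ->] := D_v i z; rewrite normrM; apply: (@le_trans _ _ (K * N)); last by rewrite lerDr.
  by apply: ler_pM => //; exact: le_trans (coord3_norm_le i _) Nz.
have [_ _ ->] := @weak_derive6 R (0, basis3 i) (gibbs F Q) (K + K * N) phi tphi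
  mf (eq_ind_r _ (mDv i) DE) (fun z => @ex_derive _ _ _ _ _ _ _ (D_v i z)) bd.
by congr (- _); apply: eq_Rintegral => z _; have [_ ->] := D_v i z.
Qed.

Let gibbs_weak_dx (i : 'I_3) : weak_dx i (gibbs F Q) (fun z => dF (energy z.2 + Q z.1) * Qx i z.1).
Proof. exact: (approximable_chain hF cdF FK dFK (AQ i)). Qed.

Lemma finite_norm2 (h : mR3 R -> R) : (\int[leb3]_x (h x ^+ 2)%:E < +oo)%E ->
  finite_norm leb3 2%:E h.
Proof.
move=> h2; rewrite /finite_norm unlock /=; apply: poweR_lty.
by under eq_integral do rewrite powR_mulrn // real_normK ?num_real //.
Qed.

(** This yields the boundary condition: f(x, v) - f0(v) is at most K |Q(x)| in absolute value,
    uniformly in v, and Q is square integrable. *)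
Let F_lipschitz (x q : R) : `|F (x + q) - F x| <= K * `|q|.
Proof.
have pos x' (h : R) : 0 <= h -> `|F (x' + h) - F x'| <= K * h.
  move=> h0; have := @le_mean_value R (fun t => F (x' + t)) (fun t => dF (x' + t)) K h h0.
  rewrite addr0; apply => y _ //.
  have I : is_derive y 1 (fun t : R => x' + t) 1.
    by have := is_derive_add (is_derive_const x' y 1) (is_derive_id y 1); rewrite add0r.
  by have := is_derive_comp1 hF I; rewrite mulr1.
have [q0|/ltW q0] := leP 0 q; first by rewrite (ger0_norm q0); exact: pos.
rewrite (ler0_norm q0) distrC.
by have := pos (x + q) (- q); rewrite oppr_ge0 => /(_ q0); rewrite addrK.
Qed.

(** Hence rho - 1 = - g(Q), which turns the semilinear equation into the Poisson equation of the
    system. *)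
Let rhoE (x : R3 R) : rho (gibbs F Q) x = 1 - defect F (Q x).
Proof.
rewrite /rho /Rintegral /gibbs /= (density_energy cF F_ge0).
by rewrite (defectE (K := K)).
Qed.

Lemma gibbs_vp_solution : vp_solution f0 mu (gibbs F Q) Q.
Proof.
split.
- split.
    split; last by move=> i; split; eexists; [exact: gibbs_weak_dx|exact: gibbs_weak_dv].
    apply: (L1loc6_dominated mf izero) => C _; exists K => z _.
    by rewrite mulr0 add0r FK.
  split; first exact: mf.
  move=> C cC; have mC := compact_measurable3 cC.
  have [S [mS S1 CS]] : exists S : set (mR3 R), [/\ measurable S, (leb3 S < +oo)%E & C `<=` S].
    have [N [_ hN]] := compact_bounded cC.
    have [S [mS S1 hS]] := leb3_bounded_set (N + 1); exists S; split => // x Cx.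
    by apply: hS; apply: (hN (N + 1)) => //; rewrite ltrDl.
  have is_ := integrable_addr (integrable_indic_lty mS S1)
     (integrable_mull (density_slope K) (integrable_norm iQ)).
  have /integrableP[_] := is_; apply: le_lt_trans.
  have mG : measurable_fun [set: mR3 R] (fun x => (1 - defect F (Q x))%:E).
    apply/measurable_EFinP; apply: measurable_funB => //.
    by apply: (measurableT_comp _ mQ); apply: (@measurable_defect R F K c0).
  rewrite [leLHS]integral_mkcond; apply: (@ge0_le_integral _ _ _ leb3 setT measurableT).
  + by move=> x _; apply: erestrict_ge0 => y _; apply: integral_ge0.
  + apply/(measurable_restrictT _ mC); apply: measurable_funTS.
    rewrite (_ : (fun x => _) = (fun x => (1 - defect F (Q x))%:E)) //.
    apply/funext => x; rewrite -(defectE (K := K)) // -density_energy //.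
    by apply: eq_integral => v _; rewrite ger0_norm // F_ge0.
  + by apply: measurableT_comp => //; have /integrableP[] := is_.
  + move=> x _; rewrite patchE; case: ifPn; rewrite ?inE => Cx; last exact: abse_ge0.
    have -> : (\int[leb3]_(v in [set: mR3 R]) `|gibbs F Q (x, v)|%:E = (1 - defect F (Q x))%:E)%E.
      rewrite -(defectE (K := K)) // -density_energy //.
      by apply: eq_integral => v _; rewrite ger0_norm // F_ge0.
    rewrite /= lee_fin; apply: le_trans (ler_norm _); rewrite indicE mem_set; last exact: CS.
    have := @defect_abs_le R F K c0 cF F_ge0 F_le F_eq0 F_int c0_gt0 F_low (Q x).
    by have := ler_norm (- defect F (Q x)); rewrite normrN mulr1n; lra.
- split; last by split; [exact: mQ|exact: finite_norm2].
  split; first exact: iQ.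
  move=> i; exists (Qx i); first exact: approximable_weak.
  by have [] := approximable_integrable (AQ i).
- exists (fun i z => dF (energy z.2 + Q z.1) * Qx i z.1), (fun i z => dF (energy z.2 + Q z.1) * coord3 i z.2), Qx.
  split.
    by move=> i; split; [exact: gibbs_weak_dx|exact: gibbs_weak_dv|exact: approximable_weak].
  (* Both sums consist of the terms dF(E) v_i Q_i, E being the total energy, and cancel term by
     term. *)
  apply: nearW => z; rewrite -sumrB big1 // => i _; ring.
- move=> phi tphi; rewrite (Qpoisson tphi) /charge_integral; congr (_ + _).
  have alg (G : R) : - G = -1 * G by ring.
  have [B B0 hB] := test_function_bounded tphi.
  have mphi : measurable_fun [set: mR3 R] phi.
    exact: continuous_measurable3 (test_function_continuous tphi).
  have mg : measurable_fun [set: mR3 R] (fun x => defect F (Q x)).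
    by apply: (measurableT_comp _ mQ); apply: (@measurable_defect R F K c0).
  have i1 : leb3.-integrable [set: mR3 R] (EFin \o (fun x => defect F (Q x) * phi x)).
    apply: (@integrable_le _ (mR3 R) R leb3 _ (fun x => density_slope K * `|Q x| * B)).
    - exact: measurable_funM.
    - exact: integrable_mulr (integrable_mull _ (integrable_norm iQ)).
    - move=> x; rewrite normrM ler_pM //.
      exact: (@defect_abs_le R F K c0 cF F_ge0 F_le F_eq0 F_int c0_gt0 F_low).
  rewrite alg -(RintegralZl _ measurableT i1); apply: eq_Rintegral => x _.
  by rewrite rhoE; ring.
- apply: nearW => v; apply: finite_norm2.
  have iQ2 : leb3.-integrable [set: mR3 R] (EFin \o (fun x => Q x ^+ 2)).
    apply/integrableP; split; first by apply/measurable_EFinP; exact: measurable_funX.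
    by under eq_integral do rewrite /= ger0_norm ?sqr_ge0 //.
  have := integrable_mull (K ^+ 2) iQ2 => /integrableP[mk]; apply: le_lt_trans.
  apply: (@ge0_le_integral _ _ _ leb3 setT measurableT).
  + by move=> x _; rewrite lee_fin sqr_ge0.
  + apply/measurable_EFinP; apply: measurable_funX; apply: measurable_funB => //.
    exact: (measurableT_comp mf (pair2_measurable v)).
  + exact: measurableT_comp.
  + move=> x _; rewrite /= lee_fin; apply: le_trans (ler_norm _).
    rewrite f0E -[leLHS]real_normK ?num_real // -[Q x ^+ 2]real_normK ?num_real // -exprMn.
    by apply: lerXn2r; rewrite ?nnegrE ?mulr_ge0 //; exact: F_lipschitz.
Qed.

End GibbsSolution.

(** * Dependence of the density on the extension *)

Section ProfileFamily.
Context {R : realType}.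
Variables (F0 dF0 : R -> R).
Hypothesis hC1 : C1_halfline F0 dF0.
Hypothesis hF0 : forall r : R, 0 <= r -> 0 <= F0 r.
Hypothesis hdecr : forall r : R, 0 <= r -> dF0 r < 0.

(** On [a, b] the factor sqrt (e - q) is at least sqrt (a - q), and the excess of G over F is at
    least d. The choice d = 0 yields plain monotonicity. *)
Lemma density_le_sub (F G : R -> R) (q a b d : R) : continuous F -> continuous G ->
  (forall e, 0 <= F e) -> (forall e, F e <= G e) -> a < b -> 0 <= d ->
  (forall e, a <= e -> e <= b -> F e + d <= G e) ->
  (density F q + (4 * pi * Num.sqrt 2 * Num.sqrt (a - q) * d * (b - a))%:E <= density G q)%E.
Proof.
move=> cF cG F_ge0 FG ab d0 hd.
have c_gt0 : 0 < 4 * pi * Num.sqrt 2 :> R by rewrite !mulr_gt0 ?pi_gt0 ?sqrtr_gt0.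
have mdens H : continuous H ->
    measurable_fun setT (fun e : R => (4 * pi * Num.sqrt 2 * Num.sqrt (e - q) * H e)%:E).
  move=> cH; apply/measurable_EFinP; apply: measurable_funM; last exact: continuous_measurable_fun.
  apply: measurable_funM => //; apply: (measurableT_comp measurable_sqrtr).
  exact: measurable_funB.
have dens0 H e : 0 <= H -> 0 <= 4 * pi * Num.sqrt 2 * Num.sqrt (e - q) * H.
  by move=> h; rewrite mulr_ge0 // energy_density_ge0.
set c := 4 * pi * Num.sqrt 2 in c_gt0 mdens dens0.
pose t0 := c * Num.sqrt (a - q) * d.
have t00 : 0 <= t0 by apply: mulr_ge0 => //; apply: mulr_ge0; [exact: ltW|exact: sqrtr_ge0].
rewrite -/t0; pose I : set (measurableTypeR R) := `[a, b]%classic.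
have mI' : measurable I by exact: measurable_itv.
have mI : measurable_fun setT (fun e => (t0 * \1_I e)%:E).
  by apply/measurable_EFinP; apply: measurable_funM => //; exact: measurable_indic.
have I0 e : (0 <= (t0 * \1_I e)%:E)%E by rewrite lee_fin mulr_ge0 ?t00 // indicE.
apply: (@le_trans _ _ (density F q + \int[lebesgue_measure]_e (t0 * \1_I e)%:E)%E).
  apply: leeD => //; under eq_integral do rewrite EFinM.
  rewrite ge0_integralZl_EFin ?t00 //; last first.
    by apply/measurable_EFinP; exact: measurable_indic.
  have E : (lebesgue_measure : set (measurableTypeR R) -> \bar R) I = (b - a)%:E.
    etransitivity; first exact: (lebesgue_measure_itv `[a, b]).
    by rewrite /= lte_fin ab EFinB.
  by rewrite integral_indic // setIT [X in (_ * X)%E]E -EFinM.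
rewrite /density -ge0_integralD //; last 2 first.
- by move=> e _; rewrite lee_fin dens0.
- exact: mdens.
apply: (@ge0_le_integral _ _ _ (@lebesgue_measure R) setT measurableT).
- by move=> e _; rewrite adde_ge0 // lee_fin dens0.
- by apply: emeasurable_funD => //; exact: mdens.
- exact: mdens.
move=> e _; rewrite -EFinD lee_fin indicE mem_setE in_itv/=.
have le0 := ler_wpM2l (mulr_ge0 (ltW c_gt0) (sqrtr_ge0 (e - q))) (FG e).
have [/andP[e1 e2]|_] := boolP (a <= e <= b); rewrite ?mulr1 ?mulr0 ?addr0 //.
have := ler_wpM2l (mulr_ge0 (ltW c_gt0) (sqrtr_ge0 (e - q))) (hd e e1 e2).
apply: le_trans; rewrite -/c mulrDr lerD2l ler_wpM2r ?d0 // ler_wpM2l ?(ltW c_gt0) //.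
by rewrite ler_wsqrtr // lerD2r.
Qed.

Lemma profile_increment (m n : nat) (e : R) : -1 <= e -> e < 0 ->
  profile F0 dF0 n e =
  profile F0 dF0 m e + (n%:R - m%:R) * ((1 + e) * (1 + e) * (e * e)).
Proof. by move=> e1 e0; rewrite !profile_negE // /profile_neg; ring. Qed.

Lemma profile_nondecreasing (m n : nat) (e : R) : (m <= n)%N ->
  profile F0 dF0 m e <= profile F0 dF0 n e.
Proof.
move=> mn; have [e0|e0] := leP 0 e; first by rewrite !profileE.
have [e1|/ltW e1] := leP e (-1); first by rewrite !profile_eq0.
rewrite (profile_increment m n) // lerDl mulr_ge0 ?subr_ge0 ?ler_nat //.
by rewrite mulr_ge0 // -expr2 sqr_ge0.
Qed.

Lemma profile_density_lt (m n : nat) (q : R) : (m < n)%N -> q < 0 ->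
  exists2 t, 0 < t & (density (profile F0 dF0 m) q + t%:E <= density (profile F0 dF0 n) q)%E.
Proof.
(* The interval [p/2, p/4] lies above q and inside (-1/2, 0] or touches -1/2. There (1 + e)^2 >= 1/4
   and e^2 >= p^2/16, so each unit of n raises the profile by at least p^2/64. *)
move=> mn q0; pose p := Num.max q (-1).
have p0 : p < 0 by rewrite gt_max q0 ltrN10.
have qp : q <= p by rewrite le_max lexx.
have p1 : -1 <= p by rewrite le_max lexx orbT.
exists (4 * pi * Num.sqrt 2 * Num.sqrt (p / 2 - q) * (p * p / 64) * (p / 4 - p / 2)).
  have pq : 0 < p / 2 - q by lra.
  have pp : 0 < p / 4 - p / 2 by lra.
  have pp2 : 0 < p * p / 64 by rewrite divr_gt0 // nmulr_lgt0.
  apply: mulr_gt0 pp; apply: mulr_gt0 pp2; apply: mulr_gt0; last by rewrite sqrtr_gt0.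
  by rewrite !mulr_gt0 ?pi_gt0 ?sqrtr_gt0.
apply: density_le_sub.
- exact: continuous_profile.
- exact: continuous_profile.
- exact: profile_ge0.
- by move=> e; apply: profile_nondecreasing; exact: ltnW.
- lra.
- by rewrite divr_ge0 // -expr2 sqr_ge0.
move=> e e1 e2; rewrite (profile_increment m n); [|lra|lra].
rewrite lerD2l; have nm : 1 <= n%:R - m%:R :> R.
  by rewrite lerBrDr -(natrD _ 1%N m) add1n ler_nat.
have h1 : p * p / 16 <= e * e by nra.
have h2 : 4^-1 <= (1 + e) * (1 + e) by nra.
have h3 : p * p / 64 <= (1 + e) * (1 + e) * (e * e).
  apply: (@le_trans _ _ (4^-1 * (p * p / 16))); first by lra.
  by apply: ler_pM => //; rewrite ?invr_ge0 // divr_ge0 // -expr2 sqr_ge0.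
apply: le_trans h3 _; rewrite ler_peMl // mulr_ge0 // -expr2 sqr_ge0 //.
Qed.

Lemma profile_density_le (m n : nat) (q : R) : (m <= n)%N ->
  (density (profile F0 dF0 m) q <= density (profile F0 dF0 n) q)%E.
Proof.
move=> mn; have := @density_le_sub (profile F0 dF0 m) (profile F0 dF0 n) q q (q + 1) 0.
rewrite mulr0 mul0r adde0; apply.
- exact: continuous_profile.
- exact: continuous_profile.
- exact: profile_ge0.
- by move=> e; exact: profile_nondecreasing.
- by rewrite ltrDl.
- by [].
- by move=> e _ _; rewrite addr0; exact: profile_nondecreasing.
Qed.

Hypothesis hint : ((4 * pi * Num.sqrt 2)%:E *
  \int[lebesgue_measure]_(r in `[0%R, +oo[) (Num.sqrt r * F0 r)%:E = 1)%E.

(** Negative energies contribute nothing because sqrt e is 0 there; the normalization of [F0] is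
    thus inherited by every extension. *)
Lemma profile_mass (n : nat) :
  (\int[lebesgue_measure]_e (4 * pi * Num.sqrt 2 * Num.sqrt e * profile F0 dF0 n e)%:E = 1)%E.
Proof.
have c0 : 0 <= 4 * pi * Num.sqrt 2 :> R by rewrite !mulr_ge0 ?pi_ge0 ?sqrtr_ge0.
have mg : measurable_fun setT (fun e : R => (Num.sqrt e * profile F0 dF0 n e)%:E).
  apply/measurable_EFinP; apply: measurable_funM; first exact: measurable_sqrtr.
  by apply: continuous_measurable_fun; exact: continuous_profile.
transitivity (\int[lebesgue_measure]_e ((4 * pi * Num.sqrt 2)%:E * (Num.sqrt e * profile F0 dF0 n e)%:E))%E.
  by apply: eq_integral => e _; rewrite -EFinM mulrA.
rewrite ge0_integralZl_EFin //; last first.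
  by move=> e _; rewrite lee_fin mulr_ge0 ?sqrtr_ge0 // profile_ge0.
rewrite -hint; congr (_ * _)%E; rewrite [RHS]integral_mkcond; apply: eq_integral => e _.
rewrite patchE mem_setE in_itv/= andbT; case: ifPn => [e0|]; first by rewrite profileE.
by rewrite -ltNge => /ltW e0; rewrite ler0_sqrtr // mul0r.
Qed.

End ProfileFamily.

Lemma Rintegral_ae_ge0 d (T : measurableType d) (R : realType) (m : {measure set T -> \bar R})
    (u : T -> R) : measurable_fun setT u -> {ae m, forall x, 0 <= u x} -> 0 <= \int[m]_x u x.
Proof.
move=> mu u0; rewrite (_ : Rintegral _ _ _ = \int[m]_x `|u x|); first exact: Rintegral_ge0.
apply: ae_eq_Rintegral => //; first exact: measurableT_comp.
by apply: filterS u0 => x h; rewrite ger0_norm.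
Qed.

(** The difference is nonnegative almost everywhere and has integral 0. *)
Lemma ae_eq_of_le d (T : measurableType d) (R : realType) (m : {measure set T -> \bar R})
    (u v : T -> R) : m.-integrable setT (EFin \o u) -> m.-integrable setT (EFin \o v) ->
  {ae m, forall x, v x <= u x} -> \int[m]_x u x = \int[m]_x v x -> {ae m, forall x, u x = v x}.
Proof.
move=> iu iv vu uv; pose D x := u x - v x.
have iD : m.-integrable setT (EFin \o D) by exact: integrable_subr.
have mD : measurable_fun setT D by apply/measurable_EFinP; exact: measurable_int iD.
have nD : \int[m]_x `|D x| = 0.
  transitivity (\int[m]_x D x); last by rewrite /D (RintegralB measurableT iu iv) uv subrr.
  apply: ae_eq_Rintegral => //; first exact: measurableT_comp.
  by apply: filterS vu => x vx; rewrite ger0_norm // subr_ge0.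
have /(ae_eq_integral_abs _ measurableT) : measurable_fun setT (EFin \o D).
  exact/measurable_EFinP.
move=> /(_ m)[+ _]; have -> : (\int[m]_x `|(EFin \o D) x| = 0)%E.
  rewrite -[LHS]fineK; first by congr EFin; exact: nD.
  by rewrite ge0_fin_numE ?integral_ge0 //; have /integrableP[] := iD.
move=> /(_ erefl); apply: filterS => x /(_ Logic.I) [] /eqP.
by rewrite subr_eq0 => /eqP.
Qed.

Lemma charge_jordan {R : realType} (mu : {charge set (mR3 R) -> \bar R}) :
  fine (mu [set: mR3 R]) =
  fine (jordan_pos (hahn_dec mu) [set: mR3 R]) - fine (jordan_neg (hahn_dec mu) [set: mR3 R]).
Proof.
have fp : jordan_pos (hahn_dec mu) [set: mR3 R] \is a fin_num by exact: fin_num_measure.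
have fn : jordan_neg (hahn_dec mu) [set: mR3 R] \is a fin_num by exact: fin_num_measure.
rewrite (jordan_decomp (hahn_dec mu) measurableT) /cadd /= cscaleN1.
by rewrite fineD ?fin_numN // fineN.
Qed.

Lemma exists_gibbs_solution (R : realType) (F dF : R -> R) (K c0 : R) (f0 : R3 R -> R)
    (mu : {charge set (mR3 R) -> \bar R}) :
  (forall r : R, is_derive r 1 F (dF r)) -> continuous dF ->
  (forall r, `|F r| <= K) -> (forall r, `|dF r| <= K) ->
  (forall e, 0 <= F e) -> (forall e : R, e <= -1 -> F e = 0) ->
  (\int[lebesgue_measure]_e (4 * pi * Num.sqrt 2 * Num.sqrt e * F e)%:E = 1)%E ->
  0 < c0 -> (forall e : R, 0 <= e -> e <= 1 -> c0 <= F e) ->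
  (forall v, f0 v = F (energy v)) ->
  exists Q : R3 R -> R,
  [/\ vp_solution f0 mu (gibbs F Q) Q,
      leb3.-integrable [set: mR3 R] (EFin \o (fun x => defect F (Q x))) &
      \int[leb3]_(x in [set: mR3 R]) defect F (Q x) = fine (mu setT)].
Proof.
move=> hF cdF FK dFK F_ge0 F_eq0 F_int c0_gt0 F_low f0E.
have cF : continuous F.
  by move=> x; apply: differentiable_continuous; apply/derivable1_diffP; have [] := hF x.
have F_le e : F e <= K by exact: le_trans (ler_norm _) (FK e).
have fp : (jordan_pos (hahn_dec mu) [set: mR3 R] < +oo)%E.
  by rewrite -ge0_fin_numE //; exact: fin_num_measure.
have fn : (jordan_neg (hahn_dec mu) [set: mR3 R] < +oo)%E.
  by rewrite -ge0_fin_numE //; exact: fin_num_measure.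
have [Q [Qx [AQ Q2 QP Qi Qm]]] :=
  exists_screened_potential cF F_ge0 F_le F_eq0 F_int c0_gt0 F_low fp fn.
exists Q; split => //; last by rewrite charge_jordan; exact: Qm.
exact: (gibbs_vp_solution hF cdF FK dFK F_ge0 F_eq0 F_int c0_gt0 F_low f0E AQ Q2 QP).
Qed.

(** * The family of solutions *)

Section SolutionFamily.
Context {R : realType}.
Variables (F0 dF0 : R -> R) (mu : {charge set (mR3 R) -> \bar R}).
Hypothesis hC1 : C1_halfline F0 dF0.
Hypothesis hF0 : forall r : R, 0 <= r -> 0 <= F0 r.
Hypothesis hint : ((4 * pi * Num.sqrt 2)%:E *
  \int[lebesgue_measure]_(r in `[0%R, +oo[) (Num.sqrt r * F0 r)%:E = 1)%E.
Hypothesis hdecay : exists2 C : R, 0 < C &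
  forall r : R, 0 <= r -> `|F0 r| + `|dF0 r| <= C / (1 + r ^+ 3).
Hypothesis hdecr : forall r : R, 0 <= r -> dF0 r < 0.

Local Notation P := (profile F0 dF0).

(** The lower bound on [0, 1] is the value of the profile at 1. All profiles agree with [F0] on
    kinetic energies, so the boundary datum is the same for every n. *)
Lemma exists_gibbs (n : nat) : exists Q : R3 R -> R,
  [/\ vp_solution (fun v => F0 (2^-1 * sqnorm v)) mu (gibbs (P n) Q) Q,
      leb3.-integrable [set: mR3 R] (EFin \o (fun x => defect (P n) (Q x))) &
      \int[leb3]_(x in [set: mR3 R]) defect (P n) (Q x) = fine (mu setT)].
Proof.
have [K [K0 PK dPK]] := profile_bounded hC1 hdecay n.
apply: (@exists_gibbs_solution R (P n) (dprofile F0 dF0 n) K (P n 1)) => //.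
- exact: is_derive_profile.
- exact: continuous_dprofile.
- exact: profile_ge0.
- by move=> e; exact: profile_eq0.
- exact: profile_mass.
- exact: (profile1_gt0 hC1).
- exact: profile_lower.
- by move=> v; rewrite profileE // mulr_ge0 // sumr_ge0 // => i _; exact: sqr_ge0.
Qed.

Lemma density_profile (n : nat) (q : R) : density (P n) q = (1 - defect (P n) q)%:E.
Proof.
have [K [_ PK _]] := profile_bounded hC1 hdecay n.
apply: (defectE (K := K)); last exact: profile_mass.
- exact: continuous_profile.
- exact: profile_ge0.
- by move=> e; exact: le_trans (ler_norm _) (PK e).
- by move=> e; exact: profile_eq0.
Qed.

Lemma defect_profile_le (m n : nat) (q : R) : (m <= n)%N -> defect (P n) q <= defect (P m) q.
Proof.
move=> mn; have := profile_density_le hC1 hF0 hdecr q mn.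
by rewrite !density_profile lee_fin; lra.
Qed.

Lemma defect_profile_lt (m n : nat) (q : R) : (m < n)%N -> q < 0 ->
  defect (P n) q < defect (P m) q.
Proof.
move=> mn q0; have [t t0] := profile_density_lt hC1 hF0 hdecr mn q0.
by rewrite !density_profile -EFinD lee_fin; lra.
Qed.

Lemma defect_profile_ge0 (n : nat) (q : R) : 0 <= q -> 0 <= defect (P n) q.
Proof.
move=> q0; have [K [_ PK _]] := profile_bounded hC1 hdecay n.
have Pm := profile_mass hC1 hF0 hdecr hint n.
rewrite -(defect0 Pm); apply: (@defect_nondecreasing _ (P n) K (P n 1)) => //.
- exact: continuous_profile.
- exact: profile_ge0.
- by move=> e; exact: le_trans (ler_norm _) (PK e).
- by move=> e; exact: profile_eq0.
- exact: profile1_gt0.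
- exact: profile_lower.
Qed.

Lemma gibbs_distinct (m n : nat) (Qm Qn : R3 R -> R) : (m < n)%N ->
  leb3.-integrable [set: mR3 R] (EFin \o (fun x => defect (P m) (Qm x))) ->
  leb3.-integrable [set: mR3 R] (EFin \o (fun x => defect (P n) (Qn x))) ->
  \int[leb3]_(x in [set: mR3 R]) defect (P m) (Qm x) =
    \int[leb3]_(x in [set: mR3 R]) defect (P n) (Qn x) ->
  \int[leb3]_(x in [set: mR3 R]) defect (P n) (Qn x) < 0 ->
  ~ {ae leb3, forall x : mR3 R, Qm x = Qn x}.
Proof.
move=> mn im in_ eqI; rewrite ltNge => /negP I0 QQ; apply: I0; apply: Rintegral_ae_ge0.
  by apply/measurable_EFinP; exact: measurable_int in_.
have le_ae : {ae leb3, forall x : mR3 R, defect (P n) (Qn x) <= defect (P m) (Qm x)}.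
  by apply: filterS QQ => x ->; exact: defect_profile_le (ltnW mn).
(* The ordered densities have equal integrals, hence agree almost everywhere; at a point where Q is
   negative the strict inequality would contradict this. *)
apply: filterS2 (ae_eq_of_le im in_ le_ae eqI) QQ => x + Qx; rewrite Qx => Dx.
apply: defect_profile_ge0; rewrite leNgt; apply/negP => /(defect_profile_lt mn).
by rewrite Dx ltxx.
Qed.

Lemma infinitely_many_solutions : (mu [set: mR3 R] < 0)%E ->
  exists s : nat -> (R3 R * R3 R -> R) * (R3 R -> R),
    (forall n, vp_solution (fun v => F0 (2^-1 * sqnorm v)) mu (s n).1 (s n).2) /\
    (forall m n : nat, m <> n -> ~ same_solution (s m) (s n)).
Proof.
move=> theta_lt0.
have [Q hQ] := choice exists_gibbs.
exists (fun n => (gibbs (P n) (Q n), Q n)); split; first by move=> n; have [] := hQ n.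
have distinct m n : (m < n)%N -> ~ {ae leb3, forall x : mR3 R, Q m x = Q n x}.
  move=> mn; have [_ im em] := hQ m; have [_ in_ en] := hQ n.
  have fmu : mu [set: mR3 R] \is a fin_num by exact: fin_num_measure.
  apply: (gibbs_distinct mn im in_ (etrans em (esym en))).
  by rewrite en -lte_fin fineK.
(* Distinctness was shown for m < n; the other order follows by symmetry of equality almost
   everywhere. *)
move=> m n /eqP; rewrite neq_ltn => /orP[mn|nm] [_ QQ]; first exact: (distinct m n mn).
apply: (distinct n m nm); apply: (filterS _ (QQ : {ae leb3, forall x : mR3 R, Q m x = Q n x})).
by move=> x ->.
Qed.

End SolutionFamily.

Theorem theorem1p1 (R : realType) (F0 dF0 : R -> R)
    (mu : {charge set (mR3 R) -> \bar R})
    (hC1 : C1_halfline F0 dF0)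
    (hF0 : forall r : R, 0 <= r -> 0 <= F0 r)
    (hint : ((4 * pi * Num.sqrt 2)%:E *
             \int[lebesgue_measure]_(r in `[0%R, +oo[) (Num.sqrt r * F0 r)%:E
             = 1)%E)
    (hdecay : exists2 C : R, 0 < C &
       forall r : R, 0 <= r -> `|F0 r| + `|dF0 r| <= C / (1 + r ^+ 3))
    (hdecr : forall r : R, 0 <= r -> dF0 r < 0)
    (hmu : (charge_total_variation mu < +oo)%E) :
  let f0 := fun v : R3 R => F0 (2^-1 * sqnorm v) in
  (exists (f : R3 R * R3 R -> R) (Q : R3 R -> R), vp_solution f0 mu f Q) /\
  ((mu [set: mR3 R] < 0)%E ->
   exists s : nat -> (R3 R * R3 R -> R) * (R3 R -> R),
     (forall n, vp_solution f0 mu (s n).1 (s n).2) /\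
     (forall m n : nat, m <> n -> ~ same_solution (s m) (s n))).
Proof.
move=> f0; split; last first.
  by move=> mu_lt0; exact: (infinitely_many_solutions hC1 hF0 hint hdecay hdecr mu_lt0).
have [Q [h _ _]] := exists_gibbs mu hC1 hF0 hint hdecay hdecr 0.
by exists (gibbs (profile F0 dF0 0) Q), Q.
Qed.
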